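(* Let $d\ge1$. Consider initial data $h_0\in\dot{\mathcal F}^{0,2}\cap\dot{\mathcal F}^{2,1}$ satisfying $$\|h_0\|_2<y_*,$$ where $y_*>0$ is the unique positive number with $f_2(y_* )=1$. Then there exists a global in time unique solution $h$ to $$\partial_th=\Delta e^{-\Delta h}+1-e^{-\Delta h}\quad\text{in }\mathbb{R}^d\times(0,\infty),\qquad h(x,0)=h_0(x),$$ with $h\in C^0_t(\dot{\mathcal F}^{0,2}\cap\dot{\mathcal F}^{2,1})$, and for all $t\ge0$ $$\|h\|_2(t)+\sigma_{2,1}\int_0^t\|h\|_6(\tau)\,d\tau\le\|h_0\|_2,$$ where $\sigma_{2,1}:=1-f_2(\|h_0\|_2)>0$.
   Context: Fourier transform on $\mathbb{R}^d$: $\hat f(\xi)=(2\pi)^{-d/2}\int_{\mathbb{R}^d}f(x)e^{-ix\cdot\xi}\,dx$. For $1\le p\le2$ and $s>-d/p$, $$\|f\|_{\dot{\mathcal F}^{s,p}}^p=\int_{\mathbb{R}^d}|\xi|^{sp}|\hat f(\xi)|^p\,d\xi,$$ and $\dot{\mathcal F}^{s,p}$ is the corresponding space. For $p=1$ write $\|f\|_s=\int_{\mathbb{R}^d}|\xi|^s|\hat f(\xi)|\,d\xi$ (so $\|\cdot\|_2$ is the $\dot{\mathcal F}^{2,1}$ norm, not the $L^2$ norm; $\dot{\mathcal F}^{0,2}=L^2(\mathbb{R}^d)$). $\|h\|_s(t)$ denotes $\|h(\cdot,t)\|_s$. Functions $h$ are real-valued. The function $f_2$ is $$f_2(y)=\sum_{j=1}^\infty\frac{(j+1)^3}{j!}y^j=(y^3+6y^2+7y+1)e^y-1,$$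 which is strictly increasing on $[0,\infty)$ with $f_2(0)=0$. *)

(* Defs.v *)
From HB Require Import structures.
From mathcomp Require Import all_boot all_order all_algebra.
From mathcomp Require Import complex.
From mathcomp Require Import all_classical all_reals all_analysis.

Set Implicit Arguments.
Unset Strict Implicit.
Unset Printing Implicit Defensive.

Import Order.TTheory GRing.Theory Num.Theory.
Import numFieldNormedType.Exports.

Local Open Scope classical_set_scope.
Local Open Scope ring_scope.

Definition rV_display : measure_display. Proof. exact: default_measure_display. Qed.

(* R^d is 'rV[R]_d with the sigma-algebra generated by the coordinates (the
   Borel one).  The library norm on 'rV[R]_d is the sup norm: it is used here
   only through the topology; Euclidean lengths are [enorm] below. *)
Section rV_measurable.
Context {R : realType} {d : nat}.

Definition rV_coord (i : 'I_d) (x : 'rV[R]_d) : R := x ord0 i.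

Let rV_set0 : g_sigma_preimage rV_coord set0.
Proof. exact: sigma_algebra0. Qed.

Let rV_setC A : g_sigma_preimage rV_coord A -> g_sigma_preimage rV_coord (~` A).
Proof. exact: sigma_algebraC. Qed.

Let rV_bigcup (F : _^nat) : (forall i, g_sigma_preimage rV_coord (F i)) ->
  g_sigma_preimage rV_coord (\bigcup_i (F i)).
Proof. exact: sigma_algebra_bigcup. Qed.

HB.instance Definition _ := @isMeasurable.Build rV_display
  'rV[R]_d (g_sigma_preimage rV_coord) rV_set0 rV_setC rV_bigcup.

Lemma measurable_rV_coord i : measurable_fun [set: 'rV[R]_d] (rV_coord i).
Proof.
move=> _ Y mY; rewrite setTI; apply: sub_sigma_algebra => /=.
rewrite -bigcup_seq/=; exists i => /=; first by rewrite mem_index_enum.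
by exists Y => //; rewrite setTI.
Qed.

Lemma measurable_fun_rV d0 (T : measurableType d0) (f : T -> 'rV[R]_d) :
  (forall i, measurable_fun [set: T] (rV_coord i \o f)) ->
  measurable_fun [set: T] f.
Proof.
move=> mf; apply: (@measurability _ _ _ _ _ _
  (\big[setU/set0]_(i < d) preimage_set_system setT (rV_coord i) measurable)) => //.
move=> _ [B + <-]; rewrite -bigcup_seq => -[i _ [A mA <-]].
rewrite [X in measurable X](_ : _ = setT `&` (rV_coord i \o f) @^-1` A).
  exact: mf.
by rewrite !setTI.
Qed.

End rV_measurable.
Section rV_cons.
Context {R : realType} {d : nat}.

Definition rV_cons (p : R * 'rV[R]_d) : 'rV[R]_d.+1 :=
  \row_i oapp (fun j => p.2 ord0 j) p.1 (unlift ord0 i).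

Definition rV_uncons (x : 'rV[R]_d.+1) : R * 'rV[R]_d :=
  (x ord0 ord0, \row_j x ord0 (lift ord0 j)).

Lemma rV_consK : cancel rV_cons rV_uncons.
Proof.
move=> [a x]; rewrite /rV_uncons /rV_cons mxE unlift_none/=; congr pair.
by apply/rowP => j; rewrite !mxE liftK.
Qed.

Lemma rV_unconsK : cancel rV_uncons rV_cons.
Proof.
by move=> x; apply/rowP => i; rewrite mxE; case: unliftP => [j|] ->//=;
  rewrite mxE.
Qed.

Lemma measurable_rV_cons : measurable_fun setT rV_cons.
Proof.
apply: measurable_fun_rV => i; case: (unliftP ord0 i) => [j ij|i0].
- rewrite (_ : _ \o _ = rV_coord j \o snd); last first.
    by apply/funext => p; rewrite /= /rV_coord /rV_cons mxE ij liftK.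
  by apply: measurableT_comp => //; exact: measurable_rV_coord.
- rewrite (_ : _ \o _ = fst)//.
  by apply/funext => p; rewrite /= /rV_coord /rV_cons mxE i0 unlift_none.
Qed.

Lemma measurable_rV_uncons : measurable_fun setT rV_uncons.
Proof.
apply: measurable_fun_pair; first exact: measurable_rV_coord.
apply: measurable_fun_rV => j.
rewrite (_ : _ \o _ = rV_coord (lift ord0 j)); first exact: measurable_rV_coord.
by apply/funext => x; rewrite /= /rV_coord mxE.
Qed.

End rV_cons.

Section lebesgue_rV.
Context {R : realType}.
Local Open Scope ereal_scope.

Section step.
Context {d : nat} (m : {sigma_finite_measure set 'rV[R]_d -> \bar R}).

Definition lebesgue_rV_step (A : set 'rV[R]_d.+1) : \bar R :=
  (@lebesgue_measure R \x m) (rV_cons @^-1` A).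

Let step0 : lebesgue_rV_step set0 = 0.
Proof. by rewrite /lebesgue_rV_step preimage_set0 measure0. Qed.

Let step_ge0 A : 0 <= lebesgue_rV_step A.
Proof. exact: measure_ge0. Qed.

Let measurable_preim A : measurable A ->
  measurable (rV_cons @^-1` A : set (R * 'rV[R]_d)).
Proof. by move=> mA; rewrite -[X in measurable X]setTI; exact: measurable_rV_cons. Qed.

Let step_sigma_additive : semi_sigma_additive lebesgue_rV_step.
Proof.
move=> F mF tF mUF; rewrite /lebesgue_rV_step preimage_bigcup.
apply: measure_semi_sigma_additive.
- by move=> n; exact: measurable_preim.
- apply/trivIsetP => /= i j _ _ ij; rewrite -preimage_setI.
  by move/trivIsetP : tF => /(_ _ _ _ _ ij) ->//; rewrite preimage_set0.
- by rewrite -preimage_bigcup; exact: measurable_preim.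
Qed.

HB.instance Definition _ := isMeasure.Build _ _ _
  lebesgue_rV_step step0 step_ge0 step_sigma_additive.

Let step_sigma_finite : sigma_finite setT lebesgue_rV_step.
Proof.
have : sigma_finite setT (@lebesgue_measure R \x m).
  have /sigma_finiteP[F [TF ndF Foo]] := sigma_finiteT (@lebesgue_measure R).
  have /sigma_finiteP[G [TG ndG Goo]] := sigma_finiteT m.
  exists (fun n => F n `*` G n).
    rewrite -setXTT TF TG predeqE => -[x y]; split.
      move=> [/= [n _ Fnx] [k _ Gky]]; exists (maxn n k) => //; split.
      - by move: x Fnx; exact/subsetPset/ndF/leq_maxl.
      - by move: y Gky; exact/subsetPset/ndG/leq_maxr.
    by move=> [n _ []/= ? ?]; split; exists n.
  move=> k; have [? ?] := Foo k; have [? ?] := Goo k.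
  split; first exact: measurableX.
  by rewrite product_measure1E// lte_mul_pinfty// ge0_fin_numE.
move=> [F FT Foo].
exists (fun n => rV_uncons @^-1` F n).
  by rewrite -preimage_bigcup -FT preimage_setT.
move=> n; have [mFn Fnoo] := Foo n; split.
  by rewrite -[X in measurable X]setTI; exact: measurable_rV_uncons.
rewrite /lebesgue_rV_step -comp_preimage (_ : _ \o _ = id)//.
by apply/funext => p; exact: rV_consK.
Qed.

HB.instance Definition _ := Measure_isSigmaFinite.Build _ _ _
  lebesgue_rV_step step_sigma_finite.

End step.

(* Lebesgue measure on R^d, as an iterated product of the one on R; see
   [lebesgue_rV_box] for the value on boxes. *)
Fixpoint lebesgue_rV (d : nat) : {sigma_finite_measure set 'rV[R]_d -> \bar R} :=
  match d with
  | 0%N => dirac (const_mx 0%R : 'rV[R]_0)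
  | d'.+1 => lebesgue_rV_step (lebesgue_rV d')
  end.

Lemma lebesgue_rV_box d (A : 'I_d -> set R) : (forall i, measurable (A i)) ->
  lebesgue_rV d [set x | forall i, A i (x ord0 i)] =
  \prod_(i < d) lebesgue_measure (A i).
Proof.
elim: d A => [|d IH] A mA.
  rewrite big_ord0 /= diracE mem_set//= => -[]//.
have mB : measurable [set x : 'rV[R]_d | forall i, A (lift ord0 i) (x ord0 i)].
  rewrite (_ : mkset _ = \bigcap_(i in [set: 'I_d])
      (rV_coord i @^-1` A (lift ord0 i))); last first.
    apply/seteqP; split => x /= Ax i; first by move=> _; exact: Ax.
    exact: (Ax i I).
  apply: fin_bigcap_measurable => // i _.
  by rewrite -[X in measurable X]setTI; exact: measurable_rV_coord.
rewrite big_ord_recl -(IH (fun i => A (lift ord0 i)))//.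
rewrite -product_measure1E /=; [|exact: mA|exact: mB].
rewrite /lebesgue_rV_step; congr (_ _).
apply/seteqP; split => -[a x]/=.
- move=> Ax; split; first by have := Ax ord0; rewrite mxE unlift_none.
  by move=> i; have := Ax (lift ord0 i); rewrite mxE liftK.
- by move=> [A0 Ax] i; rewrite mxE; case: unliftP => [j ->|->]//=.
Qed.

End lebesgue_rV.

Section fourier.
Context {R : realType} {d : nat}.
Implicit Types (f h : 'rV[R]_d -> R) (x xi : 'rV[R]_d).

Local Notation mu := (lebesgue_rV d).

Definition dotv x xi : R := \sum_(i < d) x ord0 i * xi ord0 i.

Definition enorm x : R := Num.sqrt (dotv x x).

(* (2 pi)^(-d/2) \int f(x) e^(-i x.xi) dx, for a real-valued integrable f. *)
Definition fourierL1 f xi : R[i] :=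
  let c := (2 * pi) `^ (- (d%:R / 2)) in
  Complex (c * \int[mu]_x (f x * cos (dotv x xi)))
          (- (c * \int[mu]_x (f x * sin (dotv x xi)))).

Definition cabs (z : R[i]) : R := Num.sqrt (complex.Re z ^+ 2 + complex.Im z ^+ 2).

(* An element of L^2 need not be integrable, so its transform is the
   Fourier-Plancherel one: the L^2 limit of the transforms of the truncations
   f 1_{|x| <= n}.  It is determined up to a null set. *)
Definition is_fourier f (g : 'rV[R]_d -> R[i]) : Prop :=
  [/\ measurable_fun setT (fun xi => complex.Re (g xi)),
      measurable_fun setT (fun xi => complex.Im (g xi)) &
      (\int[mu]_xi
         ((cabs (fourierL1 (f \_ [set x | enorm x <= n%:R]) xi - g xi) ^+ 2)%:E))%E
        @[n --> \oo] --> 0%E].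

(* [fourier f] is meaningful for f in L^2, where Plancherel's theorem provides
   a transform; it is only ever applied to such functions. *)
Definition fourier f : 'rV[R]_d -> R[i] := xget (cst 0) [set g | is_fourier f g].

(* (\int |xi|^(s p) |\hat f(xi)|^p dxi)^(1/p) *)
Definition Fnorm (s p : R) f : \bar R :=
  ((\int[mu]_xi ((enorm xi `^ (s * p)) * cabs (fourier f xi) `^ p)%:E)
    `^ p^-1)%E.

(* The space \dot F^{s,p} cut down to L^2, where \hat f is a function.  As
   \dot F^{0,2} = L^2, the set [Fspace 0 2 `&` Fspace s p] is exactly
   \dot F^{0,2} \cap \dot F^{s,p}. *)
Definition Fspace (s p : R) : set ('rV[R]_d -> R) :=
  [set f | f \in Lfun mu 2%:E /\ (Fnorm s p f < +oo)%E].

End fourier.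

Section distributions.
Context {R : realType} {d : nat}.
Implicit Types (f w phi : 'rV[R]_d -> R).

Local Notation mu := (lebesgue_rV d).

Definition partial (i : 'I_d) f : 'rV[R]_d -> R :=
  fun x => 'D_(delta_mx ord0 i) f x.

Definition partials (s : seq 'I_d) f : 'rV[R]_d -> R := foldr partial f s.

Definition laplacian f : 'rV[R]_d -> R :=
  fun x => \sum_(i < d) partial i (partial i f) x.

Definition test_function phi : Prop :=
  (forall s : seq 'I_d, continuous (partials s phi) /\
     forall i x, derivable (partials s phi) x (delta_mx ord0 i)) /\
  compact (closure [set x | phi x != 0]).

Definition loc_integrable f : Prop :=
  measurable_fun setT f /\
  forall K : set 'rV[R]_d, compact K -> mu.-integrable K (EFin \o f).

(* w is the Laplacian of f in the sense of distributions. *)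
Definition distr_laplacian f w : Prop :=
  [/\ loc_integrable f, loc_integrable w &
    forall phi, test_function phi ->
      \int[mu]_x (f x * laplacian phi x) = \int[mu]_x (w x * phi x)].

End distributions.

Section equation.
Context {R : realType} {d : nat}.
Local Notation mu := (lebesgue_rV d).

(* \sum_{j >= 1} (j+1)^3 / j! y^j, indexed by k = j - 1. *)
Definition f2 (y : R) : R :=
  limn (series (fun k : nat => (k.+2)%:R ^+ 3 / (k.+1)`!%:R * y ^+ k.+1)).

(* h in C^0([0, oo); \dot F^{0,2} \cap \dot F^{2,1}) with h(0) = h0 solves
   d_t h = Delta e^{-Delta h} + 1 - e^{-Delta h} in the sense of distributions:
   in this class Delta h(t) =: w is a (continuous bounded) function, while
   Delta e^{-w} is in general only a distribution, so the equation at time t > 0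
   is tested against every phi in C_c^oo(R^d). *)
Definition is_solution (h0 : 'rV[R]_d -> R) (h : R -> 'rV[R]_d -> R) : Prop :=
  [/\ forall t, 0 <= t -> (Fspace 0 2 `&` Fspace 2 1) (h t),
      forall t, 0 <= t ->
        Fnorm 0 2 (h s \- h t) @[s --> within `[0, +oo[ (nbhs t)] --> 0%E /\
        Fnorm 2 1 (h s \- h t) @[s --> within `[0, +oo[ (nbhs t)] --> 0%E,
      h 0 = h0 %[ae mu] &
      forall t, 0 < t -> exists w : 'rV[R]_d -> R,
        [/\ distr_laplacian (h t) w,
            loc_integrable (fun x => expR (- w x)) &
            forall phi, test_function phi ->
              is_derive t 1 (fun s => \int[mu]_x (h s x * phi x))
                (\int[mu]_x (expR (- w x) * laplacian phi x) +
                 \int[mu]_x ((1 - expR (- w x)) * phi x))]].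

End equation.

(* Main.v *)
(**
On the Fourier side, u = the transform of Delta h solves
  u(t) = e^{-lam t} u0 + int_0^t lam e^{-lam (t - s)} Nhat(u(s)) ds,  lam = |xi|^2 + |xi|^4,
where Nhat collects the convolution powers of order >= 2 of the exponential. Picard iteration converges
since its iterates are dominated, uniformly in time, by one L^1 majorant: e^{-lam t} and lam e^{-lam t} dt
have mass at most 1. Weighting |u| by truncations of |xi|^4 and bounding |xi|^4 on a (j+1)-fold convolution
by (j+1)^3 sum |xi_i|^4 gives |u(t)| + (1 - f2) int lam |u| <= |u0| in L^1, the decay estimate.

Uniqueness: tested against phi - Delta phi, two solutions make zeta = (h1^ - h2^)/(1 + |xi|^2) satisfy
zeta' = D in C_t L^1, where -D is lam zeta up to a perturbation that the smallness of u absorbs. An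
implicit Euler step for zeta is then a contraction in L^1, so zeta vanishes.
*)

Require Import Defs.
From HB Require Import structures.
From mathcomp Require Import all_boot all_order all_algebra.
From mathcomp Require Import complex ring lra.
From mathcomp Require Import all_classical all_reals all_analysis measurable_realfun.

Set Implicit Arguments.
Unset Strict Implicit.
Unset Printing Implicit Defensive.

Import Order.TTheory GRing.Theory Num.Theory.
Import numFieldNormedType.Exports.

Local Open Scope classical_set_scope.
Local Open Scope ring_scope.
Local Notation mfunT := (measurable_fun setT).
Local Notation via y := (@le_trans _ _ y).

(** The bound f2(y) >= 8 y gives [ystar <= 1/8], and from it come the contraction constants 1/6, 1/5
    and 1/4. Three obstacles shape the proof. Convolutions of L^1 functions converge only almost
    everywhere; majorants therefore carry a term that is infinite on the exceptional null set, and
    inequalities hold at every frequency. The transform of h is -u/|xi|^2, singular at 0: its square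
    integrability comes from a separate estimate in space and time, where the bound 1 on the
    integral of lam e^{-lam t} dt trades |u0|^2 <= lam g0 for g0 = |h0^|^2. A competing solution is
    known only through test functions and is small only at time 0: dyadic Riemann sums in L^1
    replace its time integral, and a continuity argument keeps the L^1 norm of the transform of its
    Laplacian below 1/4, since up to that threshold it coincides with the constructed solution. The
    decay estimate also closes by continuity, with barrier [ystar], where 1 - f2 is exactly 0.
    Inversion and the L^2 theory rest on the Poisson kernel, whose mass on intervals is an explicit
    arctangent. *)

(** * Boxes in R^d: they generate the measurable sets and determine measures and densities *)

Section rV_measure.
Context {R : realType} {d : nat}.
Notation V := 'rV[R]_d.
Notation mu := (lebesgue_rV d : set V -> \bar R).

Definition obox (a b : 'I_d -> R) : set V :=
  [set x | forall i, `]a i, b i]%classic (x ord0 i)].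

Definition cbox n : set V := obox (fun _ => - n%:R) (fun _ => n%:R).

Lemma meas_boxes (A : 'I_d -> set R) : (forall i, measurable (A i)) ->
  measurable [set x : V | forall i, A i (x ord0 i)].
Proof.
move=> mA.
rewrite (_ : mkset _ = \bigcap_(i in [set: 'I_d]) (rV_coord i @^-1` A i)).
  apply: fin_bigcap_measurable => // i _. by rewrite -[X in measurable X]setTI; exact: measurable_rV_coord.
by apply/seteqP; split => x /= Ax i; [move=> _; exact: Ax|exact: (Ax i I)].
Qed.

Lemma meas_obox a b : measurable (obox a b).
Proof. by apply: (@meas_boxes (fun i => `]a i, b i]%classic)) => i; exact: measurable_itv. Qed.

Lemma lebesgue_rV_obox a b : (forall i, a i <= b i) ->
  mu (obox a b) = (\prod_(i < d) (b i - a i))%:E.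
Proof.
move=> ab; rewrite /obox (lebesgue_rV_box (fun i => measurable_itv `]a i, b i])).
rewrite -prodEFin; apply: eq_bigr => i _.
rewrite lebesgue_measure_itv/= lte_fin; case: ltgtP (ab i) => [_|//|->] _.
  by rewrite EFinB.
by rewrite subrr.
Qed.

Lemma obox_eq0 a b i : ~~ (a i <= b i) -> obox a b = set0.
Proof.
move=> abi; apply/seteqP; split => x // /(_ i)/=; rewrite in_itv/= => /andP[h1 h2].
by move: abi; rewrite (le_trans (ltW h1) h2).
Qed.

Lemma obox_lty a b : (mu (obox a b) < +oo)%E.
Proof.
have [ab|] := boolP [forall i, a i <= b i].
  by rewrite lebesgue_rV_obox ?ltry// => i; exact: (forallP ab).
by rewrite negb_forall => /existsP[i /obox_eq0->]; rewrite measure0 ltry.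
Qed.

Lemma oboxI a b a' b' : obox a b `&` obox a' b' =
  obox (fun i => Order.max (a i) (a' i)) (fun i => Order.min (b i) (b' i)).
Proof.
apply/seteqP; split => x /=; rewrite /obox/=.
  move=> [h1 h2] i; have := h1 i; have := h2 i; rewrite !in_itv/= gt_max le_min. by move=> /andP[-> ->] /andP[-> ->].
move=> h; split => i; have := h i;
  by rewrite !in_itv/= gt_max le_min => /andP[/andP[h1 h2] /andP[h3 h4]]; apply/andP.
Qed.

Definition oboxes : set (set V) := [set B | exists a b, B = obox a b].

Lemma oboxes_setI : setI_closed oboxes.
Proof.
by move=> _ _ [a [b ->]] [a' [b' ->]]; rewrite oboxI; do 2 eexists.
Qed.

Lemma cboxT : \bigcup_n cbox n = setT.
Proof.
apply/seteqP; split => x // _.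
pose m := \big[Order.max/0]_(i < d) `|x ord0 i|.
exists (Num.truncn m).+1 => // i; rewrite /= in_itv/=.
have : `|x ord0 i| < (Num.truncn m).+1%:R.
  by apply: le_lt_trans (truncnS_gt m); exact: le_bigmax.
by rewrite ltr_norml => /andP[-> /ltW].
Qed.

Lemma meas_cbox n : measurable (cbox n).
Proof. exact: meas_obox. Qed.

Lemma cbox_subset n m : (n <= m)%N -> cbox n `<=` cbox m.
Proof.
move=> nm x h i; have := h i; rewrite /= !in_itv/= => /andP[h1 h2].
apply/andP; split; first by rewrite (le_lt_trans _ h1)// lerN2 ler_nat.
by rewrite (le_trans h2)// ler_nat.
Qed.

Lemma rV_measurableE : @measurable rV_display V = <<s oboxes >>.
Proof.
apply/seteqP; split; last first.
  apply: smallest_sub; first exact: sigma_algebra_measurable. by move=> _ [a [b ->]]; exact: meas_obox.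
apply: smallest_sub; first exact: smallest_sigma_algebra.
move=> A; rewrite -bigcup_seq => -[i _ [B mB <-]]; rewrite setTI.
suff : measurable_fun [set: g_sigma_algebraType oboxes]
    (@rV_coord R d i : g_sigma_algebraType oboxes -> R).
  by move=> /(_ measurableT _ mB); rewrite setTI.
apply: (@measurability _ _ _ _ _ _ (@ocitv R)) => // _ [_ [[a b] _ <-] <-].
rewrite setTI.
(* A slab a < x_i <= b is unbounded in the other coordinates: it is the union of the boxes whose
   remaining sides are ]-n, n]. *)
pose lo n := fun j : 'I_d => if j == i then a else - n%:R : R.
pose hi n := fun j : 'I_d => if j == i then b else n%:R : R.
rewrite (_ : _ @^-1` _ = \bigcup_n obox (lo n) (hi n)).
  apply: bigcupT_measurable => n; apply: sub_sigma_algebra. by exists (lo n), (hi n).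
apply/seteqP; split => x.
- move=> abx; have : setT x by []; rewrite -cboxT => -[n _ xn]; exists n => // j.
  rewrite /lo /hi; case: eqP => [->|_]; first exact: abx. exact: xn.
- by move=> [n _ /(_ i)]; rewrite /lo/hi eqxx.
Qed.

Lemma rV_measure_unique (m1 m2 : {measure set V -> \bar R}) :
  (forall a b, m1 (obox a b) = m2 (obox a b)) ->
  (forall n, (m1 (cbox n) < +oo)%E) ->
  forall A, measurable A -> m1 A = m2 A.
Proof.
move=> h hoo; apply: (measure_unique oboxes cbox) => //.
- exact: rV_measurableE.
- exact: oboxes_setI.
- by move=> n; do 2 eexists.
- exact: cboxT.
- by move=> _ [a [b ->]].
Qed.

(** f is signed, so uniqueness of measures does not apply directly; the sets on which the integral
    vanishes form a Dynkin class that contains the boxes. *)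
Lemma box_integral_ae0 (f : V -> R) : mfunT f ->
  (forall n, (lebesgue_rV d).-integrable (cbox n) (EFin \o f)) ->
  (forall a b, (\int[lebesgue_rV d]_(x in obox a b) (f x)%:E = 0)%E) ->
  {ae lebesgue_rV d, forall x, f x = 0}.
Proof.
move=> mf fi f0.
(* The fixed cube [cbox n] keeps every integral finite, which stability under complements
   requires. *)
have P S n : measurable S -> (\int[lebesgue_rV d]_(x in S `&` cbox n) (f x)%:E = 0)%E.
  rewrite rV_measurableE.
  apply: (@dynkin_induction _ V oboxes
    (fun S => \int[lebesgue_rV d]_(x in S `&` cbox n) (f x)%:E = 0)%E) => //.
  - exact: rV_measurableE.
  - exact: oboxes_setI.
  - by rewrite setTI; exact: f0.
  - by move=> _ [a [b ->]]; rewrite oboxI; exact: f0.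
  - move=> T mT T0. have := f0 (fun _ => - n%:R) (fun _ => n%:R); rewrite -/(cbox n).
    have cE : cbox n = (T `&` cbox n) `|` (~` T `&` cbox n).
      by rewrite -setIUl setUv setTI.
    rewrite {1}cE integral_setU_EFin//.
    + by rewrite T0 add0e.
    + by apply: measurableI => //; exact: meas_cbox.
    + by apply: measurableI; [exact: measurableC|exact: meas_cbox].
    + exact: measurable_funTS.
    + by apply/disj_set2P; rewrite setIACA setICr set0I.
  - move=> F mF tF F0; rewrite setI_bigcupl integral_bigcup//.
    + by rewrite eseries0.
    + by apply: trivIset_setIr.
    + by move=> k; apply: measurableI => //; exact: meas_cbox.
    + apply: integrableS (fi n).
      * exact: meas_cbox.
      * by apply: bigcup_measurable => k _; apply: measurableI => //; exact: meas_cbox.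
      * by move=> x [k _ []].
have : forall n, {ae lebesgue_rV d, forall x, cbox n x -> f x = 0}.
  move=> n. have := @integral_ae_eq _ V R (lebesgue_rV d) (cbox n) (meas_cbox n) (cst 0%E) (EFin \o f) (fi n).
  move=> /(_ (@measurable_cst _ _ _ _ _ _)) H. have : ae_eq (lebesgue_rV d) (cbox n) (EFin \o f) (cst 0%E).
    apply: H => E En mE; rewrite integral0. by rewrite -[in LHS](setIidl En); exact: P.
  by apply: filterS => x /= h /h[].
move=> /ae_foralln; apply: filterS => x h.
by have : setT x by []; rewrite -cboxT => -[n _ xn]; exact: h xn.
Qed.

End rV_measure.

Local Open Scope complex_scope.

(** * Complex modulus, complex measurability and convergence *)

Section cabs_theory.
Context {R : realType}.
Notation C := R[i].
Implicit Types z w : C.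

Lemma cabsE z : cabs z = Normc.normc z.
Proof. by case: z. Qed.

Lemma cabs_ge0 z : 0 <= cabs z.
Proof. exact: sqrtr_ge0. Qed.

Lemma cabsM z w : cabs (z * w) = cabs z * cabs w.
Proof. by rewrite !cabsE Normc.normcM. Qed.

Lemma cabsD z w : cabs (z + w) <= cabs z + cabs w.
Proof. by rewrite !cabsE le_normcD. Qed.

Lemma cabsN z : cabs (- z) = cabs z.
Proof. by case: z => a b; rewrite /cabs/= !sqrrN. Qed.

Lemma cabsB z w : cabs (z - w) <= cabs z + cabs w.
Proof. by rewrite (le_trans (cabsD _ _))// cabsN. Qed.

Lemma cabs_distC z w : cabs (z - w) = cabs (w - z).
Proof. by rewrite -cabsN opprB. Qed.

Lemma cabs_dist_triangle w z z' : cabs (z - z') <= cabs (z - w) + cabs (w - z').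
Proof. by rewrite (le_trans _ (cabsD _ _))//; rewrite addrA subrK. Qed.

Lemma cabs0 : cabs (0 : C) = 0.
Proof. by rewrite /cabs/= expr0n/= addr0 sqrtr0. Qed.

Lemma cabs0_eq0 z : cabs z = 0 -> z = 0.
Proof. by rewrite cabsE; exact: Normc.eq0_normc. Qed.

Lemma cabs_conj z : cabs z^* = cabs z.
Proof. by case: z => a b; rewrite /cabs/= sqrrN. Qed.

Lemma cabs_real (a : R) : cabs a%:C = `|a|.
Proof. by rewrite /cabs/= expr0n/= addr0 sqrtr_sqr. Qed.

Lemma cabs1 : cabs (1 : C) = 1.
Proof. by rewrite (cabs_real 1) normr1. Qed.

Lemma sqr_cabs z : cabs z ^+ 2 = complex.Re z ^+ 2 + complex.Im z ^+ 2.
Proof. by rewrite sqr_sqrtr// addr_ge0// sqr_ge0. Qed.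

Lemma normr_Re_le z : `|complex.Re z| <= cabs z.
Proof. by rewrite /cabs -sqrtr_sqr ler_wsqrtr// lerDl sqr_ge0. Qed.

Lemma normr_Im_le z : `|complex.Im z| <= cabs z.
Proof. by rewrite /cabs -sqrtr_sqr ler_wsqrtr// lerDr sqr_ge0. Qed.

Lemma cabs_le_ReIm z : cabs z <= `|complex.Re z| + `|complex.Im z|.
Proof.
rewrite -[leRHS]ger0_norm ?addr_ge0//.
rewrite -sqrtr_sqr ler_wsqrtr// sqrrD !real_normK ?num_real//.
by rewrite [leRHS]addrAC lerDl mulrn_wge0// mulr_ge0.
Qed.

Lemma ReM z w : complex.Re (z * w) =
  complex.Re z * complex.Re w - complex.Im z * complex.Im w.
Proof. by case: z; case: w. Qed.

Lemma ImM z w : complex.Im (z * w) =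
  complex.Re z * complex.Im w + complex.Im z * complex.Re w.
Proof. by case: z => a b; case: w. Qed.

Lemma ReD z w : complex.Re (z + w) = complex.Re z + complex.Re w.
Proof. by case: z; case: w. Qed.

Lemma ImD z w : complex.Im (z + w) = complex.Im z + complex.Im w.
Proof. by case: z; case: w. Qed.

Lemma ReN z : complex.Re (- z) = - complex.Re z.
Proof. by case: z. Qed.

Lemma ImN z : complex.Im (- z) = - complex.Im z.
Proof. by case: z. Qed.

Lemma Re_conj z : complex.Re z^* = complex.Re z.
Proof. by case: z. Qed.

Lemma Im_conj z : complex.Im z^* = - complex.Im z.
Proof. by case: z. Qed.

Lemma complex_ext z w : complex.Re z = complex.Re w ->
  complex.Im z = complex.Im w -> z = w.
Proof. by case: z => a b; case: w => a' b' /= -> ->. Qed.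

Lemma conjcM z w : conjc (z * w) = conjc z * conjc w.
Proof. exact: rmorphM. Qed.

Lemma conjcD z w : conjc (z + w) = conjc z + conjc w.
Proof. exact: rmorphD. Qed.

Lemma mul_conj z : z * z^* = (cabs z ^+ 2)%:C.
Proof.
by case: z => a b; rewrite sqr_cabs; apply: complex_ext => /=;
  rewrite ?mulrN ?opprK -?expr2// mulrC addrC subrr.
Qed.

End cabs_theory.

Section cmeas.
Context {R : realType} d0 {T : measurableType d0}.
Notation C := R[i].
Implicit Types f g : T -> C.

Definition cmeas f := mfunT (fun x => complex.Re (f x)) /\
  mfunT (fun x => complex.Im (f x)).

Lemma cmeasD f g : cmeas f -> cmeas g -> cmeas (fun x => f x + g x).
Proof.
move=> [f1 f2] [g1 g2]; split.
  by under eq_fun do rewrite ReD; exact: measurable_funD.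
by under eq_fun do rewrite ImD; exact: measurable_funD.
Qed.

Lemma cmeasN f : cmeas f -> cmeas (fun x => - f x).
Proof.
move=> [f1 f2]; split.
  by under eq_fun do rewrite ReN; exact: measurableT_comp.
by under eq_fun do rewrite ImN; exact: measurableT_comp.
Qed.

Lemma cmeasB f g : cmeas f -> cmeas g -> cmeas (fun x => f x - g x).
Proof. by move=> mf mg; apply: cmeasD => //; exact: cmeasN. Qed.

Lemma cmeasM f g : cmeas f -> cmeas g -> cmeas (fun x => f x * g x).
Proof.
move=> [f1 f2] [g1 g2]; split.
  by under eq_fun do rewrite ReM; apply: measurable_funB; exact: measurable_funM.
by under eq_fun do rewrite ImM; apply: measurable_funD; exact: measurable_funM.
Qed.

Lemma cmeas_cst (z : C) : cmeas (fun=> z).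
Proof. by split; exact: measurable_cst. Qed.

Lemma cmeas_conj f : cmeas f -> cmeas (fun x => (f x)^*).
Proof.
move=> [f1 f2]; split; first by under eq_fun do rewrite Re_conj.
by under eq_fun do rewrite Im_conj; exact: measurableT_comp.
Qed.

Lemma cmeas_real (f : T -> R) : mfunT f -> cmeas (fun x => (f x)%:C).
Proof. by move=> mf; split => //=; exact: measurable_cst. Qed.

Lemma meas_cabs f : cmeas f -> mfunT (fun x => cabs (f x)).
Proof.
move=> [f1 f2]; rewrite /cabs; apply: (measurableT_comp (continuous_measurable_fun (@sqrt_continuous R))).
by apply: measurable_funD; exact: measurable_funX.
Qed.

Lemma meas_ecabs f : cmeas f -> mfunT (fun x => (cabs (f x))%:E).
Proof. by move=> mf; apply/measurable_EFinP; exact: meas_cabs. Qed.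

End cmeas.

Lemma cmeas_comp {R : realType} d0 {T : measurableType d0} d1 {X : measurableType d1}
    (p : X -> T) (f : T -> R[i]) :
  cmeas f -> mfunT p -> cmeas (fun x => f (p x)).
Proof.
by move=> [f1 f2] mp; split;
  [exact: (measurableT_comp f1 mp)|exact: (measurableT_comp f2 mp)].
Qed.

Definition ccvg {R : realType} (u : nat -> R[i]) (l : R[i]) :=
  (fun n => cabs (u n - l)) @ \oo --> (0 : R).

Section ccvg_theory.
Context {R : realType}.
Implicit Types u v : nat -> R[i].

Lemma ccvg_squeeze u l (e : nat -> R) : (forall n, cabs (u n - l) <= e n) ->
  e @ \oo --> 0 -> ccvg u l.
Proof.
move=> h e0; apply: (@squeeze_cvgr _ _ _ _ (cst 0) e) => //; last exact: cvg_cst.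
by apply: nearW => n /=; rewrite cabs_ge0 h.
Qed.

Lemma ccvg_Re u l : ccvg u l -> (fun n => complex.Re (u n)) @ \oo --> complex.Re l.
Proof.
move=> h; apply/cvgrPdist_le => e e0.
move/cvgrPdist_le : h => /(_ e e0); apply: filterS => n.
rewrite sub0r normrN ger0_norm ?cabs_ge0//; apply: le_trans.
by rewrite cabs_distC (le_trans _ (normr_Re_le _))// ReD ReN.
Qed.

Lemma ccvg_Im u l : ccvg u l -> (fun n => complex.Im (u n)) @ \oo --> complex.Im l.
Proof.
move=> h; apply/cvgrPdist_le => e e0.
move/cvgrPdist_le : h => /(_ e e0); apply: filterS => n.
rewrite sub0r normrN ger0_norm ?cabs_ge0//; apply: le_trans.
by rewrite cabs_distC (le_trans _ (normr_Im_le _))// ImD ImN.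
Qed.

Lemma ccvg_ReIm u l : (fun n => complex.Re (u n)) @ \oo --> complex.Re l ->
  (fun n => complex.Im (u n)) @ \oo --> complex.Im l -> ccvg u l.
Proof.
move=> h1 h2; apply: (@ccvg_squeeze _ _ (fun n => `|complex.Re (u n) - complex.Re l| +
   `|complex.Im (u n) - complex.Im l|)).
  by move=> n; rewrite (le_trans (cabs_le_ReIm _))// !ReD !ImD !ReN !ImN.
rewrite -[X in _ --> X]addr0; apply: cvgD.
  by apply/norm_cvg0P; rewrite -(subrr (complex.Re l)); apply: cvgB => //; exact: cvg_cst.
by apply/norm_cvg0P; rewrite -(subrr (complex.Im l)); apply: cvgB => //; exact: cvg_cst.
Qed.

Lemma ccvg_cst (l : R[i]) : ccvg (fun=> l) l.
Proof. by rewrite /ccvg; under eq_fun do rewrite subrr cabs0; exact: cvg_cst. Qed.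

Lemma ccvg_unique u l l' : ccvg u l -> ccvg u l' -> l = l'.
Proof.
move=> h h'; apply: complex_ext.
  exact: (cvg_unique (@Rhausdorff R) (ccvg_Re h) (ccvg_Re h')).
exact: (cvg_unique (@Rhausdorff R) (ccvg_Im h) (ccvg_Im h')).
Qed.

Lemma ccvgM u v l l' : ccvg u l -> ccvg v l' -> ccvg (fun n => u n * v n) (l * l').
Proof.
move=> h h'; apply: ccvg_ReIm.
  under eq_fun do rewrite ReM; rewrite ReM. by apply: cvgB; apply: cvgM; (apply: ccvg_Re || apply: ccvg_Im).
under eq_fun do rewrite ImM; rewrite ImM.
by apply: cvgD; apply: cvgM; (apply: ccvg_Re || apply: ccvg_Im).
Qed.

Lemma ccvgD u v l l' : ccvg u l -> ccvg v l' -> ccvg (fun n => u n + v n) (l + l').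
Proof.
move=> h h'; apply: ccvg_ReIm.
  under eq_fun do rewrite ReD; rewrite ReD. by apply: cvgD; apply: ccvg_Re.
under eq_fun do rewrite ImD; rewrite ImD.
by apply: cvgD; apply: ccvg_Im.
Qed.

Lemma ccvg_cabs u l : ccvg u l -> (fun n => cabs (u n)) @ \oo --> cabs l.
Proof.
move=> h; apply/cvgrPdist_le => e e0.
move/cvgrPdist_le : h => /(_ e e0); apply: filterS => n.
rewrite sub0r normrN ger0_norm ?cabs_ge0//; apply: le_trans.
rewrite ler_distl lerBlDr; apply/andP; split.
  by rewrite -{1}(subrK l (u n)) (le_trans (cabsD _ _))// addrC.
by rewrite -{1}(subrK (u n) l) (le_trans (cabsD _ _))// addrC cabs_distC.
Qed.

End ccvg_theory.

(** * Complex Lebesgue integral: linearity, dominated convergence, Fubini *)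

Section cint.
Context {R : realType} d0 {T : measurableType d0} (m : {measure set T -> \bar R}).
Notation C := R[i].
Implicit Types f g : T -> C.

Definition cint f : C := Complex (\int[m]_x (complex.Re (f x))) (\int[m]_x (complex.Im (f x))).

Definition cL1 f := cmeas f /\ (\int[m]_x (cabs (f x))%:E < +oo)%E.

Lemma cL1_integrable f : cL1 f <->
  m.-integrable setT (fun x => (complex.Re (f x))%:E) /\
  m.-integrable setT (fun x => (complex.Im (f x))%:E).
Proof.
split=> [[mf fo]|[/integrableP[m1 i1] /integrableP[m2 i2]]].
  have ic : m.-integrable setT (fun x => (cabs (f x))%:E).
    apply/integrableP; split; first exact: meas_ecabs. by under eq_integral do rewrite /= ger0_norm ?cabs_ge0//.
  case: mf => m1 m2; split; apply: le_integrable ic => //=.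
  - exact/measurable_EFinP.
  - by move=> x _; rewrite lee_fin [leRHS]ger0_norm ?cabs_ge0 ?normr_Re_le.
  - exact/measurable_EFinP.
  - by move=> x _; rewrite lee_fin [leRHS]ger0_norm ?cabs_ge0 ?normr_Im_le.
split; first by split; exact/measurable_EFinP.
apply: (@le_lt_trans _ _ (\int[m]_x (`|(complex.Re (f x))%:E| + `|(complex.Im (f x))%:E|))%E).
  apply: ge0_le_integral => //.
  - by move=> x _; rewrite lee_fin cabs_ge0.
  - by apply: meas_ecabs; split; exact/measurable_EFinP.
  - by apply: emeasurable_funD; exact: measurableT_comp.
  - by move=> x _; rewrite /= -EFinD lee_fin cabs_le_ReIm.
by rewrite ge0_integralD//; [exact: lte_add_pinfty|exact: measurableT_comp|exact: measurableT_comp].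
Qed.

Lemma cL1_cabs f : cL1 f -> m.-integrable setT (fun x => (cabs (f x))%:E).
Proof.
move=> [mf fo]; apply/integrableP; split; first exact: meas_ecabs.
by under eq_integral do rewrite /= ger0_norm ?cabs_ge0//.
Qed.

Lemma le_cL1 f (g : T -> \bar R) : cmeas f -> mfunT g ->
  (forall x, ((cabs (f x))%:E <= g x)%E) -> (\int[m]_x g x < +oo)%E -> cL1 f.
Proof.
move=> mf mg fg goo; split=> //; apply: le_lt_trans goo.
apply: ge0_le_integral => //.
- by move=> x _; rewrite lee_fin cabs_ge0.
- exact: meas_ecabs.
Qed.

Lemma integrableZl_EFin (k : R) (g : T -> R) : m.-integrable setT (EFin \o g) ->
  m.-integrable setT (EFin \o (fun x => k * g x)).
Proof. by move=> ig; apply: (integrableZl measurableT k ig). Qed.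

Lemma cL1D f g : cL1 f -> cL1 g -> cL1 (fun x => f x + g x).
Proof.
move=> [mf fo] [mg go]; apply: (@le_cL1 _ (fun x => (cabs (f x))%:E + (cabs (g x))%:E)%E).
- exact: cmeasD.
- by apply: emeasurable_funD; exact: meas_ecabs.
- by move=> x; rewrite lee_fin cabsD.
- rewrite ge0_integralD//; first exact: lte_add_pinfty.
  + by move=> x _; rewrite lee_fin cabs_ge0.
  + exact: meas_ecabs.
  + by move=> x _; rewrite lee_fin cabs_ge0.
  + exact: meas_ecabs.
Qed.

Lemma cL1Z (z : C) f : cL1 f -> cL1 (fun x => z * f x).
Proof.
move=> [mf fo]; split; first exact: cmeasM (cmeas_cst z) mf.
under eq_integral do rewrite cabsM EFinM.
rewrite ge0_integralZl_EFin ?cabs_ge0//.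
- by rewrite lte_mul_pinfty// lee_fin cabs_ge0.
- by move=> x _; rewrite lee_fin cabs_ge0.
- exact: meas_ecabs.
Qed.

Lemma cL1N f : cL1 f -> cL1 (fun x => - f x).
Proof. by move=> /(cL1Z (-1)); under eq_fun do rewrite mulN1r. Qed.

Lemma cL1B f g : cL1 f -> cL1 g -> cL1 (fun x => f x - g x).
Proof. by move=> hf hg; apply: cL1D => //; exact: cL1N. Qed.

Lemma cL1_conj f : cL1 f -> cL1 (fun x => (f x)^*).
Proof.
move=> [mf fo]; split; first exact: cmeas_conj.
by under eq_integral do rewrite cabs_conj.
Qed.

Lemma cL1_0 : cL1 (fun=> 0).
Proof.
split; first exact: cmeas_cst.
by under eq_integral do rewrite cabs0; rewrite integral0 ltry.
Qed.

Lemma cL1_sum n (F : nat -> T -> C) : (forall i, cL1 (F i)) ->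
  cL1 (fun x => \sum_(i < n) F i x).
Proof.
move=> mF; elim: n => [|n IH].
  by under eq_fun do rewrite big_ord0; exact: cL1_0.
by under eq_fun do rewrite big_ord_recr/=; apply: cL1D.
Qed.

Lemma eq_cint f g : (forall x, f x = g x) -> cint f = cint g.
Proof. by move=> /funext ->. Qed.

Lemma cintD f g : cL1 f -> cL1 g -> cint (fun x => f x + g x) = cint f + cint g.
Proof.
move=> /cL1_integrable[f1 f2] /cL1_integrable[g1 g2].
apply: complex_ext; rewrite ?ReD ?ImD/=.
- by rewrite -RintegralD//; apply: eq_Rintegral => x _; rewrite ReD.
- by rewrite -RintegralD//; apply: eq_Rintegral => x _; rewrite ImD.
Qed.

Lemma cintZ (z : C) f : cL1 f -> cint (fun x => z * f x) = z * cint f.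
Proof.
move=> /cL1_integrable[f1 f2].
apply: complex_ext; rewrite ?ReM ?ImM/=.
  under eq_Rintegral do rewrite ReM. by rewrite RintegralB ?RintegralZl//; exact: integrableZl_EFin.
under eq_Rintegral do rewrite ImM.
by rewrite RintegralD ?RintegralZl//; exact: integrableZl_EFin.
Qed.

Lemma cintN f : cL1 f -> cint (fun x => - f x) = - cint f.
Proof. by move=> h; rewrite -mulN1r -cintZ//; under eq_fun do rewrite -mulN1r. Qed.

Lemma cintB f g : cL1 f -> cL1 g -> cint (fun x => f x - g x) = cint f - cint g.
Proof. by move=> hf hg; rewrite cintD//; [rewrite cintN|exact: cL1N]. Qed.

Lemma cint0 : cint (fun=> 0) = 0.
Proof. by apply: complex_ext => /=; rewrite /Rintegral integral0. Qed.

Lemma cint_sum n (F : nat -> T -> C) : (forall i, cL1 (F i)) ->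
  cint (fun x => \sum_(i < n) F i x) = \sum_(i < n) cint (F i).
Proof.
move=> hF; elim: n => [|n IH].
  by under eq_cint do rewrite big_ord0; rewrite cint0 big_ord0.
under eq_cint do rewrite big_ord_recr/=.
by rewrite cintD ?big_ord_recr/= ?IH//; exact: cL1_sum.
Qed.

Lemma cint_conj f : cint (fun x => (f x)^*) = (cint f)^*.
Proof.
apply: complex_ext => /=; first by apply: eq_Rintegral => x _; rewrite Re_conj.
rewrite /Rintegral; under eq_integral do rewrite Im_conj EFinN.
rewrite integralE [in RHS]integralE.
have := funeposN (fun x => (complex.Im (f x))%:E).
have := funenegN (fun x => (complex.Im (f x))%:E).
move=> -> ->.
(* If the positive or the negative part has infinite integral, [fine] sends both sides to 0. *)
case: (\int[m]_x _)%E => [a| |]; case: (\int[m]_x _)%E => [b| |] //=; rewrite ?oppr0//.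
by rewrite opprB.
Qed.

End cint.
Section cint_le.
Context {R : realType} d0 {T : measurableType d0} (m : {measure set T -> \bar R}).
Notation C := R[i].
Implicit Types f g : T -> C.

Lemma cabs_cint_le f : cL1 m f -> cabs (cint m f) <= \int[m]_x cabs (f x).
Proof.
move=> hf; set z := cint m f.
have [z0|z0] := eqVneq (cabs z) 0.
  by rewrite z0; apply: Rintegral_ge0 => x _; exact: cabs_ge0.
(* Rotating by this unit number makes the integral real and equal to its modulus, while
   [Re (w f) <= |f|] pointwise. *)
pose w : C := z^* * (cabs z)^-1%:C.
have w1 : cabs w = 1 by rewrite cabsM cabs_conj cabs_real normfV ger0_norm ?cabs_ge0// divff.
have wz : w * z = (cabs z)%:C.
  rewrite mulrAC [z^* * z]mulrC mul_conj -rmorphM/=; congr (_%:C). by rewrite expr2 mulfK.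
have -> : cabs z = \int[m]_x complex.Re (w * f x).
  by rewrite -[LHS]/(complex.Re (cabs z)%:C) -wz -cintZ.
have /cL1_integrable[i1 _] := cL1Z w hf.
apply: le_Rintegral => //; first exact: cL1_cabs.
move=> x _; rewrite (le_trans (ler_norm _))// (le_trans (normr_Re_le _))//.
by rewrite cabsM w1 mul1r.
Qed.

Lemma le_cabs_cint f : cmeas f ->
  ((cabs (cint m f))%:E <= \int[m]_x (cabs (f x))%:E)%E.
Proof.
move=> mf; have [->|hoo] := eqVneq (\int[m]_x (cabs (f x))%:E)%E +oo%E.
  exact: leey.
have hf : cL1 m f by split=> //; rewrite ltey.
rewrite (le_trans _ (_ : (\int[m]_x cabs (f x))%:E <= _)%E) ?lee_fin ?cabs_cint_le//.
by rewrite /Rintegral fineK// ge0_fin_numE ?ltey//; apply: integral_ge0 => x _; rewrite lee_fin cabs_ge0.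
Qed.

Lemma ae_eq_cint f g : cmeas f -> cmeas g -> {ae m, forall x, f x = g x} ->
  cint m f = cint m g.
Proof.
move=> [f1 f2] [g1 g2] fg; apply: complex_ext => /=; congr fine;
  apply: ae_eq_integral => //=; try exact/measurable_EFinP;
  by apply: filterS fg => x -> _.
Qed.

Lemma ae_eq_cL1 f g : cmeas g -> {ae m, forall x, f x = g x} -> cL1 m f -> cL1 m g.
Proof.
move=> mg fg [mf fo]; split=> //; rewrite (_ : integral _ _ _ = \int[m]_x (cabs (f x))%:E)%E//.
apply: ge0_ae_eq_integral => //=; try (by move=> x _; rewrite lee_fin cabs_ge0);
  try exact: meas_ecabs.
by apply: filterS fg => x -> _.
Qed.

Lemma cint_dct (f_ : nat -> T -> C) f (g : T -> \bar R) :
  (forall n, cmeas (f_ n)) -> cmeas f -> m.-integrable setT g ->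
  {ae m, forall x, ccvg (f_ ^~ x) (f x)} ->
  {ae m, forall x, forall n, ((cabs (f_ n x))%:E <= g x)%E} ->
  cL1 m f /\ ccvg (fun n => cint m (f_ n)) (cint m f).
Proof.
move=> mf_ mf ig cf bf.
have hf_ n : cL1 m (f_ n).
  split=> //; move/integrableP : ig => [mg]; apply: le_lt_trans.
  apply: (@ae_ge0_le_integral _ _ _ m _ measurableT _ (fun x => `|g x|)%E) => //.
  + by move=> x _; rewrite lee_fin cabs_ge0.
  + exact: meas_ecabs.
  + exact: measurableT_comp.
  + by apply: filterS bf => x h _; rewrite (le_trans (h n))// lee_abs.
have H (P : C -> R) : (forall h, cmeas h -> mfunT (fun x : T => P (h x))) ->
    (forall z, `|P z| <= cabs z) ->
    (forall u l, ccvg u l -> (P \o u) @ \oo --> P l) ->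
    m.-integrable setT (EFin \o (P \o f)) /\
    (fun n => \int[m]_x (P (f_ n x))) @ \oo --> \int[m]_x (P (f x)).
  move=> mP Pn Pc.
  have [] := @dominated_convergence _ _ _ m _ measurableT
    (fun n x => (P (f_ n x))%:E) (fun x => (P (f x))%:E) g.
  - by move=> n; apply/measurable_EFinP; exact: mP.
  - by apply/measurable_EFinP; exact: mP.
  - apply: filterS cf => x cx _; apply: cvg_EFin; first exact: nearW. exact: Pc cx.
  - exact: ig.
  - by apply: filterS bf => x h n _; rewrite (le_trans _ (h n))// lee_fin.
  - move=> iP _ cP; split=> //. by apply: fine_cvg; rewrite fineK//; exact: integrable_fin_num.
have [i1 c1] := H (@complex.Re R) (fun h hh => hh.1) normr_Re_le (@ccvg_Re R).
have [i2 c2] := H (@complex.Im R) (fun h hh => hh.2) normr_Im_le (@ccvg_Im R).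
by split; [exact/cL1_integrable|exact: ccvg_ReIm].
Qed.

Lemma cabs_dct (f_ : nat -> T -> C) f (g : T -> \bar R) :
  (forall n, cmeas (f_ n)) -> cmeas f -> m.-integrable setT g ->
  {ae m, forall x, ccvg (f_ ^~ x) (f x)} ->
  {ae m, forall x, forall n, ((cabs (f_ n x))%:E <= g x)%E} ->
  (fun n => \int[m]_x (cabs (f_ n x - f x))%:E)%E @ \oo --> 0%E.
Proof.
move=> mf_ mf ig cf bf.
(* The limit inherits the bound, so 2 g dominates the differences. *)
have bf' : {ae m, forall x, ((cabs (f x))%:E <= g x)%E}.
  apply: filterS2 cf bf => x cx bx.
  case: (g x) bx => [r| |] bx; rewrite ?leey//; last by have := bx 0%N; rewrite leeNy_eq.
  rewrite lee_fin -(cvg_lim (@Rhausdorff R) (ccvg_cabs cx)).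
  apply: limr_le; first by apply/cvg_ex; eexists; exact: ccvg_cabs cx.
  by apply: nearW => n; have := bx n; rewrite lee_fin.
have [|||||_ h _] := @dominated_convergence _ _ _ m _ measurableT
    (fun n x => (cabs (f_ n x - f x))%:E) (cst 0%E) (fun x => g x + g x)%E.
- by move=> n; apply: meas_ecabs; exact: cmeasB.
- exact: measurable_cst.
- by apply: filterS cf => x cx _; apply: cvg_EFin => //; exact: nearW.
- exact: integrableD.
- apply: filterS2 bf bf' => x h h' n _.
  by rewrite gee0_abs ?lee_fin ?cabs_ge0// (le_trans _ (leeD (h n) h'))// lee_fin cabsB.
apply: cvg_trans h; apply: near_eq_cvg; apply: nearW => n /=; apply: eq_integral => x _.
by rewrite /= subr0 ger0_norm ?cabs_ge0.
Qed.

End cint_le.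

Section cint_fubini.
Context {R : realType} d1 d2 {X : measurableType d1} {Y : measurableType d2}.
Variables (m1 : {sigma_finite_measure set X -> \bar R})
  (m2 : {sigma_finite_measure set Y -> \bar R}).
Notation C := R[i].
Implicit Type F : X * Y -> C.

(** Positive and negative parts are integrated separately by Tonelli; [fine] fixes the value where
    the integrals are infinite. *)
Lemma meas_Rintegral (f : X * Y -> R) : mfunT f ->
  mfunT (fun x => \int[m2]_y (f (x, y))).
Proof.
move=> mf; apply: measurableT_comp; first exact: fine_measurable.
under eq_fun do rewrite integralE; apply: emeasurable_funB.
  rewrite (_ : (fun _ => _) = fubini_F m2 (EFin \o f)^\+%E); last first.
    by apply/funext => x; apply: eq_integral => y _; rewrite !funeposE.
  apply: (measurable_fun_fubini_tonelli_F (m2 := m2) (EFin \o f)^\+%E) => //.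
  by apply: measurable_funepos; exact/measurable_EFinP.
rewrite (_ : (fun _ => _) = fubini_F m2 (EFin \o f)^\-%E); last first.
    by apply/funext => x; apply: eq_integral => y _; rewrite !funenegE.
  apply: (measurable_fun_fubini_tonelli_F (m2 := m2) (EFin \o f)^\-%E) => //.
by apply: measurable_funeneg; exact/measurable_EFinP.
Qed.

Lemma cmeas_cint F : cmeas F -> cmeas (fun x => cint m2 (fun y => F (x, y))).
Proof.
move=> [F1 F2]; split => /=.
  exact: (@meas_Rintegral (fun p => complex.Re (F p))).
exact: (@meas_Rintegral (fun p => complex.Im (F p))).
Qed.

Lemma cL1_prod F : cmeas F -> (\int[m1]_x \int[m2]_y (cabs (F (x, y)))%:E < +oo)%E ->
  cL1 (m1 \x m2)%E F.
Proof.
move=> mF Foo; split=> //; rewrite (fubini_tonelli1 (fun z => (cabs (F z))%:E))//.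
  exact: meas_ecabs.
by move=> z; rewrite lee_fin cabs_ge0.
Qed.

Lemma Rintegral_prod1 (f : X * Y -> R) : (m1 \x m2)%E.-integrable setT (EFin \o f) ->
  \int[m1]_x (\int[m2]_y f (x, y)) = \int[(m1 \x m2)%E]_z f z.
Proof.
move=> fi; rewrite /Rintegral; congr fine.
rewrite -integral12_prod_meas1//; apply: ae_eq_integral => //.
- apply/measurable_EFinP; apply: meas_Rintegral; apply/measurable_EFinP. exact: measurable_int fi.
- exact: (measurable_fubini_F fi).
- apply: filterS (ae_integrable1 fi) => x ix _ /=; rewrite /fubini_F fineK//. exact: integrable_fin_num.
Qed.

Lemma cint_prod1 F : cL1 (m1 \x m2)%E F ->
  cint m1 (fun x => cint m2 (fun y => F (x, y))) = cint (m1 \x m2)%E F.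
Proof.
move=> /cL1_integrable[i1 i2]; apply: complex_ext => /=.
  exact: (@Rintegral_prod1 (fun p => complex.Re (F p))).
exact: (@Rintegral_prod1 (fun p => complex.Im (F p))).
Qed.

Lemma ae_cL1_1 F : cL1 (m1 \x m2)%E F ->
  {ae m1, forall x, cL1 m2 (fun y => F (x, y))}.
Proof.
move=> /cL1_integrable[/ae_integrable1 i1 /ae_integrable1 i2].
by apply: filterS2 i1 i2 => x h1 h2; apply/cL1_integrable; split.
Qed.

Lemma cL1_cint1 F : cL1 (m1 \x m2)%E F -> cL1 m1 (fun x => cint m2 (fun y => F (x, y))).
Proof.
move=> [mF Foo].
have mc : mfunT (fun z => (cabs (F z))%:E) by exact: meas_ecabs.
have c0 z : (0 <= (cabs (F z))%:E)%E by rewrite lee_fin cabs_ge0.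
apply: (@le_cL1 _ _ _ _ _ (fun x => \int[m2]_y (cabs (F (x, y)))%:E)%E).
- exact: cmeas_cint.
- exact: (measurable_fun_fubini_tonelli_F (m2 := m2) (fun z => (cabs (F z))%:E)).
- by move=> x; apply: le_cabs_cint; apply: (cmeas_comp mF); exact: measurable_pair1.
- by move: Foo; rewrite fubini_tonelli1.
Qed.

End cint_fubini.

Section cint_swap.
Context {R : realType} d1 d2 {X : measurableType d1} {Y : measurableType d2}.
Variables (m1 : {sigma_finite_measure set X -> \bar R})
  (m2 : {sigma_finite_measure set Y -> \bar R}).
Notation C := R[i].
Implicit Type F : X * Y -> C.

Lemma Rintegral_swap (f : X * Y -> R) : (m1 \x m2)%E.-integrable setT (EFin \o f) ->
  \int[m1]_x (\int[m2]_y f (x, y)) = \int[m2]_y (\int[m1]_x f (x, y)).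
Proof.
move=> fi; rewrite Rintegral_prod1// /Rintegral; congr fine.
rewrite -integral21_prod_meas1//; apply: ae_eq_integral => //.
- exact: (measurable_fubini_G fi).
- apply/measurable_EFinP. have /measurable_EFinP mf := measurable_int _ fi.
  have mf' : mfunT (fun p : Y * X => f (p.2, p.1)).
    by apply: (measurableT_comp mf); exact: measurable_swap.
  exact: (meas_Rintegral m1 mf').
- apply: filterS (ae_integrable2 fi) => x ix _ /=; rewrite /fubini_G fineK//. exact: integrable_fin_num.
Qed.

Lemma cint_swap F : cL1 (m1 \x m2)%E F ->
  cint m1 (fun x => cint m2 (fun y => F (x, y))) =
  cint m2 (fun y => cint m1 (fun x => F (x, y))).
Proof.
move=> /cL1_integrable[i1 i2]; apply: complex_ext => /=.
  exact: (@Rintegral_swap (fun p => complex.Re (F p))).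
exact: (@Rintegral_swap (fun p => complex.Im (F p))).
Qed.

End cint_swap.

Ltac meas_hyp := match goal with
  | H : cmeas _ |- measurable_fun _ _ => solve [exact: H.1 | exact: H.2]
  | H : cL1 _ _ |- cmeas _ => solve [exact: H.1]
  | H : cL1 _ _ |- measurable_fun _ _ => solve [exact: H.1.1 | exact: H.1.2]
  end.
Ltac meas_ext := fail.
Ltac meas_step := match goal with
  | |- measurable_fun _ (fun _ => ?c) => exact: measurable_cst
  | |- measurable_fun _ (fun x => x) => exact: measurable_id
  | |- measurable_fun _ fst => exact: measurable_fst
  | |- measurable_fun _ snd => exact: measurable_snd
  | |- measurable_fun _ (fun x => (@?f x)%:E) => apply/measurable_EFinP
  | |- measurable_fun _ (EFin \o _) => apply/measurable_EFinP
  | |- measurable_fun _ (fun x => (@?f x + - @?g x)%R) => apply: measurable_funB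
  | |- measurable_fun _ (fun x => (@?f x + @?g x)%R) => apply: measurable_funD
  | |- measurable_fun _ (fun x => (@?f x * @?g x)%R) => apply: measurable_funM
  | |- measurable_fun _ (fun x => (@?f x ^+ _)%R) => apply: measurable_funX
  | |- measurable_fun _ (fun x => (- @?f x)%R) => apply: (measurableT_comp (@oppr_measurable _ _))
  | |- measurable_fun _ (fun x => (expR (@?f x))%R) => apply: (measurableT_comp (@measurable_expR _))
  | |- measurable_fun _ (fun x => (@?f x * @?g x)%E) => apply: emeasurable_funM
  | |- measurable_fun _ (fun x => @GRing.add _ (@?f x) (@?g x)) => apply: emeasurable_funD
  | |- measurable_fun _ (fun x => cabs (@?f x)) => apply: meas_cabs
  | |- measurable_fun _ (fun x => \1_ _ x) => apply: measurable_indic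
  | |- cmeas (fun _ => ?c) => exact: cmeas_cst
  | |- cmeas (fun x => (@?f x + - @?g x)%R) => apply: cmeasB
  | |- cmeas (fun x => (@?f x + @?g x)%R) => apply: cmeasD
  | |- cmeas (fun x => (@?f x * @?g x)%R) => apply: cmeasM
  | |- cmeas (fun x => (- @?f x)%R) => apply: cmeasN
  | |- cmeas (fun x => conjc (@?f x)) => apply: cmeas_conj
  | |- cmeas (fun x => (@?f x)%:C) => apply: cmeas_real
  | _ => meas_ext
  end.
Ltac meas_comp := match goal with
  | H : measurable_fun _ ?f |- measurable_fun _ (fun x => ?f (@?g x)) => apply: (measurableT_comp H)
  | H : cmeas ?f |- cmeas (fun x => ?f (@?g x)) => apply: (cmeas_comp H)
  | |- measurable_fun _ (fun x => \int[?m]_(y in _) @?F x y)%E =>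
      apply: (measurable_fun_fubini_tonelli_F (m2 := m) (fun p => F p.1 p.2)); cbv beta
  end.
Ltac pos_step := match goal with
  | |- is_true (0 <= cabs _)%R => exact: cabs_ge0
  | |- is_true (0 <= expR _)%R => exact: expR_ge0
  | |- is_true (0 <= `|_|)%R => exact: normr_ge0
  | |- is_true (0 <= _%:R)%R => exact: ler0n
  | |- is_true (0 <= _ ^+ 2)%R => exact: sqr_ge0
  | |- is_true (0 <= _ ^+ _)%R => apply: exprn_ge0
  | H : is_true (0 < ?x)%R |- is_true (0 <= ?x)%R => exact: ltW
  | |- is_true (0 <= _ - _)%R => rewrite subr_ge0
  | |- is_true (0 <= _ * _)%R => apply: mulr_ge0
  | |- is_true (0 <= _ + _)%R => apply: addr_ge0
  | |- is_true (0 <= _^-1)%R => rewrite invr_ge0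
  | |- is_true (_ <= \int[_]_(_ in _) _)%E => apply: integral_ge0
  | |- is_true (_ <= _%:E)%E => rewrite lee_fin
  | |- is_true (_ <= limn _)%E => apply: nneseries_ge0
  | |- is_true (_ <= _ * _)%E => apply: mule_ge0
  | |- is_true (@Order.le _ _ _ (@GRing.add _ _ _)) => apply: adde_ge0
  end.
Ltac meas := intros; first [solve [auto 2] | meas_hyp | meas_step; meas | meas_comp; meas | pos_step; meas].

(** * Translations, reflections and Borel sets of R^d *)

Section rV_maps.
Context {R : realType} {d : nat}.
Notation V := 'rV[R]_d.
Notation mu := (lebesgue_rV d).

Lemma meas_rV_add d0 (T : measurableType d0) (f g : T -> V) :
  mfunT f -> mfunT g -> mfunT (fun x => f x + g x).
Proof.
move=> mf mg; apply: measurable_fun_rV => i.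
rewrite (_ : _ \o _ = (rV_coord i \o f) \+ (rV_coord i \o g)); last first.
  by apply/funext => x; rewrite /= /rV_coord mxE.
apply: measurable_funD; apply: measurableT_comp => //; exact: measurable_rV_coord.
Qed.

Lemma meas_rV_opp d0 (T : measurableType d0) (f : T -> V) :
  mfunT f -> mfunT (fun x => - f x).
Proof.
move=> mf; apply: measurable_fun_rV => i.
rewrite (_ : _ \o _ = \- (rV_coord i \o f)); last first.
  by apply/funext => x; rewrite /= /rV_coord mxE.
apply: measurable_funN; apply: measurableT_comp => //; exact: measurable_rV_coord.
Qed.

Lemma meas_rV_sub d0 (T : measurableType d0) (f g : T -> V) :
  mfunT f -> mfunT g -> mfunT (fun x => f x - g x).
Proof. by move=> mf mg; apply: meas_rV_add => //; exact: meas_rV_opp. Qed.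

Section measure_preserving.
Variable T : V -> V.
Hypothesis mT : mfunT T.
Hypothesis hT : forall a b, mu (T @^-1` obox a b) = mu (obox a b).

(** The push-forward agrees with the measure on boxes, hence everywhere: changes of variables only
    have to be checked on boxes. *)
Lemma mp_measure A : measurable A -> mu (T @^-1` A) = mu A.
Proof.
pose mixin := isMeasurableFun.Build _ _ _ _ _ mT.
pose T' : {mfun V >-> V} := HB.pack T mixin.
move=> mA; apply/esym; apply: (@rV_measure_unique R d mu (pushforward mu T')) => //.
  by move=> a b; exact/esym/hT.
by move=> n; exact: obox_lty.
Qed.

Lemma mp_integral (f : V -> \bar R) : mfunT f ->
  (\int[mu]_x f (T x) = \int[mu]_x f x)%E.
Proof.
pose mixin := isMeasurableFun.Build _ _ _ _ _ mT.
pose T' : {mfun V >-> V} := HB.pack T mixin.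
have H g : mfunT g -> (forall x, 0 <= g x)%E ->
    (\int[mu]_x g (T x) = \int[mu]_x g x)%E.
  move=> mg g0; rewrite -[LHS](@ge0_integral_pushforward _ _ _ _ _ T mT mu setT g)//.
  by apply: eq_measure_integral => A mA _; exact: mp_measure.
move=> mf; rewrite integralE [RHS]integralE; congr (_ - _)%E.
  rewrite -(H (f^\+)%E)//; last exact: measurable_funepos. by apply: eq_integral => x _; rewrite !funeposE.
rewrite -(H (f^\-)%E)//; last exact: measurable_funeneg.
by apply: eq_integral => x _; rewrite !funenegE.
Qed.

Lemma mp_cint (f : V -> R[i]) : cmeas f -> cint mu (fun x => f (T x)) = cint mu f.
Proof.
move=> [f1 f2]; apply: complex_ext => /=; congr fine.
  by apply: (@mp_integral (fun x => (complex.Re (f x))%:E)); meas.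
by apply: (@mp_integral (fun x => (complex.Im (f x))%:E)); meas.
Qed.

Lemma mp_cL1 (f : V -> R[i]) : cL1 mu f -> cL1 mu (fun x => f (T x)).
Proof.
move=> [mf fo]; split; first exact: (cmeas_comp mf mT).
by rewrite (@mp_integral (fun x => (cabs (f x))%:E)); meas.
Qed.

End measure_preserving.

Lemma meas_subl (c : V) : mfunT (fun x : V => c - x).
Proof. by apply: meas_rV_sub; meas. Qed.

Lemma meas_addr (c : V) : mfunT (fun x : V => x + c).
Proof. by apply: meas_rV_add; meas. Qed.

Lemma preim_addr (c : V) a b : mu ((fun x : V => x + c) @^-1` obox a b) = mu (obox a b).
Proof.
rewrite (_ : _ @^-1` _ = obox (fun i => a i - c ord0 i) (fun i => b i - c ord0 i)); last first.
  by apply/seteqP; split => x h i; have := h i; rewrite /= !in_itv/= mxE ltrBlDr lerBrDr.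
rewrite /obox !(lebesgue_rV_box (fun i => measurable_itv _)); apply: eq_bigr => i _.
rewrite !lebesgue_measure_itv/= !lte_fin ltrD2r.
by case: ifP => // _; rewrite -!EFinB; congr (_%:E); ring.
Qed.

Lemma preim_subl (c : V) a b : mu ((fun x : V => c - x) @^-1` obox a b) = mu (obox a b).
Proof.
rewrite (_ : (fun x : V => c - x) @^-1` _ =
   [set x : V | forall i, `[c ord0 i - b i, c ord0 i - a i[%classic (x ord0 i)]); last first.
  apply/seteqP; split => x h i; have := h i; rewrite /= !in_itv/= !mxE => /andP[h1 h2];
    by apply/andP; split; lra.
rewrite /obox !(lebesgue_rV_box (fun i => measurable_itv _)); apply: eq_bigr => i _.
rewrite !lebesgue_measure_itv/= !lte_fin ltrD2l ltrN2.
by case: ifP => // _; rewrite -!EFinB; congr (_%:E); ring.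
Qed.

Definition integral_subl c := mp_integral (meas_subl c) (preim_subl c).
Definition integral_addr c := mp_integral (meas_addr c) (preim_addr c).
Definition cint_subl c := mp_cint (meas_subl c) (preim_subl c).
Definition cint_addr c := mp_cint (meas_addr c) (preim_addr c).
Definition cL1_subl c := mp_cL1 (meas_subl c) (preim_subl c).
Definition cL1_addr c := mp_cL1 (meas_addr c) (preim_addr c).

(** The sigma-algebra is generated by the coordinates, so an open set has to be exhibited as a
    countable union of measurable cells: those it contains among the grids of mesh 1/(n+1). *)
Lemma meas_open_rV (U : set V) : open U -> measurable U.
Proof.
move=> oU.
pose B (p : {ffun 'I_d -> int} * nat) : set V :=
  obox (fun i => (p.1 i)%:~R / p.2.+1%:R) (fun i => ((p.1 i)%:~R + 1) / p.2.+1%:R).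
rewrite (_ : U = \bigcup_p (if `[< B p `<=` U >] then B p else set0)).
  apply: countable_bigcupT_measurable; first exact: countableP.
  by move=> p; case: ifP => // _; exact: meas_obox.
apply/seteqP; split => [x Ux|x [p _]]; last by case: asboolP => // h /h.
have : nbhs x U by exact: open_nbhs_nbhs.
move/nbhs_ballP => [e /= e0 eU].
pose n := Num.truncn e^-1.
have ne : n.+1%:R^-1 < e.
  rewrite -[ltRHS]invrK ltf_pV2 ?posrE ?invr_gt0 ?ltr0n//. exact: truncnS_gt.
(* Cells are open on the left and closed on the right, hence [ceil - 1] and not the floor. *)
pose p : {ffun 'I_d -> int} := [ffun i => (Num.ceil (x ord0 i * n.+1%:R) - 1)%R].
have n0 : (0 : R) < n.+1%:R by rewrite ltr0n.
have xB : B (p, n) x.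
  move=> i; rewrite /= in_itv/= ltr_pdivrMr// ler_pdivlMr// /p ffunE [in X in _ && X]rmorphB/= subrK ceil_ge andbT.
  by have /andP[] := @ceil_itv R (x ord0 i * n.+1%:R).
exists (p, n) => //; case: asboolP => // -[] y yB; apply: eU.
split=> // i j; rewrite (ord1 i); have := xB j; have := yB j; rewrite /B/= !in_itv/= => /andP[y1 y2] /andP[x1 x2].
rewrite /ball/= ltr_norml.
have q : ((p j)%:~R + 1) / n.+1%:R - (p j)%:~R / n.+1%:R = n.+1%:R^-1 :> R.
  by rewrite -mulrBl addrAC subrr add0r mul1r.
rewrite -[x _ _]/(x ord0 j) -[y _ _]/(y ord0 j).
move: (x ord0 j) (y ord0 j) (_ / _) (_ / _) y1 y2 x1 x2 q => X Y P Q y1 y2 x1 x2 q.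
move: ne q; move: (n.+1%:R^-1) => N ne q.
by apply/andP; split; lra.
Qed.

Lemma cont_measurable_rV (f : V -> R) : continuous f -> mfunT f.
Proof.
move=> cf; apply: (measurability _ (RGenOInfty.measurableE R)) => //.
move=> _ [_ [r ->] <-]; rewrite setTI; apply: meas_open_rV.
by apply: open_comp => // x _; exact: cf.
Qed.

Lemma compact_measurable_rV (K : set V) : compact K -> measurable K.
Proof.
move=> cK; rewrite -[K]setCK; apply: measurableC; apply: meas_open_rV.
by apply: closed_openC; apply: compact_closed => //; exact: norm_hausdorff.
Qed.

Lemma compact_sub_cbox (K : set V) : compact K -> exists n, K `<=` cbox n.
Proof.
move=> /compact_bounded[M [Mr h]].
exists (Num.truncn (`|M| + 1)).+1 => x Kx i.
have := h (`|M| + 1); rewrite (le_lt_trans (ler_norm _)) ?ltrDl// => /(_ isT _ Kx) xM.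
have : `|x ord0 i| < (Num.truncn (`|M| + 1)).+1%:R.
  apply: le_lt_trans (truncnS_gt _); apply: le_trans xM. rewrite [leRHS]/Num.norm/= mx_normE.
  exact: (le_bigmax _ (fun p : 'I_1 * 'I_d => `|x p.1 p.2|%:nng) (ord0, i)).
by rewrite /= in_itv/= ltr_norml => /andP[-> /ltW].
Qed.

Lemma meas_dotv d0 (T : measurableType d0) (f g : T -> V) :
  mfunT f -> mfunT g ->
  mfunT (fun x => dotv (f x) (g x)).
Proof.
move=> mf mg; rewrite /dotv; apply: measurable_sum => i; apply: measurable_funM.
  by apply: (measurableT_comp (measurable_rV_coord i)).
by apply: (measurableT_comp (measurable_rV_coord i)).
Qed.

Lemma meas_enorm : mfunT (@enorm R d).
Proof.
apply: (measurableT_comp (continuous_measurable_fun (@sqrt_continuous R))).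
by apply: meas_dotv.
Qed.

End rV_maps.

(** * Splitting off a coordinate, and integrals of product functions *)

Section rV_fubini.
Context {R : realType} {d : nat}.
Notation V := 'rV[R]_d.

Lemma ge0_integral_rVS (f : 'rV[R]_d.+1 -> \bar R) :
  mfunT f -> (forall x, 0 <= f x)%E ->
  (\int[lebesgue_rV d.+1]_x f x =
   \int[(@lebesgue_measure R \x lebesgue_rV d)%E]_p f (rV_cons p))%E.
Proof.
move=> mf f0.
have E := @ge0_integral_pushforward _ _ (measurableTypeR R * 'rV[R]_d)%type _ R
  (@rV_cons R d) (@measurable_rV_cons R d)
  (@lebesgue_measure R \x lebesgue_rV d)%E setT f measurableT mf (fun y _ => f0 y).
rewrite preimage_setT in E; rewrite -[RHS]E.
apply: eq_measure_integral; first exact: measurable_rV_cons.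
meas.
Qed.

Lemma cint_rVS (f : 'rV[R]_d.+1 -> R[i]) : cmeas f ->
  cint (lebesgue_rV d.+1) f = cint (@lebesgue_measure R \x lebesgue_rV d)%E (fun p => f (rV_cons p)).
Proof.
have H (g : 'rV[R]_d.+1 -> R) : mfunT g ->
    \int[lebesgue_rV d.+1]_x g x = \int[(@lebesgue_measure R \x lebesgue_rV d)%E]_p g (rV_cons p).
  move=> mg; rewrite /Rintegral; congr fine.
  rewrite integralE [RHS]integralE; congr (_ - _)%E; rewrite ge0_integral_rVS//.
  - by apply: eq_integral => x _; rewrite !funeposE.
  - by apply: measurable_funepos; meas.
  - by apply: eq_integral => x _; rewrite !funenegE.
  - by apply: measurable_funeneg; meas.
by move=> [f1 f2]; apply: complex_ext => /=; rewrite H.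
Qed.

(** False for d = 0, where the measure is a Dirac mass. The divisions by powers of |xi|, valid
    almost everywhere, rest on this. *)
Lemma lebesgue_rV0 : (0 < d)%N -> lebesgue_rV d [set (0 : V)] = 0%E.
Proof.
case: d => [//|n _].
rewrite (_ : [set 0] = [set x : 'rV[R]_n.+1 | forall i, [set 0 : R] (x ord0 i)]).
  rewrite (lebesgue_rV_box (A := fun=> [set 0 : R])) => [|i]; last meas.
  by rewrite big_ord_recl lebesgue_measure_set1 mul0e.
apply/seteqP; split => x /= => [-> i|h]; first by rewrite mxE.
by apply/rowP => i; rewrite mxE h.
Qed.

End rV_fubini.

Section cexp.
Context {R : realType}.

Definition cexp (t : R) : R[i] := Complex (cos t) (sin t).

Lemma cexpD s t : cexp (s + t) = cexp s * cexp t.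
Proof. by apply: complex_ext; rewrite /= ?cosD ?sinD//; ring. Qed.

Lemma cexpN t : cexp (- t) = (cexp t)^*.
Proof. by apply: complex_ext; rewrite /= ?cosN ?sinN. Qed.

Lemma cabs_cexp t : cabs (cexp t) = 1.
Proof. by rewrite /cabs/= cos2Dsin2 sqrtr1. Qed.

Lemma cexp0 : cexp 0 = 1.
Proof. by apply: complex_ext; rewrite /= ?cos0 ?sin0. Qed.

Lemma cmeas_cexp d0 (T : measurableType d0) (f : T -> R) :
  mfunT f -> cmeas (fun x => cexp (f x)).
Proof.
move=> mf; split => /=.
  by apply: (measurableT_comp (continuous_measurable_fun (@continuous_cos R))).
by apply: (measurableT_comp (continuous_measurable_fun (@continuous_sin R))).
Qed.

End cexp.

Ltac meas_ext1 := match goal with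
  | |- measurable_fun _ (fun x => dotv (@?f x) (@?g x)) => apply: meas_dotv
  | |- measurable_fun _ (@enorm _ _) => exact: meas_enorm
  | |- measurable_fun _ (fun x => enorm (@?f x)) => apply: (measurableT_comp (@meas_enorm _ _))
  | |- measurable_fun _ (fun x => (@?f x + - @?g x)%R) => apply: meas_rV_sub
  | |- cmeas (fun x => cexp (@?f x)) => apply: cmeas_cexp
  end.
Ltac meas_ext ::= meas_ext1.

Section product_integral.
Context {R : realType}.
Notation leb := (@lebesgue_measure R).

Lemma meas_rV_prod d (g : 'I_d -> R -> R) :
  (forall i, mfunT (g i)) ->
  mfunT (fun x : 'rV[R]_d => \prod_(i < d) g i (x ord0 i)).
Proof.
move=> mg; apply: measurable_prod => i _.
exact: (measurableT_comp (mg i) (measurable_rV_coord i)).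
Qed.

Lemma int_rV_prod d (g : 'I_d -> R -> R) :
  (forall i, mfunT (g i)) -> (forall i x, 0 <= g i x) ->
  (\int[lebesgue_rV d]_x (\prod_(i < d) g i (x ord0 i))%:E =
   \prod_(i < d) \int[leb]_t (g i t)%:E)%E.
Proof.
elim: d g => [|d IH] g mg g0.
  rewrite big_ord0 /= integral_dirac//=; first by rewrite diracT mul1e big_ord0.
  by apply/measurable_EFinP; under eq_fun do rewrite big_ord0; exact: measurable_cst.
rewrite ge0_integral_rVS; last 2 first.
- by apply/measurable_EFinP; exact: meas_rV_prod.
- by move=> x; rewrite lee_fin prodr_ge0.
rewrite big_ord_recl -(IH (fun i => g (lift ord0 i)))//.
have E p : \prod_(i < d.+1) g i (@rV_cons R d p ord0 i) =
    g ord0 p.1 * \prod_(i < d) g (lift ord0 i) (p.2 ord0 i).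
  rewrite big_ord_recl /rV_cons mxE unlift_none/=; congr (_ * _). by apply: eq_bigr => i _; rewrite mxE liftK.
under eq_integral do rewrite E EFinM.
have mP : mfunT (fun x : 'rV[R]_d => \prod_(i < d) g (lift ord0 i) (x ord0 i)).
  exact: (meas_rV_prod (fun i => mg (lift ord0 i))).
have P0 (x : 'rV[R]_d) : 0 <= \prod_(i < d) g (lift ord0 i) (x ord0 i).
  by apply: prodr_ge0 => i _; meas.
rewrite (fubini_tonelli1 (fun p : measurableTypeR R * 'rV[R]_d => (g ord0 p.1)%:E * (\prod_(i < d) g (lift ord0 i) (p.2 ord0 i))%:E)%E)//=.
- under eq_integral => a _.
    rewrite /fubini_F/= ge0_integralZl//; last 3 first.
    + meas.
    + meas.
    + meas.
    over.
  rewrite ge0_integralZr//.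
  + by apply/measurable_EFinP; exact: (mg ord0).
  + meas.
  + meas.
- apply: emeasurable_funM; apply/measurable_EFinP.
  + exact: (measurableT_comp (mg ord0) measurable_fst).
  + exact: (measurableT_comp mP measurable_snd).
- meas.
Qed.

Lemma cmeas_rV_prod d (f : 'I_d -> R -> R[i]) : (forall i, cmeas (f i)) ->
  cmeas (fun x : 'rV[R]_d => \prod_(i < d) f i (x ord0 i)).
Proof.
move=> mf.
elim: (index_enum _) => [|i r IH].
  by under eq_fun do rewrite big_nil; meas.
under eq_fun do rewrite big_cons; apply: cmeasM => //.
by apply: (cmeas_comp (mf i)); exact: measurable_rV_coord.
Qed.

Lemma cabs_prod I (r : seq I) (P : pred I) (F : I -> R[i]) :
  cabs (\prod_(i <- r | P i) F i) = \prod_(i <- r | P i) cabs (F i).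
Proof. by apply: big_morph => [x y|]; [exact: cabsM|exact: cabs1]. Qed.

Lemma cL1_rV_prod d (f : 'I_d -> R -> R[i]) : (forall i, cL1 leb (f i)) ->
  cL1 (lebesgue_rV d) (fun x => \prod_(i < d) f i (x ord0 i)).
Proof.
move=> hf; split; first by apply: cmeas_rV_prod => i; case: (hf i).
under eq_integral do rewrite cabs_prod.
rewrite (int_rV_prod (g := fun i t => cabs (f i t))).
- suff /andP[] : (0 <= \prod_(i < d) \int[leb]_t (cabs (f i t))%:E < +oo)%E by [].
  apply: (big_ind (fun x => 0 <= x < +oo)%E); first by rewrite lee01 ltry.
    move=> x y /andP[x0 xoo] /andP[y0 yoo]; rewrite mule_ge0//=. by rewrite lte_mul_pinfty// ge0_fin_numE.
  move=> i _; case: (hf i) => _ ->; rewrite andbT. meas.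
- by move=> i; apply: meas_cabs; case: (hf i).
- meas.
Qed.

Lemma cint_rV_prod d (f : 'I_d -> R -> R[i]) : (forall i, cL1 leb (f i)) ->
  cint (lebesgue_rV d) (fun x => \prod_(i < d) f i (x ord0 i)) =
  \prod_(i < d) cint leb (f i).
Proof.
elim: d f => [|d IH] f hf.
  rewrite big_ord0; under eq_cint do rewrite big_ord0.
  apply: complex_ext => /=; rewrite /Rintegral /= integral_dirac ?diracT ?mul1e//.
have mf i : cmeas (f i) by case: (hf i).
rewrite cint_rVS; last exact: cmeas_rV_prod.
rewrite big_ord_recl -(IH (fun i => f (lift ord0 i)))//.
have E p : \prod_(i < d.+1) f i (@rV_cons R d p ord0 i) =
    f ord0 p.1 * \prod_(i < d) f (lift ord0 i) (p.2 ord0 i).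
  rewrite big_ord_recl /rV_cons mxE unlift_none/=; congr (_ * _). by apply: eq_bigr => i _; rewrite mxE liftK.
under eq_cint do rewrite E.
have hP : cL1 (lebesgue_rV d) (fun x => \prod_(i < d) f (lift ord0 i) (x ord0 i)).
  exact: (cL1_rV_prod (f := fun i => f (lift ord0 i))).
have mF : cmeas (fun p : measurableTypeR R * 'rV[R]_d =>
    f ord0 p.1 * \prod_(i < d) f (lift ord0 i) (p.2 ord0 i)).
  apply: cmeasM; first exact: (cmeas_comp (mf ord0) measurable_fst).
  by case: hP => hP _; exact: (cmeas_comp hP measurable_snd).
rewrite -cint_prod1 => [|/=].
  under eq_cint do rewrite /= cintZ//. under eq_cint do rewrite mulrC. by rewrite cintZ// mulrC.
apply: cL1_prod => //.
under eq_integral do under eq_integral do rewrite cabsM EFinM.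
under eq_integral => a _.
  rewrite /= ge0_integralZl//; last 3 first.
  + meas.
  + meas.
  + meas.
  over.
rewrite ge0_integralZr//.
- apply: lte_mul_pinfty => //.
  + by apply: integral_ge0 => x _; meas.
  + rewrite ge0_fin_numE; first by case: (hf ord0). by apply: integral_ge0 => x _; meas.
  + by case: hP.
- exact: (meas_ecabs (mf ord0)).
- meas.
- by apply: integral_ge0 => x _; meas.
Qed.

End product_integral.

(** * Abel factor and Poisson kernel on the line *)

Section poisson1.
Context {R : realType}.
Notation leb := (@lebesgue_measure R).
Implicit Types e x t : R.

(** The Cauchy density of scale e, proportional to the transform of [abel1 e]. Its primitive is an
    arctangent, so the mass of every interval is explicit. *)
Definition poisson1 e x : R := pi^-1 * (e / (e ^+ 2 + x ^+ 2)).

Definition abel1 e t : R := expR (- (e * `|t|)).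

Lemma poisson1_ge0 e x : 0 <= e -> 0 <= poisson1 e x.
Proof. by move=> e0; rewrite mulr_ge0 ?invr_ge0 ?pi_ge0// divr_ge0// addr_ge0// sqr_ge0. Qed.

Lemma cont_abel1 e : continuous (abel1 e).
Proof.
move=> t; apply: continuous_comp; last exact: continuous_expR.
by apply: continuousN; apply: continuousM; [exact: cvg_cst|exact: norm_continuous].
Qed.

Lemma cont_poisson1 e : 0 < e -> continuous (poisson1 e : R -> R).
Proof.
move=> e0 x; apply: (@continuousM _ R (fun=> pi^-1) (fun x => e / (e ^+ 2 + x ^+ 2))).
  exact: cvg_cst.
apply: (@continuousM _ R (fun=> e) (fun x => (e ^+ 2 + x ^+ 2)^-1)); first exact: cvg_cst.
apply: (@cvgV R R _ _ (fun s : R => e ^+ 2 + s ^+ 2)).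
  by rewrite gt_eqF// ltr_wpDr ?sqr_ge0// exprn_gt0.
apply: (@continuousD _ R R (fun=> e ^+ 2) (fun x => x ^+ 2)); first exact: cvg_cst.
exact: exprn_continuous.
Qed.

Lemma meas_poisson1 e : 0 < e -> mfunT (poisson1 e).
Proof. by move=> e0; apply: continuous_measurable_fun; exact: cont_poisson1. Qed.

(** The 1 added to the cosine makes the integrand nonnegative, as the fundamental theorem on a
    half-line asks; it is subtracted again in [cint_abel1]. *)
Lemma int_abel1_half e x : 0 < e ->
  (\int[leb]_(t in `[0%R, +oo[) (abel1 e t * (1 + cos (x * t)))%:E =
   (e^-1 + e / (e ^+ 2 + x ^+ 2))%:E)%E.
Proof.
move=> e0.
have D0 : e ^+ 2 + x ^+ 2 != 0 by rewrite gt_eqF// ltr_wpDr ?sqr_ge0// exprn_gt0.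
(* Undetermined coefficients for the primitive that tends to 0 at infinity. *)
pose A := x / (e ^+ 2 + x ^+ 2); pose B := - (e / (e ^+ 2 + x ^+ 2)); pose C := - e^-1.
pose F t := expR (- (e * t)) * (A * sin (x * t) + B * cos (x * t) + C).
have dF t : is_derive t 1 F (expR (- (e * t)) * (1 + cos (x * t))).
  rewrite /F; apply: is_derive_eq. rewrite /GRing.scale/= /A /B /C; field. by rewrite D0 gt_eqF.
rewrite (@ge0_continuous_FTC2y R _ F 0 0).
- rewrite /F !mulr0 sin0 cos0 oppr0 expR0 /A /B /C -EFinB; congr (_%:E).
  by rewrite mulr0 add0r mulr1 mul1r sub0r opprD !opprK addrC.
- by move=> t _; rewrite mulr_ge0 ?expR_ge0// -lerBlDl sub0r cos_geN1.
- apply: continuous_subspaceT => t; apply: continuousM; first exact: cont_abel1.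
  apply: continuousD; first exact: cvg_cst. apply: continuous_comp; last exact: continuous_cos.
  by apply: continuousM; [exact: cvg_cst|exact: cvg_id].
- apply/norm_cvg0P. have : (fun t => expR (- (e * t)) * (`|A| + `|B| + `|C|)) t @[t --> +oo] --> 0.
    rewrite -[X in _ --> X](mul0r (`|A| + `|B| + `|C|)); apply: cvgM; last exact: cvg_cst.
    apply: (@cvg_comp _ _ _ (fun t => e * t) (fun t => expR (- t)) _ +oo%R); last exact: cvgr_expR.
    apply/cvgryPge => a; exists (a / e); split; first exact: num_real.
    by move=> y ay; rewrite mulrC -ler_pdivrMr// ltW.
  apply: squeeze_cvgr; last exact: cvg_cst. apply: nearW => t; rewrite normr_ge0/= normrM (ger0_norm (expR_ge0 _)).
  rewrite ler_wpM2l ?expR_ge0// (le_trans (ler_normD _ _))// lerD2r.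
  rewrite (le_trans (ler_normD _ _))// !normrM lerD// ler_piMr//.
    by rewrite ler_norml sin_geN1 sin_le1.
  by rewrite ler_norml cos_geN1 cos_le1.
- by move=> t t0; case: (dF t).
- apply: cvg_at_right_filter; apply: differentiable_continuous. by apply/derivable1_diffP; case: (dF 0).
- move=> t; rewrite in_itv/= andbT => t0; rewrite derive1E (@derive_val _ _ _ _ _ _ _ (dF t)).
  by rewrite /abel1 gtr0_norm.
Qed.

Lemma int_abel1_cos1 e x : 0 < e ->
  (\int[leb]_t (abel1 e t * (1 + cos (x * t)))%:E =
   (2 * (e^-1 + e / (e ^+ 2 + x ^+ 2)))%:E)%E.
Proof.
move=> e0; rewrite ge0_symfun_integralT.
- by rewrite -set_itvcy int_abel1_half// EFinM.
- by move=> t; rewrite mulr_ge0 ?expR_ge0// -lerBlDl sub0r cos_geN1.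
- move=> t; apply: continuousM; first exact: cont_abel1. apply: continuousD; first exact: cvg_cst.
  apply: continuous_comp; last exact: continuous_cos. by apply: continuousM; [exact: cvg_cst|exact: cvg_id].
- by move=> t; rewrite /= /abel1 normrN mulrN cosN.
Qed.

Lemma integrable_abel1 e : 0 < e -> leb.-integrable setT (EFin \o abel1 e).
Proof.
move=> e0; apply/integrableP; split.
  by apply/measurable_EFinP; apply: continuous_measurable_fun; exact: cont_abel1.
have := int_abel1_cos1 0 e0.
under eq_integral do rewrite mul0r cos0 -(natrD _ 1 1) mulrC EFinM.
rewrite ge0_integralZl_EFin//=; last 2 first.
- by move=> t _; rewrite lee_fin expR_ge0.
- by apply/measurable_EFinP; apply: continuous_measurable_fun; exact: cont_abel1.
under [in X in _ -> X]eq_integral do rewrite /= ger0_norm ?expR_ge0//.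
have := @integral_ge0 _ _ R leb setT (fun t => (abel1 e t)%:E).
case: (\int[leb]_x _)%E => [r _ _| /(_ _)|//]; rewrite ?ltry//.
by rewrite gt0_muley ?lte_fin.
Qed.

Lemma lebesgue_integralN (f : R -> \bar R) : mfunT f ->
  (forall t, 0 <= f t)%E -> (\int[leb]_t f (- t)%R = \int[leb]_t f t)%E.
Proof.
move=> mf f0.
have mN : mfunT (-%R : measurableTypeR R -> measurableTypeR R).
  meas.
have E := @ge0_integral_pushforward _ _ (measurableTypeR R) _ R _ mN leb setT f measurableT mf (fun y _ => f0 y).
rewrite preimage_setT in E; rewrite -[LHS]E.
pose mixin := isMeasurableFun.Build _ _ (measurableTypeR R) (measurableTypeR R) _ mN.
pose T' : {mfun measurableTypeR R >-> measurableTypeR R} := HB.pack (-%R : measurableTypeR R -> measurableTypeR R) mixin.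
by apply: eq_measure_integral => A mA _; exact: lebesgue_measureN.
Qed.

Lemma cL1_abel1 e x : 0 < e -> cL1 leb (fun t => (abel1 e t)%:C * cexp (x * t)).
Proof.
move=> e0; have [m1 i1] := integrableP _ _ _ (integrable_abel1 e0).
split.
  apply: cmeasM; first by apply: cmeas_real; apply: continuous_measurable_fun; exact: cont_abel1. meas.
apply: le_lt_trans i1; apply: ge0_le_integral => //=.
- meas.
- apply: meas_ecabs; apply: cmeasM; last meas.
  by apply: cmeas_real; apply: continuous_measurable_fun; exact: cont_abel1.
- apply/measurable_EFinP; apply: measurableT_comp => //; exact/measurable_EFinP.
- by move=> t _; rewrite cabsM cabs_cexp mulr1 cabs_real lee_fin.
Qed.

Lemma cint_abel1 e x : 0 < e ->
  cint leb (fun t => (abel1 e t)%:C * cexp (x * t)) = (2 * pi * poisson1 e x)%:C.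
Proof.
move=> e0; have hL1 := cL1_abel1 x e0; have /cL1_integrable[i1 i2] := hL1.
have ia := integrable_abel1 e0.
have ma : mfunT (abel1 e).
  by apply: continuous_measurable_fun; exact: cont_abel1.
have -> : 2 * pi * poisson1 e x = 2 * (e / (e ^+ 2 + x ^+ 2)).
  by rewrite /poisson1 -mulrA mulVKf// gt_eqF// pi_gt0.
apply: complex_ext => /=.
  under eq_Rintegral do rewrite mul0r subr0.
  have ic : leb.-integrable setT (EFin \o (fun t => abel1 e t * cos (x * t))).
    by apply: eq_integrable i1 => // t _; rewrite ReM/= mul0r subr0.
  (* At x = 0 the same formula gives the mass 2/e of [abel1 e]; subtracting it isolates the cosine
     integral. *)
  have : \int[leb]_t (abel1 e t * (1 + cos (x * t))) = 2 * (e^-1 + e / (e ^+ 2 + x ^+ 2)).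
    by rewrite /Rintegral int_abel1_cos1.
  have : \int[leb]_t (abel1 e t * (1 + cos (0 * t))) = 2 * (e^-1 + e / (e ^+ 2 + 0 ^+ 2)).
    by rewrite /Rintegral int_abel1_cos1.
  under eq_Rintegral do rewrite mul0r cos0 mulrDr mulr1.
  under [X in _ -> X = _ -> _]eq_Rintegral do rewrite mulrDr mulr1. rewrite !RintegralD// expr0n/= addr0 => h1 h2.
  have e1 : e / e ^+ 2 = e^-1 by rewrite expr2 invfM mulrA divff ?mul1r// gt_eqF.
  move: h1 h2; rewrite e1; move: (Rintegral _ _ _) (Rintegral _ _ _) (e / _) e^-1 => I J p q h1 h2.
  by clear -h1 h2; lra.
(* The sine part is odd. The reflection is applied to [1 + sin], which is nonnegative, and comparing
   both sides forces the sine integral to vanish. *)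
have ms : mfunT (fun t => abel1 e t * (1 + sin (x * t))).
  apply: measurable_funM => //; apply: measurable_funD => //.
  apply: (measurableT_comp (continuous_measurable_fun (@continuous_sin R))). meas.
have ic : leb.-integrable setT (EFin \o (fun t => abel1 e t * sin (x * t))).
  by apply: eq_integrable i2 => // t _; rewrite ImM/= mul0r addr0.
under eq_Rintegral do rewrite mul0r addr0.
have E1 : \int[leb]_t (abel1 e (- t) * (1 + sin (x * - t))) =
    \int[leb]_t abel1 e t - \int[leb]_t (abel1 e t * sin (x * t)).
  rewrite -RintegralB//; apply: eq_Rintegral => t _. by rewrite /abel1 normrN mulrN sinN mulrDr mulr1 mulrN.
have E2 : \int[leb]_t (abel1 e t * (1 + sin (x * t))) =
    \int[leb]_t abel1 e t + \int[leb]_t (abel1 e t * sin (x * t)).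
  rewrite -RintegralD//; apply: eq_Rintegral => t _. by rewrite mulrDr mulr1.
have E0 : (\int[leb]_t (abel1 e (- t) * (1 + sin (x * - t)))%:E =
    \int[leb]_t (abel1 e t * (1 + sin (x * t)))%:E)%E.
  apply: (lebesgue_integralN (f := fun t => (abel1 e t * (1 + sin (x * t)))%:E)).
    meas.
  by move=> t; rewrite lee_fin mulr_ge0 ?expR_ge0// -lerBlDl sub0r sin_geN1.
have {}E0 := congr1 fine E0.
rewrite -!/(Rintegral _ _ _) E1 E2 in E0.
move: E0; move: (Rintegral _ _ _) (Rintegral _ _ _) => I J E0.
by clear -E0; lra.
Qed.

Definition poisson1_itv e a b x : R := pi^-1 * (atan ((b - x) / e) - atan ((a - x) / e)).

Lemma int_poisson1 e a b x : 0 < e -> a <= b ->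
  (\int[leb]_(s in `]a, b]) (poisson1 e (x - s))%:E = (poisson1_itv e a b x)%:E)%E.
Proof.
move=> e0; rewrite le_eqVlt => /predU1P[<-|ab].
  by rewrite /poisson1_itv subrr mulr0 set_itvoc0 integral_set0.
have mp : mfunT (fun s : R => poisson1 e (x - s)).
  apply: (measurableT_comp (meas_poisson1 e0)). meas.
rewrite integral_itv_obnd_cbnd; last by apply/measurable_EFinP; exact: measurable_funTS.
pose F s := pi^-1 * atan ((s - x) / e).
have D0 s : 0 < e ^+ 2 + (s - x) ^+ 2 by rewrite ltr_wpDr ?sqr_ge0// exprn_gt0.
have dF (s : R) : is_derive s 1 F (poisson1 e (x - s)).
  rewrite /F; apply: is_derive_eq. rewrite /GRing.scale/= /poisson1 -[(x - s) ^+ 2]sqrrN opprB.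
  have := gt_eqF (@pi_gt0 R); move: (@pi R) => p p0; field. by rewrite (gt_eqF (D0 s)) p0 gt_eqF.
have cF (s : R) : F t @[t --> s] --> F s.
  by apply: differentiable_continuous; apply/derivable1_diffP; case: (dF s).
rewrite (@continuous_FTC2 R _ F a b)//.
- by rewrite -EFinB /F/poisson1_itv mulrBr.
- apply: continuous_subspaceT => s.
  apply: (@continuous_comp _ _ _ (fun s => x - s) (poisson1 e)); last exact: cont_poisson1.
  by apply: continuousB; [exact: cvg_cst|exact: cvg_id].
- split; first by move=> s _; case: (dF s).
    by apply: cvg_at_right_filter; exact: cF.
  by apply: cvg_at_left_filter; exact: cF.
- by move=> s _; rewrite derive1E (@derive_val _ _ _ _ _ _ _ (dF s)).
Qed.

Lemma poisson1_itv_ge0 e a b x : 0 < e -> a <= b -> 0 <= poisson1_itv e a b x.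
Proof.
move=> e0 ab; rewrite mulr_ge0 ?invr_ge0 ?pi_ge0// subr_ge0 le_atan//.
by rewrite ler_pM2r ?invr_gt0// lerD2r.
Qed.

Lemma poisson1_itv_le1 e a b x : poisson1_itv e a b x <= 1.
Proof.
rewrite /poisson1_itv mulrC ler_pdivrMr ?pi_gt0// mul1r.
by have := @atan_gtNpi2 R ((a - x) / e); have := @atan_ltpi2 R ((b - x) / e); lra.
Qed.

(** Uniformity in the scale e <= 1 is the point: this is the majorant for the limit of vanishing
    scale. Near the interval the total mass 1 suffices; far away |x - s| >= |x| / 2, so the kernel
    is at most 4 / x^2. *)
Lemma poisson1_itv_decay a b : a <= b -> exists C, 0 <= C /\
  forall e x, 0 < e -> e <= 1 -> poisson1_itv e a b x <= C / (1 + x ^+ 2).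
Proof.
move=> ab; pose m := `|a| + `|b|.
have m0 : 0 <= m by rewrite addr_ge0.
exists (1 + (2 * m + 1) ^+ 2 + 8 * (b - a)); split.
  meas.
move=> e x e0 e1.
have q0 : 0 < 1 + x ^+ 2 by rewrite ltr_pwDl// sqr_ge0.
rewrite ler_pdivlMr//.
(* Beyond 2 m + 1 one has |x| > 1, and |s| <= m < |x| / 2 for every s in the interval. *)
have [xm|xm] := leP `|x| (2 * m + 1).
  apply: (via (1 * (1 + x ^+ 2))).
    by rewrite ler_pM2r// poisson1_itv_le1.
  rewrite mul1r -addrA lerD2l ler_wpDr ?mulr_ge0 ?subr_ge0//.
  by rewrite -real_normK ?num_real// lerXn2r ?nnegrE// addr_ge0// mulr_ge0.
have x1 : 1 < `|x| by rewrite (le_lt_trans _ xm)// lerDr mulr_ge0.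
have x2 : 1 <= x ^+ 2 by rewrite -real_normK ?num_real// exprn_ege1// ltW.
have x20 : 0 < x ^+ 2 by rewrite (lt_le_trans ltr01).
have H : poisson1_itv e a b x <= (b - a) * (4 / x ^+ 2).
  rewrite -lee_fin -int_poisson1//. apply: (via (\int[leb]_(s in `]a, b]) (4 / x ^+ 2)%:E)%E).
    apply: ge0_le_integral => //=.
    - by move=> s _; rewrite lee_fin poisson1_ge0// ltW.
    - apply/measurable_EFinP; apply: measurable_funTS. apply: (measurableT_comp (meas_poisson1 e0)); meas.
    - move=> s; rewrite in_itv/= => /andP[as' sb]; rewrite lee_fin. have sm : `|s| <= m.
        rewrite ler_norml /m; have := ler_norm b; have := ler_norm (- a); have := normr_ge0 a; have := normr_ge0 b.
        by rewrite normrN => *; apply/andP; split; lra.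
      have xs : `|x| / 2 <= `|x - s|.
        by have := ler_dist_dist x s; have := ler_norm (`|x| - `|s|); move: (`|x - s|) (`| _ - _ |) => *; lra.
      have xs2 : x ^+ 2 / 4 <= (x - s) ^+ 2.
        rewrite -(@real_normK _ x) ?num_real// -(@real_normK _ (x - s)) ?num_real//.
        rewrite (_ : `|x| ^+ 2 / 4 = (`|x| / 2) ^+ 2); last by field. by rewrite lerXn2r ?nnegrE// divr_ge0.
      rewrite /poisson1 (via (1 * (e / (e ^+ 2 + (x - s) ^+ 2))))//.
        rewrite ler_pM2r; first by rewrite invf_le1 ?pi_gt0// (le_trans _ (@pi_ge2 R))// ler1n.
        by rewrite divr_gt0// ltr_wpDr ?sqr_ge0// exprn_gt0.
      rewrite mul1r ler_pdivrMr; last by rewrite ltr_wpDr ?sqr_ge0// exprn_gt0.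
      apply: (le_trans e1); rewrite mulrDr ler_wpDl//.
        meas.
      rewrite mulrAC ler_pdivlMr// mul1r; lra.
  rewrite integral_cst//= lebesgue_measure_itv/= lte_fin -EFinB.
  by move: ab; rewrite le_eqVlt => /predU1P[->|->]; rewrite ?ltxx ?mule0 ?subrr ?mul0r// -EFinM mulrC.
apply: (via ((b - a) * (4 / x ^+ 2) * (1 + x ^+ 2))).
  by rewrite ler_pM2r.
apply: (via (8 * (b - a))); last by rewrite lerDr addr_ge0// sqr_ge0.
rewrite -mulrA mulrC ler_wpM2r ?subr_ge0// mulrAC ler_pdivrMr//; lra.
Qed.

(** At an endpoint of a proper interval the limit would be 1/2, so endpoints are left out; for boxes
    this costs a null set. *)
Lemma cvg_poisson1_itv a b x : a <= b -> x != a -> x != b ->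
  (fun n => poisson1_itv n.+1%:R^-1 a b x) @ \oo --> ((a < x <= b)%R%:R : R).
Proof.
move=> ab xa xb.
have L c : c != 0 -> (fun n => atan (c / n.+1%:R^-1)) @ \oo --> (if 0 < c then pi / 2 else - (pi / 2) : R).
  wlog c0 : c / 0 < c => [H c0|_].
    have [/[dup] c1 /H /(_ c0)|] := ltP 0 c; first by rewrite c1. rewrite le_eqVlt (negbTE c0)/= => cn.
    rewrite -[X in X @ _](_ : - (fun n => atan (- c / n.+1%:R^-1)) = _); last first.
      by apply/funext => n; rewrite fctE mulNr atanN opprK.
    by apply: cvgN; have := H (- c); rewrite oppr_gt0 cn oppr_eq0; apply.
  rewrite c0; apply: (@cvg_comp _ _ _ (fun n => c / n.+1%:R^-1) (@atan R) _ +oo%R); last exact: cvgy_atan.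
  under eq_fun do rewrite invrK. have : (fun n => c * n.+1%:R) @ \oo --> +oo%R.
    apply/cvgryPge => A; exists (Num.truncn (A / c)) => // n /= An.
    rewrite mulrC -ler_pdivrMr// (le_trans (ltW (truncnS_gt _)))// ler_nat. exact: leq_ltn_trans An _.
  exact.
rewrite (_ : (a < x <= b)%R%:R = pi^-1 * ((if 0 < b - x then pi / 2 else - (pi / 2)) -
   (if 0 < a - x then pi / 2 else - (pi / 2))) :> R).
  by apply: cvgM; [exact: cvg_cst|apply: cvgB; apply: L; rewrite subr_eq0 eq_sym].
have p0 : pi != 0 :> R by rewrite gt_eqF// pi_gt0.
rewrite !subr_gt0 le_eqVlt (negbTE xb)/=; case: (ltgtP x a) xa => //= xa _.
  by rewrite (lt_le_trans xa ab) subrr mulr0.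
by case: ifP => _; rewrite ?subrr ?mulr0// opprK -splitr mulVf.
Qed.

End poisson1.

(** * Product Poisson kernel and Abel factors on R^d *)

Section poisson_kernel.
Context {R : realType} {d : nat}.
Notation V := 'rV[R]_d.
Notation mu := (lebesgue_rV d).
Implicit Types (n : nat) (x xi : V) (a b : 'I_d -> R).

Definition fourier_cst : R := (2 * pi) `^ (- (d%:R / 2)).
Notation c0 := fourier_cst.

Lemma fourier_cst_gt0 : 0 < c0.
Proof. by rewrite powR_gt0// mulr_gt0// pi_gt0. Qed.

(** Allows the normalization to be dropped in norm estimates, which is why no power of 2 pi
    accompanies [f2]. *)
Lemma fourier_cst_le1 : c0 <= 1.
Proof.
have p1 : 1 <= 2 * pi :> R.
  by have := @pi_ge2 R; move: (@pi R) => p; lra.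
rewrite -(@powRr0 R (2 * pi)) /fourier_cst ler_powR// oppr_le0 divr_ge0//.
Qed.

Lemma fourier_cst_sqr : c0 ^+ 2 * (2 * pi) ^+ d = 1.
Proof.
have p0 : 0 < 2 * pi :> R by rewrite mulr_gt0// pi_gt0.
rewrite expr2 -powRD; last by rewrite (gt_eqF p0) implybT.
rewrite -opprD -splitr powRN powR_mulrn ?ltW// mulVf// gt_eqF// exprn_gt0//.
Qed.

(** The index n stands for the scale 1/(n+1), so the limit n -> oo removes the regularization. *)
Definition abel n xi : R := \prod_(i < d) abel1 n.+1%:R^-1 (xi ord0 i).
Definition poisson n x : R := \prod_(i < d) poisson1 n.+1%:R^-1 (x ord0 i).

Lemma prodr_itv01 k (F : 'I_k -> R) : (forall i, 0 <= F i <= 1) -> \prod_(i < k) F i <= 1.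
Proof.
move=> h; suff /andP[] : 0 <= \prod_(i < k) F i <= 1 by [].
apply: (big_ind (fun x : R => 0 <= x <= 1)) => [|x y /andP[x0 x1] /andP[y0 y1]|i _]; rewrite ?lexx ?ler01//.
by rewrite mulr_ge0//= mulr_ile1.
Qed.

Let en0 n : (0 : R) < n.+1%:R^-1. Proof. by rewrite invr_gt0. Qed.

Lemma abel_ge0 n xi : 0 <= abel n xi.
Proof. by apply: prodr_ge0 => i _; exact: expR_ge0. Qed.

Lemma abel_le1 n xi : abel n xi <= 1.
Proof.
apply: prodr_itv01 => i; rewrite expR_ge0/= /abel1 -expR0 ler_expR oppr_le0.
meas.
Qed.

Lemma meas_abel n : mfunT (abel n).
Proof.
apply: (meas_rV_prod (g := fun _ => abel1 n.+1%:R^-1)) => i.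
by apply: continuous_measurable_fun; exact: cont_abel1.
Qed.

Lemma cvg_prod_ord k (u : 'I_k -> nat -> R) (l : 'I_k -> R) :
  (forall i, u i @ \oo --> l i) ->
  (fun n => \prod_(i < k) u i n) @ \oo --> \prod_(i < k) l i.
Proof.
elim: k u l => [|k IH] u l h.
  by rewrite big_ord0; under eq_fun do rewrite big_ord0; exact: cvg_cst.
rewrite big_ord_recl; under eq_fun do rewrite big_ord_recl.
by apply: cvgM => //; apply: (IH (fun i => u (lift ord0 i))).
Qed.

Lemma cvg_abel xi : abel ^~ xi @ \oo --> (1 : R).
Proof.
have -> : 1 = \prod_(i < d) (1 : R) by rewrite big1.
apply: (@cvg_prod_ord _ (fun i n => abel1 n.+1%:R^-1 (xi ord0 i))) => i.
have : (fun n => - (n.+1%:R^-1 * `|xi ord0 i|)) @ \oo --> (0 : R).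
  rewrite -oppr0 -(mul0r `|xi ord0 i|); apply: cvgN; apply: cvgM; last exact: cvg_cst. exact: cvg_harmonic.
move=> h; have := cvg_comp _ _ h (@continuous_expR R 0).
by rewrite expR0.
Qed.

Lemma poisson_ge0 n x : 0 <= poisson n x.
Proof. by apply: prodr_ge0 => i _; apply: poisson1_ge0; meas. Qed.

Lemma meas_poisson n : mfunT (poisson n).
Proof. by apply: (meas_rV_prod (g := fun _ => poisson1 n.+1%:R^-1)) => i; exact: meas_poisson1. Qed.

Lemma poissonN n x : poisson n (- x) = poisson n x.
Proof. by apply: eq_bigr => i _; rewrite mxE /poisson1 sqrrN. Qed.

Lemma poissonB n x y : poisson n (x - y) = poisson n (y - x).
Proof. by rewrite -poissonN opprB. Qed.

Lemma abel_cexp_prod n x xi : (abel n xi)%:C * cexp (dotv x xi) =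
  \prod_(i < d) ((abel1 n.+1%:R^-1 (xi ord0 i))%:C * cexp (x ord0 i * xi ord0 i)).
Proof.
rewrite big_split /= /abel rmorph_prod; congr (_ * _).
by rewrite /dotv; apply: (big_morph _ (@cexpD R) (@cexp0 R)).
Qed.

Lemma cL1_abel_cexp n x : cL1 mu (fun xi => (abel n xi)%:C * cexp (dotv x xi)).
Proof.
under eq_fun do rewrite abel_cexp_prod.
apply: (@cL1_rV_prod _ _ (fun i t => (abel1 n.+1%:R^-1 t)%:C * cexp (x ord0 i * t))) => i.
exact: cL1_abel1.
Qed.

Lemma cint_abel_cexp n x :
  cint mu (fun xi => (abel n xi)%:C * cexp (dotv x xi)) = ((2 * pi) ^+ d * poisson n x)%:C.
Proof.
under eq_cint do rewrite abel_cexp_prod.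
rewrite (@cint_rV_prod _ _ (fun i t => (abel1 n.+1%:R^-1 t)%:C * cexp (x ord0 i * t))); last first.
  by move=> i; exact: cL1_abel1.
under eq_bigr do rewrite cint_abel1//.
by rewrite -rmorph_prod/= big_split/= prodr_const card_ord.
Qed.

Lemma dot0v xi : dotv (0 : V) xi = 0.
Proof. by apply: big1 => i _; rewrite mxE mul0r. Qed.

Lemma cL1_abel n : cL1 mu (fun xi => (abel n xi)%:C).
Proof. by have := cL1_abel_cexp n 0; under eq_fun do rewrite dot0v cexp0 mulr1. Qed.

Lemma poisson_bounded n : exists2 M, 0 <= M & forall x, poisson n x <= M.
Proof.
pose M := \prod_(i < d) (pi^-1 * n.+1%:R) : R.
exists M; first by apply: prodr_ge0 => i _; rewrite mulr_ge0// invr_ge0 pi_ge0.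
move=> x; apply: ler_prod => i _; rewrite poisson1_ge0 ?(ltW (en0 _))//=.
rewrite ler_pM2l ?invr_gt0 ?pi_gt0// -[leRHS]invrK ler_pdivrMr.
  by rewrite expr2 mulrDr mulrA mulVf ?mul1r ?gt_eqF// lerDl mulr_ge0 ?sqr_ge0// invr_ge0 ltW.
by rewrite ltr_wpDr ?sqr_ge0// exprn_gt0.
Qed.

Definition poisson_box n a b x : R := \prod_(i < d) poisson1_itv n.+1%:R^-1 (a i) (b i) (x ord0 i).

Lemma int_poisson_box n a b x : (forall i, a i <= b i) ->
  (\int[mu]_(s in obox a b) (poisson n (x - s))%:E = (poisson_box n a b x)%:E)%E.
Proof.
move=> ab; rewrite integral_mkcond.
pose g i (t : R) := if t \in `]a i, b i] then poisson1 n.+1%:R^-1 (x ord0 i - t) else 0.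
have mg i : mfunT (g i).
  rewrite /g; apply: measurable_fun_if => //.
  - apply: (measurable_fun_bool true); rewrite setTI. exact: measurable_itv.
  - apply: measurable_funTS. apply: (measurableT_comp (meas_poisson1 (en0 n))); meas.
rewrite (_ : (_ \_ _) = (fun s : V => (\prod_(i < d) g i (s ord0 i))%:E)); last first.
  apply/funext => s; rewrite patchE; case: ifPn => [/set_mem sab|].
    congr (_%:E); apply: eq_bigr => i _; rewrite /g; have := sab i => /= ->. by rewrite !mxE.
  rewrite notin_setE => sab. have [i si] : exists i, s ord0 i \notin `]a i, b i].
    apply: contrapT => h; apply: sab => i /=; apply: contrapT => hi; apply: h. by exists i; exact/negP.
  by rewrite (bigD1 i)//= /g (negbTE si) mul0r.
rewrite int_rV_prod//; last first.
  by move=> i t; rewrite /g; case: ifP => // _; apply: poisson1_ge0; meas.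
rewrite /poisson_box -prodEFin; apply: eq_bigr => i _.
rewrite -int_poisson1// [RHS]integral_mkcond; apply: eq_integral => t _.
by rewrite patchE /g mem_setE; case: ifP.
Qed.

Lemma poisson_box_ge0 n a b x : (forall i, a i <= b i) -> 0 <= poisson_box n a b x.
Proof. by move=> ab; apply: prodr_ge0 => i _; exact: poisson1_itv_ge0. Qed.

Lemma poisson_box_le1 n a b x : (forall i, a i <= b i) -> poisson_box n a b x <= 1.
Proof. by move=> ab; apply: prodr_itv01 => i; rewrite poisson1_itv_ge0//= poisson1_itv_le1. Qed.

(** A weight against which integrable and square integrable functions are both integrable, so that a
    single inversion lemma serves L^1 and L^2. Up to pi^d it is the Poisson kernel of scale 1. *)
Definition decay x : R := \prod_(i < d) (1 + x ord0 i ^+ 2)^-1.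

Lemma decay_gt0 x : 0 < decay x.
Proof. by apply: prodr_gt0 => i _; rewrite invr_gt0 ltr_pwDl// sqr_ge0. Qed.

Lemma decay_le1 x : decay x <= 1.
Proof.
apply: prodr_itv01 => i; rewrite invr_ge0 addr_ge0 ?sqr_ge0//=.
by rewrite invf_le1 ?ltr_pwDl ?sqr_ge0// lerDl sqr_ge0.
Qed.

Lemma decay_poisson x : decay x = pi ^+ d * poisson 0 x.
Proof.
rewrite /decay /poisson -[X in _ ^+ X]card_ord -prodr_const -big_split; apply: eq_bigr => i _ /=.
by rewrite /poisson1 invr1 expr1n mul1r mulVKf// gt_eqF// pi_gt0.
Qed.

Lemma meas_decay : mfunT decay.
Proof.
rewrite (_ : decay = fun x => pi ^+ d * poisson 0 x); last by apply/funext => x; exact: decay_poisson.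
by apply: measurable_funM => //; exact: meas_poisson.
Qed.

Lemma poisson_box_decay a b : (forall i, a i <= b i) ->
  exists2 C, 0 <= C & forall n x, poisson_box n a b x <= C * decay x.
Proof.
move=> ab.
have /choice[C hC] : forall i, exists C : R, 0 <= C /\
    forall e (x : R), 0 < e -> e <= 1 -> poisson1_itv e (a i) (b i) x <= C / (1 + x ^+ 2).
  by move=> i; exact: poisson1_itv_decay.
exists (\prod_(i < d) C i); first by apply: prodr_ge0 => i _; case: (hC i).
move=> n x; rewrite /decay -big_split/=; apply: ler_prod => i _.
rewrite poisson1_itv_ge0//=; case: (hC i) => _; apply => //.
by rewrite invf_le1// ler1n.
Qed.

(** Monotone limit over cubes, on which the mass is a product of normalized arctangent differences,
    each at most 1. *)
Lemma int_poisson_le1 n x : (\int[mu]_s (poisson n (x - s))%:E <= 1)%E.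
Proof.
have mp : mfunT (fun s : V => (poisson n (x - s))%:E).
  apply/measurable_EFinP; apply: (measurableT_comp (meas_poisson n)). meas.
have := @ge0_nondecreasing_set_cvg_integral _ V R (@cbox R d) (fun s => (poisson n (x - s))%:E).
move=> H0; have H : (\int[mu]_(s in @cbox R d k) (poisson n (x - s))%:E)%E @[k --> \oo] -->
    (\int[mu]_(s in \bigcup_k @cbox R d k) (poisson n (x - s))%:E)%E.
  apply: H0.
  - by move=> k l kl; apply/subsetPset; exact: cbox_subset.
  - by move=> k; exact: meas_cbox.
  - by move=> k; apply: measurable_funTS.
  - by move=> k s _; rewrite lee_fin poisson_ge0.
rewrite cboxT in H; rewrite -(cvg_lim (@ereal_hausdorff R) H).
apply: lime_le; first by apply/cvg_ex; eexists; exact: H.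
apply: nearW => k; rewrite int_poisson_box ?lee_fin ?poisson_box_le1//.
  by move=> i; rewrite ge0_cp// ?ler0n//.
by move=> i; rewrite ge0_cp// ?ler0n//.
Qed.

Lemma cvg_poisson_box a b x : (forall i, a i <= b i) ->
  (forall i, x ord0 i != a i) -> (forall i, x ord0 i != b i) ->
  (fun n => poisson_box n a b x) @ \oo --> (\1_(obox a b) x : R).
Proof.
move=> ab xa xb.
have -> : \1_(obox a b) x = \prod_(i < d) ((a i < x ord0 i <= b i)%R%:R : R).
  rewrite indicE; case: (boolP (x \in obox a b)) => [/set_mem h|].
    by rewrite big1// => i _; have := h i; rewrite /= in_itv/= => ->.
  rewrite notin_setE => h. have [i si] : exists i, x ord0 i \notin `]a i, b i].
    apply: contrapT => h'; apply: h => i /=; apply: contrapT => hi; apply: h'. by exists i; exact/negP.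
  by rewrite (bigD1 i)//=; move: si; rewrite in_itv/= => /negbTE->; rewrite mul0r.
by apply: (@cvg_prod_ord _ (fun i n => poisson1_itv n.+1%:R^-1 (a i) (b i) (x ord0 i))) => i; exact: cvg_poisson1_itv.
Qed.

(** A hyperplane x_i = a_i is a box with one side reduced to a point. *)
Lemma ae_coord_neq (a : 'I_d -> R) : {ae mu, forall x : V, forall i, x ord0 i != a i}.
Proof.
have : forall i, {ae mu, forall x : V, x ord0 i != a i}.
  move=> i; exists [set x : V | forall j, (if j == i then [set a i] else setT) (x ord0 j)].
  have mA j : measurable (if j == i then [set a i] else setT) by case: ifP => // _; meas. split.
  - exact: (meas_boxes mA).
  - rewrite (lebesgue_rV_box mA) (bigD1 i)//= eqxx lebesgue_measure_set1 mul0e//.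
  - by move=> x /negP; rewrite negbK => /eqP xa j; case: eqP => [->|].
move=> h; have : {ae mu, forall x : V, forall k, forall i : 'I_d, i = k :> nat -> x ord0 i != a i}.
  apply/ae_foralln => k; have [kd|dk] := ltnP k d.
    apply: filterS (h (Ordinal kd)) => x hx i ik. by rewrite (_ : i = Ordinal kd)//; exact: val_inj.
  by apply: aeW => x i ik; move: dk; rewrite -ik leqNgt ltn_ord.
by apply: filterS => x hx i; exact: hx.
Qed.

End poisson_kernel.
Arguments fourier_cst {R} d.

Lemma Re_cint {R : realType} d0 (T : measurableType d0) (m : {measure set T -> \bar R}) (f : T -> R[i]) :
  complex.Re (cint m f) = \int[m]_x (complex.Re (f x)).
Proof. by []. Qed.

Lemma Im_cint {R : realType} d0 (T : measurableType d0) (m : {measure set T -> \bar R}) (f : T -> R[i]) :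
  complex.Im (cint m f) = \int[m]_x (complex.Im (f x)).
Proof. by []. Qed.

Opaque cint.

Lemma fatou_le {R : realType} d0 (T : measurableType d0) (m : {measure set T -> \bar R})
    (f_ : nat -> T -> \bar R) (f : T -> \bar R) (B : \bar R) :
  (forall n, mfunT (f_ n)) -> (forall n x, 0 <= f_ n x)%E ->
  mfunT f -> (forall x, 0 <= f x)%E ->
  {ae m, forall x, f_ ^~ x @ \oo --> f x} ->
  (forall n, \int[m]_x f_ n x <= B)%E -> (\int[m]_x f x <= B)%E.
Proof.
move=> mf_ f0_ mf f0 cf hB.
apply: (via (\int[m]_x limn_einf (f_ ^~ x))%E).
  apply: ae_ge0_le_integral => //.
  - move=> x _; rewrite limn_einf_lim; apply: lime_ge; first exact: is_cvg_einfs.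
    by apply: nearW => n; apply: le_ereal_inf_tmp => _ [k _ <-]; exact: f0_.
  - apply: (emeasurable_fun_cvg (fun n x => einfs (f_ ^~ x) n)).
      by move=> n; exact: measurable_fun_einfs.
    by move=> x _; rewrite limn_einf_lim; exact: is_cvg_einfs.
  - apply: filterS cf => x cx _; rewrite is_cvg_limn_einfE; last by apply/cvg_ex; eexists; exact: cx.
    by rewrite (cvg_lim (@ereal_hausdorff R) cx).
apply: le_trans (fatou m measurableT mf_ (fun n x _ => f0_ n x)) _.
rewrite limn_einf_lim; apply: lime_le; first exact: is_cvg_einfs.
apply: nearW => n; apply: le_trans (hB n); apply: ereal_inf_lbound.
by exists n => //=.
Qed.

(** * Fourier transform of integrable functions *)

Section fourier_transform.
Context {R : realType} {d : nat}.
Notation V := 'rV[R]_d.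
Notation C := R[i].
Notation mu := (lebesgue_rV d).
Notation c0 := (@fourier_cst R d).
Implicit Types (f g : V -> C) (x xi : V).

Definition ift g x : C := c0%:C * cint mu (fun xi => g xi * cexp (dotv x xi)).
Definition ft f xi : C := c0%:C * cint mu (fun x => f x * cexp (- dotv x xi)).

Lemma dotvC x xi : dotv x xi = dotv xi x.
Proof. by apply: eq_bigr => i _; rewrite mulrC. Qed.

Lemma dotvN x xi : dotv x (- xi) = - dotv x xi.
Proof. by rewrite /dotv -sumrN; apply: eq_bigr => i _; rewrite mxE mulrN. Qed.

Lemma dotvD x y xi : dotv (x + y) xi = dotv x xi + dotv y xi.
Proof. by rewrite /dotv -big_split; apply: eq_bigr => i _; rewrite mxE mulrDl. Qed.

Lemma ft_ift f xi : ft f xi = ift f (- xi).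
Proof. by rewrite /ft /ift; congr (_ * _); apply: eq_cint => x; rewrite dotvC [dotv (- xi) x]dotvC dotvN dotvC. Qed.

Lemma ift_conj g x : (ift g x)^* = ft (fun xi => (g xi)^*) x.
Proof.
rewrite /ift /ft conjcM -cint_conj; congr (_ * _); first exact: conjc_real.
by apply: eq_cint => xi; rewrite conjcM -cexpN dotvC.
Qed.

Lemma ft_conj f xi : (ft f xi)^* = ift (fun x => (f x)^*) xi.
Proof.
rewrite /ift /ft conjcM -cint_conj; congr (_ * _); first exact: conjc_real.
by apply: eq_cint => x; rewrite conjcM cexpN conjcK dotvC.
Qed.

Lemma cL1_cexp g x : cL1 mu g -> cL1 mu (fun xi => g xi * cexp (dotv x xi)).
Proof.
move=> [mg go]; split.
  apply: cmeasM => //; apply: cmeas_cexp; apply: meas_dotv; meas.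
by under eq_integral do rewrite cabsM cabs_cexp mulr1.
Qed.

Lemma cmeas_ift g : cmeas g -> cmeas (ift g).
Proof.
move=> mg; apply: cmeasM; first meas.
apply: (@cmeas_cint _ _ _ _ _ mu (fun p : V * V => g p.2 * cexp (dotv p.1 p.2))).
meas.
Qed.

Lemma meas_oppV : mfunT (-%R : V -> V).
Proof. exact: meas_rV_opp. Qed.

Lemma cmeas_ft f : cmeas f -> cmeas (ft f).
Proof.
move=> mf; rewrite (_ : ft f = ift f \o -%R); last by apply/funext => x; exact: ft_ift.
exact: (cmeas_comp (cmeas_ift mf) meas_oppV).
Qed.

Lemma cabs_ift_le g x : cL1 mu g -> cabs (ift g x) <= \int[mu]_xi cabs (g xi).
Proof.
move=> hg; rewrite /ift cabsM cabs_real gtr0_norm ?fourier_cst_gt0//.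
apply: (via (1 * cabs (cint mu (fun xi => g xi * cexp (dotv x xi))))).
  by rewrite ler_wpM2r ?cabs_ge0// fourier_cst_le1.
rewrite mul1r (le_trans (cabs_cint_le (cL1_cexp x hg)))//.
by under eq_Rintegral do rewrite cabsM cabs_cexp mulr1.
Qed.

Lemma cabs_ft_le f xi : cL1 mu f -> cabs (ft f xi) <= \int[mu]_x cabs (f x).
Proof. by move=> hf; rewrite ft_ift cabs_ift_le. Qed.

Lemma le_cabs_ift g x : cmeas g -> ((cabs (ift g x))%:E <= \int[mu]_xi (cabs (g xi))%:E)%E.
Proof.
move=> mg; have [->|hoo] := eqVneq (\int[mu]_xi (cabs (g xi))%:E)%E +oo%E.
  exact: leey.
have hg : cL1 mu g by split=> //; rewrite ltey.
rewrite (le_trans _ (_ : (\int[mu]_x cabs (g x))%:E <= _)%E) ?lee_fin ?cabs_ift_le//.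
by rewrite /Rintegral fineK// ge0_fin_numE ?ltey; meas.
Qed.

Lemma iftD g g' x : cL1 mu g -> cL1 mu g' ->
  ift (fun xi => g xi + g' xi) x = ift g x + ift g' x.
Proof.
move=> hg hg'; rewrite /ift -mulrDr -cintD; try exact: cL1_cexp.
by congr (_ * _); apply: eq_cint => xi; rewrite mulrDl.
Qed.

Lemma iftZ (z : C) g x : cL1 mu g -> ift (fun xi => z * g xi) x = z * ift g x.
Proof.
move=> hg; rewrite /ift mulrCA -(cintZ z (cL1_cexp x hg)).
by under eq_cint do rewrite -mulrA.
Qed.

Lemma iftN g x : cL1 mu g -> ift (fun xi => - g xi) x = - ift g x.
Proof.
move=> hg; rewrite /ift -mulrN -(cintN (cL1_cexp x hg)).
by under eq_cint do rewrite mulNr.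
Qed.

Lemma iftB g g' x : cL1 mu g -> cL1 mu g' ->
  ift (fun xi => g xi - g' xi) x = ift g x - ift g' x.
Proof.
move=> hg hg'; rewrite iftD//; last exact: cL1N.
by rewrite iftN.
Qed.

Lemma ftB g g' x : cL1 mu g -> cL1 mu g' ->
  ft (fun xi => g xi - g' xi) x = ft g x - ft g' x.
Proof. by move=> hg hg'; rewrite !ft_ift iftB. Qed.

Lemma ae_eq_ift g g' x : cmeas g -> cmeas g' -> {ae mu, forall xi, g xi = g' xi} ->
  ift g x = ift g' x.
Proof.
move=> mg mg' gg'; congr (_ * _); apply: ae_eq_cint.
- apply: cmeasM => //; apply: cmeas_cexp; apply: meas_dotv; meas.
- apply: cmeasM => //; apply: cmeas_cexp; apply: meas_dotv; meas.
- by apply: filterS gg' => xi ->.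
Qed.

Lemma cL1_tensor f g : cL1 mu f -> cL1 mu g ->
  cL1 (mu \x mu)%E (fun p : V * V => f p.1 * g p.2).
Proof.
move=> [mf fo] [mg go]; apply: cL1_prod.
  meas.
under eq_integral do under eq_integral do rewrite /= cabsM EFinM.
under eq_integral => a _.
  rewrite ge0_integralZl//; last 3 first.
  + meas.
  + meas.
  + meas.
  over.
rewrite ge0_integralZr//.
- apply: lte_mul_pinfty => //.
  + meas.
  + rewrite ge0_fin_numE//. meas.
- meas.
- meas.
- meas.
Qed.

Lemma cL1_tensor_cexp f g : cL1 mu f -> cL1 mu g ->
  cL1 (mu \x mu)%E (fun p : V * V => f p.1 * g p.2 * cexp (dotv p.1 p.2)).
Proof.
move=> hf hg; have [m fo] := cL1_tensor hf hg; split.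
  meas.
by under eq_integral do rewrite cabsM cabs_cexp mulr1.
Qed.

(** The multiplication formula, by Fubini for f(x) g(y) e^{i x.y}. Inversion, Bessel and the
    pairings with test functions go through it. *)
Lemma cint_mul_ift f g : cL1 mu f -> cL1 mu g ->
  cint mu (fun x => f x * ift g x) = cint mu (fun x => g x * ift f x).
Proof.
move=> hf hg; have h := cL1_tensor_cexp hf hg.
have fE x : f x * ift g x = c0%:C * cint mu (fun y => f x * g y * cexp (dotv x y)).
  rewrite /ift mulrCA -(cintZ (f x) (cL1_cexp x hg)). by under eq_cint do rewrite mulrA.
have gE y : g y * ift f y = c0%:C * cint mu (fun x => f x * g y * cexp (dotv x y)).
  rewrite /ift mulrCA -(cintZ (g y) (cL1_cexp y hf)). by under eq_cint => x do rewrite mulrA (mulrC (g y)) dotvC.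
under eq_cint do rewrite fE; under [RHS]eq_cint do rewrite gE.
rewrite cintZ; last exact: (cL1_cint1 h).
rewrite (cint_swap h) cintZ//.
have h' : cL1 (mu \x mu)%E (fun p : V * V => f p.2 * g p.1 * cexp (dotv p.2 p.1)).
  have [m fo] := cL1_tensor_cexp hg hf; split.
    apply: cmeasM.
      apply: cmeasM; [exact: (cmeas_comp hf.1 measurable_snd)|exact: (cmeas_comp hg.1 measurable_fst)].
    meas.
  apply: le_lt_trans fo; under eq_integral do rewrite mulrC (mulrC (f _)) mulrC dotvC. by [].
exact: (cL1_cint1 h').
Qed.

Lemma cint_reflect g : cmeas g -> cint mu (fun x => g (- x)) = cint mu g.
Proof. by move=> mg; rewrite -(cint_subl 0 mg); apply: eq_cint => x; rewrite sub0r. Qed.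

Lemma cL1_reflect g : cL1 mu g -> cL1 mu (fun x => g (- x)).
Proof. by move=> /(cL1_subl 0); under eq_fun do rewrite sub0r. Qed.

Lemma int_reflect (g : V -> \bar R) : mfunT g ->
  (\int[mu]_x g (- x)%R = \int[mu]_x g x)%E.
Proof. by move=> mg; rewrite -(integral_subl 0 mg); apply: eq_integral => x _; rewrite sub0r. Qed.

Lemma ift_reflect g x : cmeas g -> ift (fun y => g (- y)) x = ft g x.
Proof.
move=> mg; rewrite /ift /ft -cint_reflect; last first.
  apply: cmeasM; first exact: (cmeas_comp mg meas_oppV). apply: cmeas_cexp; apply: meas_dotv; meas.
by congr (_ * _); apply: eq_cint => y; rewrite opprK dotvN dotvC.
Qed.

Lemma cL1_abel_mul n g : cmeas g -> (exists M, forall x, cabs (g x) <= M) ->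
  cL1 mu (fun xi => (abel n xi)%:C * g xi).
Proof.
move=> mg [M hM]; have [ma ao] := cL1_abel (R := R) (d := d) n.
apply: (@le_cL1 _ _ _ _ _ (fun xi => M%:E * (cabs (abel n xi)%:C)%:E)%E).
- meas.
- meas.
- by move=> x; rewrite cabsM -EFinM lee_fin mulrC ler_wpM2r ?cabs_ge0.
- have M0 : 0 <= M by apply: le_trans (hM 0); meas. rewrite ge0_integralZl_EFin//.
  + by rewrite lte_mul_pinfty.
  + meas.
  + meas.
Qed.

Lemma cL1_abel_ft n g : cL1 mu g -> cL1 mu (fun xi => (abel n xi)%:C * ft g xi).
Proof.
move=> hg; apply: cL1_abel_mul; first by apply: cmeas_ft; meas.
by eexists => x; exact: cabs_ft_le.
Qed.

Lemma cL1_abel_ift n g : cL1 mu g -> cL1 mu (fun xi => (abel n xi)%:C * ift g xi).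
Proof.
move=> hg; apply: cL1_abel_mul; first by apply: cmeas_ift; meas.
by eexists => x; exact: cabs_ift_le.
Qed.

(** Regularized inversion: the multiplication formula moves the transform onto the Abel factor,
    whose transform is the Poisson kernel; the normalizations combine to 1 by [fourier_cst_sqr]. *)
Lemma ift_abel_ft n g a : cL1 mu g ->
  ift (fun xi => (abel n xi)%:C * ft g xi) a = cint mu (fun x => g x * (poisson n (x - a))%:C).
Proof.
move=> hg; have mg := hg.1.
rewrite /ift.
have hphi := cL1_abel_cexp (R := R) n a.
have := cint_mul_ift hphi (cL1_reflect hg).
under eq_cint => xi do rewrite (ift_reflect _ mg) mulrAC.
move=> ->.
have phiE x : ift (fun xi => (abel n xi)%:C * cexp (dotv a xi)) x =
    (c0 * ((2 * pi) ^+ d * poisson n (a + x)))%:C.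
  rewrite /ift [RHS]rmorphM/= -cint_abel_cexp; congr (_ * _). by apply: eq_cint => xi; rewrite dotvD cexpD mulrA.
have mP : cmeas (fun x => g (- x) * (poisson n (a + x))%:C).
  apply: cmeasM; first exact: (cmeas_comp mg meas_oppV).
  apply: cmeas_real; apply: (measurableT_comp (meas_poisson n)). by apply: meas_rV_add; meas.
under eq_cint => x do rewrite phiE mulrA rmorphM/= mulrCA.
have [M M0 hM] := poisson_bounded (R := R) (d := d) n.
rewrite cintZ; last first.
  apply: (@le_cL1 _ _ _ _ _ (fun xi => M%:E * (cabs (g (- xi)))%:E)%E) => //.
  - apply: emeasurable_funM => //; apply: meas_ecabs; exact: (cmeas_comp mg meas_oppV).
  - move=> x; rewrite cabsM -EFinM lee_fin mulrC cabs_real ger0_norm ?poisson_ge0//. by rewrite ler_wpM2r ?cabs_ge0.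
  - have [mg' go'] := cL1_reflect hg. rewrite ge0_integralZl_EFin//.
    + by rewrite lte_mul_pinfty.
    + meas.
    + meas.
have cE : c0%:C * (c0 * (2 * pi) ^+ d)%:C = 1 :> C.
  by rewrite -rmorphM/= mulrA -expr2 fourier_cst_sqr.
rewrite mulrA.
rewrite cE.
rewrite mul1r.
rewrite -(cint_reflect mP).
by apply: eq_cint => x; rewrite opprK poissonB.
Qed.

Lemma ft_abel_ift n g a : cL1 mu g ->
  ft (fun xi => (abel n xi)%:C * ift g xi) a = cint mu (fun x => g x * (poisson n (x - a))%:C).
Proof.
move=> hg; have mg := hg.1; rewrite ft_ift.
have E : (fun xi => (abel n xi)%:C * ift g xi) =
    (fun xi => (abel n xi)%:C * ft (fun y => g (- y)) xi).
  apply/funext => xi; rewrite -ift_reflect; last exact: (cmeas_comp mg meas_oppV).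
  by rewrite (_ : (fun y => g (- - y)) = g)//; apply/funext => y; rewrite opprK.
rewrite E ift_abel_ft; last exact: cL1_reflect.
rewrite -cint_reflect; last first.
  apply: cmeasM; first exact: (cmeas_comp mg meas_oppV).
  apply: cmeas_real; apply: (measurableT_comp (meas_poisson n)). meas.
by apply: eq_cint => x; rewrite !opprK addrC poissonB.
Qed.

End fourier_transform.

(** * Inversion through Poisson averages *)

Section inversion.
Context {R : realType} {d : nat}.
Notation V := 'rV[R]_d.
Notation C := R[i].
Notation mu := (lebesgue_rV d).
Implicit Types (f g F : V -> C) (x : V) (a b : 'I_d -> R).

Definition ind (A : set V) x : C := (\1_A x)%:C.

Lemma cmeas_ind A : measurable A -> cmeas (ind A).
Proof. by move=> mA; apply: cmeas_real; meas. Qed.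

Lemma cabs_ind A x : cabs (ind A x) = \1_A x.
Proof. by rewrite cabs_real ger0_norm// indicE ler0n. Qed.

Lemma Re_ind A f x : complex.Re (ind A x * f x) = \1_A x * complex.Re (f x).
Proof. by rewrite ReM/= mul0r subr0. Qed.

Lemma Im_ind A f x : complex.Im (ind A x * f x) = \1_A x * complex.Im (f x).
Proof. by rewrite ImM/= mul0r addr0. Qed.

Lemma obox_sub_cbox a b : exists n, obox a b `<=` cbox n.
Proof.
pose M := \big[Order.max/0]_(i < d) (`|a i| + `|b i|).
exists (Num.truncn M).+1 => x xab i; have := xab i; rewrite /= !in_itv/= => /andP[x1 x2].
have : `|a i| + `|b i| < (Num.truncn M).+1%:R.
  apply: le_lt_trans (truncnS_gt M). exact: (le_bigmax _ (fun i => `|a i| + `|b i|) i).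
have := ler_norm (- a i); have := ler_norm (b i); rewrite normrN.
have := normr_ge0 (a i); have := normr_ge0 (b i).
move: (`|a i|) (`|b i|) ((Num.truncn M).+1%:R) => A B N *.
by apply/andP; split; lra.
Qed.

Lemma cL1_obox f a b : cmeas f -> (forall n, cL1 mu (fun x => ind (cbox n) x * f x)) ->
  cL1 mu (fun x => ind (obox a b) x * f x).
Proof.
move=> mf hf; have [m hm] := obox_sub_cbox a b.
apply: (@le_cL1 _ _ _ _ _ (fun x => (cabs (ind (cbox m) x * f x))%:E)).
- by apply: cmeasM => //; apply: cmeas_ind; exact: meas_obox.
- by apply: meas_ecabs; case: (hf m).
- move=> x; rewrite !cabsM !cabs_ind lee_fin ler_wpM2r ?cabs_ge0// !indicE ler_nat.
  case: (boolP (x \in obox a b)) => // /set_mem /hm xm. by rewrite mem_set.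
- by case: (hf m).
Qed.

Lemma cint_box_ae0 f : cmeas f -> (forall n, cL1 mu (fun x => ind (cbox n) x * f x)) ->
  (forall a b, (forall i, a i <= b i) -> cint mu (fun x => ind (obox a b) x * f x) = 0) ->
  {ae mu, forall x, f x = 0}.
Proof.
move=> mf hf h0.
have H (P : C -> R) : mfunT (fun x : V => P (f x)) ->
   (forall A x, P (ind A x * f x) = \1_A x * P (f x)) ->
   (forall A, cL1 mu (fun x => ind A x * f x) -> mu.-integrable setT (EFin \o (fun x => P (ind A x * f x)))) ->
   (forall A, cint mu (fun x => ind A x * f x) = 0 -> \int[mu]_x P (ind A x * f x) = 0) ->
   {ae mu, forall x, P (f x) = 0}.
  move=> mP P1 P2 P3. have E A : (EFin \o (fun x => P (f x))) \_ A = EFin \o (fun x => P (ind A x * f x)).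
    apply/funext => x; rewrite patchE /= P1 indicE; case: ifP => _; rewrite ?mul1r ?mul0r//.
  have I n : mu.-integrable (cbox n) (EFin \o (fun x => P (f x))).
    apply/(integrable_mkcond _ (meas_cbox n)); rewrite E; meas.
  apply: box_integral_ae0 => //. move=> a b; have [ab|] := boolP [forall i, a i <= b i]; last first.
    by rewrite negb_forall => /existsP[i /obox_eq0->]; rewrite integral_set0.
  rewrite integral_mkcond; have := E (obox a b); rewrite /comp => ->.
  have /P3 : cint mu (fun x => ind (obox a b) x * f x) = 0 by apply: h0 => i; exact: (forallP ab).
  rewrite /Rintegral => h; rewrite -[LHS]fineK ?h//. apply: integrable_fin_num => //; apply: P2. exact: cL1_obox.
have h1 : {ae mu, forall x, complex.Re (f x) = 0}.
  apply: (H (@complex.Re R)); first by case: mf.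
  - by move=> A x; exact: Re_ind.
  - by move=> A /cL1_integrable[].
  - by move=> A /(congr1 (@complex.Re R)).
have h2 : {ae mu, forall x, complex.Im (f x) = 0}.
  apply: (H (@complex.Im R)); first by case: mf.
  - by move=> A x; exact: Im_ind.
  - by move=> A /cL1_integrable[].
  - by move=> A /(congr1 (@complex.Im R)).
by apply: filterS2 h1 h2 => x e1 e2; apply: complex_ext.
Qed.

Lemma cL1_decay f : cL1 mu (fun x => f x * (decay x)%:C) -> cmeas f ->
  forall n, cL1 mu (fun x => ind (cbox n) x * f x).
Proof.
move=> hf mf n.
pose D : R := (1 + n%:R ^+ 2) ^+ d.
have D0 : 0 <= D by rewrite exprn_ge0// addr_ge0 ?sqr_ge0.
apply: (@le_cL1 _ _ _ _ _ (fun x => D%:E * (cabs (f x * (decay x)%:C))%:E)%E).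
- by apply: cmeasM => //; apply: cmeas_ind; exact: meas_cbox.
- meas.
- move=> x; rewrite !cabsM cabs_ind cabs_real -EFinM lee_fin mulrCA mulrC ler_wpM2l ?cabs_ge0//.
  rewrite indicE; case: (boolP (x \in cbox n)) => [/set_mem xn|_]; last first.
    by rewrite mulr_ge0.
  rewrite ger0_norm ?(ltW (decay_gt0 _))// -[D]invrK mulrC ler_pdivlMr ?invr_gt0 ?exprn_gt0 ?ltr_pwDl ?sqr_ge0//.
  rewrite mul1r -exprVn -[X in _ ^+ X]card_ord -prodr_const; apply: ler_prod => i _.
  rewrite invr_ge0 addr_ge0 ?sqr_ge0//= lef_pV2 ?posrE ?ltr_pwDl ?sqr_ge0// lerD2l.
  have := xn i; rewrite /= in_itv/= => /andP[x1 x2].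
  rewrite -(@real_normK _ (x ord0 i)) ?num_real// lerXn2r ?nnegrE//. by rewrite ler_norml x2 ltW.
- rewrite ge0_integralZl_EFin//.
  + by rewrite lte_mul_pinfty//; case: hf.
  + meas.
  + meas.
Qed.

(** The Poisson averages g n are compared with f and F only through integrals over boxes. These tend
    to the integrals of F by hypothesis and to those of f by dominated convergence, and box
    integrals determine a function almost everywhere. *)
Lemma poisson_inversion f F (g : nat -> V -> C) :
  cmeas f -> cL1 mu (fun x => f x * (decay x)%:C) ->
  cmeas F -> (forall n, cL1 mu (fun x => ind (cbox n) x * F x)) ->
  (forall n s, g n s = cint mu (fun x => f x * (poisson n (x - s))%:C)) ->
  (forall a b, (forall i, a i <= b i) ->
    ccvg (fun n => cint mu (fun s => ind (obox a b) s * g n s))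
         (cint mu (fun s => ind (obox a b) s * F s))) ->
  {ae mu, forall x, f x = F x}.
Proof.
move=> mf hf mF hF gE hg.
suff : {ae mu, forall x, f x - F x = 0}.
  by apply: filterS => x /eqP; rewrite subr_eq0 => /eqP.
have hf' := cL1_decay hf mf.
apply: cint_box_ae0; first meas.
  by move=> n; under eq_fun do rewrite mulrBr; apply: cL1B.
move=> a b ab; under eq_cint do rewrite mulrBr.
rewrite cintB; try exact: cL1_obox.
apply/eqP; rewrite subr_eq0; apply/eqP.
apply: (@ccvg_unique _ (fun n => cint mu (fun s => ind (obox a b) s * g n s))); last exact: hg.
have [K K0 hK] := poisson_box_decay ab.
have mB : measurable (obox a b) by exact: meas_obox.
have mp n : mfunT (fun p : V * V => poisson n (p.2 - p.1)).
  by apply: (measurableT_comp (meas_poisson n)); meas.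
have boxE n x : (\int[mu]_s (\1_(obox a b) s * poisson n (x - s))%:E = (poisson_box n a b x)%:E)%E.
  rewrite -int_poisson_box// [RHS]integral_mkcond; apply: eq_integral => s _.
  by rewrite patchE indicE; case: ifP; rewrite ?mul1r ?mul0r.
(* Fubini moves the averaging from f onto the indicator of the box, whose average [poisson_box] is
   explicit and bounded by a multiple of [decay] uniformly in n. *)
have fub n : cint mu (fun s => ind (obox a b) s * g n s) =
    cint mu (fun x => f x * (poisson_box n a b x)%:C).
  pose H (p : V * V) := ind (obox a b) p.1 * (f p.2 * (poisson n (p.2 - p.1))%:C). have mH : cmeas H.
    apply: cmeasM; first exact: (cmeas_comp (cmeas_ind mB) measurable_fst). meas.
  have hH : cL1 (mu \x mu)%E H.
    apply: cL1_prod => //. rewrite (fubini_tonelli (fun p : V * V => (cabs (H p))%:E)); last 2 first.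
    - meas.
    - meas.
    apply: (@le_lt_trans _ _ (\int[mu]_x (K%:E * (cabs (f x * (decay x)%:C))%:E))%E).
      apply: ge0_le_integral => //.
      - meas.
      - apply: (measurable_fun_fubini_tonelli_G (m1 := mu) (fun p : V * V => (cabs (H p))%:E)).
          meas.
        meas.
      - meas.
      - move=> x _; rewrite /H/=. under eq_integral => s _.
          rewrite !cabsM cabs_ind cabs_real ger0_norm ?poisson_ge0// mulrCA EFinM; over.
        rewrite ge0_integralZl_EFin ?cabs_ge0//; last 2 first.
        + by move=> s _; rewrite lee_fin mulr_ge0 ?poisson_ge0// indicE.
        + apply/measurable_EFinP; apply: measurable_funM => //.
          apply: (measurableT_comp (meas_poisson n)); meas.
        rewrite boxE -EFinM -EFinM lee_fin cabsM cabs_real (gtr0_norm (decay_gt0 x)) mulrCA.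
        by rewrite ler_wpM2l ?cabs_ge0.
    rewrite ge0_integralZl_EFin//.
    + by rewrite lte_mul_pinfty//; case: hf.
    + meas.
    + meas.
  have [M M0 hM] := poisson_bounded (R := R) (d := d) n.
  transitivity (cint mu (fun s => cint mu (fun x => H (s, x)))).
    have := ae_cL1_1 hH; move=> ae1. apply: ae_eq_cint.
    - apply: cmeasM; first exact: cmeas_ind.
      rewrite (_ : g n = fun s => cint mu (fun x => f x * (poisson n (x - s))%:C)); last first.
        by apply/funext => s; exact: gE.
      apply: (@cmeas_cint _ _ _ _ _ mu (fun p : V * V => f p.2 * (poisson n (p.2 - p.1))%:C)). meas.
    - exact: cmeas_cint.
    - apply: filterS ae1 => s hs'; rewrite gE /H/= /ind indicE. case: (boolP (s \in obox a b)) hs' => sB hs'.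
        by rewrite mul1r; apply: eq_cint => x; rewrite /= mul1r.
      by rewrite mul0r; under eq_cint do rewrite mul0r; rewrite cint0.
  rewrite (cint_swap hH); apply: eq_cint => x; rewrite /H/=.
  have mC : cmeas (fun s => (\1_(obox a b) s * poisson n (x - s))%:C).
    apply: cmeas_real; apply: measurable_funM => //. apply: (measurableT_comp (meas_poisson n)); meas.
  have hC : cL1 mu (fun s => (\1_(obox a b) s * poisson n (x - s))%:C).
    split=> //; apply: (@le_lt_trans _ _ (poisson_box n a b x)%:E); last by rewrite ltry.
    rewrite -boxE le_eqVlt; apply/orP; left; apply/eqP; apply: eq_integral => s _.
    by rewrite cabs_real ger0_norm// mulr_ge0 ?poisson_ge0// indicE.
  under eq_cint => s do rewrite mulrCA -rmorphM/=. rewrite (cintZ (f x) hC); congr (_ * _).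
  apply: complex_ext; rewrite ?Re_cint ?Im_cint /=; first by rewrite /Rintegral boxE. by rewrite /Rintegral integral0.
under eq_fun do rewrite fub.
have [] := @cint_dct R _ _ mu (fun n x => f x * (poisson_box n a b x)%:C)
   (fun x => ind (obox a b) x * f x) (fun x => K%:E * (cabs (f x * (decay x)%:C))%:E)%E.
- move=> n; apply: cmeasM => //; apply: cmeas_real.
  have mG : mfunT (fun x => (\int[mu]_s (\1_(obox a b) s * poisson n (x - s))%:E)%E).
    apply: (measurable_fun_fubini_tonelli_F (m2 := mu) (fun p : V * V => (\1_(obox a b) p.2 * poisson n (p.1 - p.2))%:E)).
      apply/measurable_EFinP; apply: measurable_funM.
        exact: (measurableT_comp (measurable_indic _) measurable_snd).
      by apply: (measurableT_comp (meas_poisson n)); meas.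
    by move=> p; rewrite lee_fin mulr_ge0 ?poisson_ge0// indicE.
  by apply/measurable_EFinP; move: mG; under eq_fun do rewrite boxE.
- by apply: cmeasM => //; exact: cmeas_ind.
- by apply: integrableZl => //; exact: cL1_cabs.
- have := ae_coord_neq b; have := ae_coord_neq a; apply: filterS2 => x xa xb.
  rewrite mulrC; apply: ccvgM; first exact: ccvg_cst. apply: ccvg_ReIm => /=; last exact: cvg_cst.
  exact: cvg_poisson_box.
- apply: aeW => x n; rewrite !cabsM !cabs_real -EFinM lee_fin mulrCA ler_wpM2l ?cabs_ge0//.
  by rewrite ger0_norm ?poisson_box_ge0// (gtr0_norm (decay_gt0 x)).
by [].
Qed.

Lemma cL1_mul_decay f : cL1 mu f -> cL1 mu (fun x => f x * (decay x)%:C).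
Proof.
move=> [mf fo]; apply: (@le_cL1 _ _ _ _ _ (fun x => (cabs (f x))%:E)) => //.
- by apply: cmeasM => //; apply: cmeas_real; exact: meas_decay.
- meas.
- move=> x; rewrite cabsM cabs_real (gtr0_norm (decay_gt0 x)) lee_fin. by rewrite ler_piMr ?cabs_ge0// decay_le1.
Qed.

(** If the inverse transform vanishes, so do all Poisson averages of g. *)
Lemma ift_eq0 g : cL1 mu g -> (forall x, ift g x = 0) -> {ae mu, forall x, g x = 0}.
Proof.
move=> hg g0; apply: (@poisson_inversion g (fun=> 0) (fun _ _ => 0)).
- meas.
- exact: cL1_mul_decay.
- meas.
- by move=> n; under eq_fun do rewrite mulr0; exact: cL1_0.
- move=> n s; rewrite -(ft_abel_ift n s hg) /ft. by under eq_cint do rewrite g0 mulr0 mul0r; rewrite cint0 mulr0.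
- move=> a b _; under eq_cint do rewrite mulr0. by under eq_fun do rewrite cint0; exact: ccvg_cst.
Qed.

End inversion.

(** * Series as integrals over the counting measure; completeness of L^1 and L^2 *)

Section natcount.
Context {R : realType}.

(* The counting measure, whose library version carries no sigma-finite structure. *)
Definition natcount : set nat -> \bar R := @counting nat R.

HB.instance Definition _ := Measure.copy natcount (@counting nat R).

HB.instance Definition _ := Measure_isSigmaFinite.Build _ _ _
  natcount (sigma_finite_counting R).

End natcount.

Section counting_integral.
Context {R : realType}.
Notation C := R[i].
Notation count := (@natcount R).

Lemma ge0_integral_natcount (a : nat -> \bar R) : (forall k, 0 <= a k)%E ->
  (\int[count]_t (a t) = \sum_(k <oo) (a k))%E.
Proof. exact: ge0_integral_count. Qed.

Lemma meas_nat_prod d1 d2 (X : measurableType d1) (Y : measurableType d2)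
    (F : X * nat -> Y) : (forall n, mfunT (fun x => F (x, n))) ->
  mfunT F.
Proof.
move=> mF _ B mB; rewrite setTI.
rewrite (_ : F @^-1` B = \bigcup_n (((fun x => F (x, n)) @^-1` B) `*` [set n])).
  apply: bigcupT_measurable => n; apply: measurableX => //. by rewrite -[X in measurable X]setTI; exact: mF.
apply/seteqP; split => [[x n] /= h|[x n] [k _ [/= h ->]]//].
by exists n.
Qed.

Lemma cmeas_nat_prod d1 (X : measurableType d1) (F : X * nat -> C) :
  (forall n, cmeas (fun x => F (x, n))) -> cmeas F.
Proof.
move=> mF; split; first by apply: meas_nat_prod => n; case: (mF n).
by apply: meas_nat_prod => n; case: (mF n).
Qed.

Lemma cmeas_nat (a : nat -> C) : cmeas a.
Proof. by split. Qed.

Lemma cL1_count (a : nat -> C) : (\sum_(k <oo) (cabs (a k))%:E < +oo)%E -> cL1 count a.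
Proof.
move=> h; split; first exact: cmeas_nat.
by rewrite ge0_integral_natcount// => k; meas.
Qed.

Lemma counting_set1 j : count [set j] = 1%E.
Proof. by rewrite /natcount /= /counting asboolT//= fset_set1 finmap.cardfs1. Qed.

Lemma cint_count_single j (z : C) :
  cL1 count (fun i => if i == j then z else 0) /\
  cint count (fun i => if i == j then z else 0) = z.
Proof.
have E i : (if i == j then z else 0) = z * (\1_[set j] i)%:C.
  rewrite indicE; case: eqP => [->|ij]; first by rewrite mem_set// mulr1. by rewrite memNset//= mulr0.
have i1 : (\int[count]_i (\1_[set j] i)%:E = 1%:E :> \bar R)%E.
  by rewrite integral_indic// setIT; exact: counting_set1.
have h : cL1 count (fun i => (\1_[set j] i)%:C).
  split; first meas. have h0 i : 0 <= \1_[set j] i :> R by rewrite indicE.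
  under eq_integral => i _ do rewrite cabs_real (ger0_norm (h0 i)). by rewrite i1 ltry.
under eq_fun do rewrite E; split; first exact: cL1Z.
rewrite (cintZ z h) -[RHS]mulr1; congr (_ * _).
apply: complex_ext; rewrite ?Re_cint ?Im_cint /=; first by rewrite /Rintegral i1.
by rewrite /Rintegral integral0.
Qed.

Lemma cint_count_ccvg (a : nat -> C) : cL1 count a ->
  ccvg (fun n => \sum_(i < n) a i) (cint count a).
Proof.
move=> ha.
have := @cint_dct R _ _ count (fun n i => if (i < n)%N then a i else 0) a (fun i => (cabs (a i))%:E).
case=> [n|||||_ h].
- meas.
- meas.
- exact: cL1_cabs.
- apply: aeW => i; rewrite /ccvg; apply: cvg_near_cst; exists i.+1 => // n /= ni. by rewrite ni subrr cabs0.
- by apply: aeW => i n; case: ifP => _; rewrite lee_fin ?cabs0 ?cabs_ge0.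
move: h; rewrite /ccvg.
suff E n : cint count (fun i => if (i < n)%N then a i else 0) = \sum_(i < n) a i.
  by under eq_fun do rewrite E.
rewrite (_ : (fun i : nat => _) = fun i : nat => \sum_(j < n) (if i == j then a j else 0)).
  rewrite (@cint_sum _ _ _ count n (fun j i => if i == j then a j else 0)).
    by apply: eq_bigr => j _; case: (cint_count_single j (a j)).
  by move=> j; case: (cint_count_single j (a j)).
apply/funext => i; case: ifPn => [ilt|].
  rewrite (bigD1 (Ordinal ilt))//= eqxx big1 ?addr0// => j ji.
  by case: eqP => // ij; move: ji; rewrite -val_eqE/= ij eqxx.
rewrite -leqNgt => ni; rewrite big1// => j _; case: eqP => // ij.
by move: (ltn_ord j); rewrite -ij ltnNge ni.
Qed.

Lemma geometric_half_lty (B : R) : (\sum_(j <oo) (B / 2 ^+ j)%:E < +oo)%E.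
Proof.
have := @cvg_geometric_eseries_half R (2 * B) 0; rewrite /eseries /=.
rewrite expr0 divr1.
rewrite (_ : (fun n => \sum_(0 <= k < n) (2 * B / (2 ^ (k + 1))%:R)%:E)%E = fun n => (\sum_(0 <= k < n) (B / 2 ^+ k)%:E)%E).
  by move=> /cvg_lim -> //; rewrite ltry.
apply/funext => n; apply: eq_bigr => k _; congr (_%:E); rewrite natrX addn1 exprS; field.
by rewrite expf_neq0.
Qed.

Section completeness.
Context d0 (T : measurableType d0) (m : {measure set T -> \bar R}).

(** The limit is written as an integral of the increments over the counting measure, so its
    measurability is that of an integral depending on a parameter. *)
Lemma ae_ccvg_of_summable (u : nat -> T -> C) : (forall j, cmeas (u j)) ->
  {ae m, forall x, (\sum_(j <oo) (cabs (u j.+1 x - u j x))%:E < +oo)%E} ->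
  exists2 F, cmeas F & {ae m, forall x, ccvg (u ^~ x) (F x)}.
Proof.
move=> mu hu; pose F x := u 0%N x + cint count (fun j => u j.+1 x - u j x).
exists F.
  apply: cmeasD => //; apply: (@cmeas_cint _ _ _ _ _ count (fun p : T * nat => u p.2.+1 p.1 - u p.2 p.1)).
  by apply: cmeas_nat_prod => n; exact: (cmeasB (mu n.+1) (mu n)).
apply: filterS hu => x /cL1_count /cint_count_ccvg h.
have := ccvgD (ccvg_cst (u 0%N x)) h; rewrite /ccvg.
suff E n : u 0%N x + \sum_(i < n) (u i.+1 x - u i x) = u n x by under eq_fun do rewrite E.
elim: n => [|n IH]; first by rewrite big_ord0 addr0.
by rewrite big_ord_recr/= addrA IH addrCA subrr addr0.
Qed.

Lemma ae_summable (w : nat -> T -> R) (B : R) : (forall j, mfunT (w j)) ->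
  (forall j x, 0 <= w j x) -> (forall j, \int[m]_x (w j x)%:E <= (B / 2 ^+ j)%:E)%E ->
  {ae m, forall x, (\sum_(j <oo) (w j x)%:E < +oo)%E}.
Proof.
move=> mw w0 hw.
have i1 : (\int[m]_x \sum_(j <oo) (w j x)%:E < +oo)%E.
  rewrite integral_nneseries//; last 2 first.
  - meas.
  - meas.
  apply: (@le_lt_trans _ _ (\sum_(j <oo) (B / 2 ^+ j)%:E)%E).
    apply: lee_nneseries => // j _ _. meas.
  exact: geometric_half_lty.
have : m.-integrable setT (fun x => \sum_(j <oo) (w j x)%:E)%E.
  apply/integrableP; split.
    apply: ge0_emeasurable_sum => //; first meas. meas.
  have n0 x : (0 <= \sum_(j <oo) (w j x)%:E)%E by apply: nneseries_ge0 => k _ _; meas.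
  under eq_integral => x _ do rewrite (gee0_abs (n0 x)). by [].
move=> /integrable_ae => /(_ measurableT); apply: filterS => x /(_ I).
by rewrite ge0_fin_numE// nneseries_ge0// => k _ _; meas.
Qed.

(** For a geometrically Cauchy sequence the increments are summable almost everywhere; Fatou
    transfers the rate to the limit. *)
Lemma L1_complete (u : nat -> T -> C) : (forall j, cmeas (u j)) ->
  (forall j k, (j <= k)%N -> \int[m]_x (cabs (u k x - u j x))%:E <= (2 / 2 ^+ j)%:E)%E ->
  exists2 F, cmeas F & forall j, (\int[m]_x (cabs (u j x - F x))%:E <= (2 / 2 ^+ j)%:E)%E.
Proof.
move=> mu hu.
have /(ae_ccvg_of_summable mu)[F mF cF] : {ae m, forall x, (\sum_(j <oo) (cabs (u j.+1 x - u j x))%:E < +oo)%E}.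
  apply: (@ae_summable (fun j x => cabs (u j.+1 x - u j x)) 2).
  - meas.
  - meas.
  - by move=> j; exact: hu.
exists F => // j.
apply: (@fatou_le _ _ _ m (fun k x => (cabs (u j x - u (j + k)%N x))%:E)).
- meas.
- meas.
- meas.
- meas.
- apply: filterS cF => x cx; apply: cvg_EFin; first exact: nearW. apply: ccvg_cabs.
  have {}cx : ccvg (fun k => u (j + k)%N x) (F x).
    by move: cx; rewrite /ccvg -(@cvg_shiftn j _ (fun n => cabs (u n x - F x))); under eq_fun do rewrite addnC.
  have := ccvgD (ccvg_cst (u j x)) (ccvgM (ccvg_cst (-1)) cx).
  by rewrite mulN1r /ccvg; under eq_fun do rewrite mulN1r.
- move=> k; under eq_integral do rewrite cabs_distC; apply: hu; exact: leq_addr.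
Qed.

Lemma cabs_sqD (a b : C) : cabs (a + b) ^+ 2 <= 2 * cabs a ^+ 2 + 2 * cabs b ^+ 2.
Proof.
have h := cabsD a b; have h0 := cabs_ge0 (a + b).
apply: (via ((cabs a + cabs b) ^+ 2)).
  by rewrite lerXn2r ?nnegrE// addr_ge0// cabs_ge0.
by have := sqr_ge0 (cabs a - cabs b); rewrite !expr2; move: (cabs a) (cabs b) => p q; lra.
Qed.

Definition sqint (f : T -> C) : \bar R := (\int[m]_x (cabs (f x) ^+ 2)%:E)%E.

Lemma meas_sqcabs (f : T -> C) : cmeas f -> mfunT (fun x => (cabs (f x) ^+ 2)%:E).
Proof. meas. Qed.

Lemma sqint_ge0 f : (0 <= sqint f)%E.
Proof. by apply: integral_ge0 => x _; meas. Qed.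

Lemma sqintD f g : cmeas f -> cmeas g ->
  (sqint (fun x => f x + g x)%R <= 2%:E * sqint f + 2%:E * sqint g)%E.
Proof.
move=> mf mg; rewrite /sqint -!ge0_integralZl_EFin//; try exact: meas_sqcabs;
  try meas.
rewrite -ge0_integralD//.
- apply: ge0_le_integral => //.
  + meas.
  + meas.
  + meas.
  + by move=> x _; rewrite -!EFinM -EFinD lee_fin cabs_sqD.
- meas.
- meas.
- meas.
- meas.
Qed.

Lemma sqintN f : sqint (fun x => - f x) = sqint f.
Proof. by apply: eq_integral => x _; rewrite cabsN. Qed.

Lemma sqintB f g : cmeas f -> cmeas g ->
  (sqint (fun x => f x - g x)%R <= 2%:E * sqint f + 2%:E * sqint g)%E.
Proof. by move=> mf mg; rewrite -(sqintN g); apply: sqintD; meas. Qed.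

Lemma sqint_dist_triangle (f g h : T -> C) : cmeas f -> cmeas g -> cmeas h ->
  (sqint (fun x => f x - h x)%R <=
   2%:E * sqint (fun x => f x - g x)%R + 2%:E * sqint (fun x => g x - h x)%R)%E.
Proof.
move=> mf mg mh; rewrite (_ : (fun x => f x - h x) = fun x => (f x - g x) + (g x - h x)).
  by apply: sqintD; meas.
by apply/funext => x; rewrite addrA subrK.
Qed.

Lemma sqint_eq0 f : cmeas f -> sqint f = 0%E -> {ae m, forall x, f x = 0}.
Proof.
move=> mf; rewrite /sqint => h.
have := @ae_eq_integral_abs _ T R m setT measurableT (fun x => (cabs (f x) ^+ 2)%:E) (meas_sqcabs mf).
under eq_integral do rewrite gee0_abs ?lee_fin ?sqr_ge0//.
move=> [] /(_ h) + _; apply: filterS => x /(_ I)[] /eqP; rewrite sqrf_eq0 => /eqP.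
exact: cabs0_eq0.
Qed.

Lemma ae_eq_sqint f g : cmeas f -> cmeas g -> {ae m, forall x, f x = g x} -> sqint f = sqint g.
Proof.
move=> mf mg fg; apply: ge0_ae_eq_integral => //; try exact: meas_sqcabs;
  try meas.
by apply: filterS fg => x -> _.
Qed.

Lemma L2_complete (u : nat -> T -> C) : (forall j, cmeas (u j)) ->
  (forall j k, (j <= k)%N -> sqint (fun x => u k x - u j x)%R <= ((4 ^+ j)^-1)%:E)%E ->
  exists2 F, cmeas F & {ae m, forall x, ccvg (u ^~ x) (F x)} /\
    forall j, (sqint (fun x => u j x - F x)%R <= ((4 ^+ j)^-1)%:E)%E.
Proof.
move=> mu hu.
(* The weight 2^j passes from squares to first powers: q <= 2^-j + 2^j q^2, and 2^j 4^-j is still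
   summable. *)
have h1 : {ae m, forall x, (\sum_(j <oo) (2 ^+ j * cabs (u j.+1 x - u j x) ^+ 2)%:E < +oo)%E}.
  apply: (@ae_summable (fun j x => 2 ^+ j * cabs (u j.+1 x - u j x) ^+ 2) 1).
  - meas.
  - meas.
  - move=> j; under eq_integral do rewrite EFinM. rewrite ge0_integralZl_EFin ?exprn_ge0//; last 2 first.
    + meas.
    + meas.
    apply: (via ((2 ^+ j)%:E * ((4 ^+ j)^-1)%:E)%E).
      by rewrite lee_pmul2l ?lte_fin ?exprn_gt0//; apply: hu.
    rewrite -EFinM lee_fin (_ : 4 = 2 * 2 :> R); last by ring.
    by rewrite exprMn invfM mulrA divff ?mul1r ?lexx// gt_eqF// exprn_gt0.
have /(ae_ccvg_of_summable mu)[F mF cF] : {ae m, forall x, (\sum_(j <oo) (cabs (u j.+1 x - u j x))%:E < +oo)%E}.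
  apply: filterS h1 => x h1.
  apply: (@le_lt_trans _ _ (\sum_(j <oo) ((1 / 2 ^+ j)%:E + (2 ^+ j * cabs (u j.+1 x - u j x) ^+ 2)%:E))%E).
    apply: lee_nneseries => [j _ _|j _]; first meas.
    rewrite -EFinD lee_fin; move: (cabs _) (cabs_ge0 (u j.+1 x - u j x)) => q q0.
    have e0 : (0 : R) < 2 ^+ j by rewrite exprn_gt0.
    have := sqr_ge0 (1 - 2 ^+ j * q); rewrite -subr_ge0 -(pmulr_lge0 _ e0).
    have -> : (1 / 2 ^+ j + 2 ^+ j * q ^+ 2 - q) * 2 ^+ j = 1 + (2 ^+ j * q) ^+ 2 - 2 ^+ j * q.
      by field; rewrite gt_eqF.
    have : 0 <= 2 ^+ j * q by rewrite mulr_ge0// ltW. by rewrite !expr2; move: (2 ^+ j * q) => r; lra.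
  rewrite nneseriesD => [|j _ _|j _ _]; last 2 first.
  - meas.
  - meas.
  apply: lte_add_pinfty => //. exact: geometric_half_lty.
exists F => //; split=> // j.
apply: (@fatou_le _ _ _ m (fun k x => (cabs (u j x - u (j + k)%N x) ^+ 2)%:E)).
- meas.
- meas.
- meas.
- meas.
- apply: filterS cF => x cx; apply: cvg_EFin; first exact: nearW.
  rewrite (_ : fine \o _ = fun k => cabs (u j x - u (j + k)%N x) * cabs (u j x - u (j + k)%N x))//. rewrite expr2.
  have {}cx : ccvg (fun k => u (j + k)%N x) (F x).
    by move: cx; rewrite /ccvg -(@cvg_shiftn j _ (fun n => cabs (u n x - F x))); under eq_fun do rewrite addnC.
  have := ccvgD (ccvg_cst (u j x)) (ccvgM (ccvg_cst (-1)) cx).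
  rewrite mulN1r => h; have {}h : ccvg (fun k => u j x - u (j + k)%N x) (u j x - F x).
    by move: h; rewrite /ccvg; under eq_fun do rewrite mulN1r.
  by apply: cvgM; exact: ccvg_cabs.
- move=> k; under eq_integral do rewrite cabs_distC; apply: hu; exact: leq_addr.
Qed.

End completeness.
End counting_integral.

Ltac meas_ext3 := match goal with
  | |- measurable_fun _ (poisson ?n) => exact: meas_poisson
  | |- measurable_fun _ (fun x => poisson ?n (@?f x)) => apply: (measurableT_comp (meas_poisson n))
  | |- measurable_fun _ (abel ?n) => exact: meas_abel
  | |- measurable_fun _ (fun x => abel ?n (@?f x)) => apply: (measurableT_comp (meas_abel n))
  | |- measurable_fun _ (fun x => - x)%R => exact: meas_oppV
  | |- measurable (cbox _) => exact: meas_cbox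
  | |- cmeas (ft _) => apply: cmeas_ft
  | |- cmeas (fun x => ft ?f x) => apply: (@cmeas_ft _ _ f)
  | |- cmeas (ift _) => apply: cmeas_ift
  | |- cmeas (fun x => ift ?f x) => apply: (@cmeas_ift _ _ f)
  | |- is_true (0 <= poisson _ _)%R => exact: poisson_ge0
  | |- is_true (0 <= abel _ _)%R => exact: abel_ge0
  | |- is_true (_ <= sqint _ _)%E => exact: sqint_ge0
  | _ => meas_ext1
  end.
Ltac meas_ext ::= meas_ext3.

(** * Bessel inequality for the Fourier transform *)

Section plancherel.
Context {R : realType} {d : nat}.
Notation V := 'rV[R]_d.
Notation C := R[i].
Notation mu := (lebesgue_rV d).
Implicit Types (f g : V -> C) (x xi : V).

(** Schur test: p q <= (p^2 + q^2) / 2, and the kernel has mass at most 1 in either variable. *)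
Lemma int_poisson_sq_le n (f : V -> C) : cmeas f ->
  (\int[mu]_x \int[mu]_y (cabs (f x) * (cabs (f y) * poisson n (y - x)))%:E <= sqint mu f)%E.
Proof.
move=> mf.
have m1 : mfunT (fun p : V * V => cabs (f p.1)).
  meas.
have m2 : mfunT (fun p : V * V => cabs (f p.2)).
  meas.
pose A (p : V * V) := (2^-1 * (cabs (f p.1) ^+ 2 * poisson n (p.2 - p.1)))%:E.
pose B (p : V * V) := (2^-1 * (cabs (f p.2) ^+ 2 * poisson n (p.2 - p.1)))%:E.
have mA : mfunT A.
  by apply/measurable_EFinP; meas.
have mB : mfunT B.
  by apply/measurable_EFinP; meas.
have A0 p : (0 <= A p)%E by rewrite lee_fin mulr_ge0// mulr_ge0 ?sqr_ge0 ?poisson_ge0.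
have B0 p : (0 <= B p)%E by rewrite lee_fin mulr_ge0// mulr_ge0 ?sqr_ge0 ?poisson_ge0.
have mAx x : mfunT (fun y => A (x, y)) by apply: (measurableT_comp mA); meas.
have mBx x : mfunT (fun y => B (x, y)) by apply: (measurableT_comp mB); meas.
have mSq : mfunT (fun x => (2^-1 * cabs (f x) ^+ 2)%:E).
  meas.
have q0 x : 0 <= 2^-1 * cabs (f x) ^+ 2 by rewrite mulr_ge0// sqr_ge0.
have hA : (\int[mu]_x \int[mu]_y A (x, y) <= \int[mu]_x (2^-1 * cabs (f x) ^+ 2)%:E)%E.
  apply: ge0_le_integral => //.
  - meas.
  - meas.
  - move=> x _; rewrite /A/=; under eq_integral do rewrite mulrA EFinM.
    rewrite ge0_integralZl_EFin; [|by []|meas| |exact: q0 x].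
      rewrite -[leRHS]mule1; apply: lee_wpmul2l; first meas.
      under eq_integral do rewrite poissonB; exact: int_poisson_le1.
    meas.
have hB : (\int[mu]_x \int[mu]_y B (x, y) <= \int[mu]_x (2^-1 * cabs (f x) ^+ 2)%:E)%E.
  rewrite (fubini_tonelli _ mB B0); apply: ge0_le_integral => //.
  - meas.
  - exact: (measurable_fun_fubini_tonelli_G (m1 := mu) B).
  - move=> x _; rewrite /B/=; under eq_integral do rewrite mulrA EFinM.
    rewrite ge0_integralZl_EFin; [|by []|meas| |exact: q0 x].
      rewrite -[leRHS]mule1; apply: lee_wpmul2l; first meas. exact: int_poisson_le1.
    meas.
apply: (via (\int[mu]_x \int[mu]_y A (x, y) + \int[mu]_x \int[mu]_y B (x, y))%E).
  rewrite -ge0_integralD//; last 4 first.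
  - meas.
  - meas.
  - meas.
  - meas.
  apply: ge0_le_integral => //.
  - meas.
  - meas.
  - meas.
  - move=> x _; rewrite -ge0_integralD//; apply: ge0_le_integral => //.
    + meas.
    + meas.
    + meas.
    + move=> y _; rewrite -EFinD lee_fin /A /B/=.
      move: (cabs _) (cabs _) (poisson n _) (poisson_ge0 n (y - x)) => p q k k0.
      by have := mulr_ge0 k0 (sqr_ge0 (p - q)); rewrite !expr2; lra.
have -> : sqint mu f = (\int[mu]_x (2^-1 * cabs (f x) ^+ 2)%:E + \int[mu]_x (2^-1 * cabs (f x) ^+ 2)%:E)%E.
  rewrite -ge0_integralD//; try meas.
  by apply: eq_integral => x _; rewrite -EFinD; congr (_%:E); field.
exact: (leeD hA hB).
Qed.

(** The Abel-damped square of the transform is, by the multiplication formula, a double integral of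
    f and its conjugate against the Poisson kernel, which the Schur test bounds; Fatou then removes
    the damping. *)
Lemma bessel_ft f : cL1 mu f -> (sqint mu (ft f) <= sqint mu f)%E.
Proof.
move=> hf; have mf := hf.1; have mF : cmeas (ft f) by exact: cmeas_ft.
apply: (@fatou_le _ _ _ mu (fun n xi => (abel n xi * cabs (ft f xi) ^+ 2)%:E)).
- meas.
- meas.
- meas.
- meas.
- apply: aeW => x; apply: cvg_EFin; first exact: nearW.
  rewrite -[X in _ --> X]mul1r; apply: cvgM; [exact: cvg_abel|exact: cvg_cst].
move=> n.
have hc : cL1 mu (fun x => (f x)^*%C) by exact: cL1_conj.
have h1 := cL1_abel_ft n hf.
have hS : cL1 mu (fun xi => (abel n xi)%:C * (cabs (ft f xi) ^+ 2)%:C).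
  apply: cL1_abel_mul; first meas.
  exists ((\int[mu]_x cabs (f x)) ^+ 2) => x; rewrite cabs_real ger0_norm ?sqr_ge0//.
  rewrite lerXn2r ?nnegrE ?cabs_ge0//; first by apply: Rintegral_ge0 => y _; meas. exact: cabs_ft_le.
have E1 : cint mu (fun xi => (abel n xi)%:C * (cabs (ft f xi) ^+ 2)%:C) =
    cint mu (fun x => (f x)^*%C * cint mu (fun y => f y * (poisson n (y - x))%:C)).
  have := cint_mul_ift h1 hc. under eq_cint => xi do rewrite -ft_conj -mulrA mul_conj.
  move=> ->; by under eq_cint => xi do rewrite (ift_abel_ft n xi hf).
apply: (via (cabs (cint mu (fun xi => (abel n xi)%:C * (cabs (ft f xi) ^+ 2)%:C)))%:E).
  have /cL1_integrable[i1 _] := hS.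
  have -> : (\int[mu]_x (abel n x * cabs (ft f x) ^+ 2)%:E =
     (complex.Re (cint mu (fun xi => (abel n xi)%:C * (cabs (ft f xi) ^+ 2)%:C)))%:E)%E.
    rewrite Re_cint /Rintegral fineK; last exact: integrable_fin_num.
    by apply: eq_integral => x _; rewrite ReM/= mulr0 subr0.
  by rewrite lee_fin (le_trans (ler_norm _))// normr_Re_le.
rewrite E1.
have mI : cmeas (fun x => cint mu (fun y => f y * (poisson n (y - x))%:C)).
  apply: (@cmeas_cint _ _ _ _ _ mu (fun p : V * V => f p.2 * (poisson n (p.2 - p.1))%:C)). meas.
have mM : cmeas (fun x => (f x)^*%C * cint mu (fun y => f y * (poisson n (y - x))%:C)).
  meas.
apply: le_trans (le_cabs_cint mu mM) _; apply: le_trans (int_poisson_sq_le n mf).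
apply: ge0_le_integral => //.
- meas.
- meas.
- meas.
- move=> x _; have mx : cmeas (fun y => f y * (poisson n (y - x))%:C).
    meas.
  rewrite cabsM cabs_conj EFinM. under eq_integral do rewrite EFinM.
  rewrite ge0_integralZl_EFin ?cabs_ge0//; last 2 first.
  + meas.
  + meas.
  apply: lee_wpmul2l; first meas.
  apply: le_trans (le_cabs_cint mu mx) _; rewrite le_eqVlt; apply/orP; left; apply/eqP.
  by apply: eq_integral => y _; rewrite cabsM cabs_real ger0_norm ?poisson_ge0.
Qed.

Lemma sqint_reflect f : cmeas f -> sqint mu (fun x => f (- x)) = sqint mu f.
Proof. by move=> mf; apply: (@int_reflect _ _ (fun x => (cabs (f x) ^+ 2)%:E)); meas. Qed.

Lemma bessel_ift f : cL1 mu f -> (sqint mu (ift f) <= sqint mu f)%E.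
Proof.
move=> hf; have := bessel_ft hf.
rewrite (_ : ft f = fun x => ift f (- x)); last by apply/funext => x; exact: ft_ift.
by rewrite sqint_reflect; meas.
Qed.

Lemma cL1_mul_sqint f g : cmeas f -> cmeas g -> (sqint mu f < +oo)%E -> (sqint mu g < +oo)%E ->
  cL1 mu (fun x => f x * g x).
Proof.
move=> mf mg fo go.
apply: (@le_cL1 _ _ _ _ _ (fun x => (cabs (f x) ^+ 2)%:E + (cabs (g x) ^+ 2)%:E)%E).
- meas.
- meas.
- move=> x; rewrite cabsM -EFinD lee_fin.
  have := sqr_ge0 (cabs (f x) - cabs (g x)); have := cabs_ge0 (f x); have := cabs_ge0 (g x).
  rewrite !expr2; move: (cabs (f x)) (cabs (g x)) => p q q0 p0. by have := mulr_ge0 p0 q0; lra.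
- rewrite ge0_integralD//; first exact: lte_add_pinfty.
  + meas.
  + meas.
  + meas.
  + meas.
Qed.

(* Cauchy-Schwarz in the form [2 p q <= e p^2 + q^2 / e] *)
Lemma cabs_cint_mul_le f g (e : R) : cmeas f -> cmeas g -> (sqint mu f < +oo)%E -> (sqint mu g < +oo)%E ->
  0 < e -> ((cabs (cint mu (fun x => f x * g x)))%:E <= e%:E * sqint mu f + e^-1%:E * sqint mu g)%E.
Proof.
move=> mf mg fo go e0; apply: le_trans (le_cabs_cint mu (cmeasM mf mg)) _.
have ei0 : 0 < e^-1 by rewrite invr_gt0.
have sq0 h (x : V) : (0 <= (cabs (h x : C) ^+ 2)%:E :> \bar R)%E by rewrite lee_fin sqr_ge0.
rewrite /sqint -!ge0_integralZl_EFin//; try exact: meas_sqcabs; try exact: ltW.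
rewrite -ge0_integralD//; last 4 first.
- meas.
- meas.
- meas.
- meas.
apply: ge0_le_integral => //.
- meas.
- meas.
- meas.
- move=> x _; rewrite cabsM -!EFinM -EFinD lee_fin.
  have := sqr_ge0 (e * cabs (f x) - cabs (g x)); have := cabs_ge0 (f x); have := cabs_ge0 (g x).
  move: (cabs (f x)) (cabs (g x)) => p q q0 p0 h. rewrite -subr_ge0 -(pmulr_lge0 _ e0).
  have -> : (e * p ^+ 2 + e^-1 * q ^+ 2 - p * q) * e = (e * p - q) ^+ 2 + e * (p * q).
    by field; rewrite gt_eqF.
  meas.
Qed.

End plancherel.

Lemma ecvg0P {R : realType} {T : Type} (F : set_system T) {FF : Filter F} (a : T -> \bar R) :
  (forall n, 0 <= a n)%E ->
  (a @ F --> 0%E) <-> (forall e : R, 0 < e -> \forall n \near F, (a n <= e%:E)%E).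
Proof.
move=> a0; split => [/fine_cvgP[h1 /cvgrPdist_le h2] e e0|h].
  have := h2 e e0; apply: filterS2 h1 => n h1 /=. by rewrite sub0r normrN ger0_norm ?fine_ge0// -lee_fin fineK.
apply/fine_cvgP; split.
  by apply: filterS (h 1 ltr01) => n an; rewrite ge0_fin_numE// (le_lt_trans an)// ltry.
apply/cvgrPdist_le => e e0; apply: filterS (h e e0) => n an.
rewrite sub0r normrN ger0_norm ?fine_ge0// -lee_fin fineK//.
by rewrite ge0_fin_numE// (le_lt_trans an)// ltry.
Qed.

(** * Fourier transform of square integrable functions *)

Section fourier_L2.
Context {R : realType} {d : nat}.
Notation V := 'rV[R]_d.
Notation C := R[i].
Notation mu := (lebesgue_rV d).
Implicit Types (f g F G : V -> C) (x xi : V).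

Definition eball n : set V := [set x | enorm x <= n%:R].

Lemma meas_eball n : measurable (eball n).
Proof.
have := @meas_enorm R d measurableT `]-oo, n%:R]%classic (measurable_itv _).
by rewrite setTI; meas.
Qed.

Lemma coord_le_enorm x i : `|x ord0 i| <= enorm x.
Proof.
rewrite /enorm -sqrtr_sqr ler_wsqrtr// /dotv (bigD1 i)//= expr2 lerDl.
by apply: sumr_ge0 => j _; rewrite -expr2 sqr_ge0.
Qed.

Lemma eball_sub_cbox n : eball n `<=` cbox n.+1.
Proof.
move=> x xn i; rewrite /= in_itv/=.
have : `|x ord0 i| < n.+1%:R.
  by rewrite (le_lt_trans (coord_le_enorm x i))// (le_lt_trans xn)// ltr_nat.
by rewrite ltr_norml => /andP[-> /ltW].
Qed.

Lemma eball_lty n : (mu (eball n) < +oo)%E.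
Proof.
apply: le_lt_trans (obox_lty (fun=> - n.+1%:R) (fun=> n.+1%:R)).
by apply: le_measure; rewrite ?inE; [exact: meas_eball|exact: meas_obox|exact: eball_sub_cbox].
Qed.

Lemma sqint_ind (A : set V) : measurable A -> sqint mu (ind A) = mu A.
Proof.
move=> mA; rewrite -[X in _ = mu X](setIT A) -(integral_indic mu measurableT mA); apply: eq_integral => x _.
by rewrite cabs_ind indicE; case: (_ \in _); rewrite ?expr1n ?expr0n.
Qed.

Definition trunc f n x : C := ind (eball n) x * f x.

Lemma cmeas_trunc f n : cmeas f -> cmeas (trunc f n).
Proof. by move=> mf; apply: cmeasM => //; apply: cmeas_ind; exact: meas_eball. Qed.

Lemma cL1_trunc f n : cmeas f -> (sqint mu f < +oo)%E -> cL1 mu (trunc f n).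
Proof.
move=> mf fo; apply: cL1_mul_sqint => //.
- by apply: cmeas_ind; exact: meas_eball.
- by rewrite sqint_ind; [exact: eball_lty|exact: meas_eball].
Qed.

(** Covers both the truncations to balls and the Abel factors. *)
Lemma mult_cvg (chi : nat -> V -> R) f : (forall n, mfunT (chi n)) ->
  (forall n x, 0 <= chi n x <= 1) -> (forall x, chi ^~ x @ \oo --> (1 : R)) ->
  cmeas f -> (sqint mu f < +oo)%E ->
  (fun n => sqint mu (fun x => (chi n x)%:C * f x - f x)) @ \oo --> 0%E.
Proof.
move=> mchi chi01 chi1 mf fo.
have E n x : cabs ((cabs ((chi n x)%:C * f x - f x) ^+ 2)%:C - 0 : C) = cabs ((chi n x)%:C * f x - f x) ^+ 2.
  by rewrite subr0 cabs_real ger0_norm ?sqr_ge0.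
have E2 n x : cabs ((chi n x)%:C * f x - f x) = (1 - chi n x) * cabs (f x).
  rewrite -cabsN opprB -{1}[f x]mul1r -mulrBl cabsM -(rmorphB _ 1 (chi n x)) cabs_real ger0_norm//.
  by rewrite subr_ge0; case/andP: (chi01 n x).
have H := @cabs_dct R _ _ mu (fun n x => (cabs ((chi n x)%:C * f x - f x) ^+ 2)%:C) (fun=> 0)
  (fun x => (cabs (f x) ^+ 2)%:E).
have {}H : (fun n => (\int[mu]_x (cabs ((cabs ((chi n x)%:C * f x - f x) ^+ 2)%:C - 0))%:E)%E) @ \oo --> 0%E.
  apply: H.
  - meas.
  - meas.
  - apply/integrableP; split; first meas. by under eq_integral do rewrite gee0_abs ?lee_fin ?sqr_ge0//.
  - apply: aeW => x; rewrite /ccvg; under eq_fun do rewrite E E2 exprMn.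
    rewrite -(mul0r (cabs (f x) ^+ 2)); apply: cvgM; last exact: cvg_cst.
    have h : (fun n => 1 - chi n x) @ \oo --> (0 : R).
      by rewrite -(subrr (1 : R)); apply: cvgB; [exact: cvg_cst|exact: chi1].
    by rewrite -(mulr0 (0 : R)); under eq_fun do rewrite expr2; exact: cvgM.
  - apply: aeW => x n; rewrite cabs_real ger0_norm ?sqr_ge0// lee_fin E2. have /andP[c0 c1] := chi01 n x.
    rewrite lerXn2r ?nnegrE ?cabs_ge0 ?mulr_ge0 ?cabs_ge0 ?subr_ge0//. by rewrite ler_piMl ?cabs_ge0// gerBl.
by move: H; under eq_fun do under eq_integral do rewrite E.
Qed.

Lemma trunc_cvg f : cmeas f -> (sqint mu f < +oo)%E ->
  (fun n => sqint mu (fun x => trunc f n x - f x)) @ \oo --> 0%E.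
Proof.
apply: mult_cvg => [n|n x|x].
- by apply: measurable_indic; exact: meas_eball.
- by rewrite indicE ler0n lern1; case: (_ \in _).
- apply: cvg_near_cst; exists (Num.truncn (enorm x)).+1 => // n /= hn.
  rewrite indicE mem_set// /eball/= (le_trans (ltW (truncnS_gt _)))// ler_nat//.
Qed.

Definition is_ft2 f F := cmeas F /\
  (fun n => sqint mu (fun xi => ft (trunc f n) xi - F xi)) @ \oo --> 0%E.

Lemma cvg_sqint_le f (u : nat -> V -> C) F :
  (fun n => sqint mu (fun x => u n x - F x)) @ \oo --> 0%E ->
  forall e : R, 0 < e -> \forall n \near \oo, (sqint mu (fun x => u n x - F x)%R <= e%:E)%E.
Proof. by move=> h; apply/ecvg0P => // n; meas. Qed.

Lemma sqint_ftB_le f g : cL1 mu f -> cL1 mu g ->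
  (sqint mu (fun xi => ft f xi - ft g xi)%R <= sqint mu (fun x => f x - g x)%R)%E.
Proof.
move=> hf hg; apply: le_trans (bessel_ft (cL1B hf hg)).
by rewrite le_eqVlt; apply/orP; left; apply/eqP; apply: eq_integral => xi _; rewrite ftB.
Qed.

Lemma is_ft2_exists f : cmeas f -> (sqint mu f < +oo)%E -> exists F, is_ft2 f F.
Proof.
move=> mf fo; have hT n : cL1 mu (trunc f n) by exact: cL1_trunc.
have mT n : cmeas (trunc f n) by exact: cmeas_trunc.
have mFT n : cmeas (ft (trunc f n)) by exact: cmeas_ft.
have tc := cvg_sqint_le f (trunc_cvg mf fo).
(* The triangle inequality for [sqint] costs a factor 2 on each of two terms, so a quarter of 4^-j
   gives back 4^-j. *)
pose eps j : R := (4 ^+ j)^-1 / 4.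
have eps0 j : 0 < eps j by rewrite divr_gt0// invr_gt0 exprn_gt0.
have /choice[m hm] j : exists k, forall n, (k <= n)%N -> (sqint mu (fun x => trunc f n x - f x)%R <= (eps j)%:E)%E.
  by have [k _ hk] := tc _ (eps0 j); exists k => n kn; exact: hk.
have step n k j : (m j <= n)%N -> (sqint mu (fun x => trunc f k x - f x)%R <= (eps j)%:E)%E ->
    (sqint mu (fun xi => ft (trunc f k) xi - ft (trunc f n) xi)%R <= ((4 ^+ j)^-1)%:E)%E.
  move=> mn hk; apply: le_trans (sqint_ftB_le (hT k) (hT n)) _.
  apply: le_trans (sqint_dist_triangle mu (mT k) mf (mT n)) _.
  have hn : (sqint mu (fun x => f x - trunc f n x)%R <= (eps j)%:E)%E.
    rewrite (_ : sqint mu _ = sqint mu (fun x => trunc f n x - f x)) ?hm//.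
    by apply: eq_integral => x _; rewrite cabs_distC.
  apply: (via (2%:E * (eps j)%:E + 2%:E * (eps j)%:E)%E).
    by apply: leeD; apply: lee_wpmul2l.
  by rewrite -!EFinM -EFinD lee_fin /eps; move: (_^-1) => q; lra.
have [F mF [_ hF]] : exists2 F, cmeas F & {ae mu, forall x, ccvg ((fun j => ft (trunc f (m j))) ^~ x) (F x)} /\
    forall j, (sqint mu (fun x => ft (trunc f (m j)) x - F x)%R <= ((4 ^+ j)^-1)%:E)%E.
  apply: (L2_complete (fun j => mFT (m j))) => j k jk; apply: (step _ _ _ (leqnn _)).
  apply: le_trans (hm k (m k) (leqnn _)) _; rewrite lee_fin ler_wpM2r// lef_pV2 ?posrE ?exprn_gt0//.
  by rewrite ler_eXn2l// ltr1n.
exists F; split=> //; apply/ecvg0P; first meas.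
move=> e e0.
have [j hj] : exists j, 4 * (4 ^+ j)^-1 <= e.
  exists (Num.truncn (4 / e)).+1. rewrite ler_pdivrMr ?exprn_gt0// mulrC -ler_pdivrMr//.
  apply: (le_trans (ltW (truncnS_gt _))); rewrite -natrX ler_nat. exact/ltnW/ltn_expl.
exists (m j) => // n /= mn.
apply: le_trans (sqint_dist_triangle mu (mFT n) (mFT (m j)) mF) _.
apply: (via (2%:E * ((4 ^+ j)^-1)%:E + 2%:E * ((4 ^+ j)^-1)%:E)%E).
  apply: leeD; apply: lee_wpmul2l => //. by apply: step => //; exact: hm.
by rewrite -!EFinM -EFinD lee_fin; move: (_^-1) hj => q; lra.
Qed.

Lemma is_ft2_unique f F G : cmeas f -> is_ft2 f F -> is_ft2 f G -> {ae mu, forall xi, F xi = G xi}.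
Proof.
move=> mf [mF hF] [mG hG].
suff : sqint mu (fun x => F x - G x) = 0%E.
  move=> /(sqint_eq0 (cmeasB mF mG)); apply: filterS => x /eqP; rewrite subr_eq0 => /eqP//.
apply/eqP; rewrite eq_le sqint_ge0 andbT; apply/lee_addgt0Pr => e e0; rewrite add0e.
have e4 : 0 < e / 4 by rewrite divr_gt0.
near \oo => n.
have hn : (sqint mu (fun x => ft (trunc f n) x - F x)%R <= (e / 4)%:E)%E.
  by near: n; exact: (cvg_sqint_le f hF e4).
have hn' : (sqint mu (fun x => ft (trunc f n) x - G x)%R <= (e / 4)%:E)%E.
  by near: n; exact: (cvg_sqint_le f hG e4).
have mT : cmeas (ft (trunc f n)) by apply: cmeas_ft; exact: cmeas_trunc.
apply: le_trans (sqint_dist_triangle mu mF mT mG) _.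
apply: (via (2%:E * (e / 4)%:E + 2%:E * (e / 4)%:E)%E).
  apply: leeD; apply: lee_wpmul2l => //. rewrite (_ : sqint mu _ = sqint mu (fun x => ft (trunc f n) x - F x))//.
  by apply: eq_integral => x _; rewrite cabs_distC.
by rewrite -!EFinM -EFinD lee_fin; lra.
Unshelve. all: by end_near. Qed.

Lemma is_ft2B f g F G : cmeas f -> cmeas g -> (sqint mu f < +oo)%E -> (sqint mu g < +oo)%E ->
  is_ft2 f F -> is_ft2 g G -> is_ft2 (fun x => f x - g x) (fun x => F x - G x).
Proof.
move=> mf mg fo go [mF hF] [mG hG]; split; first meas.
apply/ecvg0P => [n|e e0]; first meas.
have e4 : 0 < e / 4 by rewrite divr_gt0.
near=> n.
have hn : (sqint mu (fun x => ft (trunc f n) x - F x)%R <= (e / 4)%:E)%E.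
  by near: n; exact: (cvg_sqint_le f hF e4).
have hn' : (sqint mu (fun x => ft (trunc g n) x - G x)%R <= (e / 4)%:E)%E.
  by near: n; exact: (cvg_sqint_le g hG e4).
have -> : (fun xi => ft (trunc (fun x => f x - g x) n) xi - (F xi - G xi)) =
    (fun xi => (ft (trunc f n) xi - F xi) - (ft (trunc g n) xi - G xi)).
  apply/funext => xi; rewrite (_ : trunc _ n = fun x => trunc f n x - trunc g n x); last first.
    by apply/funext => x; rewrite /trunc mulrBr.
  by rewrite (ftB xi (cL1_trunc n mf fo) (cL1_trunc n mg go)); ring.
have mT : cmeas (ft (trunc f n)) by apply: cmeas_ft; exact: cmeas_trunc.
have mT' : cmeas (ft (trunc g n)) by apply: cmeas_ft; exact: cmeas_trunc.
apply: le_trans (sqintB mu (cmeasB mT mF) (cmeasB mT' mG)) _.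
apply: (via (2%:E * (e / 4)%:E + 2%:E * (e / 4)%:E)%E).
  by apply: leeD; apply: lee_wpmul2l.
by rewrite -!EFinM -EFinD lee_fin; lra.
Unshelve. all: by end_near. Qed.

Lemma ae_eq_ft f g xi : cmeas f -> cmeas g -> {ae mu, forall x, f x = g x} -> ft f xi = ft g xi.
Proof. by move=> mf mg fg; rewrite !ft_ift; exact: ae_eq_ift. Qed.

Lemma ae_eq_is_ft2 f g F : cmeas f -> cmeas g -> {ae mu, forall x, f x = g x} ->
  is_ft2 f F -> is_ft2 g F.
Proof.
move=> mf mg fg [mF hF]; split; first exact: mF.
have E : (fun n => sqint mu (fun xi => ft (trunc f n) xi - F xi)) =
    (fun n => sqint mu (fun xi => ft (trunc g n) xi - F xi)).
  apply/funext => n; congr (sqint mu _); apply/funext => xi; congr (_ - _).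
  apply: ae_eq_ft; [exact: cmeas_trunc|exact: cmeas_trunc|]. by apply: filterS fg => x e; rewrite /trunc e.
exact: (eq_ind _ (fun u : nat -> \bar R => u @ \oo --> 0%E) hF _ E).
Qed.

Lemma sqint_ft2_lty f F : cmeas f -> (sqint mu f < +oo)%E -> is_ft2 f F -> (sqint mu F < +oo)%E.
Proof.
move=> mf fo [mF hF].
near \oo => n.
have hn : (sqint mu (fun x => ft (trunc f n) x - F x)%R <= 1%:E)%E.
  by near: n; exact: (cvg_sqint_le f hF ltr01).
have mT : cmeas (ft (trunc f n)) by apply: cmeas_ft; exact: cmeas_trunc.
have E : F = fun x => ft (trunc f n) x - (ft (trunc f n) x - F x).
  by apply/funext => x; rewrite subKr.
rewrite E; apply: le_lt_trans (sqintB mu mT (cmeasB mT mF)) _.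
have tf : (sqint mu (ft (trunc f n)) <= sqint mu f)%E.
  apply: le_trans (bessel_ft (cL1_trunc n mf fo)) _. apply: ge0_le_integral => //.
  - meas.
  - by apply: meas_sqcabs; exact: cmeas_trunc.
  - meas.
  - move=> x _; rewrite lee_fin /trunc cabsM cabs_ind indicE.
    by case: (_ \in _); rewrite ?mul1r// mul0r expr0n/= sqr_ge0.
apply: lte_add_pinfty; apply: lte_mul_pinfty => //.
  exact: le_lt_trans fo.
by apply: le_lt_trans hn _; rewrite ltry.
Unshelve. all: by end_near. Qed.

End fourier_L2.

Lemma ccvg_le {R : realType} (u : nat -> R[i]) l :
  (forall e : R, 0 < e -> \forall n \near \oo, cabs (u n - l) <= e) -> ccvg u l.
Proof.
move=> h; apply/cvgr0Pnorm_le => e e0.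
by apply: filterS (h e e0) => n; rewrite ger0_norm ?cabs_ge0.
Qed.

(** * Inversion for square integrable functions *)

Section inversion_L2.
Context {R : realType} {d : nat}.
Notation V := 'rV[R]_d.
Notation C := R[i].
Notation mu := (lebesgue_rV d).
Implicit Types (f g F G : V -> C) (x xi : V).

Lemma eq_cabs_sqint f g : (forall x, cabs (f x) = cabs (g x)) -> sqint mu f = sqint mu g.
Proof. by move=> h; apply: eq_integral => x _; rewrite h. Qed.

Lemma bounded_sqint_lty f (M : R) : cmeas f -> (forall x, cabs (f x) <= M) ->
  cL1 mu f -> (sqint mu f < +oo)%E.
Proof.
move=> mf fM [_ fo].
have M0 : 0 <= M by apply: le_trans (fM 0); meas.
apply: (@le_lt_trans _ _ (M%:E * \int[mu]_x (cabs (f x))%:E)%E).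
  rewrite -ge0_integralZl_EFin//; last first.
  - meas.
  - meas.
  apply: ge0_le_integral => //.
  - meas.
  - meas.
  - meas.
  - by move=> x _; rewrite -EFinM lee_fin expr2 ler_wpM2r// cabs_ge0.
by apply: lte_mul_pinfty; meas.
Qed.

Lemma cmeas_poisson n (s : V) : cmeas (fun x => (poisson n (x - s))%:C : C).
Proof.
meas.
Qed.

Lemma cL1_poisson n (s : V) : cL1 mu (fun x => (poisson n (x - s))%:C : C).
Proof.
split; first meas.
apply: (@le_lt_trans _ _ 1%E); last by rewrite ltry.
apply: le_trans (int_poisson_le1 n s); apply: ge0_le_integral => //.
- meas.
- meas.
- meas.
- by move=> x _; rewrite cabs_real ger0_norm ?poisson_ge0// poissonB.
Qed.

Lemma sqint_poisson_lty n (s : V) : (sqint mu (fun x => (poisson n (x - s))%:C : C) < +oo)%E.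
Proof.
have [M M0 hM] := @poisson_bounded R d n.
apply: (bounded_sqint_lty (M := M) (cmeas_poisson n s) _ (cL1_poisson n s)) => x.
by rewrite cabs_real ger0_norm ?poisson_ge0.
Qed.

Lemma cL1_mul_decay_sqint f : cmeas f -> (sqint mu f < +oo)%E -> cL1 mu (fun x => f x * (decay x)%:C).
Proof.
move=> mf fo; have E : (fun x : V => f x * (decay x)%:C) = (fun x => ((pi ^+ d)%:C * (f x * (poisson 0 (x - 0))%:C))).
  by apply/funext => x; rewrite decay_poisson subr0 rmorphM /=; ring.
rewrite E; apply: cL1Z; apply: cL1_mul_sqint => //; first meas.
exact: sqint_poisson_lty.
Qed.

Lemma cint_mul_ccvg f (u : nat -> V -> C) F : cmeas f -> (sqint mu f < +oo)%E ->
  (forall n, cmeas (u n)) -> cmeas F -> (sqint mu F < +oo)%E ->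
  (fun n => sqint mu (fun x => u n x - F x)) @ \oo --> 0%E ->
  ccvg (fun n => cint mu (fun x => f x * u n x)) (cint mu (fun x => f x * F x)).
Proof.
move=> mf fo mu_ mF Fo h; apply: ccvg_le => e e0.
have [K K0 hK] : exists2 K, 0 < K & (sqint mu f <= K%:E)%E.
  have fn : sqint mu f \is a fin_num by rewrite ge0_fin_numE ?sqint_ge0.
  exists (fine (sqint mu f) + 1); first by rewrite ltr_wpDl// fine_ge0// sqint_ge0.
  by rewrite -{1}(fineK fn) lee_fin lerDl.
(* The Cauchy-Schwarz parameter for which both terms are e / 2, given the tolerance a e / 2 on the
   distance. *)
pose a := e / (2 * K); have a0 : 0 < a by rewrite divr_gt0// mulr_gt0.
have b0 : 0 < a * e / 2 by rewrite divr_gt0// mulr_gt0.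
near=> n.
have hn : (sqint mu (fun x => u n x - F x)%R <= (a * e / 2)%:E)%E.
  by near: n; exact: (cvg_sqint_le f h b0).
have mD : cmeas (fun x => u n x - F x) by exact: cmeasB.
have Do : (sqint mu (fun x => u n x - F x)%R < +oo)%E by apply: le_lt_trans hn _; rewrite ltry.
have uo : (sqint mu (u n) < +oo)%E.
  have E : u n = fun x => (u n x - F x) - (- F x) by apply/funext => x; ring.
  rewrite E; apply: le_lt_trans (sqintB mu mD (cmeasN mF)) _.
  rewrite sqintN; apply: lte_add_pinfty; exact: lte_mul_pinfty.
have E : cint mu (fun x => f x * u n x) - cint mu (fun x => f x * F x) =
    cint mu (fun x => f x * (u n x - F x)).
  rewrite -(cintB (cL1_mul_sqint mf (mu_ n) fo uo) (cL1_mul_sqint mf mF fo Fo)).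
  by apply: eq_cint => x; rewrite mulrBr.
rewrite E -lee_fin; apply: le_trans (cabs_cint_mul_le mf mD fo Do a0) _.
have ai0 : 0 <= a^-1 by rewrite invr_ge0 ltW.
apply: (via (a%:E * K%:E + a^-1%:E * (a * e / 2)%:E)%E).
  by apply: leeD; apply: lee_wpmul2l; meas.
rewrite -!EFinM -EFinD lee_fin.
have -> : a^-1 * (a * e / 2) = e / 2 by field; rewrite gt_eqF.
have -> : a * K = e / 2 by rewrite /a; field; rewrite gt_eqF.
by clear; lra.
Unshelve. all: by end_near. Qed.

Lemma cL1_ind_bounded (A : set V) f (M : R) : measurable A -> (mu A < +oo)%E -> cmeas f ->
  (forall x, cabs (f x) <= M) -> cL1 mu (fun x => ind A x * f x).
Proof.
move=> mA Ao mf fM.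
have M0 : 0 <= M by apply: le_trans (fM 0); meas.
apply: (@le_cL1 _ _ _ _ _ (fun x => M%:E * (\1_A x)%:E)%E).
- by apply: cmeasM => //; exact: cmeas_ind.
- meas.
- move=> x; rewrite cabsM cabs_ind -EFinM lee_fin mulrC ler_wpM2r//.
- rewrite ge0_integralZl_EFin//; last meas. by rewrite integral_indic// setIT; apply: lte_mul_pinfty; meas.
Qed.

Lemma cint_obox_ccvg f (u : nat -> V -> C) (M : R) a b :
  (forall n, cmeas (u n)) -> cmeas f -> (forall n x, cabs (u n x) <= M) ->
  (forall x, ccvg (u ^~ x) (f x)) ->
  ccvg (fun n => cint mu (fun s => ind (obox a b) s * u n s))
       (cint mu (fun s => ind (obox a b) s * f s)).
Proof.
move=> mu_ mf uM uf.
have M0 : 0 <= M by apply: le_trans (uM 0%N 0); meas.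
have mB := meas_obox a b.
have mi := cmeas_ind mB.
refine (cint_dct (fun n => cmeasM mi (mu_ n)) (cmeasM mi mf) _ _ _).2.
- apply: (cL1_cabs (f := fun x => ind (obox a b) x * M%:C)).
  apply: (cL1_ind_bounded (M := M)) => //; first exact: obox_lty. by move=> _; rewrite cabs_real ger0_norm.
- by apply: aeW => x; apply: ccvgM (ccvg_cst _) (uf x).
- apply: aeW => x n; rewrite lee_fin !cabsM cabs_real (ger0_norm M0). by rewrite ler_wpM2l// cabs_ge0.
Qed.

Lemma sqint_abel_lty n : (sqint mu (fun x => (abel n x)%:C : C) < +oo)%E.
Proof.
apply: (bounded_sqint_lty (M := 1)).
- meas.
- by move=> x; rewrite cabs_real ger0_norm ?abel_ge0 ?abel_le1.
- exact: cL1_abel.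
Qed.

Lemma ccvg_abel xi : ccvg (fun n => (abel n xi)%:C : C) 1.
Proof. by apply: ccvg_ReIm => /=; [exact: cvg_abel|exact: cvg_cst]. Qed.

Lemma cmeas_abel n : cmeas (fun x : V => (abel n x)%:C : C).
Proof. meas. Qed.

(** The Poisson average of f equals the inverse transform of the damped F: this holds for
    truncations of f and passes to the limit, both sides being continuous for the square norm. The
    damping then disappears by dominated convergence, F being integrable. *)
Lemma ft2_inversion f F : cmeas f -> (sqint mu f < +oo)%E -> is_ft2 f F -> cL1 mu F ->
  {ae mu, forall x, f x = ift F x}.
Proof.
move=> mf fo fF F1.
have Fo := sqint_ft2_lty mf fo fF.
have [mF hF] := fF.
have mT n : cmeas (ft (trunc f n)) by apply: cmeas_ft; exact: cmeas_trunc.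
have mca n : cmeas (fun xi => (abel n xi)%:C * F xi) by apply: cmeasM; meas.
have abF n xi : cabs ((abel n xi)%:C * F xi) <= cabs (F xi).
  rewrite cabsM cabs_real ger0_norm ?abel_ge0// ler_piMl ?cabs_ge0//; exact: abel_le1.
have aF1 n : cL1 mu (fun xi => (abel n xi)%:C * F xi).
  apply: (le_cL1 (mca n) (meas_ecabs mF)); last exact: F1.2. meas.
apply: (@poisson_inversion _ _ _ _ (fun n => ift (fun xi => (abel n xi)%:C * F xi))) => //.
- exact: cL1_mul_decay_sqint.
- meas.
- move=> n; apply: (cL1_ind_bounded (meas_cbox n) (obox_lty _ _) (cmeas_ift mF)) => x. exact: cabs_ift_le.
- move=> n s. have mP := cmeas_poisson n s. have Po := sqint_poisson_lty n s.
  have := cint_mul_ccvg mP Po (fun m => cmeas_trunc m mf) mf fo (trunc_cvg mf fo).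
  have E m : cint mu (fun x => (poisson n (x - s))%:C * trunc f m x) =
      ift (fun xi => (abel n xi)%:C * ft (trunc f m) xi) s.
    by rewrite (ift_abel_ft n s (cL1_trunc m mf fo)); apply: eq_cint => x; rewrite mulrC.
  under eq_fun do rewrite E. have mW : cmeas (fun xi => (abel n xi)%:C * cexp (dotv s xi) : C).
    apply: cmeasM; first meas. by apply: cmeas_cexp; exact: meas_dotv.
  have Wo : (sqint mu (fun xi => (abel n xi)%:C * cexp (dotv s xi) : C)%R < +oo)%E.
    rewrite (eq_cabs_sqint (g := fun xi => (abel n xi)%:C)); first exact: sqint_abel_lty.
    by move=> x; rewrite cabsM cabs_cexp mulr1.
  have := cint_mul_ccvg mW Wo mT mF Fo hF. move=> /(ccvgM (ccvg_cst ((fourier_cst d)%:C : C))) h1 h2.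
  have E1 m : (fourier_cst d)%:C * cint mu (fun xi => (abel n xi)%:C * cexp (dotv s xi) * ft (trunc f m) xi)
     = ift (fun xi => (abel n xi)%:C * ft (trunc f m) xi) s.
    by rewrite /ift; congr (_ * _); apply: eq_cint => xi; ring.
  have h1' : ccvg (fun m => ift (fun xi => (abel n xi)%:C * ft (trunc f m) xi) s)
     ((fourier_cst d)%:C * cint mu (fun xi => (abel n xi)%:C * cexp (dotv s xi) * F xi)).
    by move: h1; under eq_fun do rewrite E1.
  rewrite /ift.
  rewrite (eq_cint mu (f := fun x => f x * (poisson n (x - s))%:C) (g := fun x => (poisson n (x - s))%:C * f x)); last first.
    by move=> x; rewrite mulrC.
  rewrite -(ccvg_unique h1' h2); congr (_ * _); apply: eq_cint => xi; ring.
- move=> a b ab; apply: (cint_obox_ccvg (M := \int[mu]_xi cabs (F xi))).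
  + meas.
  + meas.
  + move=> n x; apply: le_trans (cabs_ift_le x (aF1 n)) _.
    apply: le_Rintegral => //; [exact: (cL1_cabs (aF1 n))|exact: (cL1_cabs F1)].
  + move=> x; apply: (ccvgM (ccvg_cst _)).
    have mcx : cmeas (fun xi => cexp (dotv x xi) : C) by apply: cmeas_cexp; exact: meas_dotv.
    refine (cint_dct (fun n => cmeasM (mca n) mcx) (cmeasM mF mcx) (cL1_cabs F1) _ _).2.
    * apply: aeW => xi; apply: ccvgM (ccvg_cst _). by have := ccvgM (ccvg_abel xi) (ccvg_cst (F xi)); rewrite mul1r.
    * by apply: aeW => xi n; rewrite lee_fin cabsM cabs_cexp mulr1.
Qed.

Lemma ae_eq_is_ft2_r f F G : cmeas f -> cmeas F -> cmeas G -> {ae mu, forall xi, F xi = G xi} ->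
  is_ft2 f F -> is_ft2 f G.
Proof.
move=> mf mF mG FG [_ hF]; split=> //.
have E : (fun n => sqint mu (fun xi => ft (trunc f n) xi - F xi)) =
    (fun n => sqint mu (fun xi => ft (trunc f n) xi - G xi)).
  have mT n : cmeas (ft (trunc f n)) by apply: cmeas_ft; exact: cmeas_trunc.
  apply/funext => n; apply: (ae_eq_sqint (cmeasB (mT n) mF) (cmeasB (mT n) mG)). by apply: filterS FG => x ->.
exact: (eq_ind _ (fun u : nat -> \bar R => u @ \oo --> 0%E) hF _ E).
Qed.

(** Some L^2 transform F of [ift g] exists. The Abel-damped [ift g] is integrable, its transform is
    the Poisson average of g, and these averages tend to F in L^2; hence F = g. *)
Lemma is_ft2_ift g : cL1 mu g -> (sqint mu g < +oo)%E -> is_ft2 (ift g) g.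
Proof.
move=> g1 go; have mg := g1.1; have mf := cmeas_ift mg.
have fo : (sqint mu (ift g) < +oo)%E by apply: le_lt_trans go; exact: bessel_ift.
have [F fF] := is_ft2_exists mf fo; have [mF hF] := fF.
have Fo := sqint_ft2_lty mf fo fF.
apply: (ae_eq_is_ft2_r mf mF mg _ fF).
suff h : {ae mu, forall x, g x = F x} by apply: filterS h => x ->.
pose G n := ft (fun xi => (abel n xi)%:C * ift g xi).
have mG n : cmeas (G n) by apply: cmeas_ft; apply: cmeasM (cmeas_abel n) mf.
have GF : (fun n => sqint mu (fun x => G n x - F x)) @ \oo --> 0%E.
  apply/ecvg0P => [n|e e0]; first exact: sqint_ge0. have e8 : 0 < e / 16 by rewrite divr_gt0.
  have hm : (fun n => sqint mu (fun x => (abel n x)%:C * ift g x - ift g x)) @ \oo --> 0%E.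
    exact: mult_cvg (@meas_abel R d) (fun n x => introT andP (conj (abel_ge0 n x) (abel_le1 n x)))
    (@cvg_abel R d) mf fo.
  have ev := @cvg_sqint_le _ _ F (fun n x => (abel n x)%:C * ift g x) (ift g) hm _ e8. near=> n.
  have h1 : (sqint mu (fun x => ft (trunc (ift g) n) x - F x)%R <= (e / 16)%:E)%E.
    by near: n; exact: (cvg_sqint_le F hF e8).
  have h2 : (sqint mu (fun x => trunc (ift g) n x - ift g x)%R <= (e / 16)%:E)%E.
    by near: n; exact: (cvg_sqint_le F (trunc_cvg mf fo) e8).
  have h3 : (sqint mu (fun x => (abel n x)%:C * ift g x - ift g x)%R <= (e / 16)%:E)%E.
    by near: n; exact: ev.
  have t1 := cL1_trunc n mf fo. have a1 := cL1_abel_ift n g1.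
  apply: le_trans (sqint_dist_triangle mu (mG n) (cmeas_ft t1.1) mF) _.
  have h4 : (sqint mu (fun x => ift g x - trunc (ift g) n x)%R <= (e / 16)%:E)%E.
    apply: le_trans h2; rewrite (eq_cabs_sqint (g := fun x => trunc (ift g) n x - ift g x)) => // x.
    by rewrite cabs_distC.
  have h5 : (sqint mu (fun x => G n x - ft (trunc (ift g) n) x)%R <= (2%:E * (e / 16)%:E + 2%:E * (e / 16)%:E))%E.
    apply: le_trans (sqint_ftB_le a1 t1) _. apply: le_trans (sqint_dist_triangle mu a1.1 mf t1.1) _.
    by apply: leeD; apply: lee_wpmul2l.
  apply: (via (2%:E * (2%:E * (e / 16)%:E + 2%:E * (e / 16)%:E) + 2%:E * (e / 16)%:E)%E).
    by apply: leeD; apply: lee_wpmul2l.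
  by rewrite -!(EFinM, EFinD) lee_fin; move: e0; clear; lra.
apply: (@poisson_inversion _ _ _ _ G) => //.
- exact: cL1_mul_decay.
- move=> n; apply: cL1_mul_sqint => //; first exact: cmeas_ind (meas_cbox n).
  by rewrite (sqint_ind (meas_cbox n)); exact: obox_lty.
- by move=> n s; rewrite /G (ft_abel_ift n s g1).
- move=> a b ab; have mB := meas_obox a b.
  have Io : (sqint mu (ind (obox a b)) < +oo)%E by rewrite sqint_ind//; exact: obox_lty.
  exact: (cint_mul_ccvg (cmeas_ind mB) Io mG mF Fo GF).
Unshelve. all: by end_near. Qed.

End inversion_L2.

Lemma ecvg0_sqrt {R : realType} {T : Type} (F : set_system T) {FF : Filter F} (a : T -> \bar R) :
  (forall n, 0 <= a n)%E ->
  ((fun n => a n `^ 2^-1)%E @ F --> 0%E) <-> (a @ F --> 0%E).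
Proof.
move=> a0; have s0 n : (0 <= a n `^ 2^-1)%E by exact: poweR_ge0.
split => /ecvg0P h; apply/ecvg0P => // e e0.
- have := h s0 (e `^ 2^-1) (powR_gt0 _ e0); apply: filterS => n le.
  have -> : a n = ((a n `^ 2^-1) `^ 2)%E by rewrite -poweRrM mulVf ?poweRe1.
  have -> : e%:E = ((e `^ 2^-1)%:E `^ 2)%E by rewrite -poweR_EFin -poweRrM mulVf ?poweRe1// lee_fin ltW.
  by apply: gt0_ler_poweR => //; rewrite in_itv/= leey ?andbT// lee_fin powR_ge0.
- have := h a0 (e ^+ 2) (exprn_gt0 _ e0); apply: filterS => n le. have -> : e%:E = ((e ^+ 2)%:E `^ 2^-1)%E.
    by rewrite poweR_EFin -powR_mulrn ?ltW// -powRrM mulfV// powRr1// ltW.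
  by apply: gt0_ler_poweR => //; rewrite ?invr_ge0// in_itv/= leey ?andbT// lee_fin sqr_ge0.
Qed.

(** * The norms of the statement in terms of the transform *)

Section fourier_norms.
Context {R : realType} {d : nat}.
Notation V := 'rV[R]_d.
Notation C := R[i].
Notation mu := (lebesgue_rV d).
Implicit Types (f g : V -> R) (F G : V -> C) (x xi : V).

Definition tocx f : V -> C := fun x => (f x)%:C.

Definition inL2 f := mfunT f /\ (sqint mu (tocx f) < +oo)%E.

Lemma inL2P f : f \in Lfun mu 2%:E <-> inL2 f.
Proof.
have E : ('N[mu]_2[EFin \o f] = (sqint mu (tocx f)) `^ 2^-1)%E.
  rewrite unlock /Lnorm.body /=; congr (_ `^ _)%E; apply: eq_integral => x _ /=.
  by rewrite /tocx cabs_real powR_mulrn.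
have E1 : f \in Lfun mu 2%:E = (f \in mfun) && (('N[mu]_2[EFin \o f] < +oo)%E).
  by rewrite /Lfun inE /=; congr (_ && _); apply/idP/idP => h; [move/set_mem: h|apply/mem_set].
rewrite E1 E; split.
- move=> /andP[mf fo]; split; first by move: mf; rewrite inE. by apply: lty_poweRy fo; rewrite invr_eq0.
- move=> [mf fo]; apply/andP; split; first by rewrite inE. exact: poweR_lty.
Qed.

Lemma cmeas_tocx f : mfunT f -> cmeas (tocx f).
Proof. exact: cmeas_real. Qed.

Lemma inL2B f g : inL2 f -> inL2 g -> inL2 (f \- g).
Proof.
move=> [mf fo] [mg go]; split; first exact: measurable_funB.
rewrite (_ : tocx (f \- g) = fun x => tocx f x - tocx g x); last first.
  by apply/funext => x; rewrite /tocx rmorphB.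
apply: le_lt_trans (sqintB mu (cmeas_tocx mf) (cmeas_tocx mg)) _.
by apply: lte_add_pinfty; exact: lte_mul_pinfty.
Qed.

Lemma fourierL1E f xi : cL1 mu (tocx f) -> fourierL1 f xi = ft (tocx f) xi.
Proof.
move=> f1; have f1' := cL1_cexp (- xi) f1.
rewrite ft_ift /ift; apply: complex_ext.
- rewrite ReM /= mul0r subr0 Re_cint; congr (_ * _); apply: eq_Rintegral => x _.
  by rewrite ReM /= mul0r subr0 (dotvC (- xi)) dotvN cosN.
- rewrite ImM /= mul0r addr0 Im_cint -mulrN; congr (_ * _).
  rewrite (_ : (fun x : V => complex.Im _) = (fun x => - (f x * sin (dotv x xi)))); last first.
    by apply/funext => x; rewrite ImM /= mul0r addr0 (dotvC (- xi)) dotvN sinN mulrN.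
  rewrite /Rintegral; rewrite -fineN; congr fine. rewrite -integralN/=.
    by apply: eq_integral => x _.
  apply: integrable_add_def; first meas. have [_] := (cL1_integrable _ _).1 f1'.
  have E : (fun x : V => (f x * sin (dotv x xi))%:E) = (\- (fun x : V => (complex.Im (tocx f x * cexp (dotv (- xi) x)))%:E))%E.
    apply/funext => x; have -> : complex.Im (tocx f x * cexp (dotv (- xi) x)) = - (f x * sin (dotv x xi)).
      by rewrite ImM /= mul0r addr0 (dotvC (- xi)) dotvN sinN mulrN.
    by congr (_%:E); rewrite opprK.
  by move=> h; rewrite E; apply: integrableN; exact: h.
Qed.

Lemma tocx_restrict f n : tocx (f \_ [set x | enorm x <= n%:R]) = trunc (tocx f) n.
Proof.
apply/funext => x; rewrite /tocx /trunc /ind patchE indicE -/(eball n).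
by case: (x \in _); rewrite ?mul1r ?mul0r.
Qed.

Lemma is_fourierE f G : inL2 f -> is_fourier f G <-> is_ft2 (tocx f) G.
Proof.
move=> [mf fo]; have mc := cmeas_tocx mf.
have E : (fun n => (\int[mu]_xi
   ((cabs (fourierL1 (f \_ [set x | enorm x <= n%:R]) xi - G xi) ^+ 2)%:E))%E) =
   (fun n => sqint mu (fun xi => ft (trunc (tocx f) n) xi - G xi)).
  apply/funext => n; apply: eq_integral => xi _. by rewrite fourierL1E tocx_restrict//; exact: cL1_trunc.
split => [[mRe mIm h]|[[mRe mIm] h]].
  by split; [split|exact: (eq_ind _ (fun u : nat -> \bar R => u @ \oo --> 0%E) h _ E)].
by split; [exact: mRe|exact: mIm|exact: (eq_ind_r (fun u : nat -> \bar R => u @ \oo --> 0%E) h E)].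
Qed.

Lemma fourierP f : inL2 f -> is_ft2 (tocx f) (fourier f).
Proof.
move=> h; have [mf fo] := h; apply/(is_fourierE _ h).
have [G hG] := is_ft2_exists (cmeas_tocx mf) fo.
by apply: (@xgetPex _ _ [set g | is_fourier f g]); exists G; apply/(is_fourierE _ h).
Qed.

Lemma cmeas_fourier f : inL2 f -> cmeas (fourier f).
Proof. by move=> /fourierP[]. Qed.

Lemma ae_fourier f G : inL2 f -> is_ft2 (tocx f) G -> {ae mu, forall xi, fourier f xi = G xi}.
Proof. by move=> h; apply: is_ft2_unique (cmeas_tocx h.1) (fourierP h). Qed.

Lemma ae_fourierB f g : inL2 f -> inL2 g ->
  {ae mu, forall xi, fourier (f \- g) xi = fourier f xi - fourier g xi}.
Proof.
move=> hf hg; apply: ae_fourier; first exact: inL2B.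
rewrite (_ : tocx (f \- g) = fun x => tocx f x - tocx g x); last first.
  by apply/funext => x; rewrite /tocx rmorphB.
exact: (is_ft2B (cmeas_tocx hf.1) (cmeas_tocx hg.1) hf.2 hg.2 (fourierP hf) (fourierP hg)).
Qed.

Lemma enorm_ge0 x : 0 <= enorm x. Proof. exact: sqrtr_ge0. Qed.

Lemma Fnorm02 f : Fnorm 0 2 f = (sqint mu (fourier f) `^ 2^-1)%E.
Proof.
rewrite /Fnorm; congr (_ `^ _)%E; apply: eq_integral => xi _.
by rewrite mul0r powRr0 mul1r powR_mulrn ?cabs_ge0.
Qed.

(* the norm \int |xi|^k |G(xi)| dxi of a transform G *)
Definition wnorm (k : nat) G : \bar R := (\int[mu]_xi (enorm xi ^+ k * cabs (G xi))%:E)%E.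

Lemma wnorm_ge0 k G : (0 <= wnorm k G)%E.
Proof. by apply: integral_ge0 => x _; rewrite lee_fin mulr_ge0 ?cabs_ge0 ?exprn_ge0 ?enorm_ge0. Qed.

Lemma Fnorm1 k f : Fnorm k%:R 1 f = wnorm k (fourier f).
Proof.
have -> : wnorm k (fourier f) = (wnorm k (fourier f) `^ 1^-1)%E by rewrite invr1 poweRe1 ?wnorm_ge0.
rewrite /Fnorm; congr (_ `^ _)%E; apply: eq_integral => xi _.
by rewrite mulr1 powR_mulrn ?enorm_ge0// powRr1 ?cabs_ge0.
Qed.

Lemma meas_wnorm k G : cmeas G ->
  mfunT (fun xi : V => (enorm xi ^+ k * cabs (G xi))%:E).
Proof.
meas.
Qed.

Lemma ae_eq_wnorm k F G : cmeas F -> cmeas G -> {ae mu, forall xi, F xi = G xi} ->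
  wnorm k F = wnorm k G.
Proof.
move=> mF mG h; apply: ae_eq_integral => //; try exact: meas_wnorm.
by apply: filterS h => x e _; rewrite e.
Qed.

Lemma FspaceP f : (Fspace 0 2 `&` Fspace 2 1) f <->
  inL2 f /\ (wnorm 2 (fourier f) < +oo)%E.
Proof.
rewrite /Fspace /=; split => [[[/inL2P fL _] [_]]|[/[dup] fL /inL2P fL' h]].
  by rewrite (Fnorm1 2).
split; split=> //; last by rewrite (Fnorm1 2).
rewrite Fnorm02; apply: poweR_lty; apply: sqint_ft2_lty (fourierP fL); last exact: fL.2.
exact: cmeas_tocx fL.1.
Qed.

End fourier_norms.

Lemma nneseries_le {R : realType} (a : nat -> \bar R) (B : \bar R) : (forall k, 0 <= a k)%E ->
  (forall n, \sum_(0 <= k < n) a k <= B)%E -> (\sum_(k <oo) a k <= B)%E.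
Proof.
move=> a0 h; apply: lime_le; first by apply: is_cvg_nneseries => k _ _; exact: a0.
by apply: nearW => n; exact: h.
Qed.

Lemma nneseries_geometric_le {R : realType} (y B : R) : 0 <= y -> y < 1 -> 0 <= B ->
  (\sum_(k <oo) (y ^+ k.+1 * B)%:E <= (y / (1 - y) * B)%:E)%E.
Proof.
move=> y0 y1 B0; apply: nneseries_le => [k|n].
  meas.
rewrite sumEFin lee_fin -mulr_suml ler_wpM2r// ler_pdivlMr ?subr_gt0//.
suff -> : (\sum_(0 <= i < n) y ^+ i.+1) * (1 - y) = y - y ^+ n.+1.
  by rewrite gerBl exprn_ge0.
elim: n => [|n IH]; first by rewrite big_geq// mul0r expr1 subrr.
by rewrite big_nat_recr//= mulrDl IH !exprS; ring.
Qed.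

Lemma mule_lty {R : realType} (a b : \bar R) : (0 <= a)%E -> (a < +oo)%E -> (b < +oo)%E ->
  (a * b < +oo)%E.
Proof. by move=> a0 ao bo; apply: lte_mul_pinfty => //; rewrite ge0_fin_numE. Qed.

(** * Nonnegative extended functions and guards *)

Section nonnegative_functions.
Context {R : realType} d0 {T : measurableType d0}.

Definition nnfun (f : T -> \bar R) := mfunT f /\ forall x, (0 <= f x)%E.

Lemma nnfunD f g : nnfun f -> nnfun g -> nnfun (fun x => f x + g x)%E.
Proof. by move=> [mf f0] [mg g0]; split; [meas|move=> x; exact: adde_ge0]. Qed.

Lemma nnfunM f g : nnfun f -> nnfun g -> nnfun (fun x => f x * g x)%E.
Proof. by move=> [mf f0] [mg g0]; split; meas. Qed.

Lemma nnfun_cst (k : \bar R) : (0 <= k)%E -> nnfun (fun=> k).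
Proof. by move=> k0; split. Qed.

Lemma nnfunZ (k : \bar R) f : (0 <= k)%E -> nnfun f -> nnfun (fun x => k * f x)%E.
Proof. by move=> /nnfun_cst; exact: nnfunM. Qed.

Lemma nnfun_series (F : nat -> T -> \bar R) : (forall k, nnfun (F k)) ->
  nnfun (fun x => \sum_(k <oo) F k x)%E.
Proof.
move=> h; split; last by move=> x; apply: nneseries_ge0 => k _ _; exact: (h k).2.
apply: (@ge0_emeasurable_sum _ _ _ _ _ xpredT) => [k x _ _|k _]; [exact: (h k).2|exact: (h k).1].
Qed.

Lemma nnfun_cabs (f : T -> R[i]) : cmeas f -> nnfun (fun x => (cabs (f x))%:E).
Proof. by move=> mf; split; meas. Qed.

Lemma int_series (m : {measure set T -> \bar R}) (F : nat -> T -> \bar R) :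
  (forall k, nnfun (F k)) ->
  (\int[m]_x (\sum_(k <oo) F k x) = \sum_(k <oo) \int[m]_x F k x)%E.
Proof. by move=> h; apply: integral_nneseries => // [k|k x _]; [exact: (h k).1|exact: (h k).2]. Qed.

Lemma integralZ (m : {measure set T -> \bar R}) (k : \bar R) f : (0 <= k)%E -> nnfun f ->
  (\int[m]_x (k * f x) = k * \int[m]_x f x)%E.
Proof. by move=> k0 [mf f0]; apply: ge0_integralZl. Qed.

Lemma integralD2 (m : {measure set T -> \bar R}) f g : nnfun f -> nnfun g ->
  (\int[m]_x (f x + g x) = \int[m]_x f x + \int[m]_x g x)%E.
Proof. by move=> [mf f0] [mg g0]; apply: ge0_integralD. Qed.

Lemma int_mono (m : {measure set T -> \bar R}) f g : nnfun f -> nnfun g ->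
  (forall x, f x <= g x)%E -> (\int[m]_x f x <= \int[m]_x g x)%E.
Proof. by move=> [mf f0] [mg g0] h; apply: ge0_le_integral. Qed.

Lemma ae_lty (m : {measure set T -> \bar R}) f : nnfun f -> (\int[m]_x f x < +oo)%E ->
  {ae m, forall x, (f x < +oo)%E}.
Proof.
move=> [mf f0] fo.
have fi : m.-integrable setT f.
  by apply/integrableP; split => //; under eq_integral do rewrite gee0_abs//.
have := integrable_ae measurableT fi.
by apply: filterS => x /(_ I); rewrite ge0_fin_numE.
Qed.

(* [+oo] exactly where [f] is: keeps a bound true where an auxiliary majorant diverges *)
Definition guard (f : T -> \bar R) : T -> \bar R := fun x => (+oo * (\1_(f @^-1` [set (+oo : \bar R)%E]) x)%:E)%E.

Lemma guard_lty f x : (f x < +oo)%E -> guard f x = 0%E.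
Proof.
move=> fx; rewrite /guard indicE memNset ?mule0//= => e.
by rewrite e in fx.
Qed.

Lemma guard_pinfty f x : f x = +oo%E -> guard f x = +oo%E.
Proof. by move=> fx; rewrite /guard indicE mem_set// mule1. Qed.

Lemma nnfun_guard f : nnfun f -> nnfun (guard f).
Proof.
move=> [mf f0]; split; last by move=> x; rewrite /guard mule_ge0// lee_fin.
apply: emeasurable_funM => //; apply/measurable_EFinP; apply: measurable_indic.
by rewrite -[X in measurable X]setTI; meas.
Qed.

Lemma int_guard (m : {measure set T -> \bar R}) f : nnfun f -> (\int[m]_x f x < +oo)%E ->
  (\int[m]_x guard f x = 0)%E.
Proof.
move=> nf fo; rewrite (ae_eq_integral (cst 0%E))//; first by rewrite integral0.
- exact: (nnfun_guard nf).1.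
- apply: filterS (ae_lty nf fo) => x fx _; exact: guard_lty.
Qed.

End nonnegative_functions.

Ltac meas_ext2 := match goal with
  | |- measurable_fun _ (fun x => (cabs (@?f x) ^+ 2)%:E) => apply: meas_sqcabs
  | |- nnfun (fun _ => ?c) => apply: nnfun_cst
  | |- nnfun (fun x => @GRing.add _ (@?f x) (@?g x)) => apply: nnfunD
  | |- nnfun (fun x => (cabs (@?f x))%:E) => apply: nnfun_cabs
  | |- nnfun (fun x => (?c * @?g x)%E) => apply: nnfunZ
  | |- nnfun (fun x => (@?f x * @?g x)%E) => apply: nnfunM
  | H : nnfun ?f |- measurable_fun _ _ => solve [exact: H.1]
  | H : nnfun ?f |- is_true (_ <= _)%E => exact: H.2
  | |- measurable (eball _) => exact: meas_eball
  | |- cmeas (trunc _ _) => apply: cmeas_trunc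
  | |- cmeas (tocx _) => apply: cmeas_tocx
  | |- is_true (0 <= enorm _)%R => exact: enorm_ge0
  | |- is_true (_ <= wnorm _ _)%E => exact: wnorm_ge0
  | H : nnfun ?f |- measurable_fun _ (fun x => ?f (@?g x)) => apply: (measurableT_comp H.1)
  | |- nnfun _ => split; [|intros ?]
  | _ => meas_ext3
  end.
Ltac meas_ext ::= meas_ext2.

(** * Convolution and the convolution theorem *)

Section convolution.
Context {R : realType} {d : nat}.
Notation V := 'rV[R]_d.
Notation C := R[i].
Notation mu := (lebesgue_rV d).
Notation c0 := (@fourier_cst R d).
Implicit Types (a b w : V -> \bar R) (u v : V -> C) (xi eta : V).

Definition rconv (a b : V -> \bar R) (xi : V) : \bar R := (\int[mu]_eta (a (xi - eta)%R * b eta))%E.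

Lemma meas_conv_arg d1 (X : measurableType d1) :
  mfunT (fun p : (X * V) * V => (p.1.1, p.1.2 - p.2)).
Proof.
apply: measurable_fun_pair; first by apply: measurableT_comp; meas.
by apply: meas_rV_sub => //; apply: measurableT_comp; meas.
Qed.

Lemma meas_subV : mfunT (fun p : V * V => p.1 - p.2).
Proof. meas. Qed.

Lemma nnfun_rconv_integrand a b : nnfun a -> nnfun b ->
  nnfun (fun p : V * V => a (p.1 - p.2)%R * b p.2)%E.
Proof.
meas.
Qed.

Lemma nnfun_rconv a b : nnfun a -> nnfun b -> nnfun (rconv a b).
Proof.
move=> na nb; have [mF F0] := nnfun_rconv_integrand na nb.
split; last by move=> x; apply: integral_ge0 => y _; meas.
exact: (@measurable_fun_fubini_tonelli_F _ _ _ _ R mu _ mF F0).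
Qed.

Lemma rconv_le a b a' b' xi : nnfun a -> nnfun b -> nnfun a' -> nnfun b' ->
  (forall x, a x <= a' x)%E -> (forall x, b x <= b' x)%E -> (rconv a b xi <= rconv a' b' xi)%E.
Proof.
move=> na nb na' nb' aa bb; apply: int_mono => [||x].
- meas.
- meas.
- by apply: lee_pmul; [exact: na.2|exact: nb.2|exact: aa|exact: bb].
Qed.

Lemma int_rconv a b : nnfun a -> nnfun b ->
  (\int[mu]_xi rconv a b xi = \int[mu]_x a x * \int[mu]_x b x)%E.
Proof.
move=> na nb; have [mF F0] := nnfun_rconv_integrand na nb.
rewrite /rconv (fubini_tonelli _ mF F0) /=.
rewrite -integralZ//; last meas.
apply: eq_integral => eta _.
rewrite ge0_integralZr//; [|meas|by move=> *; exact: na.2|exact: nb.2].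
by rewrite (integral_addr (- eta) na.1).
Qed.

(** The weight is split at xi = (xi - eta) + eta under the convolution integral. Two constants are
    kept because a single factor and a power of many factors are weighted differently. *)
Lemma int_weight_rconv (w a b : V -> \bar R) (al be : R) : nnfun w -> nnfun a -> nnfun b ->
  0 <= al -> 0 <= be ->
  (forall x y, w (x + y)%R <= al%:E * w x + be%:E * w y)%E ->
  (\int[mu]_xi (w xi * rconv a b xi) <=
   al%:E * (\int[mu]_x (w x * a x) * \int[mu]_x b x) +
   be%:E * (\int[mu]_x a x * \int[mu]_x (w x * b x)))%E.
Proof.
move=> nw na nb al0 be0 hw.
have nwa := nnfunM nw na; have nwb := nnfunM nw nb.
rewrite -(int_rconv nwa nb) -(int_rconv na nwb).
have n1 := nnfun_rconv nwa nb; have n2 := nnfun_rconv na nwb.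
rewrite -!integralZ// ?lee_fin//.
rewrite -integralD2; [|by apply: nnfunZ => //; rewrite lee_fin..].
apply: int_mono; first by apply: nnfunM => //; exact: nnfun_rconv.
  meas.
move=> xi; rewrite /rconv.
have sec (a' b' : V -> \bar R) : nnfun a' -> nnfun b' -> nnfun (fun eta : V => a' (xi - eta)%R * b' eta)%E.
  meas.
have al0' : (0 <= al%:E)%E by rewrite lee_fin.
have be0' : (0 <= be%:E)%E by rewrite lee_fin.
rewrite -(integralZ mu (nw.2 xi) (sec _ _ na nb)) -(integralZ mu al0' (sec _ _ nwa nb)).
rewrite -(integralZ mu be0' (sec _ _ na nwb)).
rewrite -(integralD2 mu (nnfunZ al0' (sec _ _ nwa nb)) (nnfunZ be0' (sec _ _ na nwb))).
apply: int_mono.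
- meas.
- meas.
- move=> eta; have := hw (xi - eta) eta; rewrite subrK => h.
  apply: (via ((al%:E * w (xi - eta)%R + be%:E * w eta) * (a (xi - eta)%R * b eta))%E).
    by apply: lee_wpmul2r h; meas.
  rewrite ge0_muleDl; [|by rewrite mule_ge0 ?lee_fin//; exact: nw.2..]. by rewrite /= -!muleA (muleCA (w eta)).
Qed.

Definition conv (u v : V -> C) xi : C := cint mu (fun eta => u (xi - eta) * v eta).

Lemma cmeas_conv_section u v (xi : V) : cmeas u -> cmeas v -> cmeas (fun eta : V => u (xi - eta) * v eta).
Proof. meas. Qed.

Lemma cmeas_conv d1 (X : measurableType d1) (u v : X -> V -> C) :
  cmeas (fun p : X * V => u p.1 p.2) -> cmeas (fun p : X * V => v p.1 p.2) ->
  cmeas (fun p : X * V => conv (u p.1) (v p.1) p.2).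
Proof.
move=> mu_ mv.
apply: (@cmeas_cint _ _ _ _ _ mu (fun q : (X * V) * V => u q.1.1 (q.1.2 - q.2) * v q.1.1 q.2)).
apply: cmeasM.
  exact: (cmeas_comp (p := fun q : (X * V) * V => (q.1.1, q.1.2 - q.2)) mu_ (@meas_conv_arg _ X)).
apply: (cmeas_comp (p := fun q : (X * V) * V => (q.1.1, q.2)) mv).
apply: measurable_fun_pair; last meas.
by apply: measurableT_comp; meas.
Qed.

Lemma cmeas_conv1 u v : cmeas u -> cmeas v -> cmeas (conv u v).
Proof.
move=> mu_ mv.
apply: (@cmeas_cint _ _ _ _ _ mu (fun q : V * V => u (q.1 - q.2) * v q.2)).
meas.
Qed.

Lemma cabs_conv_le u v (a b : V -> \bar R) xi : cmeas u -> cmeas v -> nnfun a -> nnfun b ->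
  (forall x, (cabs (u x))%:E <= a x)%E -> (forall x, (cabs (v x))%:E <= b x)%E ->
  ((cabs (conv u v xi))%:E <= rconv a b xi)%E.
Proof.
move=> mu_ mv na nb ua vb; apply: le_trans (le_cabs_cint mu (cmeas_conv_section xi mu_ mv)) _.
apply: le_trans (rconv_le xi (nnfun_cabs mu_) (nnfun_cabs mv) na nb ua vb).
by rewrite /rconv; under eq_integral do rewrite cabsM EFinM.
Qed.

Lemma cL1_conv_section u v (a b : V -> \bar R) xi : cmeas u -> cmeas v -> nnfun a -> nnfun b ->
  (forall x, (cabs (u x))%:E <= a x)%E -> (forall x, (cabs (v x))%:E <= b x)%E ->
  (rconv a b xi < +oo)%E -> cL1 mu (fun eta => u (xi - eta) * v eta).
Proof.
move=> mu_ mv na nb ua vb h; split; first meas.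
apply: le_lt_trans h; apply: le_trans (rconv_le xi (nnfun_cabs mu_) (nnfun_cabs mv) na nb ua vb).
by rewrite /rconv; under eq_integral do rewrite cabsM EFinM.
Qed.

Lemma cL1_conv u v : cL1 mu u -> cL1 mu v -> cL1 mu (conv u v).
Proof.
move=> [mu_ uo] [mv vo].
apply: (@le_cL1 _ _ _ _ _ (rconv (fun x => (cabs (u x))%:E) (fun x => (cabs (v x))%:E))).
- exact: cmeas_conv1.
- exact: (nnfun_rconv (nnfun_cabs mu_) (nnfun_cabs mv)).1.
- by move=> x; apply: (cabs_conv_le x mu_ mv (nnfun_cabs mu_) (nnfun_cabs mv)) => y; meas.
- rewrite (int_rconv (nnfun_cabs mu_) (nnfun_cabs mv)). by apply: mule_lty; meas.
Qed.

Lemma ift_conv u v x : cL1 mu u -> cL1 mu v ->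
  ift (fun xi => c0%:C * conv u v xi) x = ift u x * ift v x.
Proof.
move=> u1 v1; rewrite (iftZ _ _ (cL1_conv u1 v1)) /ift.
have mcx : cmeas (fun xi : V => cexp (dotv x xi) : C) by apply: cmeas_cexp; exact: meas_dotv.
pose F (p : V * V) : C := u (p.1 - p.2) * v p.2 * cexp (dotv x p.1).
have mF : cmeas F.
  apply: cmeasM; last meas. apply: cmeasM; first exact: (cmeas_comp u1.1 meas_subV).
  exact: (cmeas_comp v1.1 measurable_snd).
have F1 : cL1 (mu \x mu)%E F.
  apply: cL1_prod => //.
  apply: (@le_lt_trans _ _ (\int[mu]_xi rconv (fun x => (cabs (u x))%:E) (fun x => (cabs (v x))%:E) xi)%E).
    by rewrite /rconv; under eq_integral do under eq_integral do rewrite cabsM cabs_cexp mulr1 cabsM EFinM.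
  rewrite (int_rconv (nnfun_cabs u1.1) (nnfun_cabs v1.1)).
  by apply: mule_lty; [apply: integral_ge0 => y _; rewrite lee_fin cabs_ge0|exact: u1.2|exact: v1.2].
have rI : (\int[mu]_xi rconv (fun x => (cabs (u x))%:E) (fun x => (cabs (v x))%:E) xi < +oo)%E.
  rewrite (int_rconv (nnfun_cabs u1.1) (nnfun_cabs v1.1)).
  by apply: mule_lty; [apply: integral_ge0 => y _; rewrite lee_fin cabs_ge0|exact: u1.2|exact: v1.2].
(* The phase can enter the inner integral only where the convolution converges absolutely, which is
   almost everywhere. *)
have E1 : cint mu (fun xi => conv u v xi * cexp (dotv x xi)) =
    cint mu (fun xi => cint mu (fun eta => F (xi, eta))).
  apply: ae_eq_cint.
  - exact: cmeasM (cmeas_conv1 u1.1 v1.1) mcx.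
  - exact: (@cmeas_cint _ _ _ _ _ mu F mF).
  - apply: filterS (ae_lty (nnfun_rconv (nnfun_cabs u1.1) (nnfun_cabs v1.1)) rI) => xi hxi.
    have l1 := cL1_conv_section u1.1 v1.1 (nnfun_cabs u1.1) (nnfun_cabs v1.1)
      (fun _ => lexx _) (fun _ => lexx _) hxi.
    by rewrite mulrC /conv -(cintZ (cexp (dotv x xi)) l1); apply: eq_cint => eta; rewrite /F /= mulrC.
rewrite E1 (cint_swap F1).
have v1x := cL1_cexp x v1; have u1x := cL1_cexp x u1.
have E2 eta : cint mu (fun xi => F (xi, eta)) =
    cint mu (fun xi => u xi * cexp (dotv x xi)) * (v eta * cexp (dotv x eta)).
  rewrite -(cint_addr (- eta) u1x.1) mulrC. rewrite -(cintZ (v eta * cexp (dotv x eta)) (cL1_addr (- eta) u1x)).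
  apply: eq_cint => xi; rewrite /F /= -[in dotv x xi](subrK eta xi) dotvC dotvD cexpD. by rewrite !(dotvC _ x); ring.
rewrite (eq_cint mu E2) (cintZ _ v1x); ring.
Qed.

End convolution.

(** * Convolution powers, the exponential nonlinearity and its Lipschitz bound *)

Section nonlinearity.
Context {R : realType} {d : nat}.
Notation V := 'rV[R]_d.
Notation C := R[i].
Notation mu := (lebesgue_rV d).
Notation c0 := (@fourier_cst R d).
Notation count := (@natcount R).
Implicit Types (a b w m M : V -> \bar R) (u v : V -> C) (xi eta : V).

Fixpoint pw u k : V -> C :=
  if k is j.+1 then fun xi => c0%:C * conv u (pw u j) xi else u.

Fixpoint rpw m k : V -> \bar R := if k is j.+1 then rconv m (rpw m j) else m.

(* [pw u k] is the transform of a (k+1)-st power, so [Nhat u] is the transform of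
   e^{-w} - 1 + w = \sum_k (-1)^k w^(k+2) / (k+2)! when u is the one of w. *)
Definition nlc k : R := (-1) ^+ k / k.+2`!%:R.

Definition Nhat u xi : C := cint count (fun k => (nlc k)%:C * pw u k.+1 xi).

Lemma normr_nlc k : `|nlc k| = k.+2`!%:R^-1.
Proof. by rewrite normrM normrX normrN1 expr1n mul1r ger0_norm ?invr_ge0. Qed.

Lemma invfact_ge0 k : (0 <= (k`!%:R^-1 : R)%:E)%E.
Proof. meas. Qed.

Lemma nnfun_rpw m k : nnfun m -> nnfun (rpw m k).
Proof. by move=> nm; elim: k => [//|k IH]; exact: nnfun_rconv. Qed.

Lemma int_rpw_le m k (y : R) : nnfun m -> 0 <= y -> (\int[mu]_x m x <= y%:E)%E ->
  (\int[mu]_x rpw m k x <= (y ^+ k.+1)%:E)%E.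
Proof.
move=> nm y0 my; elim: k => [|k IH]; first by rewrite expr1.
rewrite /= (int_rconv nm (nnfun_rpw k nm)) exprS EFinM.
by apply: lee_pmul => //; apply: integral_ge0 => x _; [exact: nm.2|exact: (nnfun_rpw k nm).2].
Qed.

Lemma cmeas_pw d1 (X : measurableType d1) (u : X -> V -> C) k :
  cmeas (fun p : X * V => u p.1 p.2) -> cmeas (fun p : X * V => pw (u p.1) k p.2).
Proof.
move=> mu_; elim: k => [//|k IH] /=.
apply: cmeasM; first meas.
exact: (cmeas_conv (v := fun x => pw (u x) k) mu_ IH).
Qed.

Lemma cmeas_pw1 u k : cmeas u -> cmeas (pw u k).
Proof.
move=> mu_; elim: k => [//|k IH] /=.
by apply: cmeasM; [meas|exact: cmeas_conv1].
Qed.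

Lemma cmeas_Nhat d1 (X : measurableType d1) (u : X -> V -> C) :
  cmeas (fun p : X * V => u p.1 p.2) -> cmeas (fun p : X * V => Nhat (u p.1) p.2).
Proof.
move=> mu_; apply: (@cmeas_cint _ _ _ _ _ count
  (fun q : (X * V) * nat => (nlc q.2)%:C * pw (u q.1.1) q.2.+1 q.1.2)).
apply: cmeas_nat_prod => k /=.
by apply: cmeasM; [meas|exact: (cmeas_pw k.+1 mu_)].
Qed.

Lemma cmeas_Nhat1 u : cmeas u -> cmeas (Nhat u).
Proof.
move=> mu_; apply: (@cmeas_cint _ _ _ _ _ count
  (fun q : V * nat => (nlc q.2)%:C * pw u q.2.+1 q.1)).
apply: cmeas_nat_prod => k /=.
by apply: cmeasM; [meas|exact: (cmeas_pw1 k.+1 mu_)].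
Qed.

Lemma cabs_c0M_le (z : C) : cabs (c0%:C * z) <= cabs z.
Proof.
have c0p := ltW (@fourier_cst_gt0 R d); rewrite cabsM cabs_real ger0_norm//.
by rewrite ler_piMl ?cabs_ge0 ?fourier_cst_le1.
Qed.

Lemma cabs_pw_le u m k xi : cmeas u -> nnfun m -> (forall x, (cabs (u x))%:E <= m x)%E ->
  ((cabs (pw u k xi))%:E <= rpw m k xi)%E.
Proof.
move=> mu_ nm um; elim: k xi => [//|k IH] xi /=.
apply: (via (cabs (conv u (pw u k) xi))%:E); first by rewrite lee_fin cabs_c0M_le.
exact: (cabs_conv_le xi mu_ (cmeas_pw1 k mu_) nm (nnfun_rpw k nm) um IH).
Qed.

Lemma cabs_count_le (z : nat -> C) : ((cabs (cint count z))%:E <= \sum_(k <oo) (cabs (z k))%:E)%E.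
Proof.
apply: le_trans (le_cabs_cint count (cmeas_nat z)) _.
by rewrite ge0_integral_natcount// => k; meas.
Qed.

Lemma cabs_Nhat_le u m xi : cmeas u -> nnfun m -> (forall x, (cabs (u x))%:E <= m x)%E ->
  ((cabs (Nhat u xi))%:E <= \sum_(k <oo) ((k.+2`!%:R^-1)%:E * rpw m k.+1 xi))%E.
Proof.
move=> mu_ nm um; apply: le_trans (cabs_count_le _) _.
apply: lee_nneseries => [k _ _|k _]; first meas.
rewrite cabsM cabs_real normr_nlc EFinM; apply: lee_wpmul2l; first meas.
exact: (cabs_pw_le k.+1 xi mu_ nm um).
Qed.

(** The factorials are dropped, so the integral is a geometric series. Where this is finite, the
    series of [Nhat u] converges absolutely for every u bounded by m. *)
Definition rsum m xi := (\sum_(k <oo) rpw m k xi)%E.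

Lemma nnfun_rsum m : nnfun m -> nnfun (rsum m).
Proof. by move=> nm; apply: nnfun_series => k; exact: nnfun_rpw. Qed.

Lemma int_rsum_le m (y : R) : nnfun m -> 0 <= y -> y < 1 -> (\int[mu]_x m x <= y%:E)%E ->
  (\int[mu]_x rsum m x <= (y / (1 - y))%:E)%E.
Proof.
move=> nm y0 y1 my; rewrite /rsum int_series; last by move=> k; exact: nnfun_rpw.
apply: le_trans (_ : (\sum_(k <oo) (y ^+ k.+1 * 1)%:E <= _)%E); last first.
  by rewrite -[X in (_ <= X%:E)%E]mulr1; exact: nneseries_geometric_le.
apply: lee_nneseries => [k _ _|k _]; first by apply: integral_ge0 => x _; exact: (nnfun_rpw k nm).2.
by rewrite mulr1; exact: int_rpw_le.
Qed.

Lemma invfact_le1 k : (k`!%:R^-1 : R) <= 1.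
Proof. by rewrite invf_le1 ?ltr0n ?fact_gt0// ler1n fact_gt0. Qed.

(** One factor |u| is left untouched: the others act as a kernel of small mass, which is the form
    that square integral estimates need. *)
Lemma cabs_Nhat_le_rsum u m xi : cmeas u -> nnfun m -> (forall x, (cabs (u x))%:E <= m x)%E ->
  ((cabs (Nhat u xi))%:E <= rconv (fun x => (cabs (u x))%:E) (rsum m) xi)%E.
Proof.
move=> mu_ nm um; apply: le_trans (cabs_count_le _) _.
have nu := nnfun_cabs mu_.
have E : rconv (fun x => (cabs (u x))%:E) (rsum m) xi =
    (\sum_(k <oo) rconv (fun x => (cabs (u x))%:E) (rpw m k) xi)%E.
  rewrite /rconv -int_series.
    apply: eq_integral => eta _; rewrite /rsum nneseriesZl// => k _. exact: (nnfun_rpw k nm).2.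
  move=> k; split; last by move=> x; apply: mule_ge0; [rewrite lee_fin cabs_ge0|exact: (nnfun_rpw k nm).2].
  apply: emeasurable_funM; last exact: (nnfun_rpw k nm).1. meas.
rewrite E; apply: lee_nneseries => [k _ _|k _]; first meas.
rewrite cabsM cabs_real normr_nlc.
apply: (via (cabs (conv u (pw u k) xi))%:E).
  rewrite lee_fin; apply: le_trans (_ : 1 * cabs (pw u k.+1 xi) <= _).
    by rewrite ler_wpM2r ?cabs_ge0 ?invfact_le1.
  by rewrite mul1r; exact: cabs_c0M_le.
apply: (cabs_conv_le xi mu_ (cmeas_pw1 k mu_) nu (nnfun_rpw k nm)) => x; first exact: lexx.
exact: (cabs_pw_le k x mu_ nm um).
Qed.

(** Iterates a b - a' b' = (a - a') b + a' (b - b') over the factors. The guard makes the bound hold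
    where convolutions of M diverge, at no cost for the integral. *)
Fixpoint rlip M m k : V -> \bar R :=
  if k is j.+1 then fun xi =>
    (rconv m (rpw M j) xi + rconv M (rlip M m j) xi + guard (rpw M j.+1) xi)%E
  else m.

Lemma nnfun_rlip M m k : nnfun M -> nnfun m -> nnfun (rlip M m k).
Proof.
move=> nM nm; elim: k => [//|k IH].
apply: nnfunD; first by apply: nnfunD; apply: nnfun_rconv => //; exact: nnfun_rpw.
exact: (nnfun_guard (nnfun_rpw k.+1 nM)).
Qed.

Lemma int_rlip_le M m k (y z : R) : nnfun M -> nnfun m -> 0 <= y -> 0 <= z ->
  (\int[mu]_x M x <= y%:E)%E -> (\int[mu]_x m x <= z%:E)%E ->
  (\int[mu]_x rlip M m k x <= (k.+1%:R * (y ^+ k * z))%:E)%E.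
Proof.
move=> nM nm y0 z0 My mz; elim: k => [|k IH]; first by rewrite expr0 !mul1r.
have nr := nnfun_rpw k nM; have nl := nnfun_rlip k nM nm.
have n1 := nnfun_rconv nm nr; have n2 := nnfun_rconv nM nl.
have n3 := nnfun_rpw k.+1 nM.
have fo : (\int[mu]_x rpw M k.+1 x < +oo)%E.
  by apply: le_lt_trans (int_rpw_le k.+1 nM y0 My) _; rewrite ltry.
rewrite /= (integralD2 mu (nnfunD n1 n2) (nnfun_guard n3)) (int_guard n3 fo) adde0.
rewrite (integralD2 mu n1 n2) (int_rconv nm nr) (int_rconv nM nl).
have p0 a : nnfun a -> (0 <= \int[mu]_x a x)%E by move=> h; meas.
apply: (via (z%:E * (y ^+ k.+1)%:E + y%:E * (k.+1%:R * (y ^+ k * z))%:E)%E).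
  apply: leeD; apply: lee_pmul; rewrite ?p0//. exact: int_rpw_le.
rewrite -!EFinM -EFinD lee_fin exprS -[k.+2]addn1 natrD.
by move: (y ^+ k) (k.+1%:R : R) => p q; lra.
Qed.

Lemma cabs_pwB_le u v M m k xi : cmeas u -> cmeas v -> nnfun M -> nnfun m ->
  (forall x, (cabs (u x))%:E <= M x)%E -> (forall x, (cabs (v x))%:E <= M x)%E ->
  (forall x, (cabs (u x - v x))%:E <= m x)%E ->
  ((cabs (pw u k xi - pw v k xi))%:E <= rlip M m k xi)%E.
Proof.
move=> mu_ mv nM nm uM vM uvm; elim: k xi => [//|k IH] xi.
have nr := nnfun_rpw k nM; have nl := nnfun_rlip k nM nm.
have n1 := nnfun_rconv nm nr; have n2 := nnfun_rconv nM nl.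
(* Where the power of M diverges, the guard makes the bound infinite; elsewhere both convolution
   integrals converge absolutely and may be subtracted. *)
have [fo|] := ltP (rpw M k.+1 xi) +oo%E; last first.
  rewrite leye_eq => /eqP e; rewrite [rlip _ _ _ _]/= (guard_pinfty e) addey ?leey//.
  by apply/eqP => h; have := adde_ge0 (n1.2 xi) (n2.2 xi); rewrite h.
have mpu := cmeas_pw1 k mu_; have mpv := cmeas_pw1 k mv.
have pu x := cabs_pw_le k x mu_ nM uM; have pv x := cabs_pw_le k x mv nM vM.
have l1 := cL1_conv_section mu_ mpu nM nr uM pu fo.
have l2 := cL1_conv_section mv mpv nM nr vM pv fo.
rewrite /= -mulrBr /conv -(cintB l1 l2).
apply: (via (rconv m (rpw M k) xi + rconv M (rlip M m k) xi)%E); last first.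
  by apply: leeDl; exact: (nnfun_guard (nnfun_rpw k.+1 nM)).2.
apply: (le_trans (_ : _ <= (cabs (cint mu (fun eta => u (xi - eta) * pw u k eta - v (xi - eta) * pw v k eta)))%:E)%E).
  by rewrite lee_fin cabs_c0M_le.
apply: le_trans (le_cabs_cint mu (cmeasB l1.1 l2.1)) _.
have sec a b : nnfun a -> nnfun b -> nnfun (fun eta => a (xi - eta)%R * b eta)%E.
  meas.
rewrite /rconv -(integralD2 mu (sec _ _ nm nr) (sec _ _ nM nl)).
apply: int_mono.
- meas.
- meas.
move=> eta.
have -> : u (xi - eta) * pw u k eta - v (xi - eta) * pw v k eta =
   (u (xi - eta) - v (xi - eta)) * pw u k eta + v (xi - eta) * (pw u k eta - pw v k eta) by ring.
apply: (via ((cabs ((u (xi - eta) - v (xi - eta)) * pw u k eta))%:E +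
   (cabs (v (xi - eta) * (pw u k eta - pw v k eta)))%:E)%E).
  by rewrite -EFinD lee_fin cabsD.
by rewrite !cabsM !EFinM; apply: leeD; apply: lee_pmul; meas.
Qed.

Definition Lip M m xi : \bar R :=
  ((\sum_(k <oo) ((k.+2`!%:R^-1)%:E * rlip M m k.+1 xi)) + guard (rsum M) xi)%E.

Lemma nnfun_Lip M m : nnfun M -> nnfun m -> nnfun (Lip M m).
Proof.
move=> nM nm; apply: nnfunD; last exact: nnfun_guard (nnfun_rsum nM).
by apply: nnfun_series => k; apply: nnfunZ; [meas|exact: nnfun_rlip].
Qed.

(** The factor k + 2 from differencing a (k+2)-nd power cancels against (k+2)!; what remains is at
    most a geometric series. *)
Lemma int_Lip_le M m (y z : R) : nnfun M -> nnfun m -> 0 <= y -> y < 1 -> 0 <= z ->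
  (\int[mu]_x M x <= y%:E)%E -> (\int[mu]_x m x <= z%:E)%E ->
  (\int[mu]_x Lip M m x <= (y / (1 - y) * z)%:E)%E.
Proof.
move=> nM nm y0 y1 z0 My mz.
have n1 k : nnfun (fun xi => (k.+2`!%:R^-1)%:E * rlip M m k.+1 xi)%E.
  by apply: nnfunZ; [meas|exact: nnfun_rlip].
have fo : (\int[mu]_x rsum M x < +oo)%E.
  by apply: le_lt_trans (int_rsum_le nM y0 y1 My) _; rewrite ltry.
rewrite /Lip (integralD2 mu (nnfun_series n1) (nnfun_guard (nnfun_rsum nM))).
rewrite (int_guard (nnfun_rsum nM) fo) adde0 (int_series mu n1).
apply: le_trans (nneseries_geometric_le y0 y1 z0).
apply: lee_nneseries => [k _ _|k _]; first by apply: integral_ge0 => x _; exact: (n1 k).2.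
rewrite (integralZ mu (invfact_ge0 _) (nnfun_rlip k.+1 nM nm)).
apply: le_trans (lee_wpmul2l (invfact_ge0 _) (int_rlip_le k.+1 nM nm y0 z0 My mz)) _.
rewrite -EFinM lee_fin (mulrA (k.+2`!%:R^-1)); apply: ler_piMl; first meas.
by rewrite factS natrM invfM mulrAC mulVf ?mul1r ?pnatr_eq0// invfact_le1.
Qed.

Lemma nneseries_shift_le (a : nat -> \bar R) : (forall k, 0 <= a k)%E ->
  (\sum_(k <oo) a k.+1 <= \sum_(k <oo) a k)%E.
Proof.
move=> a0; apply: nneseries_le => // n.
apply: le_trans (nneseries_lim_ge n.+1 _) => //.
by rewrite big_nat_recl//= leeDr.
Qed.

Lemma cL1_Nhat_terms u M xi : cmeas u -> nnfun M -> (forall x, (cabs (u x))%:E <= M x)%E ->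
  (rsum M xi < +oo)%E -> cL1 count (fun k => (nlc k)%:C * pw u k.+1 xi).
Proof.
move=> mu_ nM uM fo; apply: cL1_count; apply: le_lt_trans fo.
apply: le_trans (nneseries_shift_le (fun k => (nnfun_rpw k nM).2 xi)).
apply: lee_nneseries => [k _ _|k _]; first meas.
rewrite cabsM cabs_real normr_nlc.
apply: le_trans (cabs_pw_le k.+1 xi mu_ nM uM).
by rewrite lee_fin ler_piMl ?cabs_ge0 ?invfact_le1.
Qed.

Lemma cabs_NhatB_le u v M m xi : cmeas u -> cmeas v -> nnfun M -> nnfun m ->
  (forall x, (cabs (u x))%:E <= M x)%E -> (forall x, (cabs (v x))%:E <= M x)%E ->
  (forall x, (cabs (u x - v x))%:E <= m x)%E ->
  ((cabs (Nhat u xi - Nhat v xi))%:E <= Lip M m xi)%E.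
Proof.
move=> mu_ mv nM nm uM vM uvm.
have [fo|] := ltP (rsum M xi) +oo%E; last first.
  rewrite leye_eq => /eqP e; rewrite /Lip (guard_pinfty e) addey ?leey//.
  apply/eqP => h; have : (0 <= \sum_(k <oo) ((k.+2`!%:R^-1)%:E * rlip M m k.+1 xi))%E.
    by apply: nneseries_ge0 => k _ _; apply: mule_ge0; [meas|exact: (nnfun_rlip k.+1 nM nm).2].
  by rewrite h.
have l1 := cL1_Nhat_terms mu_ nM uM fo; have l2 := cL1_Nhat_terms mv nM vM fo.
rewrite /Nhat -(cintB l1 l2); apply: le_trans (cabs_count_le _) _.
apply: (via (\sum_(k <oo) ((k.+2`!%:R^-1)%:E * rlip M m k.+1 xi))%E); last first.
  by apply: leeDl; exact: (nnfun_guard (nnfun_rsum nM)).2.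
apply: lee_nneseries => [k _ _|k _]; first meas.
rewrite -mulrBr cabsM cabs_real normr_nlc EFinM; apply: lee_wpmul2l; first meas.
exact: (cabs_pwB_le k.+1 xi mu_ mv nM nm uM vM uvm).
Qed.

(* The hypothesis on [w] holds for |xi|^s with s <= 4, by convexity. *)
Lemma int_weight_rpw_le w m k (y : R) : nnfun w -> nnfun m -> 0 <= y ->
  (forall j x x', w (x + x')%R <= ((j.+2%:R) ^+ 3)%:E * w x + ((j.+2%:R / j.+1%:R) ^+ 3)%:E * w x')%E ->
  (\int[mu]_x m x <= y%:E)%E -> (\int[mu]_x (w x * m x) < +oo)%E ->
  (\int[mu]_x (w x * rpw m k x) <= ((k.+1%:R) ^+ 4 * y ^+ k)%:E * \int[mu]_x (w x * m x))%E.
Proof.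
move=> nw nm y0 hw my wo.
have p0 a : nnfun a -> (0 <= \int[mu]_x a x)%E by move=> h; meas.
have [z z0 ez] : exists2 z : R, 0 <= z & (\int[mu]_x (w x * m x))%E = z%:E.
  exists (fine (\int[mu]_x (w x * m x))); first by apply: fine_ge0; meas. by rewrite fineK// ge0_fin_numE// p0; meas.
rewrite ez -EFinM; elim: k => [|k IH]; first by rewrite /= ez expr1n expr0 !mul1r.
have nr := nnfun_rpw k nm.
have a0 : (0 : R) <= (k.+2%:R) ^+ 3 by rewrite exprn_ge0.
have b0 : (0 : R) <= (k.+2%:R / k.+1%:R) ^+ 3 by rewrite exprn_ge0// divr_ge0.
apply: le_trans (int_weight_rconv nw nm nr a0 b0 (hw k)) _.
rewrite ez.
(* Both terms carry (k+2)^3 y^(k+1) z, the first once and the second k + 1 times; together they give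
   (k+2)^4. *)
apply: (via (((k.+2%:R) ^+ 3)%:E * (z%:E * (y ^+ k.+1)%:E) +
  ((k.+2%:R / k.+1%:R) ^+ 3)%:E * (y%:E * (k.+1%:R ^+ 4 * y ^+ k * z)%:E))%E).
  apply: leeD; apply: lee_wpmul2l; rewrite ?lee_fin//; apply: lee_pmul; rewrite ?lee_fin ?p0//.
  - exact: int_rpw_le.
  - meas.
rewrite -!EFinM -EFinD lee_fin (exprS y k).
have : (k.+1%:R : R) != 0 by rewrite pnatr_eq0.
have -> : (k.+2%:R : R) = k.+1%:R + 1 by rewrite -natr1.
move: (k.+1%:R : R) (y ^+ k) => q p q0; rewrite le_eqVlt; apply/orP; left; apply/eqP; field.
exact: q0.
Qed.

End nonlinearity.

(** * The series f2 *)

Section f2_series.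
Context {R : realType}.
Implicit Types x y : R.

Definition f2_term y (k : nat) : R := (k.+2)%:R ^+ 3 / (k.+1)`!%:R * y ^+ k.+1.

Lemma f2_term_ge0 y k : 0 <= y -> 0 <= f2_term y k.
Proof. by move=> y0; rewrite mulr_ge0 ?exprn_ge0// divr_ge0// exprn_ge0. Qed.

(** (k+2)^3 <= 8^(k+1) because k + 2 <= 2^(k+1): comparison with the exponential series at 8 y. *)
Lemma is_cvg_f2 y : 0 <= y -> cvgn (series (f2_term y)).
Proof.
move=> y0; have : cvgn (series (exp_coeff (8 * y))) by exact: is_cvg_series_exp_coeff.
rewrite -(is_cvg_series_restrict 1) => h.
have h' : cvgn (series (fun k => exp_coeff (8 * y) k.+1)).
  move: (is_cvg_series_exp_coeff (8 * y)) => /cvg_ex[l hl]; apply/cvg_ex; exists (l - 1).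
  have hl' : (fun n => series (exp_coeff (8 * y)) n.+1) @ \oo --> l by rewrite cvg_shiftS.
  rewrite (_ : series _ = fun n => series (exp_coeff (8 * y)) n.+1 - 1).
    by apply: cvgB => //; exact: cvg_cst.
  apply/funext => n; rewrite !seriesEnat /= big_nat_recl//= /exp_coeff /= expr0 fact0 divr1; ring.
apply: series_le_cvg h' => [k|k|k].
- exact: f2_term_ge0.
- by rewrite /exp_coeff /= divr_ge0// exprn_ge0// mulr_ge0.
- rewrite /f2_term /exp_coeff /= exprMn mulrAC ler_wpM2r ?invr_ge0// ler_wpM2r ?exprn_ge0//.
  rewrite -(natrX _ _ 3) -natrX ler_nat (_ : 8 = 2 ^ 3)%N// -expnM mulnC expnM leq_exp2r//. exact: ltn_expl.
Qed.

Lemma f2_eseries y : 0 <= y -> (\sum_(k <oo) (f2_term y k)%:E = (f2 y)%:E)%E.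
Proof.
move=> y0; rewrite /f2 -(EFin_lim (is_cvg_f2 y0)); congr (limn _).
by apply/funext => n /=; rewrite seriesEnat /= sumEFin.
Qed.

(** The first term of the series is 8 y and the others are nondecreasing. Started at 0 it gives
    [ystar <= 1/8]; ended at [ystar] it gives the positivity of sigma. *)
Lemma f2_ge_slope x y : 0 <= x -> x <= y -> f2 x + 8 * (y - x) <= f2 y.
Proof.
move=> x0 xy; have y0 := le_trans x0 xy.
have cx := is_cvg_f2 x0; have cy := is_cvg_f2 y0.
rewrite -lerBrDl.
have : (series (f2_term y) n - series (f2_term x) n @[n --> \oo]) --> (f2 y - f2 x) by exact: cvgB.
move/cvg_lim => <-//; apply: limr_ge; first by apply: is_cvgB.
have key n : (0 < n)%N -> 8 * (y - x) <= series (f2_term y) n - series (f2_term x) n.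
  rewrite !seriesEnat /= -sumrB. case: n => // n _; rewrite big_nat_recl//= -[leLHS]addr0; apply: lerD.
    by rewrite /f2_term expr1 expr1 factS fact0 /=; rewrite !divr1; lra.
  apply: sumr_ge0 => k _; rewrite subr_ge0 /f2_term ler_wpM2l//. by rewrite lerXn2r// nnegrE.
near=> n; apply: key; near: n; exact: nbhs_infty_gt.
Unshelve. all: by end_near. Qed.

Lemma f2_0 : f2 (0 : R) = 0.
Proof.
have := f2_eseries (lexx (0 : R)); rewrite eseries0; first by move=> [].
by move=> k _ _; rewrite /f2_term expr0n /= mulr0.
Qed.

End f2_series.

(** Recovers Cauchy-Schwarz from its additive form; the optimal parameter is e = p / k. *)
Lemma sqr_le_of_young {R : realType} (p k B : R) : 0 <= p -> 0 < k -> 0 <= B ->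
  (forall e, 0 < e -> 2 * p <= e * k + B / e) -> p ^+ 2 <= k * B.
Proof.
rewrite le_eqVlt => /predU1P[<-|p0] k0 B0 h; first by rewrite expr0n/= mulr_ge0// ltW.
have /h : 0 < p / k by rewrite divr_gt0.
rewrite divfK ?gt_eqF// invf_div mulrA -lerBlDl (_ : 2 * p - p = p); last by lra.
by rewrite ler_pdivlMr// -expr2 mulrC.
Qed.

(** * Weighted and square-integral bounds for the nonlinearity, and its inverse transform *)

Section nonlinearity2.
Context {R : realType} {d : nat}.
Notation V := 'rV[R]_d.
Notation C := R[i].
Notation mu := (lebesgue_rV d).
Notation c0 := (@fourier_cst R d).
Notation count := (@natcount R).
Implicit Types (a b w m : V -> \bar R) (u v : V -> C) (xi eta : V).

Lemma nnfun_rconv_section a b xi : nnfun a -> nnfun b -> nnfun (fun eta => a (xi - eta)%R * b eta)%E.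
Proof.
meas.
Qed.

Lemma nnfun_sqcabs u : cmeas u -> nnfun (fun x => (cabs (u x) ^+ 2)%:E).
Proof. meas. Qed.

(* Cauchy-Schwarz for the measure with density [rsum m (xi - .)]. *)
Lemma sq_cabs_Nhat_le u m xi (k : R) : cmeas u -> nnfun m -> (forall x, (cabs (u x))%:E <= m x)%E ->
  0 < k -> (\int[mu]_x rsum m x <= k%:E)%E ->
  ((cabs (Nhat u xi) ^+ 2)%:E <= k%:E * rconv (fun x => (cabs (u x) ^+ 2)%:E) (rsum m) xi)%E.
Proof.
move=> mu_ nm um k0 mk; have nK := nnfun_rsum nm; have nu := nnfun_cabs mu_.
have nu2 := nnfun_sqcabs mu_.
have nr := nnfun_rconv nu2 nK.
case: (ltP (rconv (fun x => (cabs (u x) ^+ 2)%:E) (rsum m) xi) +oo%E) => [Bo|]; last first.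
  by rewrite leye_eq => /eqP ->; rewrite gt0_muley ?lte_fin// leey.
set B := rconv _ _ xi in Bo *.
have Bf : B = (fine B)%:E by rewrite fineK// ge0_fin_numE; meas.
rewrite Bf -EFinM lee_fin; apply: sqr_le_of_young => //; rewrite ?cabs_ge0//.
  by rewrite fine_ge0; meas.
move=> e e0; rewrite -lee_fin EFinM.
apply: (via (2%:E * rconv (fun x => (cabs (u x))%:E) (rsum m) xi)%E).
  by apply: lee_wpmul2l => //; exact: cabs_Nhat_le_rsum.
have e2 : (0 <= 2%:E :> \bar R)%E by rewrite lee_fin.
rewrite /rconv -(integralZ mu e2 (nnfun_rconv_section xi nu nK)).
have e0' : (0 <= e%:E)%E by rewrite lee_fin ltW.
have ei0 : (0 <= (e^-1)%:E)%E by rewrite lee_fin invr_ge0 ltW.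
apply: (via (\int[mu]_x (e%:E * rsum m x + (e^-1)%:E * ((cabs (u (xi - x)%R) ^+ 2)%:E * rsum m x)))%E).
  apply: int_mono.
  - meas.
  - meas.
  move=> x; rewrite !muleA -ge0_muleDl; [|exact: e0'|meas]. apply: lee_wpmul2r; first exact: nK.2.
  rewrite -!EFinM -EFinD lee_fin; have := sqr_ge0 (e - cabs (u (xi - x))). move: (cabs _) => p hp; rewrite -subr_ge0.
  have -> : e + e^-1 * p ^+ 2 - 2 * p = e^-1 * (e - p) ^+ 2 by field; rewrite gt_eqF. meas.
rewrite (integralD2 mu (nnfunZ e0' nK) (nnfunZ ei0 (nnfun_rconv_section xi nu2 nK))).
rewrite (integralZ mu e0' nK) (integralZ mu ei0 (nnfun_rconv_section xi nu2 nK)).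
rewrite EFinD; apply: leeD; first by rewrite EFinM; exact: lee_wpmul2l.
by rewrite mulrC EFinM -Bf.
Qed.

Lemma cL1_Nhat u (y : R) : cmeas u -> 0 <= y -> y < 1 -> (\int[mu]_x (cabs (u x))%:E <= y%:E)%E ->
  cL1 mu (Nhat u).
Proof.
move=> mu_ y0 y1 uy; have nu := nnfun_cabs mu_.
apply: (@le_cL1 _ _ _ _ _ (rsum (fun x => (cabs (u x))%:E))).
- exact: cmeas_Nhat1.
- exact: (nnfun_rsum nu).1.
- move=> x; apply: le_trans (cabs_Nhat_le x mu_ nu (fun _ => lexx _)) _.
  apply: le_trans (nneseries_shift_le (fun k => (nnfun_rpw k nu).2 x)). apply: lee_nneseries => [k _ _|k _].
    by apply: mule_ge0; [meas|exact: (nnfun_rpw k.+1 nu).2].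
  rewrite -[leRHS]mul1e; apply: lee_wpmul2r; first exact: (nnfun_rpw k.+1 nu).2. by rewrite lee_fin invfact_le1.
- by apply: le_lt_trans (int_rsum_le nu y0 y1 uy) _; rewrite ltry.
Qed.

Lemma int_weight_Nhat_le w u (y : R) : nnfun w -> (forall x, w x < +oo)%E -> cmeas u -> 0 <= y ->
  (forall j x x', w (x + x')%R <= ((j.+2%:R) ^+ 3)%:E * w x + ((j.+2%:R / j.+1%:R) ^+ 3)%:E * w x')%E ->
  (\int[mu]_x (cabs (u x))%:E <= y%:E)%E -> (\int[mu]_x (w x * (cabs (u x))%:E) < +oo)%E ->
  (\int[mu]_x (w x * (cabs (Nhat u x))%:E) <= (f2 y)%:E * \int[mu]_x (w x * (cabs (u x))%:E))%E.
Proof.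
move=> nw wf mu_ y0 hw uy wo; have nu := nnfun_cabs mu_.
have nr k := nnfun_rpw k nu.
pose F k x := (w x * ((k.+2`!%:R^-1)%:E * rpw (fun x => (cabs (u x))%:E) k.+1 x))%E.
have nF k : nnfun (F k) by apply: nnfunM; meas.
apply: (via (\int[mu]_x \sum_(k <oo) F k x)%E).
  apply: int_mono.
  - by apply: nnfunM => //; exact: nnfun_cabs (cmeas_Nhat1 mu_).
  - exact: nnfun_series.
  move=> x.
  have -> : (\sum_(k <oo) F k x = w x * \sum_(k <oo) ((k.+2`!%:R^-1)%:E * rpw (fun x => (cabs (u x))%:E) k.+1 x))%E.
    rewrite /F; have := wf x; have := nw.2 x; case: (w x) => [r r0 _|//|//].
      by rewrite nneseriesZl// => k _; apply: mule_ge0; [meas|exact: (nr k.+1).2].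
  by apply: lee_wpmul2l; [exact: nw.2|exact: (cabs_Nhat_le x mu_ nu (fun _ => lexx _))].
rewrite (int_series mu nF) -(f2_eseries y0).
have [z z0 ez] : exists2 z : R, 0 <= z & (\int[mu]_x (w x * (cabs (u x))%:E))%E = z%:E.
  have n0 : (0 <= \int[mu]_x (w x * (cabs (u x))%:E))%E.
    meas.
  exists (fine (\int[mu]_x (w x * (cabs (u x))%:E))); first exact: fine_ge0. by rewrite fineK// ge0_fin_numE.
rewrite ez muleC -nneseriesZl; last by move=> k _; rewrite lee_fin f2_term_ge0.
apply: lee_nneseries => [k _ _|k _]; first by apply: integral_ge0 => x _; exact: (nF k).2.
rewrite /F; under eq_integral do rewrite muleCA.
rewrite (integralZ mu (invfact_ge0 _) (nnfunM nw (nr k.+1))).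
apply: le_trans (lee_wpmul2l (invfact_ge0 _) (int_weight_rpw_le k.+1 nw nu y0 hw uy wo)) _.
rewrite ez -!EFinM lee_fin /f2_term factS natrM invfM.
have : (k.+2%:R : R) != 0 by rewrite pnatr_eq0.
move: (k.+1`!%:R^-1 : R) (y ^+ k.+1) (k.+2%:R : R) => p q r r0.
rewrite le_eqVlt; apply/orP; left; apply/eqP; field; exact: r0.
Qed.

Lemma cL1_pw u k : cL1 mu u -> cL1 mu (pw u k).
Proof. by move=> u1; elim: k => [//|k IH] /=; apply: cL1Z; exact: cL1_conv. Qed.

Lemma ift_pw u k x : cL1 mu u -> ift (pw u k) x = ift u x ^+ k.+1.
Proof.
move=> u1; elim: k => [|k IH]; first by rewrite expr1.
by have := ift_conv x u1 (cL1_pw k u1); rewrite IH -exprS => <-.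
Qed.

Lemma cint_nlc (a : R) : cL1 count (fun k => (nlc k * a ^+ k.+2)%:C) ->
  cint count (fun k => (nlc k * a ^+ k.+2)%:C) = (expR (- a) - 1 + a)%:C.
Proof.
move=> h; apply: ccvg_unique (cint_count_ccvg h) _.
(* The terms 1 and -a of the exponential are removed, so n terms here correspond to n + 2 terms
   there. *)
have E n : \sum_(i < n) (nlc i * a ^+ i.+2)%:C = (series (exp_coeff (- a)) n.+2 - 1 + a)%:C.
  rewrite -rmorph_sum; congr (_%:C).
  rewrite seriesEord /= 2!big_ord_recl /= /bump /= /exp_coeff /= expr0 fact0 expr1 divr1.
  rewrite (_ : 1`!%:R = 1 :> R)// divr1. have -> : forall s : R, 1 + (- a + s) - 1 + a = s by move=> s; ring.
  apply: eq_bigr => i _; rewrite /nlc /bump /= !add1n [(- a) ^+ _]exprNn [(-1) ^+ i.+2]exprS [(-1) ^+ i.+1]exprS.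
  by rewrite !mulN1r opprK mulrAC.
under eq_fun do rewrite E.
apply: ccvg_ReIm => /=; last exact: cvg_cst.
apply: cvgD; last exact: cvg_cst.
apply: cvgB; last exact: cvg_cst.
have := @is_cvg_series_exp_coeff R (- a).
rewrite /expR => hc.
pose sr n := series (exp_coeff (- a)) n; pose l := limn sr.
have h1 : (fun n => sr n.+1) @ \oo --> l by rewrite cvg_shiftS.
have h2 : (fun n => (fun j : nat => sr j.+1) n.+1) @ \oo --> l by rewrite (cvg_shiftS (fun j : nat => sr j.+1)).
exact: h2.
Qed.

(** Convolution powers become powers of a, and exchanging the sum with the inverse transform leaves
    the exponential series without its first two terms. *)
Lemma ift_Nhat u x (a y : R) : cmeas u -> 0 <= y -> y < 1 ->
  (\int[mu]_x (cabs (u x))%:E <= y%:E)%E -> ift u x = a%:C ->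
  ift (Nhat u) x = (expR (- a) - 1 + a)%:C.
Proof.
move=> mu_ y0 y1 uy ua.
have u1 : cL1 mu u by split => //; apply: le_lt_trans uy _; rewrite ltry.
have nu := nnfun_cabs mu_.
have N1 := cL1_Nhat mu_ y0 y1 uy.
have ro := int_rsum_le nu y0 y1 uy.
pose F (p : V * nat) : C := c0%:C * ((nlc p.2)%:C * pw u p.2.+1 p.1 * cexp (dotv x p.1)).
have mcx : cmeas (fun xi : V => cexp (dotv x xi) : C) by apply: cmeas_cexp; exact: meas_dotv.
have mF : cmeas F.
  apply: cmeas_nat_prod => k; apply: cmeasM; first meas.
  by apply: cmeasM mcx; apply: cmeasM; [exact: (cmeas_cst (nlc k)%:C)|exact: (cmeas_pw1 k.+1 mu_)].
have F1 : cL1 (mu \x count)%E F.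
  apply: cL1_prod => //. apply: le_lt_trans (le_lt_trans ro (ltry _)).
  have nG : nnfun (fun xi => (\int[count]_k (cabs (F (xi, k)))%:E)%E).
    split; last meas.
    apply: (@measurable_fun_fubini_tonelli_F _ _ _ _ R count (fun p => (cabs (F p))%:E)) => //.
      meas.
    meas.
  apply: int_mono => // [|xi]; first exact: nnfun_rsum. rewrite ge0_integral_natcount; last meas.
  apply: le_trans (nneseries_shift_le (fun k => (nnfun_rpw k nu).2 xi)).
  apply: lee_nneseries => [k _ _|k _]; first meas.
  apply: le_trans (cabs_pw_le k.+1 xi mu_ nu (fun _ => lexx _)); rewrite lee_fin.
  apply: le_trans (cabs_c0M_le _) _; rewrite cabsM cabs_cexp mulr1 cabsM cabs_real normr_nlc.
  by apply: ler_piMl; [meas|exact: invfact_le1].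
have -> : ift (Nhat u) x = cint mu (fun xi => cint count (fun k => F (xi, k))).
  rewrite /ift -(cintZ c0%:C (cL1_cexp x N1)); apply: ae_eq_cint.
  - meas.
  - exact: (@cmeas_cint _ _ _ _ _ count F mF).
  apply: filterS (ae_lty (nnfun_rsum nu) (le_lt_trans ro (ltry _))) => xi hxi.
  have l1 := cL1_Nhat_terms mu_ nu (fun _ => lexx _) hxi.
  have E k : F (xi, k) = c0%:C * cexp (dotv x xi) * ((nlc k)%:C * pw u k.+1 xi).
    by rewrite /F; ring.
  by rewrite (eq_cint count E) (cintZ _ l1) /Nhat; ring.
rewrite (cint_swap F1).
have E k : cint mu (fun xi => F (xi, k)) = (nlc k * a ^+ k.+2)%:C.
  rewrite rmorphM rmorphXn /= -ua -(ift_pw k.+1 x u1) /ift. have p1 := cL1_cexp x (cL1_pw k.+1 u1).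
  rewrite mulrA -(cintZ ((nlc k)%:C * c0%:C) p1); apply: eq_cint => xi. by rewrite /F /=; ring.
rewrite (eq_cint count E); apply: cint_nlc.
have ay : `|a| <= y.
  by rewrite -lee_fin -cabs_real -ua; apply: le_trans (le_cabs_ift x mu_) uy.
apply: cL1_count; apply: le_lt_trans (le_lt_trans (nneseries_geometric_le y0 y1 y0) (ltry _)).
apply: lee_nneseries => [k _ _|k _]; first meas.
rewrite lee_fin cabs_real normrM normr_nlc normrX -exprSr -[leRHS]mul1r.
by apply: ler_pM => //; rewrite ?invr_ge0 ?exprn_ge0 ?invfact_le1// lerXn2r// nnegrE.
Qed.

(** Hermitian symmetry, the mark of transforms of real functions. Each operation of the iteration
    preserves it, which makes the solution real-valued. *)
Definition herm u := forall xi, u (- xi) = (u xi)^*%C.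

Lemma herm_conv u v : cmeas u -> cmeas v -> herm u -> herm v -> herm (conv u v).
Proof.
move=> mu_ mv hu hv xi; rewrite /conv -cint_conj.
rewrite -(cint_reflect (cmeas_conv_section (- xi) mu_ mv)); apply: eq_cint => eta.
by rewrite (_ : - xi - - eta = - (xi - eta)) ?hu ?hv ?conjcM// opprD.
Qed.

Lemma herm_pw u k : cmeas u -> herm u -> herm (pw u k).
Proof.
move=> mu_ hu; elim: k => [//|k IH] xi /=.
by rewrite (herm_conv mu_ (cmeas_pw1 k mu_) hu IH) conjcM /= oppr0.
Qed.

Lemma herm_Nhat u : cmeas u -> herm u -> herm (Nhat u).
Proof.
move=> mu_ hu xi; rewrite /Nhat -cint_conj; apply: eq_cint => k.
by rewrite conjcM -(herm_pw k.+1 mu_ hu) (_ : conjc (nlc k)%:C = (nlc k)%:C)//= oppr0.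
Qed.

End nonlinearity2.

Section real_cint.
Context {R : realType} d0 {T : measurableType d0} (m : {measure set T -> \bar R}).
Notation C := R[i].

Lemma cint_real_mul (f : T -> R) (r : R) (a : C) : mfunT f -> (forall x, 0 <= f x) ->
  (\int[m]_x (f x)%:E = r%:E)%E ->
  cL1 m (fun x => (f x)%:C * a) /\ cint m (fun x => (f x)%:C * a) = r%:C * a.
Proof.
move=> mf f0 fr.
have f1 : cL1 m (fun x => (f x)%:C : C).
  split; first meas. by under eq_integral do rewrite cabs_real ger0_norm//; rewrite fr ltry.
have E x : (f x)%:C * a = a * (f x)%:C by rewrite mulrC.
split; first by have := cL1Z a f1; under [X in cL1 _ X -> _]eq_fun do rewrite mulrC.
rewrite (eq_cint m E) (cintZ a f1) mulrC; congr (_ * _).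
apply: complex_ext; rewrite ?Re_cint ?Im_cint /=; first by rewrite /Rintegral fr.
by rewrite /Rintegral integral0.
Qed.

End real_cint.

(** * Exponential kernel in time and the Duhamel formula *)

Section time_kernel.
Context {R : realType}.
Notation TR := (measurableTypeR R).
Notation leb := (@lebesgue_measure R).
Notation C := R[i].
Implicit Types l s t a b T : R.

Lemma int_derive_itv (F f : R -> R) a b : a <= b -> (forall s : R, is_derive s 1 F (f s)) ->
  continuous f -> (\int[leb]_(s in `[a, b]) (f s)%:E = (F b - F a)%:E)%E.
Proof.
rewrite le_eqVlt => /predU1P[<-|ab] dF cf.
  by rewrite subrr set_itv1 integral_set1.
have cF (s : R) : F t @[t --> s] --> F s.
  by apply: differentiable_continuous; apply/derivable1_diffP; case: (dF s).
rewrite (@continuous_FTC2 R f F a b)//.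
- by apply: continuous_subspaceT => s; exact: cf.
- split; first by move=> s _; case: (dF s).
    by apply: cvg_at_right_filter; exact: cF.
  by apply: cvg_at_left_filter; exact: cF.
- by move=> s _; rewrite derive1E (@derive_val _ _ _ _ _ _ _ (dF s)).
Qed.

Lemma int_exp_left l a b : a <= b ->
  (\int[leb]_(s in `[a, b]) (l * expR (- (l * (b - s))))%:E = (1 - expR (- (l * (b - a))))%:E)%E.
Proof.
move=> ab; pose F s := expR (- (l * (b - s))); pose f s := l * expR (- (l * (b - s))).
have dF (s : R) : is_derive s 1 F (f s).
  by rewrite /F /f; apply: is_derive_eq; rewrite /GRing.scale /=; ring.
have cf : continuous f.
  move=> s; apply: differentiable_continuous; apply/derivable1_diffP.
  have h : is_derive s (1 : R) f (l * (l * expR (- (l * (b - s))))).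
    have E : f = l \*: F by apply/funext => x. by rewrite E; apply: is_derive_eq.
  exact: (@ex_derive _ _ _ _ _ _ _ h).
rewrite (int_derive_itv ab dF cf) /F.
by rewrite subrr mulr0 oppr0 expR0.
Qed.

Lemma int_exp_right l a b : a <= b ->
  (\int[leb]_(s in `[a, b]) (l * expR (- (l * (s - a))))%:E = (1 - expR (- (l * (b - a))))%:E)%E.
Proof.
move=> ab; pose F s := - expR (- (l * (s - a))); pose f s := l * expR (- (l * (s - a))).
have dF (s : R) : is_derive s 1 F (f s).
  by rewrite /F /f; apply: is_derive_eq; rewrite /GRing.scale /=; ring.
have cf : continuous f.
  move=> s; apply: differentiable_continuous; apply/derivable1_diffP.
  have h : is_derive s (1 : R) f (- l * (l * expR (- (l * (s - a))))).
    by rewrite /f; apply: is_derive_eq; rewrite /GRing.scale /=; ring.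
  exact: (@ex_derive _ _ _ _ _ _ _ h).
rewrite (int_derive_itv ab dF cf) /F.
by rewrite subrr mulr0 oppr0 expR0; congr (_%:E); ring.
Qed.

(** Integrals over [0, t] are taken over the whole line against this indicator, so that Fubini
    applies with t itself a variable. *)
Definition tri t s : R := ((0 <= s) && (s <= t))%:R.
Definition heat l t s : R := tri t s * (l * expR (- (l * (t - s)))).

Lemma tri_ge0 t s : 0 <= tri t s. Proof. by []. Qed.
Lemma heat_ge0 l t s : 0 <= l -> 0 <= heat l t s.
Proof. by move=> l0; rewrite mulr_ge0// mulr_ge0// expR_ge0. Qed.

Lemma meas_tri d0 (X : measurableType d0) (f g : X -> R) :
  mfunT f -> mfunT g -> mfunT (fun x => tri (f x) (g x)).
Proof.
move=> mf mg; rewrite /tri.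
rewrite (_ : (fun x => _) = (fun x => if (0 <= g x) && (g x <= f x) then 1 else 0)); last first.
  by apply/funext => x; case: (_ && _).
apply: measurable_fun_ifT => //; apply: measurable_and; last exact: measurable_fun_ler.
by apply: measurable_fun_ler; meas.
Qed.

Lemma meas_heat d0 (X : measurableType d0) (l f g : X -> R) : mfunT l ->
  mfunT f -> mfunT g ->
  mfunT (fun x => heat (l x) (f x) (g x)).
Proof.
move=> ml mf mg; apply: measurable_funM; first exact: meas_tri.
meas.
Qed.

Lemma int_tri_mul t (f : R -> R) :
  (\int[leb]_s (tri t s * f s)%:E = \int[leb]_(s in `[0%R, t]) (f s)%:E)%E.
Proof.
rewrite [RHS]integral_mkcond; apply: eq_integral => s _; rewrite patchE /tri.
have -> : ((0 <= s) && (s <= t)) = (s \in `[0, t]%classic) by rewrite mem_setE in_itv.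
by case: (s \in _); rewrite ?mul1r ?mul0r.
Qed.

Lemma int_tri t : 0 <= t -> (\int[leb]_s (tri t s)%:E = t%:E)%E.
Proof.
move=> t0; under eq_integral do rewrite -[tri _ _]mulr1.
rewrite (int_tri_mul t (fun=> 1)) integral_cst// mul1e.
rewrite (_ : lebesgue_measure_lebesgue_measure__canonical__measure_function_Measure R _ = lebesgue_measure (`[0, t]%classic : set R))//.
rewrite lebesgue_measure_itv/= lte_fin; move: t0; rewrite le_eqVlt => /predU1P[<-|t1].
  by rewrite ltxx.
by rewrite t1 sube0.
Qed.

Lemma int_heat l t : 0 <= t -> (\int[leb]_s (heat l t s)%:E = (1 - expR (- (l * t)))%:E)%E.
Proof.
by move=> t0; rewrite (int_tri_mul t (fun s => l * expR (- (l * (t - s))))) int_exp_left// subr0.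
Qed.

Lemma int_heat_le1 l t : 0 <= l -> (\int[leb]_s (heat l t s)%:E <= 1)%E.
Proof.
move=> l0; have [t0|t0] := leP 0 t.
  by rewrite int_heat// lee_fin gerBl expR_ge0.
rewrite (int_tri_mul t (fun s => l * expR (- (l * (t - s))))) set_itv_ge ?integral_set0// bnd_simp.
by rewrite -ltNge.
Qed.

(** The mass in the later time t instead of s: this is what an exchange of the two time integrals
    produces, and for l >= 0 it is again at most 1. *)
Lemma int_heat_dual l T s :
  (\int[leb]_t (tri T t * heat l t s)%:E = (tri T s * (1 - expR (- (l * (T - s)))))%:E)%E.
Proof.
have [/andP[s0 sT]|ns] := boolP ((0 <= s) && (s <= T)).
  rewrite [in RHS]/tri s0 sT mul1r -(int_exp_right l sT) [RHS]integral_mkcond.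
  apply: eq_integral => t _; rewrite patchE mem_setE in_itv/= /heat /tri s0 /=.
  case: (leP s t) => st /=; last by rewrite mul0r mulr0.
  by rewrite (le_trans s0 st) /=; case: (t <= T); rewrite ?mul1r ?mul0r.
rewrite [in RHS]/tri (negbTE ns) mul0r; transitivity (\int[leb]_(t in setT) (cst 0 t : \bar R))%E; last by rewrite integral0.
apply: eq_integral => t _.
congr (_%:E); rewrite /heat /tri; move: ns; case: (leP 0 s) => s0 /=; last by rewrite mul0r mulr0.
rewrite -ltNge => Ts; case: (leP s t) => st; last by rewrite mul0r mulr0.
by rewrite [t <= T]leNgt (lt_le_trans Ts st) andbF mul0r.
Qed.

Definition Duh l t (g : R -> \bar R) : \bar R := (\int[leb]_s ((heat l t s)%:E * g s))%E.

Lemma nnfun_heat_mul l t (g : TR -> \bar R) : 0 <= l -> nnfun g -> nnfun (fun s : TR => (heat l t s)%:E * g s)%E.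
Proof.
move=> l0 ng; apply: nnfunM => //; split; last by move=> s; rewrite lee_fin heat_ge0.
apply/measurable_EFinP; apply: meas_heat; meas.
Qed.

Lemma Duh_le l t (g : TR -> \bar R) (B : \bar R) : 0 <= l -> nnfun g -> (0 <= B)%E ->
  (forall s, 0 <= s -> s <= t -> (g s <= B)%E) -> (Duh l t g <= B)%E.
Proof.
move=> l0 ng B0 gB; apply: (via (\int[leb]_s ((heat l t s)%:E * B))%E).
  apply: int_mono => [||s]; [exact: nnfun_heat_mul|exact: (nnfun_heat_mul t l0 (nnfun_cst B0))|].
  have [/andP[s0 st]|ns] := boolP ((0 <= s) && (s <= t)).
    by apply: lee_wpmul2l; [rewrite lee_fin heat_ge0|exact: gB].
  by rewrite /heat /tri (negbTE ns) mul0r !mul0e.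
under eq_integral do rewrite muleC.
have nh : nnfun (fun s : TR => (heat l t s)%:E).
  split; last by move=> s; rewrite lee_fin heat_ge0. by apply/measurable_EFinP; apply: meas_heat; meas.
rewrite (integralZ leb B0 nh) -[leRHS]mule1; apply: lee_wpmul2l => //.
exact: int_heat_le1.
Qed.

Lemma nnfun_Duh l (g : TR -> \bar R) : 0 <= l -> nnfun g -> nnfun (fun t : TR => Duh l t g).
Proof.
move=> l0 [mg g0]; split.
  apply: (@measurable_fun_fubini_tonelli_F _ _ _ _ R leb (fun p : TR * TR => (heat l p.1 p.2)%:E * g p.2)%E).
    apply: emeasurable_funM; last meas. apply/measurable_EFinP; apply: meas_heat; meas.
  by move=> p; rewrite mule_ge0// lee_fin heat_ge0.
by move=> t; apply: integral_ge0 => s _; rewrite mule_ge0// lee_fin heat_ge0.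
Qed.

Lemma nnfun_tri T : nnfun (fun s : TR => (tri T s)%:E).
Proof.
split; last meas.
by apply/measurable_EFinP; apply: meas_tri; meas.
Qed.

Lemma int_Duh l T (g : TR -> \bar R) : 0 <= l -> nnfun g ->
  (\int[leb]_t ((tri T t)%:E * Duh l t g) =
   \int[leb]_s ((tri T s * (1 - expR (- (l * (T - s)))))%:E * g s))%E.
Proof.
move=> l0 ng; have [mg g0] := ng.
pose F (p : TR * TR) : \bar R := ((tri T p.1 * heat l p.1 p.2)%:E * g p.2)%E.
have mF : mfunT F.
  apply: emeasurable_funM; last meas. apply/measurable_EFinP; apply: measurable_funM.
    by apply: meas_tri; meas.
  apply: meas_heat; meas.
have F0 p : (0 <= F p)%E by rewrite mule_ge0// lee_fin mulr_ge0 ?heat_ge0// tri_ge0.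
transitivity (\int[leb]_t \int[leb]_s F (t, s))%E.
  apply: eq_integral => t _; rewrite /Duh -(integralZ leb _ (nnfun_heat_mul t l0 ng)) ?lee_fin//.
  by apply: eq_integral => s _; rewrite /F /= EFinM muleA.
rewrite (fubini_tonelli _ mF F0); apply: eq_integral => s _.
rewrite /F /= -(int_heat_dual l T s).
under eq_integral do rewrite muleC.
rewrite integralZ//; first by rewrite muleC.
split; last by move=> t; rewrite lee_fin mulr_ge0 ?heat_ge0// tri_ge0.
apply/measurable_EFinP; apply: measurable_funM; first by apply: meas_tri; meas.
by apply: meas_heat; meas.
Qed.

Lemma expRN_le1 x : 0 <= x -> expR (- x) <= 1 :> R.
Proof. by move=> x0; rewrite -expR0 ler_expR oppr_le0. Qed.

Lemma int_Duh_le l T (g : TR -> \bar R) : 0 <= l -> nnfun g ->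
  (\int[leb]_t ((tri T t)%:E * Duh l t g) <= \int[leb]_s ((tri T s)%:E * g s))%E.
Proof.
move=> l0 ng; rewrite int_Duh//.
have h s : 0 <= tri T s * (1 - expR (- (l * (T - s)))) <= tri T s.
  rewrite /tri; have [/andP[s0 sT]|_] := boolP ((0 <= s) && (s <= T)); last by rewrite mul0r lexx.
  by rewrite mul1r subr_ge0 gerBl expR_ge0 expRN_le1// mulr_ge0// subr_ge0.
apply: int_mono.
- apply: nnfunM => //; split; last by move=> s; rewrite lee_fin; case/andP: (h s).
  apply/measurable_EFinP; apply: measurable_funM; first by apply: meas_tri; meas. meas.
- by apply: nnfunM => //; exact: nnfun_tri.
- by move=> s; apply: lee_wpmul2r; [exact: ng.2|rewrite lee_fin; case/andP: (h s)].
Qed.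

(* D' = l (g - D) for D = Duh l . g, in integrated form *)
Lemma Duh_identity l T (g : TR -> \bar R) : 0 <= l -> nnfun g ->
  (Duh l T g + l%:E * \int[leb]_t ((tri T t)%:E * Duh l t g) =
   l%:E * \int[leb]_s ((tri T s)%:E * g s))%E.
Proof.
move=> l0 ng; rewrite int_Duh//.
have le0 : (0 <= l%:E)%E by rewrite lee_fin.
have nk : nnfun (fun s : TR => (tri T s * (1 - expR (- (l * (T - s)))))%:E * g s)%E.
  apply: nnfunM => //; split.
    apply/measurable_EFinP; apply: measurable_funM; first by apply: meas_tri; meas. meas.
  move=> s; rewrite lee_fin /tri; have [/andP[s0 sT]|_] := boolP (_ && _); last by rewrite mul0r.
  by rewrite mul1r subr_ge0 expRN_le1// mulr_ge0// subr_ge0.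
have nt : nnfun (fun s : TR => (tri T s)%:E * g s)%E by apply: nnfunM => //; exact: nnfun_tri.
rewrite -(integralZ leb le0 nk) -(integralZ leb le0 nt) /Duh.
rewrite -(integralD2 leb (nnfun_heat_mul T l0 ng) (nnfunZ le0 nk)).
apply: eq_integral => s _; rewrite !muleA -!EFinM -ge0_muleDl.
- by rewrite -EFinD; congr (_%:E * _)%E; rewrite /heat; ring.
- by rewrite lee_fin heat_ge0.
- rewrite lee_fin mulr_ge0// /tri; have [/andP[s0 sT]|_] := boolP (_ && _); last by rewrite mul0r.
  by rewrite mul1r subr_ge0 expRN_le1// mulr_ge0// subr_ge0.
Qed.

(** Cauchy-Schwarz for the measure of density [heat l t]. Its mass bound k is a parameter because
    near frequency 0 a bound better than 1 is used. *)
Lemma sq_cabs_cint_heat_le l t (k : R) (z : TR -> C) : 0 <= l -> cmeas z -> 0 < k ->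
  (\int[leb]_s (heat l t s)%:E <= k%:E)%E ->
  ((cabs (cint leb (fun s => (heat l t s)%:C * z s)) ^+ 2)%:E <= k%:E * Duh l t (fun s => (cabs (z s) ^+ 2)%:E))%E.
Proof.
move=> l0 mz k0 hk.
have nz2 : nnfun (fun s => (cabs (z s) ^+ 2)%:E).
  meas.
have nD := nnfun_heat_mul t l0 nz2.
have [Bo|] := ltP (Duh l t (fun s => (cabs (z s) ^+ 2)%:E)) +oo%E; last first.
  by rewrite leye_eq => /eqP ->; rewrite gt0_muley ?lte_fin// leey.
have B0 : (0 <= Duh l t (fun s => (cabs (z s) ^+ 2)%:E))%E by exact: (nnfun_Duh l0 nz2).2.
set B := Duh _ _ _ in Bo B0 *.
have Bf : B = (fine B)%:E by rewrite fineK// ge0_fin_numE.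
rewrite Bf -EFinM lee_fin; apply: sqr_le_of_young => //; rewrite ?cabs_ge0 ?fine_ge0//.
move=> e e0; rewrite -lee_fin EFinM.
have mh : mfunT (fun s : TR => heat l t s) by apply: meas_heat; meas.
have mc : cmeas (fun s : TR => (heat l t s)%:C * z s) by apply: cmeasM; meas.
have e2 : (0 <= 2%:E :> \bar R)%E by rewrite lee_fin.
have e0' : (0 <= e%:E)%E by rewrite lee_fin ltW.
have ei0 : (0 <= (e^-1)%:E)%E by rewrite lee_fin invr_ge0 ltW.
have nh : nnfun (fun s : TR => (heat l t s)%:E).
  by split; [exact/measurable_EFinP|move=> s; rewrite lee_fin heat_ge0].
apply: (via (2%:E * \int[leb]_s (cabs ((heat l t s)%:C * z s))%:E)%E).
  by apply: lee_wpmul2l => //; exact: le_cabs_cint.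
rewrite -(integralZ leb e2 (nnfun_cabs mc)).
apply: (via (\int[leb]_s (e%:E * (heat l t s)%:E + (e^-1)%:E * ((heat l t s)%:E * (cabs (z s) ^+ 2)%:E)))%E).
  apply: int_mono.
  - meas.
  - meas.
  move=> s; rewrite -!EFinM -EFinD lee_fin cabsM cabs_real ger0_norm ?heat_ge0//.
  have h0 := heat_ge0 t s l0; move: (heat l t s) h0 => h h0.
  have := sqr_ge0 (e - cabs (z s)); move: (cabs _) => p hp; rewrite -subr_ge0.
  have -> : e * h + e^-1 * (h * p ^+ 2) - 2 * (h * p) = h * (e^-1 * (e - p) ^+ 2) by field; rewrite gt_eqF. meas.
rewrite (integralD2 leb (nnfunZ e0' nh) (nnfunZ ei0 nD)) (integralZ leb e0' nh) (integralZ leb ei0 nD).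
rewrite EFinD; apply: leeD; first by rewrite EFinM; exact: lee_wpmul2l.
by rewrite mulrC EFinM -Bf.
Qed.

Section duhamel_complex.
Variables (l B : R) (a : C) (z : TR -> C).
Hypotheses (l0 : 0 <= l) (B0 : 0 <= B) (mz : cmeas z) (zB : forall s, cabs (z s) <= B).

Definition duhamel t : C := (expR (- (l * t)))%:C * a + cint leb (fun s => (heat l t s)%:C * z s).

Lemma cL1_heat_mul t : cL1 leb (fun s : TR => (heat l t s)%:C * z s).
Proof.
have mh : mfunT (fun s : TR => heat l t s) by apply: meas_heat; meas.
split; first meas.
apply: (@le_lt_trans _ _ (B%:E)); last by rewrite ltry.
apply: le_trans (Duh_le (g := fun=> B%:E) (B := B%:E) (t := t) l0 _ _ _).
- apply: int_mono; first meas.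
    by apply: nnfun_heat_mul; meas.
  by move=> s; rewrite cabsM cabs_real ger0_norm ?heat_ge0// -EFinM lee_fin ler_wpM2l// heat_ge0.
- meas.
- meas.
- meas.
Qed.

Lemma cabs_duhamel_le t : 0 <= t -> cabs (duhamel t) <= cabs a + B.
Proof.
move=> t0; apply: le_trans (cabsD _ _) _; apply: lerD.
  by rewrite cabsM cabs_real ger0_norm ?expR_ge0// ler_piMl ?cabs_ge0// expRN_le1// mulr_ge0.
rewrite -lee_fin; apply: le_trans (le_cabs_cint leb (cL1_heat_mul t).1) _.
apply: le_trans (Duh_le (g := fun=> B%:E) (B := B%:E) (t := t) l0 _ _ _).
- apply: int_mono; first exact: nnfun_cabs (cL1_heat_mul t).1.
    by apply: nnfun_heat_mul; meas.
  by move=> s; rewrite cabsM cabs_real ger0_norm ?heat_ge0// -EFinM lee_fin ler_wpM2l// heat_ge0.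
- meas.
- meas.
- meas.
Qed.

Lemma cmeas_duhamel : cmeas (duhamel : TR -> C).
Proof.
apply: cmeasD.
  meas.
apply: (@cmeas_cint _ _ _ _ _ leb (fun p : TR * TR => (heat l p.1 p.2)%:C * z p.2)).
apply: cmeasM; last meas.
apply: cmeas_real; apply: meas_heat; meas.
Qed.

Lemma cL1_tri_mul T (v : TR -> C) (K : R) : 0 <= T -> cmeas v ->
  (forall s, 0 <= s -> cabs (v s) <= K) -> cL1 leb (fun s : TR => (tri T s)%:C * v s).
Proof.
move=> T0 mv vK.
have K0 : 0 <= K by apply: le_trans (vK 0 (lexx _)); meas.
have mt : mfunT (fun s : TR => tri T s) by apply: meas_tri; meas.
apply: (@le_cL1 _ _ _ _ _ (fun s : TR => K%:E * (tri T s)%:E)%E).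
- meas.
- meas.
- move=> s; rewrite cabsM cabs_real ger0_norm ?tri_ge0// -EFinM lee_fin mulrC.
  rewrite /tri; have [/andP[s0 _]|_] := boolP (_ && _); last by rewrite !mulr0. by rewrite !mulr1 vK.
- rewrite integralZ ?lee_fin//; last meas. by rewrite int_tri// -EFinM ltry.
Qed.

(** The equation D' = l (z - D) in integrated form. The forcing z is only bounded and measurable, so
    it is derived from Fubini and [int_heat_dual] and not by differentiation. *)
Lemma duhamel_identity T : 0 <= T ->
  duhamel T = a - l%:C * cint leb (fun t => (tri T t)%:C * duhamel t) +
    l%:C * cint leb (fun s => (tri T s)%:C * z s).
Proof.
move=> T0.
have mt : mfunT (fun s : TR => tri T s) by apply: meas_tri; meas.
have [h1 e1] : cL1 leb (fun t : TR => (tri T t * (l * expR (- (l * t))))%:C * a) /\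
    cint leb (fun t : TR => (tri T t * (l * expR (- (l * t))))%:C * a) = (1 - expR (- (l * T)))%:C * a.
  apply: cint_real_mul; first meas.
    meas.
  rewrite (int_tri_mul T (fun t => l * expR (- (l * t)))).
  have := int_exp_right l T0; under eq_integral do rewrite subr0. by rewrite subr0.
pose F (p : TR * TR) : C := (l * tri T p.1 * heat l p.1 p.2)%:C * z p.2.
have mF : cmeas F.
  apply: cmeasM; last meas. apply: cmeas_real; apply: measurable_funM.
    meas.
  apply: meas_heat; meas.
have lt0 t : 0 <= l * tri T t by rewrite mulr_ge0 ?tri_ge0.
have F1 : cL1 (leb \x leb)%E F.
  apply: cL1_prod => //; apply: (@le_lt_trans _ _ ((l * B)%:E * \int[leb]_t (tri T t)%:E)%E); last first.
    by rewrite int_tri// -EFinM ltry.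
  rewrite -(integralZ leb _ (nnfun_tri T)) ?lee_fin ?mulr_ge0//. apply: int_mono.
  - meas.
  - meas.
  - move=> t; apply: (via ((l * tri T t)%:E * Duh l t (fun=> B%:E))%E).
      rewrite -(integralZ leb _ (nnfun_heat_mul t l0 (nnfun_cst (_ : 0 <= B%:E)%E))) ?lee_fin//. apply: int_mono.
      + meas.
      + apply: nnfunZ; first meas. by apply: nnfun_heat_mul; meas.
      + move=> s; rewrite /F /= cabsM cabs_real ger0_norm; last by rewrite mulr_ge0 ?heat_ge0.
        apply: (via ((l * tri T t) * (heat l t s * B))%:E); last by rewrite !EFinM.
        rewrite lee_fin -(mulrA (l * tri T t)); apply: ler_wpM2l => //. by apply: ler_wpM2l => //; exact: heat_ge0.
    rewrite -EFinM (_ : (l * B * tri T t)%:E = (l * tri T t)%:E * B%:E)%E; last by rewrite -EFinM; congr (_%:E); ring.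
    apply: lee_wpmul2l; first meas. by apply: Duh_le; meas.
have F2 : cL1 leb (fun t => cint leb (fun s => F (t, s))) by exact: cL1_cint1.
have E t : cint leb (fun s => F (t, s)) = (l * tri T t)%:C * cint leb (fun s => (heat l t s)%:C * z s).
  rewrite -(cintZ (l * tri T t)%:C (cL1_heat_mul t)); apply: eq_cint => s. by rewrite /F /= rmorphM /= mulrA.
have dl : cL1 leb (fun t : TR => (tri T t)%:C * duhamel t).
  by apply: (cL1_tri_mul (K := cabs a + B)) => //; [exact: cmeas_duhamel|exact: cabs_duhamel_le].
have -> : l%:C * cint leb (fun t : TR => (tri T t)%:C * duhamel t) =
   (1 - expR (- (l * T)))%:C * a + cint leb (fun t => cint leb (fun s => F (t, s))).
  rewrite -e1 -(cintD h1 F2) -(cintZ l%:C dl); apply: eq_cint => t. by rewrite E /duhamel !rmorphM /=; ring.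
rewrite (cint_swap F1).
have E2 s : cint leb (fun t => F (t, s)) = l%:C * ((tri T s * (1 - expR (- (l * (T - s)))))%:C * z s).
  have := @cint_real_mul R _ _ leb (fun t : TR => tri T t * heat l t s) _ (z s) _ _ (int_heat_dual l T s).
  case=> [||h3 <-].
  - by apply: measurable_funM => //; apply: meas_heat; meas.
  - by move=> t; rewrite mulr_ge0 ?heat_ge0 ?tri_ge0.
  by rewrite -(cintZ l%:C h3); apply: eq_cint => t; rewrite /F /= -mulrA rmorphM /= mulrA.
rewrite (eq_cint leb E2).
have tz : cL1 leb (fun s : TR => (tri T s)%:C * z s) by exact: (cL1_tri_mul (K := B)).
have hz := cL1_heat_mul T.
have E3 s : l%:C * ((tri T s * (1 - expR (- (l * (T - s)))))%:C * z s) =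
   l%:C * ((tri T s)%:C * z s) - (heat l T s)%:C * z s.
  by rewrite /heat !rmorphM rmorphB /= rmorph1; ring.
rewrite (eq_cint leb E3) (cintB (cL1Z l%:C tz) hz) (cintZ l%:C tz) /duhamel rmorphB /= rmorph1; ring.
Qed.

(** In [duhamel_identity] the integrand z - D is at most |a| + 2 B. The constant grows with l, so
    this modulus of continuity is not uniform in frequency. *)
Lemma cabs_duhamelB_le t t' : 0 <= t -> t <= t' ->
  cabs (duhamel t' - duhamel t) <= l * (cabs a + 2 * B) * (t' - t).
Proof.
move=> t0 tt'; have t'0 := le_trans t0 tt'.
pose v s := z s - duhamel s.
have mv : cmeas (v : TR -> C) by apply: cmeasB => //; exact: cmeas_duhamel.
have vK s : 0 <= s -> cabs (v s) <= cabs a + 2 * B.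
  move=> s0; apply: le_trans (cabsB _ _) _; have := zB s; have := cabs_duhamel_le s0; lra.
have dl T : 0 <= T -> cL1 leb (fun t : TR => (tri T t)%:C * duhamel t).
  by move=> T0; apply: (cL1_tri_mul (K := cabs a + B)) => //; [exact: cmeas_duhamel|exact: cabs_duhamel_le].
have tz T : 0 <= T -> cL1 leb (fun s : TR => (tri T s)%:C * z s) by move=> T0; exact: (cL1_tri_mul (K := B)).
have tv T : 0 <= T -> cL1 leb (fun s : TR => (tri T s)%:C * v s) by move=> T0; exact: (cL1_tri_mul (K := cabs a + 2 * B)).
have Ed T : 0 <= T -> duhamel T = a + l%:C * cint leb (fun s => (tri T s)%:C * v s).
  move=> T0; rewrite (duhamel_identity T0).
  have E s : (tri T s)%:C * v s = (tri T s)%:C * z s - (tri T s)%:C * duhamel s by rewrite mulrBr.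
  by rewrite (eq_cint leb E) (cintB (tz T T0) (dl T T0)); ring.
rewrite (Ed _ t'0) (Ed _ t0).
rewrite (_ : _ - _ = l%:C * (cint leb (fun s => (tri t' s)%:C * v s) - cint leb (fun s => (tri t s)%:C * v s))); last by ring.
rewrite -(cintB (tv _ t'0) (tv _ t0)) cabsM cabs_real ger0_norm// -mulrA ler_wpM2l//.
rewrite -lee_fin; apply: le_trans (le_cabs_cint leb (cL1B (tv _ t'0) (tv _ t0)).1) _.
have K0 : 0 <= cabs a + 2 * B by rewrite addr_ge0 ?cabs_ge0// mulr_ge0.
have tt s : 0 <= tri t' s - tri t s.
  rewrite subr_ge0 /tri ler_nat; case: (0 <= s) => //=; case: (leP s t) => // st. by rewrite (le_trans st tt').
have nD : nnfun (fun s : TR => (tri t' s - tri t s)%:E).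
  split; last meas. by apply/measurable_EFinP; apply: measurable_funB; apply: meas_tri; meas.
apply: (via ((cabs a + 2 * B)%:E * \int[leb]_s (tri t' s - tri t s)%:E)%E).
  rewrite -(integralZ leb _ nD) ?lee_fin//; apply: int_mono.
  - exact: nnfun_cabs (cL1B (tv _ t'0) (tv _ t0)).1.
  - meas.
  move=> s; rewrite -mulrBl -rmorphB cabsM cabs_real ger0_norm// -EFinM lee_fin mulrC.
  have [s0|s0] := leP 0 s; first by apply: ler_wpM2r => //; exact: vK.
  by rewrite /tri [0 <= s]leNgt s0 /= subrr !mulr0.
have : (\int[leb]_s (tri t s)%:E + \int[leb]_s (tri t' s - tri t s)%:E = \int[leb]_s (tri t' s)%:E)%E.
  rewrite -(integralD2 leb (nnfun_tri t) nD); apply: eq_integral => s _. by rewrite -EFinD addrC subrK.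
rewrite !int_tri// => E.
have -> : (\int[leb]_s (tri t' s - tri t s)%:E = (t' - t)%:E)%E.
  by rewrite EFinB -E addeAC subee// add0e.
by rewrite -EFinM.
Qed.

End duhamel_complex.
End time_kernel.

Ltac meas_ext4 := match goal with
  | |- measurable_fun _ (fun x => tri (@?f x) (@?g x)) => apply: meas_tri
  | |- measurable_fun _ (fun x => heat (@?l x) (@?f x) (@?g x)) => apply: meas_heat
  | |- nnfun (fun x => (cabs (@?f x) ^+ 2)%:E) => apply: nnfun_sqcabs
  | |- nnfun (fun x => (tri _ x)%:E) => exact: nnfun_tri
  | |- cmeas (Nhat _) => apply: cmeas_Nhat1
  | |- is_true (0 <= tri _ _)%R => exact: tri_ge0
  | |- is_true (0 <= heat _ _ _)%R => apply: heat_ge0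
  | |- nnfun (rsum _) => apply: nnfun_rsum
  | |- nnfun (rpw _ _) => apply: nnfun_rpw
  | |- cmeas (fourier _) => apply: cmeas_fourier
  | _ => meas_ext2
  end.
Ltac meas_ext ::= meas_ext4.

(** * Picard iteration for the transform of the Laplacian *)

Section decay_rate.
Context {R : realType} {d : nat}.
Notation V := 'rV[R]_d.
Implicit Type xi : V.

Definition lam xi : R := enorm xi ^+ 2 + enorm xi ^+ 4.

Lemma lam_ge0 xi : 0 <= lam xi.
Proof. by rewrite addr_ge0// exprn_ge0// enorm_ge0. Qed.

Lemma meas_lam : mfunT lam.
Proof. by apply: measurable_funD; meas. Qed.

End decay_rate.

Ltac meas_ext5 := match goal with
  | |- measurable_fun _ lam => exact: meas_lam
  | |- measurable_fun _ (fun x => lam (@?f x)) => apply: (measurableT_comp meas_lam)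
  | |- is_true (0 <= lam _)%R => exact: lam_ge0
  | _ => meas_ext4
  end.
Ltac meas_ext ::= meas_ext5.

Section picard.
Context {R : realType} {d : nat}.
Notation V := 'rV[R]_d.
Notation C := R[i].
Notation mu := (lebesgue_rV d).
Notation TR := (measurableTypeR R).
Notation leb := (@lebesgue_measure R).
Notation count := (@natcount R).
Implicit Types (xi : V) (t s : R) (v : R -> V -> C).

Lemma cabs_Nhat_le_sum (u : V -> C) (M : V -> \bar R) xi : cmeas u -> nnfun M ->
  (forall x, (cabs (u x))%:E <= M x)%E -> ((cabs (Nhat u xi))%:E <= rsum M xi)%E.
Proof.
move=> mu_ nM uM; apply: le_trans (cabs_Nhat_le xi mu_ nM uM) _.
apply: le_trans (nneseries_shift_le (fun k => (nnfun_rpw k nM).2 xi)).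
apply: lee_nneseries => [k _ _|k _].
  by apply: mule_ge0; [meas|exact: (nnfun_rpw k.+1 nM).2].
rewrite -[leRHS]mul1e; apply: lee_wpmul2r; first exact: (nnfun_rpw k.+1 nM).2.
by rewrite lee_fin invfact_le1.
Qed.

Lemma Lip_lty_rsum (M m : V -> \bar R) xi : nnfun M -> nnfun m -> (Lip M m xi < +oo)%E -> (rsum M xi < +oo)%E.
Proof.
move=> nM nm; rewrite !ltey; apply: contra_neq => e; rewrite /Lip (guard_pinfty e) addey//.
apply/eqP => h; have : (0 <= \sum_(k <oo) ((k.+2`!%:R^-1)%:E * rlip M m k.+1 xi))%E.
  by apply: nneseries_ge0 => k _ _; apply: mule_ge0; [meas|exact: (nnfun_rlip k.+1 nM nm).2].
by rewrite h.
Qed.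

Lemma cmeas_curry v t : cmeas (fun p : TR * V => v p.1 p.2) -> cmeas (v t).
Proof. by move=> mv; exact: (cmeas_comp mv (measurable_pair1 (t : TR))). Qed.

Lemma cmeas_curry_time v xi : cmeas (fun p : TR * V => v p.1 p.2) -> cmeas (fun s : TR => v s xi).
Proof. by move=> mv; exact: (cmeas_comp mv (measurable_pair2 xi)). Qed.

Variables (u0 : V -> C) (y0 : R).
Hypotheses (mu0 : cmeas u0) (y00 : 0 <= y0) (y0_le : y0 <= 8^-1)
  (u0_le : (\int[mu]_xi (cabs (u0 xi))%:E <= y0%:E)%E).

(* Freezing the time variable at 0 for t < 0 makes every bound below hold for all t. *)
Definition Phi v t xi : C :=
  duhamel (lam xi) (u0 xi) (fun s => Nhat (v s) xi) (Num.max 0 t).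

Fixpoint un n : R -> V -> C := if n is k.+1 then Phi (un k) else fun _ _ => 0.

Lemma cmeas_Nhat_time v xi : cmeas (fun p : TR * V => v p.1 p.2) -> cmeas (fun s : TR => Nhat (v s) xi).
Proof.
move=> mv; have := cmeas_Nhat (X := TR) (u := fun s : TR => v s) mv.
by move=> h; exact: (cmeas_comp h (measurable_pair2 xi)).
Qed.

Lemma meas_max0 d0 (X : measurableType d0) (f : X -> R) : mfunT f ->
  mfunT (fun x => Num.max 0 (f x)).
Proof. by move=> mf; apply: measurable_maxr; meas. Qed.

Lemma cmeas_Phi v : cmeas (fun p : TR * V => v p.1 p.2) -> cmeas (fun p : TR * V => Phi v p.1 p.2).
Proof.
move=> mv; have mN := cmeas_Nhat (X := TR) (u := fun s : TR => v s) mv.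
have ml d1 (X : measurableType d1) (f : X -> V) : mfunT f -> mfunT (fun x => lam (f x)).
  meas.
have mm d1 (X : measurableType d1) (f : X -> TR) : mfunT f ->
    mfunT (fun x => Num.max 0 (f x : R)) by exact: meas_max0.
apply: cmeasD.
  apply: cmeasM; last meas. apply: cmeas_real; apply: measurableT_comp; first meas.
  apply: measurableT_comp; first meas. meas.
apply: (@cmeas_cint _ _ _ _ _ leb
  (fun q : (TR * V) * TR => (heat (lam q.1.2) (Num.max 0 q.1.1) q.2)%:C * Nhat (v q.2) q.1.2)).
apply: cmeasM.
  apply: cmeas_real; apply: meas_heat.
  - by apply: ml; apply: measurableT_comp; meas.
  - by apply: mm; apply: measurableT_comp; meas.
  - meas.
apply: (cmeas_comp (p := fun q : (TR * V) * TR => (q.2, q.1.2)) mN).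
by apply: measurable_fun_pair; [meas|apply: measurableT_comp => //; exact: measurable_snd].
Qed.

Lemma cmeas_un n : cmeas (fun p : TR * V => un n p.1 p.2).
Proof. by elim: n => [|n IH]; [exact: (cmeas_cst 0)|exact: cmeas_Phi]. Qed.

Lemma max0_ge0 t : 0 <= Num.max 0 t. Proof. by rewrite le_max lexx. Qed.

(** The time kernel has mass at most 1, so a bound on the nonlinear difference that is uniform in s
    passes to [Phi] unchanged, with no factor growing in t. *)
Lemma cabs_PhiB_le v v' (M m : V -> \bar R) t xi :
  cmeas (fun p : TR * V => v p.1 p.2) -> cmeas (fun p : TR * V => v' p.1 p.2) ->
  nnfun M -> nnfun m -> (forall s x, (cabs (v s x))%:E <= M x)%E ->
  (forall s x, (cabs (v' s x))%:E <= M x)%E -> (forall s x, (cabs (v s x - v' s x))%:E <= m x)%E ->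
  ((cabs (Phi v t xi - Phi v' t xi))%:E <= Lip M m xi)%E.
Proof.
move=> mv mv' nM nm vM v'M vm.
have [fo|] := ltP (Lip M m xi) +oo%E; last by rewrite leye_eq => /eqP ->; rewrite leey.
have ro := Lip_lty_rsum nM nm fo.
have Bf : rsum M xi = (fine (rsum M xi))%:E by rewrite fineK// ge0_fin_numE// (nnfun_rsum nM).2.
have B0 : 0 <= fine (rsum M xi) by rewrite fine_ge0// (nnfun_rsum nM).2.
have bd w : cmeas (fun p : TR * V => w p.1 p.2) -> (forall s x, (cabs (w s x))%:E <= M x)%E ->
    forall s, cabs (Nhat (w s) xi) <= fine (rsum M xi).
  by move=> mw wM s; rewrite -lee_fin -Bf; exact: (cabs_Nhat_le_sum xi (cmeas_curry s mw) nM (wM s)).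
have h1 := cL1_heat_mul (lam_ge0 xi) B0 (cmeas_Nhat_time xi mv) (bd _ mv vM) (Num.max 0 t).
have h2 := cL1_heat_mul (lam_ge0 xi) B0 (cmeas_Nhat_time xi mv') (bd _ mv' v'M) (Num.max 0 t).
rewrite /Phi /duhamel; set E0 := _ * u0 xi; rewrite opprD addrACA subrr add0r.
rewrite -(cintB h1 h2); apply: le_trans (le_cabs_cint leb (cL1B h1 h2).1) _.
have L0 := (nnfun_Lip nM nm).2 xi.
apply: le_trans (Duh_le (t := Num.max 0 t) (lam_ge0 xi) (nnfun_cst L0) L0 (fun s _ _ => lexx _)).
apply: int_mono.
- exact: nnfun_cabs (cL1B h1 h2).1.
- exact: nnfun_heat_mul (lam_ge0 xi) (nnfun_cst L0).
move=> s; rewrite -mulrBr cabsM cabs_real ger0_norm ?heat_ge0 ?lam_ge0// EFinM.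
apply: lee_wpmul2l; first meas.
exact: (cabs_NhatB_le xi (cmeas_curry s mv) (cmeas_curry s mv') nM nm (vM s) (v'M s) (vm s)).
Qed.

(** The first component bounds the n-th iterate and the second the next increment, at all times at
    once, so that time has dropped out of the recursion. *)
Fixpoint picM n : (V -> \bar R) * (V -> \bar R) :=
  if n is k.+1 then
    let M := (fun xi => (picM k).1 xi + (picM k).2 xi)%E in (M, Lip M (picM k).2)
  else (fun=> 0%E, fun xi => (cabs (u0 xi))%:E).
Notation MM n := (picM n).1.
Notation mm n := (picM n).2.

Lemma nnfun_picM n : nnfun (MM n) /\ nnfun (mm n).
Proof.
elim: n => [|n [IH1 IH2]]; first by split; [exact: nnfun_cst|exact: nnfun_cabs].
have h : nnfun (MM n.+1) by exact: nnfunD.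
by split=> //; exact: nnfun_Lip.
Qed.

Lemma Phi0E t xi : cabs (Phi (fun _ _ => 0) t xi) <= cabs (u0 xi).
Proof.
have N0 (x : V) : Nhat (fun _ : V => (0 : C)) x = 0.
  apply: cabs0_eq0; apply/eqP; rewrite eq_le cabs_ge0 andbT -lee_fin.
  apply: le_trans (cabs_Nhat_le_sum x (cmeas_cst 0) (nnfun_cst (lexx 0%E)) _) _.
    by move=> y; rewrite cabs0.
  rewrite /rsum eseries0// => k _ _; elim: k x => [//|k IH] x /=.
  by rewrite /rconv; under eq_integral do rewrite mul0e; rewrite integral0.
have := cabs_duhamel_le (u0 xi) (lam_ge0 xi) (lexx 0) (cmeas_cst 0) (fun s => _ : cabs (0 : C) <= 0) (max0_ge0 t).
rewrite addr0 /Phi /duhamel; under [X in _ -> cabs (_ + X) <= _]eq_cint do rewrite N0.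
by apply; rewrite cabs0.
Qed.

Lemma un_bounds n : (forall t xi, (cabs (un n t xi))%:E <= MM n xi)%E /\
  (forall t xi, (cabs (un n.+1 t xi - un n t xi))%:E <= mm n xi)%E.
Proof.
elim: n => [|n [IH1 IH2]].
  split=> t xi; first by rewrite cabs0. by rewrite subr0 lee_fin; exact: Phi0E.
have [n1 n2] := nnfun_picM n; have [n3 n4] := nnfun_picM n.+1.
have b1 t xi : ((cabs (un n.+1 t xi))%:E <= MM n.+1 xi)%E.
  rewrite -[un n.+1 t xi](subrK (un n t xi)) addrC.
  apply: (via ((cabs (un n t xi))%:E + (cabs (un n.+1 t xi - un n t xi))%:E)%E).
    by rewrite -EFinD lee_fin cabsD.
  by apply: leeD; [exact: IH1|exact: IH2].
split=> // t xi; apply: (cabs_PhiB_le t xi (cmeas_un n.+1) (cmeas_un n) n3 n2) => // s x.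
by apply: le_trans (IH1 s x) _; apply: leeDl; exact: n2.2.
Qed.

(** 1/5 = (1/6) / (1 - 1/6) is the Lipschitz factor of [Nhat] on functions with a common majorant of
    mass 1/6; and 1/6 exceeds (1/8)(5/4), the total mass of increments that start at 1/8 with ratio
    1/5. *)
Let th : R := 5^-1.

Let th0 n : 0 <= th ^+ n. Proof. by rewrite exprn_ge0// invr_ge0. Qed.

Lemma geo_sum n : (\sum_(0 <= k < n) th ^+ k) * (1 - th) = 1 - th ^+ n.
Proof.
elim: n => [|n IH]; first by rewrite big_geq// mul0r expr0 subrr.
by rewrite big_nat_recr//= mulrDl IH exprS; ring.
Qed.

Lemma geo_le n : y0 * (\sum_(0 <= k < n) th ^+ k) <= 6^-1.
Proof.
have := geo_sum n; have := th0 n.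
have : 0 <= \sum_(0 <= k < n) th ^+ k by apply: sumr_ge0 => k _; meas.
rewrite /th; move: (_ ^+ n) (\sum_(0 <= k < n) _) => p S S0 p0 h.
have S1 : S <= 5 / 4 by lra.
apply: (via (8^-1 * (5 / 4))); first by apply: ler_pM.
by lra.
Qed.

Lemma int_picM n : (\int[mu]_xi MM n xi <= (y0 * \sum_(0 <= k < n) th ^+ k)%:E)%E /\
  (\int[mu]_xi mm n xi <= (th ^+ n * y0)%:E)%E.
Proof.
elim: n => [|n [IH1 IH2]].
  by rewrite integral0 big_geq// mulr0 expr0 mul1r.
have [n1 n2] := nnfun_picM n; have [n3 n4] := nnfun_picM n.+1.
have b1 : (\int[mu]_xi MM n.+1 xi <= (y0 * \sum_(0 <= k < n.+1) th ^+ k)%:E)%E.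
  rewrite (integralD2 mu n1 n2) big_nat_recr//= mulrDr EFinD; apply: leeD => //. by rewrite mulrC.
split=> //; have b2 : (\int[mu]_xi MM n.+1 xi <= (6^-1)%:E)%E.
  by apply: le_trans b1 _; rewrite lee_fin geo_le.
apply: le_trans (int_Lip_le n3 n2 _ _ _ b2 IH2) _ => //.
- by rewrite invf_lt1// ltr1n.
- meas.
- rewrite lee_fin exprS -(mulrA th) ler_wpM2r//; first meas. by rewrite (_ : 6^-1 / (1 - 6^-1) = th)// /th; field.
Qed.

Definition Msup xi : \bar R := (\sum_(k <oo) mm k xi)%E.

Lemma nnfun_Msup : nnfun Msup.
Proof. by apply: nnfun_series => k; exact: (nnfun_picM k).2. Qed.

Lemma tail_le n : (\sum_(k <oo) \int[mu]_xi mm (n + k)%N xi <= (th ^+ n * (y0 * 5 / 4))%:E)%E.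
Proof.
apply: nneseries_le => [k|N]; first by apply: integral_ge0 => x _; exact: (nnfun_picM _).2.2.
apply: (via (\sum_(0 <= k < N) (th ^+ n * (y0 * th ^+ k))%:E)%E).
  apply: lee_sum => k _; apply: le_trans (int_picM (n + k)).2 _.
  by rewrite lee_fin exprD -mulrA [th ^+ k * _]mulrC.
rewrite sumEFin lee_fin -!mulr_sumr ler_wpM2l ?th0// -mulrA ler_wpM2l//.
have := geo_sum N; have := th0 N.
by rewrite /th; move: (_ ^+ N) (\sum_(0 <= k < N) _) => p S p0 h; lra.
Qed.

Lemma int_Msup_le : (\int[mu]_xi Msup xi <= (6^-1)%:E)%E.
Proof.
rewrite /Msup int_series; last by move=> k; exact: (nnfun_picM k).2.
apply: le_trans (tail_le 0) _; rewrite expr0 mul1r lee_fin.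
by move: y0_le; lra.
Qed.

Lemma Msup_lty : (\int[mu]_xi Msup xi < +oo)%E.
Proof. by apply: le_lt_trans int_Msup_le _; rewrite ltry. Qed.

Lemma MM_le n xi : (MM n xi <= Msup xi)%E.
Proof.
have -> : (MM n xi = \sum_(0 <= k < n) mm k xi)%E.
  elim: n => [|n IH]; first by rewrite big_geq. by rewrite big_nat_recr//= IH.
by apply: nneseries_lim_ge => k _ _; exact: (nnfun_picM k).2.2.
Qed.

Definition usol t xi : C := cint count (fun k => un k.+1 t xi - un k t xi).

Lemma cmeas_usol : cmeas (fun p : TR * V => usol p.1 p.2).
Proof.
apply: (@cmeas_cint _ _ _ _ _ count (fun q : (TR * V) * nat => un q.2.+1 q.1.1 q.1.2 - un q.2 q.1.1 q.1.2)).
by apply: cmeas_nat_prod => k /=; exact: cmeasB (cmeas_un k.+1) (cmeas_un k).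
Qed.

Lemma usol_le t xi : ((cabs (usol t xi))%:E <= Msup xi)%E.
Proof.
apply: le_trans (cabs_count_le _) _; apply: lee_nneseries => [k _ _|k _].
  meas.
exact: (un_bounds k).2.
Qed.

Lemma un_le n t xi : ((cabs (un n t xi))%:E <= Msup xi)%E.
Proof. exact: le_trans ((un_bounds n).1 t xi) (MM_le n xi). Qed.

Definition rr n xi : \bar R := (\sum_(k <oo) mm (n + k)%N xi + guard Msup xi)%E.

Lemma nnfun_rr n : nnfun (rr n).
Proof.
apply: nnfunD; first by apply: nnfun_series => k; exact: (nnfun_picM _).2.
exact: nnfun_guard nnfun_Msup.
Qed.

Lemma int_rr_le n : (\int[mu]_xi rr n xi <= (th ^+ n * (y0 * 5 / 4))%:E)%E.
Proof.
have nk k : nnfun (mm (n + k)%N) by exact: (nnfun_picM _).2.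
rewrite (integralD2 mu (nnfun_series nk) (nnfun_guard nnfun_Msup)).
rewrite (int_guard nnfun_Msup Msup_lty) adde0 (int_series mu nk).
exact: tail_le.
Qed.

Lemma cL1_usol_terms t xi : (Msup xi < +oo)%E -> cL1 count (fun k => un k.+1 t xi - un k t xi).
Proof.
move=> fo; apply: cL1_count; apply: le_lt_trans fo; apply: lee_nneseries => [k _ _|k _].
  meas.
exact: (un_bounds k).2.
Qed.

Lemma un_ccvg t xi : (Msup xi < +oo)%E -> ccvg (fun n => un n t xi) (usol t xi).
Proof.
move=> fo; have := cint_count_ccvg (cL1_usol_terms t fo).
have E n : \sum_(i < n) (un i.+1 t xi - un i t xi) = un n t xi.
  elim: n => [|n IH]; first by rewrite big_ord0. by rewrite big_ord_recr /= IH addrC subrK.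
by under eq_fun do rewrite E.
Qed.

Lemma usolB_le n t xi : ((cabs (usol t xi - un n t xi))%:E <= rr n xi)%E.
Proof.
have r0 : (0 <= \sum_(k <oo) mm (n + k)%N xi)%E.
  by apply: nneseries_ge0 => k _ _; exact: (nnfun_picM _).2.2.
have [fo|] := ltP (Msup xi) +oo%E; last first.
  rewrite leye_eq => /eqP e; rewrite /rr (guard_pinfty e) addey ?leey//. by apply/eqP => h; rewrite h in r0.
rewrite /rr guard_lty// adde0.
have h : (fun k => (cabs (un (k + n)%N t xi - un n t xi))%:E) @ \oo --> (cabs (usol t xi - un n t xi))%:E.
  rewrite (cvg_shiftn n (fun k => (cabs (un k t xi - un n t xi))%:E)). apply: cvg_EFin; first by near=> k.
  exact: (ccvg_cabs (ccvgD (un_ccvg t fo) (ccvg_cst (- un n t xi)))).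
rewrite -(cvg_lim (@ereal_hausdorff R) h); apply: lime_le; first by apply/cvg_ex; exists (cabs (usol t xi - un n t xi))%:E.
apply: nearW => k.
apply: (via (\sum_(0 <= j < k) mm (n + j)%N xi)%E); last first.
  by apply: nneseries_lim_ge => j _ _; exact: (nnfun_picM _).2.2.
elim: k => [|k IH]; first by rewrite add0n subrr cabs0 big_geq.
rewrite big_nat_recr//=.
apply: (via ((cabs (un (k + n)%N t xi - un n t xi))%:E + (cabs (un (k + n).+1 t xi - un (k + n)%N t xi))%:E)%E).
  by rewrite -EFinD lee_fin [leRHS]addrC; exact: (cabs_dist_triangle (un (k + n)%N t xi) (un (k + n).+1 t xi) (un n t xi)).
by apply: leeD => //; rewrite (addnC n k); exact: (un_bounds _).2.
Unshelve. all: by end_near. Qed.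

(** The defect at xi is below every term e n xi of a series that converges for almost every xi,
    hence is 0. The terms do not involve t, so the exceptional null set is independent of time. *)
Lemma usol_fixpoint : {ae mu, forall xi, forall t, usol t xi = Phi usol t xi}.
Proof.
pose e n xi := (rr n.+1 xi + Lip Msup (rr n) xi)%E.
have nL n : nnfun (Lip Msup (rr n)) by exact: nnfun_Lip nnfun_Msup (nnfun_rr n).
have ne n : nnfun (e n) by exact: nnfunD (nnfun_rr n.+1) (nL n).
have ie n : (\int[mu]_xi e n xi <= (y0 * 2 / 2 ^+ n)%:E)%E.
  rewrite (integralD2 mu (nnfun_rr n.+1) (nL n)).
  apply: le_trans (leeD (int_rr_le n.+1) (int_Lip_le nnfun_Msup (nnfun_rr n) _ _ _ int_Msup_le (int_rr_le n))) _ => //.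
  - by rewrite invf_lt1// ltr1n.
  - meas.
  rewrite -EFinD lee_fin exprS. have : th ^+ n <= 2^-1 ^+ n by rewrite lerXn2r// ?nnegrE// /th; lra.
  rewrite exprVn; have := th0 n. rewrite /th; move: (_ ^+ n) ((2 ^+ n)^-1) => p q p0 pq.
  have := mulr_ge0 y00 p0; have : y0 * p <= y0 * q by rewrite ler_wpM2l.
  move=> h1 h2; rewrite [leLHS](_ : _ = (y0 * p) * 2^-1); last by field.
  by rewrite [leRHS](_ : _ = (y0 * q) * 2); [lra|ring].
have se : (\int[mu]_xi (\sum_(n <oo) e n xi) < +oo)%E.
  rewrite (int_series mu ne); apply: le_lt_trans (geometric_half_lty (y0 * 2)).
  by apply: lee_nneseries => [k _ _|k _]; [apply: integral_ge0 => x _; exact: (ne k).2|exact: ie].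
apply: filterS (ae_lty (nnfun_series ne) se) => xi hxi t.
apply/eqP; rewrite -subr_eq0; apply/eqP; apply: cabs0_eq0; apply/eqP.
rewrite eq_le cabs_ge0 andbT; set x := cabs _.
have xe n : (x%:E <= e n xi)%E.
  rewrite /x; apply: (via ((cabs (usol t xi - un n.+1 t xi))%:E + (cabs (un n.+1 t xi - Phi usol t xi))%:E)%E).
    by rewrite -EFinD lee_fin; exact: cabs_dist_triangle.
  apply: leeD; first exact: usolB_le.
  apply: (cabs_PhiB_le t xi (cmeas_un n) cmeas_usol nnfun_Msup (nnfun_rr n)) => s y.
  - exact: un_le.
  - exact: usol_le.
  - by rewrite cabs_distC; exact: usolB_le.
rewrite leNgt; apply/negP => x0.
have [Sg eS] : exists Sg : R, (\sum_(n <oo) e n xi)%E = Sg%:E.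
  exists (fine (\sum_(n <oo) e n xi)%E); rewrite fineK// ge0_fin_numE//.
  by apply: nneseries_ge0 => n _ _; exact: (ne n).2.
have key N : N%:R * x <= Sg.
  rewrite -lee_fin -eS; apply: (via (\sum_(0 <= n < N) e n xi)%E); last first.
    by apply: nneseries_lim_ge => n _ _; exact: (ne n).2.
  have -> : ((N%:R * x)%:E = \sum_(0 <= n < N) x%:E)%E.
    by rewrite sumEFin sumr_const_nat subn0 mulr_natl.
  by apply: lee_sum => n _; exact: xe.
have := key (Num.truncn (Sg / x)).+1; rewrite -ler_pdivlMr// leNgt => /negP; apply.
exact: truncnS_gt.
Qed.

End picard.

(** Uniform continuity gives a step on which f cannot climb from a to b; [0, T] is exhausted in such
    steps, the last hypothesis bringing the bound back from b to a each time. *)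
Lemma bootstrap {R : realType} (f : R -> R) (a b T : R) : a < b -> f 0 <= a ->
  (forall e, 0 < e -> exists2 dl, 0 < dl & forall s t, 0 <= s -> s <= T -> 0 <= t -> t <= T ->
     `|t - s| <= dl -> `|f t - f s| <= e) ->
  (forall t, 0 <= t -> t <= T -> (forall s, 0 <= s -> s <= t -> f s <= b) -> f t <= a) ->
  forall t, 0 <= t -> t <= T -> f t <= a.
Proof.
move=> ab f0 uc step.
have ba : 0 < b - a by rewrite subr_gt0.
have [dl dl0 hdl] := uc _ ba.
suff h n : forall t, 0 <= t -> t <= T -> t <= n%:R * dl -> f t <= a.
  move=> t t0 tT; apply: (h (Num.truncn (t / dl)).+1) => //. by rewrite -ler_pdivrMr//; exact/ltW/truncnS_gt.
elim: n => [|n IH] t t0 tT tn.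
  by rewrite mul0r in tn; have /le_anti -> : t <= 0 <= t by rewrite tn t0.
apply: step => // s s0 st; have sT := le_trans st tT.
have [sn|ns] := leP s (n%:R * dl); first by apply: le_trans (IH s s0 sT sn) (ltW ab).
have n0 : 0 <= n%:R * dl by rewrite mulr_ge0// ltW.
have nT : n%:R * dl <= T by apply: le_trans (ltW ns) sT.
have /ler_normlP[_] : `|f s - f (n%:R * dl)| <= b - a.
  apply: hdl => //; rewrite ger0_norm ?subr_ge0 ?(ltW ns)// lerBlDl.
  by apply: le_trans (le_trans st tn) _; rewrite -natr1 mulrDl mul1r.
by have := IH _ n0 nT (lexx _); lra.
Qed.

Lemma int_mono_ae {R : realType} d0 (T : measurableType d0) (m : {measure set T -> \bar R})
    (f g : T -> \bar R) : nnfun f -> nnfun g -> {ae m, forall x, (f x <= g x)%E} ->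
  (\int[m]_x f x <= \int[m]_x g x)%E.
Proof.
move=> [mf f0] [mg g0] h; apply: ae_ge0_le_integral => //.
by apply: filterS h => x hx _.
Qed.

(** Applied with c = [tri T t]: the inner inequality is available only for times in [0, T], where c
    is nonzero. *)
Lemma lee_scale {R : realType} (a I J : \bar R) (c : R) : 0 <= c -> (c != 0 -> (I <= a * J)%E) ->
  (c%:E * I <= a * (c%:E * J))%E.
Proof.
move=> c0 h; have [->|cn0] := eqVneq c 0; first by rewrite !mul0e mule0.
by rewrite muleCA; apply: lee_wpmul2l; meas.
Qed.

(** * Euclidean norm, convexity and truncated weights *)

Section enorm_theory.
Context {R : realType} {d : nat}.
Notation V := 'rV[R]_d.
Implicit Types x y : V.

Lemma dotv_ge0 x : 0 <= dotv x x.
Proof. by apply: sumr_ge0 => i _; rewrite -expr2 sqr_ge0. Qed.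

Lemma sqr_enorm x : enorm x ^+ 2 = dotv x x.
Proof. by rewrite sqr_sqrtr ?dotv_ge0. Qed.

Lemma dotv_cauchy x y : dotv x y <= enorm x * enorm y.
Proof.
have [y0|y0] := eqVneq (dotv y y) 0.
  have yi i : y ord0 i = 0.
    apply/eqP; rewrite -sqrf_eq0; apply/eqP. have /psumr_eq0P : \sum_(i < d) y ord0 i ^+ 2 = 0.
      by rewrite -[RHS]y0; apply: eq_bigr => j _; rewrite expr2.
    by apply=> // j _; meas.
  rewrite /dotv big1; first meas. by move=> i _; rewrite yi mulr0.
have yy : 0 < dotv y y by rewrite lt_neqAle eq_sym y0 dotv_ge0.
have h : dotv x y ^+ 2 <= dotv x x * dotv y y.
  have : 0 <= \sum_(i < d) (dotv y y * x ord0 i - dotv x y * y ord0 i) ^+ 2.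
    by apply: sumr_ge0 => i _; meas.
  have Q (q p : R) : \sum_(i < d) (q * x ord0 i - p * y ord0 i) ^+ 2 =
      q ^+ 2 * dotv x x - 2 * q * p * dotv x y + p ^+ 2 * dotv y y.
    by rewrite /dotv !mulr_sumr -sumrB -big_split /=; apply: eq_bigr => i _; ring.
  rewrite Q (_ : _ + _ = dotv y y * (dotv x x * dotv y y - dotv x y ^+ 2)); last by ring.
  by rewrite pmulr_rge0// subr_ge0.
apply: le_trans (ler_norm _) _; rewrite -(@ler_pXn2r _ 2)// ?nnegrE ?mulr_ge0 ?sqrtr_ge0//.
by rewrite real_normK ?num_real// exprMn !sqr_enorm.
Qed.

Lemma enormD x y : enorm (x + y) <= enorm x + enorm y.
Proof.
rewrite -(@ler_pXn2r _ 2)// ?nnegrE ?addr_ge0 ?sqrtr_ge0// sqr_enorm.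
rewrite dotvD !(dotvC _ (x + y)) !dotvD sqrrD !sqr_enorm (dotvC y x).
by have := dotv_cauchy x y; lra.
Qed.

Lemma enormN x : enorm (- x) = enorm x.
Proof. by rewrite /enorm dotvN (dotvC (- x)) dotvN opprK. Qed.

Lemma enorm_eq0 x : enorm x = 0 -> x = 0.
Proof.
move=> h; have : dotv x x = 0 by rewrite -sqr_enorm h expr0n.
move=> /eqP; rewrite psumr_eq0; last by move=> i _; rewrite -expr2 sqr_ge0.
move=> /allP h'; apply/rowP => i; rewrite mxE.
by have := h' i (mem_index_enum i); rewrite -expr2 sqrf_eq0 => /eqP.
Qed.

End enorm_theory.

Section convexity.
Context {R : realType}.
Implicit Types a b p : R.

Lemma sqr_convex a b p : 0 < p -> (a + b) ^+ 2 <= (p + 1) * a ^+ 2 + (p + 1) / p * b ^+ 2.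
Proof.
move=> p0; rewrite -subr_ge0.
have -> : (p + 1) * a ^+ 2 + (p + 1) / p * b ^+ 2 - (a + b) ^+ 2 = (p * a - b) ^+ 2 / p.
  by field; rewrite gt_eqF.
meas.
Qed.

(** Convexity of the fourth power with weights 1/(p+1) and p/(p+1), from two applications of the
    square case. Taking p = j + 1 weighs one factor against j + 1 others. *)
Lemma pow4_convex a b p : 0 < p ->
  (a + b) ^+ 4 <= (p + 1) ^+ 3 * a ^+ 4 + ((p + 1) / p) ^+ 3 * b ^+ 4.
Proof.
move=> p0; rewrite (exprM _ 2 2).
have h := sqr_convex a b p0.
apply: (via (((p + 1) * a ^+ 2 + (p + 1) / p * b ^+ 2) ^+ 2)).
  by rewrite lerXn2r// nnegrE ?sqr_ge0; meas.
apply: le_trans (sqr_convex _ _ p0) _; rewrite le_eqVlt; apply/orP; left; apply/eqP; field.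
by rewrite gt_eqF.
Qed.

End convexity.

Section truncated_weight.
Context {R : realType} {d : nat}.
Notation V := 'rV[R]_d.
Implicit Types (x : V) (K : nat).

(** Truncating |x| and not its powers keeps subadditivity, hence constants independent of K; being
    bounded, the weight gives finite integrals before any decay is known. *)
Definition tnorm K x : R := Num.min (enorm x) K%:R.
Definition wlam K x : R := tnorm K x ^+ 2 + tnorm K x ^+ 4.

Lemma tnorm_ge0 K x : 0 <= tnorm K x.
Proof. by rewrite le_min enorm_ge0 ler0n. Qed.

Lemma wlam_ge0 K x : 0 <= wlam K x.
Proof. by rewrite addr_ge0// exprn_ge0// tnorm_ge0. Qed.

Lemma wlam_le_lam K x : wlam K x <= lam x.
Proof.
have h : tnorm K x <= enorm x by rewrite ge_min lexx.
by apply: lerD; rewrite lerXn2r// ?nnegrE ?tnorm_ge0 ?enorm_ge0.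
Qed.

Lemma wlam_bounded K x : wlam K x <= K%:R ^+ 2 + K%:R ^+ 4.
Proof.
have h : tnorm K x <= K%:R by rewrite ge_min lexx orbT.
by apply: lerD; rewrite lerXn2r// ?nnegrE ?tnorm_ge0.
Qed.

Lemma meas_wlam K : mfunT (wlam K).
Proof.
have h : mfunT (tnorm K).
  by apply: measurable_minr; meas.
by apply: measurable_funD; meas.
Qed.

Lemma wlam_weight K (j : nat) x y : wlam K (x + y) <=
  (j.+2%:R) ^+ 3 * wlam K x + ((j.+2%:R / j.+1%:R) ^+ 3) * wlam K y.
Proof.
have p0 : 0 < j.+1%:R :> R by rewrite ltr0n.
have -> : (j.+2%:R : R) = j.+1%:R + 1 by rewrite -natr1.
move: (j.+1%:R : R) p0 => p p0.
have t : tnorm K (x + y) <= tnorm K x + tnorm K y.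
  rewrite /tnorm; have := enormD x y; have := enorm_ge0 x; have := enorm_ge0 y; have := ler0n R K.
  move: (enorm (x + y)) (enorm x) (enorm y) (K%:R : R) => e a b k k0 b0 a0 h.
  by rewrite ge_min; case: (leP a k) => ak; case: (leP b k) => bk; apply/orP; [left|right|right|right]; lra.
have t0 := tnorm_ge0 K (x + y).
have a0 := tnorm_ge0 K x; have b0 := tnorm_ge0 K y.
rewrite /wlam; move: (tnorm K (x + y)) (tnorm K x) (tnorm K y) t t0 a0 b0 => e a b t t0 a0 b0.
have h2 : e ^+ 2 <= (a + b) ^+ 2 by rewrite lerXn2r// nnegrE ?addr_ge0.
have h4 : e ^+ 4 <= (a + b) ^+ 4 by rewrite lerXn2r// nnegrE ?addr_ge0.
have := sqr_convex a b p0; have := pow4_convex a b p0.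
(* The square part comes with p + 1 and (p + 1) / p, which are at least 1 and hence below their
   cubes. *)
have q1 : 1 <= (p + 1) / p by rewrite ler_pdivlMr// mul1r; lra.
have q3 : (p + 1) / p <= ((p + 1) / p) ^+ 3 by rewrite ler_eXnr.
have p3 : p + 1 <= (p + 1) ^+ 3 by rewrite ler_eXnr//; lra.
have := ler_wpM2r (sqr_ge0 a) p3; have := ler_wpM2r (sqr_ge0 b) q3.
move: ((p + 1) ^+ 3) (((p + 1) / p) ^+ 3) ((p + 1) / p) (p + 1) => P3 Q3 Q P.
by rewrite !mulrDr; lra.
Qed.

Lemma wlam_near x : \forall K \near \oo, wlam K x = lam x.
Proof.
near=> K; rewrite /wlam /tnorm min_l//.
apply: (via (Num.truncn (enorm x)).+1%:R); first exact/ltW/truncnS_gt.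
by rewrite ler_nat; near: K; exact: nbhs_infty_ge.
Unshelve. all: by end_near. Qed.

Lemma lam_gt0 x : x != 0 -> 0 < lam x.
Proof.
move=> x0; have e0 : 0 < enorm x.
  by rewrite lt_neqAle enorm_ge0 andbT eq_sym; apply: contra_neq x0 => /enorm_eq0.
by rewrite addr_gt0// exprn_gt0.
Qed.

End truncated_weight.

Lemma ae_neq0 {R : realType} {d : nat} (hd : (0 < d)%N) : {ae lebesgue_rV d, forall x : 'rV[R]_d, x != 0}.
Proof.
exists [set 0]; split.
- apply: compact_measurable_rV; exact: compact_set1.
- exact: lebesgue_rV0.
- by move=> x /= /negP; rewrite negbK => /eqP.
Qed.

(** Converts a pointwise modulus dl G, with G finite almost everywhere but possibly not integrable,
    into a modulus in the mean: cut at an integrable A and let dl -> 0 under dominated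
    convergence. *)
Lemma min_modulus {R : realType} d0 (T : measurableType d0) (m : {measure set T -> \bar R})
    (A G : T -> \bar R) : nnfun A -> nnfun G -> (\int[m]_x A x < +oo)%E ->
  {ae m, forall x, (G x < +oo)%E} -> forall e : R, 0 < e ->
  exists2 dl : R, 0 < dl & (\int[m]_x Order.min (A x) (dl%:E * G x) <= e%:E)%E.
Proof.
move=> nA nG Ao Gf e e0.
pose f n x : \bar R := Order.min (A x) ((n.+1%:R^-1)%:E * G x)%E.
have iA : m.-integrable setT A.
  apply/integrableP; split; first exact: nA.1. by under eq_integral do rewrite gee0_abs ?nA.2//.
have nf n : nnfun (f n).
  have nn : nnfun (fun x => (n.+1%:R^-1)%:E * G x)%E by apply: nnfunZ. split; first exact: measurable_mine nA.1 nn.1.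
  by move=> x; rewrite le_min nA.2 nn.2.
have Af := ae_lty nA Ao.
have := @dominated_convergence _ _ _ m setT measurableT f (cst 0%E) A (fun n => (nf n).1).
case.
- meas.
- apply: filterS2 Gf Af => x Gx Ax _. apply/ecvg0P => [n|e' e'0]; first exact: (nf n).2.
  have [g eg] : exists g : R, G x = g%:E by exists (fine (G x)); rewrite fineK// ge0_fin_numE// nG.2.
  near=> n; rewrite /f eg ge_min; apply/orP; right; rewrite -EFinM lee_fin mulrC ler_pdivrMr// mulrC -ler_pdivrMr//.
  apply: (via (Num.truncn (g / e')).+1%:R); first exact/ltW/truncnS_gt.
  by rewrite ler_nat ltnS; near: n; exact: nbhs_infty_ge.
- exact: iA.
- by apply: aeW => x n _ ; rewrite gee0_abs ?(nf n).2// ge_min lexx.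
move=> _ _; rewrite integral0 => /ecvg0P h.
have pos n : (0 <= \int[m]_x f n x)%E by apply: integral_ge0 => x _; exact: (nf n).2.
have [n _ hn] := h pos e e0.
by exists (n.+1%:R^-1); rewrite ?invr_gt0//; exact: (hn n (leqnn n)).
Unshelve. all: by end_near. Qed.

(** * Exchanging time and frequency integrals; square integrals *)

Section time_fubini.
Context {R : realType} {d : nat}.
Notation V := 'rV[R]_d.
Notation mu := (lebesgue_rV d).
Notation TR := (measurableTypeR R).
Notation leb := (@lebesgue_measure R).
Implicit Type T : R.

Lemma meas_swapVT : mfunT (fun p : V * TR => (p.2, p.1)).
Proof. by apply: measurable_fun_pair; meas. Qed.

Lemma tri_swap (w : V -> \bar R) (F : TR * V -> \bar R) T : nnfun w -> nnfun F ->
  (\int[mu]_xi (w xi * \int[leb]_t ((tri T t)%:E * F (t, xi))) =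
   \int[leb]_t ((tri T t)%:E * \int[mu]_xi (w xi * F (t, xi))))%E.
Proof.
move=> nw nF; pose G (p : V * TR) := (w p.1 * ((tri T p.2)%:E * F (p.2, p.1)))%E.
have nt := @nnfun_tri R T.
have mG : mfunT G.
  apply: emeasurable_funM; first meas. apply: emeasurable_funM; first meas.
  exact: (measurableT_comp nF.1 meas_swapVT).
have G0 p : (0 <= G p)%E by apply: mule_ge0; meas.
have n1 xi : nnfun (fun t : TR => (tri T t)%:E * F (t, xi))%E.
  meas.
have n2 t : nnfun (fun xi => w xi * F (t, xi))%E.
  meas.
transitivity (\int[mu]_xi \int[leb]_t G (xi, t))%E.
  by apply: eq_integral => xi _; rewrite -(integralZ leb (nw.2 xi) (n1 xi)).
rewrite (fubini_tonelli _ mG G0); apply: eq_integral => t _.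
rewrite -(integralZ mu (nt.2 t) (n2 t)); apply: eq_integral => xi _.
by rewrite /G /= muleCA.
Qed.

Lemma nnfun_tri_integral (F : TR * V -> \bar R) T : nnfun F ->
  nnfun (fun xi => \int[leb]_t ((tri T t)%:E * F (t, xi)))%E.
Proof.
move=> nF; have nt := @nnfun_tri R T; split; last first.
  meas.
apply: (@measurable_fun_fubini_tonelli_F _ _ _ _ R leb (fun p : V * TR => (tri T p.2)%:E * F (p.2, p.1))%E).
  apply: emeasurable_funM; first meas. exact: (measurableT_comp nF.1 meas_swapVT).
meas.
Qed.

End time_fubini.

Section square_integrals.
Context {R : realType} {d : nat}.
Notation V := 'rV[R]_d.
Notation C := R[i].
Notation mu := (lebesgue_rV d).
Notation TR := (measurableTypeR R).
Notation leb := (@lebesgue_measure R).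

(** The Young inequality for the convolution of |v| with a kernel of mass at most k. *)
Lemma sqint_Nhat_le (v : V -> C) (M : V -> \bar R) (k : R) : cmeas v -> nnfun M ->
  (forall x, (cabs (v x))%:E <= M x)%E -> 0 < k -> (\int[mu]_x rsum M x <= k%:E)%E ->
  (sqint mu (Nhat v) <= (k ^+ 2)%:E * sqint mu v)%E.
Proof.
move=> mv nM vM k0 Mk; have nv2 := nnfun_sqcabs mv; have nK := nnfun_rsum nM.
have k0' : (0 <= k%:E)%E by rewrite lee_fin ltW.
apply: (via (\int[mu]_xi (k%:E * rconv (fun x => (cabs (v x) ^+ 2)%:E) (rsum M) xi))%E).
  apply: int_mono; first meas.
    exact: nnfunZ k0' (nnfun_rconv nv2 nK).
  by move=> xi; exact: sq_cabs_Nhat_le.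
rewrite (integralZ mu k0' (nnfun_rconv nv2 nK)) (int_rconv nv2 nK) expr2 EFinM -muleA.
apply: lee_wpmul2l => //; rewrite muleC; apply: lee_wpmul2r; meas.
Qed.

Lemma nnfun_sq_joint (v : R -> V -> C) : cmeas (fun p : TR * V => v p.1 p.2) ->
  nnfun (fun p : TR * V => (cabs (v p.1 p.2) ^+ 2)%:E).
Proof. meas. Qed.

Lemma nnfun_sqint_time (v : R -> V -> C) : cmeas (fun p : TR * V => v p.1 p.2) ->
  nnfun (fun t : TR => sqint mu (v t)).
Proof.
move=> mv; split; last meas.
apply: (@measurable_fun_fubini_tonelli_F _ _ _ _ R mu (fun p : TR * V => (cabs (v p.1 p.2) ^+ 2)%:E)).
  meas.
meas.
Qed.

Lemma int_tri_sq (v : R -> V -> C) T : cmeas (fun p : TR * V => v p.1 p.2) ->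
  (\int[mu]_xi \int[leb]_t ((tri T t)%:E * (cabs (v t xi) ^+ 2)%:E) =
   \int[leb]_t ((tri T t)%:E * sqint mu (v t)))%E.
Proof.
move=> mv; have n1 : nnfun (fun _ : V => 1%E : \bar R) by apply: nnfun_cst; meas.
have := tri_swap T n1 (nnfun_sq_joint mv).
under eq_integral do rewrite mul1e.
by move=> ->; apply: eq_integral => t _; congr (_ * _)%E; apply: eq_integral => x _; rewrite mul1e.
Qed.

End square_integrals.

(** * Square bounds in space and time for the Picard iterates *)

Section picard_L2.
Context {R : realType} {d : nat}.
Notation V := 'rV[R]_d.
Notation C := R[i].
Notation mu := (lebesgue_rV d).
Notation TR := (measurableTypeR R).
Notation leb := (@lebesgue_measure R).
Variables (u0 : V -> C) (y0 : R) (g0 : V -> R).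
Hypotheses (mu0 : cmeas u0) (y00 : 0 <= y0) (y0_le : y0 <= 8^-1)
  (u0_le : (\int[mu]_xi (cabs (u0 xi))%:E <= y0%:E)%E)
  (mg : mfunT g0) (g00 : forall xi, 0 <= g0 xi)
  (u0g : forall xi, cabs (u0 xi) ^+ 2 <= lam xi * g0 xi)
  (g0o : (\int[mu]_xi (g0 xi)%:E < +oo)%E).
Notation un := (un u0).
Notation usol := (usol u0).
Notation Msup := (Msup u0).

Lemma rsum_Msup_le : (\int[mu]_xi rsum Msup xi <= (5^-1)%:E)%E.
Proof.
have y1 : (6^-1 : R) < 1 by rewrite invf_lt1// ltr1n.
apply: le_trans (int_rsum_le (nnfun_Msup mu0) _ y1 (int_Msup_le mu0 y00 y0_le u0_le)) _.
  meas.
by rewrite lee_fin; have -> : (6^-1 / (1 - 6^-1) = 5^-1 :> R) by field.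
Qed.

Let k0 : (0 : R) < 5^-1. Proof. by rewrite invr_gt0. Qed.

(** By |u0|^2 <= lam g0 the square of the linear part is at most lam e^{-lam t} g0, whose time
    integral is at most g0. Thus integrability of g0 suffices, although |u0|^2 itself may fail to be
    integrable. *)
Lemma un_sq_le n T xi : 0 <= T ->
  (\int[leb]_t ((tri T t)%:E * (cabs (un n.+1 t xi) ^+ 2)%:E) <= (2 * g0 xi)%:E +
   2%:E * \int[leb]_t ((tri T t)%:E * (cabs (Nhat (un n t) xi) ^+ 2)%:E))%E.
Proof.
move=> T0; have l0 := lam_ge0 xi; set l := lam xi in l0 *.
have mz := cmeas_Nhat_time xi (cmeas_un mu0 n).
have nz : nnfun (fun s : TR => (cabs (Nhat (un n s) xi) ^+ 2)%:E).
  by split; [meas|move=> s; rewrite lee_fin sqr_ge0].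
have nt := @nnfun_tri R T.
have nD := nnfun_Duh l0 nz.
have g0' : 0 <= 2 * g0 xi by rewrite mulr_ge0.
have e2 : (0 <= 2%:E :> \bar R)%E by rewrite lee_fin.
have nh : nnfun (fun t : TR => (tri T t * (l * expR (- (l * t))))%:E).
  split; last by move=> t; rewrite lee_fin mulr_ge0// mulr_ge0// expR_ge0.
  apply/measurable_EFinP; apply: measurable_funM; first by apply: meas_tri; meas. meas.
have g0'' : (0 <= (2 * g0 xi)%:E)%E by rewrite lee_fin.
have hI : (\int[leb]_t (tri T t * (l * expR (- (l * t))))%:E <= 1)%E.
  rewrite (int_tri_mul T (fun t => l * expR (- (l * t)))).
  have -> : (\int[leb]_(t in `[0%R, T]) (l * expR (- (l * t)))%:E = (1 - expR (- (l * T)))%:E)%E.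
    rewrite -[in RHS](subr0 T) -(int_exp_right l T0). by apply: eq_integral => t _; rewrite subr0.
  by rewrite lee_fin gerBl expR_ge0.
apply: (via (\int[leb]_t ((2 * g0 xi)%:E * (tri T t * (l * expR (- (l * t))))%:E +
   2%:E * ((tri T t)%:E * Duh l t (fun s => (cabs (Nhat (un n s) xi) ^+ 2)%:E))))%E).
  apply: int_mono.
  - apply: nnfunM => //; split; last by move=> t; rewrite lee_fin sqr_ge0.
    by apply: meas_sqcabs; exact: cmeas_curry_time (cmeas_un mu0 n.+1).
  - exact: nnfunD (nnfunZ g0'' nh) (nnfunZ e2 (nnfunM nt nD)).
  move=> t; rewrite /tri; have [/andP[t0 tT]|_] := boolP ((0 <= t) && (t <= T)); last first.
    by rewrite mul0e mul0r mule0 mul0e mule0 adde0.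
  rewrite mul1e mul1r mul1e [un n.+1 t xi]/(Phi u0 (un n) t xi) /Phi (max_idPr t0) /duhamel.
  have h := sq_cabs_cint_heat_le (t := t) l0 mz ltr01 (int_heat_le1 t l0). rewrite mul1e in h.
  apply: (via ((2 * cabs ((expR (- (l * t)))%:C * u0 xi) ^+ 2)%:E +
     2%:E * (cabs (cint leb (fun s => (heat l t s)%:C * Nhat (un n s) xi)) ^+ 2)%:E)%E).
    by rewrite -EFinM -EFinD lee_fin; exact: cabs_sqD.
  apply: leeD; last exact: lee_wpmul2l.
  rewrite -EFinM lee_fin -mulrA ler_wpM2l// cabsM cabs_real ger0_norm ?expR_ge0// exprMn.
  have e1 : expR (- (l * t)) <= 1 by rewrite expRN_le1// mulr_ge0.
  apply: (via (expR (- (l * t)) * (l * g0 xi))).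
    apply: ler_pM; rewrite ?sqr_ge0 ?u0g//. by rewrite expr2 ler_piMl// expR_ge0.
  by rewrite le_eqVlt; apply/orP; left; apply/eqP; ring.
rewrite (integralD2 leb (nnfunZ g0'' nh) (nnfunZ e2 (nnfunM nt nD))).
rewrite (integralZ leb g0'' nh) (integralZ leb e2 (nnfunM nt nD)).
apply: leeD; first by rewrite -[leRHS]mule1; exact: lee_wpmul2l.
by apply: lee_wpmul2l => //; exact: int_Duh_le.
Qed.

(** The constant 3 closes the recursion: 2 A + 2 (1/5)^2 (3 A) <= 3 A. *)
Lemma un_sq_bound n T (A : R) : 0 <= T -> (\int[mu]_xi (g0 xi)%:E <= A%:E)%E ->
  (\int[leb]_t ((tri T t)%:E * sqint mu (un n t)) <= (3 * A)%:E)%E.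
Proof.
move=> T0 gA.
have A0 : 0 <= A.
  by rewrite -lee_fin; apply: le_trans gA; meas.
elim: n => [|n IH].
  apply: (via 0%E); last meas. rewrite (_ : (fun t => _) = cst 0%E) ?integral0//; apply/funext => t.
  rewrite (_ : sqint mu _ = 0%E) ?mule0// /sqint; under eq_integral do rewrite cabs0 expr0n /=. by rewrite integral0.
have nt := @nnfun_tri R T.
have mN : cmeas (fun p : TR * V => Nhat (un n p.1) p.2).
  exact: (cmeas_Nhat (X := TR) (u := fun s : TR => un n s) (cmeas_un mu0 n)).
have nP := nnfun_tri_integral T (nnfun_sq_joint (v := fun t => Nhat (un n t)) mN).
have ng : nnfun (fun xi : V => (2 * g0 xi)%:E).
  meas.
have e2 : (0 <= 2%:E :> \bar R)%E by rewrite lee_fin.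
rewrite -(int_tri_sq T (cmeas_un mu0 n.+1)).
apply: (via (\int[mu]_xi ((2 * g0 xi)%:E +
   2%:E * \int[leb]_t ((tri T t)%:E * (cabs (Nhat (un n t) xi) ^+ 2)%:E)))%E).
  apply: int_mono; last by move=> xi; exact: un_sq_le.
    exact: (nnfun_tri_integral T (nnfun_sq_joint (cmeas_un mu0 n.+1))).
  meas.
rewrite (integralD2 mu ng (nnfunZ e2 nP)) (integralZ mu e2 nP) (int_tri_sq (v := fun t => Nhat (un n t)) T mN).
have nn := nnfun_sqint_time (cmeas_un mu0 n).
have h : (\int[leb]_t ((tri T t)%:E * sqint mu (fun xi => Nhat (un n t) xi)) <=
   ((5^-1) ^+ 2)%:E * (3 * A)%:E)%E.
  have k2 : (0 <= ((5^-1 : R) ^+ 2)%:E)%E by rewrite lee_fin sqr_ge0. apply: le_trans (lee_wpmul2l k2 IH).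
  rewrite -(integralZ leb k2 (nnfunM nt nn)); apply: int_mono.
  - exact: nnfunM nt (nnfun_sqint_time (v := fun t => Nhat (un n t)) mN).
  - meas.
  move=> t; rewrite muleCA; apply: lee_wpmul2l; first exact: nt.2.
  apply: (sqint_Nhat_le (cmeas_curry t (cmeas_un mu0 n)) (nnfun_Msup mu0) _ k0 rsum_Msup_le).
  by move=> x; exact: un_le.
have ng0 : nnfun (fun xi : V => (g0 xi)%:E) by split; meas.
have hg : (\int[mu]_xi (2 * g0 xi)%:E <= (2 * A)%:E)%E.
  under eq_integral do rewrite EFinM. by rewrite (integralZ mu e2 ng0) EFinM; exact: lee_wpmul2l.
apply: le_trans (leeD hg (lee_wpmul2l e2 h)) _.
by rewrite -!EFinM -EFinD lee_fin; move: A0; lra.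
Qed.

Lemma usol_sq_lty T : 0 <= T -> (\int[leb]_t ((tri T t)%:E * sqint mu (usol t)) < +oo)%E.
Proof.
move=> T0.
have [A gA] : exists A : R, (\int[mu]_xi (g0 xi)%:E)%E = A%:E.
  exists (fine (\int[mu]_xi (g0 xi)%:E)%E); rewrite fineK// ge0_fin_numE//. meas.
have nt := @nnfun_tri R T.
have nM := nnfun_Msup mu0.
(* Convergence of the iterates is known only where [Msup] is finite. The indicator gd discards the
   other frequencies, a null set, so that Fatou applies on the product space. *)
pose G : set V := [set xi | (Msup xi < +oo)%E].
have mG : measurable G.
  rewrite -[G]setTI; apply: emeasurable_fun_infty_o; meas.
pose gd xi : \bar R := (\1_G xi)%:E.
have ngd : nnfun gd by split; [apply/measurable_EFinP; exact: measurable_indic|move=> x; rewrite lee_fin].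
pose f (v : R -> V -> C) (p : TR * V) : \bar R := (gd p.2 * ((tri T p.1)%:E * (cabs (v p.1 p.2) ^+ 2)%:E))%E.
have nf v : cmeas (fun p : TR * V => v p.1 p.2) -> nnfun (f v).
  move=> mv; split; last by move=> p; apply: mule_ge0; meas. apply: emeasurable_funM; first meas. meas.
have fI v : cmeas (fun p : TR * V => v p.1 p.2) ->
    (\int[(leb \x mu)%E]_p f v p = \int[leb]_t ((tri T t)%:E * sqint mu (v t)))%E.
  move=> mv; rewrite (fubini_tonelli1 (f v) (nf v mv).1 (nf v mv).2) /fubini_F.
  apply: eq_integral => t _; rewrite /sqint -(integralZ mu (nt.2 t)); last exact: nnfun_sqcabs (cmeas_curry t mv).
  apply: ae_eq_integral => //.
  - exact: measurableT_comp (nf v mv).1 (measurable_pair1 t).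
  - by apply: (nnfunZ (nt.2 t) (nnfun_sqcabs (cmeas_curry t mv))).1.
  apply: filterS (ae_lty nM (Msup_lty mu0 y00 y0_le u0_le)) => xi hxi _. by rewrite /f /gd indicE mem_set// mul1e.
apply: (@le_lt_trans _ _ (3 * A)%:E); last by rewrite ltry.
rewrite -(fI _ (cmeas_usol mu0)).
apply: (fatou_le (f_ := fun n => f (un n))).
- by move=> n; exact: (nf _ (cmeas_un mu0 n)).1.
- by move=> n; exact: (nf _ (cmeas_un mu0 n)).2.
- exact: (nf _ (cmeas_usol mu0)).1.
- exact: (nf _ (cmeas_usol mu0)).2.
- apply: aeW => -[t xi]; rewrite /f /gd /= indicE. have [/set_mem hxi|_] := boolP (xi \in G); last first.
    rewrite mul0e (_ : (fun n => _) = cst 0%E); first exact: cvg_cst. by apply/funext => n; rewrite mul0e.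
  apply: (@cvg_trans _ ((fun n => (tri T t * cabs (un n t xi) ^+ 2)%:E) @ \oo)).
    apply: near_eq_cvg; near=> n; by rewrite mul1e EFinM.
  rewrite mul1e -EFinM; apply: cvg_EFin; first by near=> n. apply: cvgM; first exact: cvg_cst.
  have hc := ccvg_cabs (un_ccvg mu0 t hxi). by apply: cvgM; exact: hc.
- by move=> n; rewrite (fI _ (cmeas_un mu0 n)); apply: un_sq_bound => //; rewrite gA.
Unshelve. all: by end_near. Qed.

(** Supplies the hypothesis [hP] under which the transform of h is shown to be square integrable. *)
Lemma Nhat_usol_sq_lty T : 0 <= T ->
  (\int[mu]_xi \int[leb]_t ((tri T t)%:E * (cabs (Nhat (usol t) xi) ^+ 2)%:E) < +oo)%E.
Proof.
move=> T0; have nt := @nnfun_tri R T.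
have mN : cmeas (fun p : TR * V => Nhat (usol p.1) p.2).
  exact: (cmeas_Nhat (X := TR) (u := fun s : TR => usol s) (cmeas_usol mu0)).
have nn := nnfun_sqint_time (cmeas_usol mu0).
have k2 : (0 <= ((5^-1 : R) ^+ 2)%:E)%E by rewrite lee_fin sqr_ge0.
rewrite (int_tri_sq (v := fun t => Nhat (usol t)) T mN).
apply: (@le_lt_trans _ _ (((5^-1) ^+ 2)%:E * \int[leb]_t ((tri T t)%:E * sqint mu (usol t)))%E); last first.
  by apply: mule_lty => //; [rewrite ltry|exact: usol_sq_lty].
rewrite -(integralZ leb k2 (nnfunM nt nn)); apply: int_mono.
- exact: nnfunM nt (nnfun_sqint_time (v := fun t => Nhat (usol t)) mN).
- meas.
move=> t; rewrite muleCA; apply: lee_wpmul2l; first exact: nt.2.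
apply: (sqint_Nhat_le (cmeas_curry t (cmeas_usol mu0)) (nnfun_Msup mu0) _ k0 rsum_Msup_le).
by move=> x; exact: usol_le.
Qed.

End picard_L2.

Lemma dnbhs_harmonic {R : realType} : (fun n : nat => n.+1%:R^-1 : R) @ \oo --> (0 : R)^'.
Proof.
move=> A hA; have : \forall n \near \oo, (harmonic n : R) != 0 -> A (harmonic n).
  exact: (@cvg_harmonic R (fun t => t != 0 -> A t) hA).
apply: (@filterS _ \oo _ (fun n => (harmonic n : R) != 0 -> A (harmonic n))
  (fun n => A (n.+1%:R^-1))) => n /= h.
by apply: h; rewrite invr_eq0 pnatr_eq0.
Qed.

(** The derivative along the steps 1/(n+1), a form suited to dominated convergence. *)
Lemma cvg_derive_harmonic {R : realType} (f : R -> R) (x l : R) : is_derive x 1 f l ->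
  (fun n : nat => n.+1%:R * (f (n.+1%:R^-1 + x) - f x)) @ \oo --> l.
Proof.
move=> [df <-]; have := cvg_comp _ _ dnbhs_harmonic df.
rewrite /= (_ : _ \o _ = fun n : nat => n.+1%:R * (f (n.+1%:R^-1 + x) - f x))//.
by apply/funext => n /=; rewrite invrK /GRing.scale/= mulr1.
Qed.

Lemma cint_sum_seq {R : realType} d0 (T : measurableType d0) (m : {measure set T -> \bar R})
    (I : Type) (r : seq I) (F : I -> T -> R[i]) : (forall i, cL1 m (F i)) ->
  cL1 m (fun x => \sum_(i <- r) F i x) /\
  cint m (fun x => \sum_(i <- r) F i x) = \sum_(i <- r) cint m (F i).
Proof.
move=> hF; elim: r => [|i r [L E]].
  have e : (fun x => \sum_(i <- [::]) F i x) = fun=> 0 by apply/funext => x; rewrite big_nil.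
  by rewrite e big_nil; split; [exact: cL1_0|exact: cint0].
have e : (fun x => \sum_(j <- i :: r) F j x) = fun x => F i x + \sum_(j <- r) F j x.
  by apply/funext => x; rewrite big_cons.
by rewrite e big_cons; split; [exact: cL1D|rewrite (cintD (hF i) L) E].
Qed.

(** * Fourier transform of test functions *)

Section test_functions.
Context {R : realType} {d : nat}.
Notation V := 'rV[R]_d.
Notation C := R[i].
Notation mu := (lebesgue_rV d).
Implicit Types (phi : V -> R) (x xi : V) (i : 'I_d).
Notation ee i := (delta_mx ord0 i : V).
Notation c0 := (@fourier_cst R d).

Lemma test_partial phi i : test_function phi -> test_function (partial i phi).
Proof.
move=> [hs hc]; split.
  move=> s; have E : partials s (partial i phi) = partials (rcons s i) phi.
    by rewrite /partials foldr_rcons.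
  by rewrite E; exact: hs.
apply: (subclosed_compact _ hc); first exact: closed_closure.
suff h : [set x | partial i phi x != 0] `<=` closure [set x | phi x != 0].
  apply: (subset_trans (closure_subset h)).
  by rewrite -(closure_id (closure _)).1; [exact: subset_refl|exact: closed_closure].
move=> x /= dx; apply: contrapT => nx.
have : \near x, phi x = (cst 0 : V -> R) x.
  have : open (~` closure [set x | phi x != 0]) by apply: closed_openC; exact: closed_closure.
  move=> oA; have := open_nbhs_nbhs (conj oA nx). apply: filterS => y ny; apply/eqP; apply: contrapT => /negP h.
  by apply: ny; apply: subset_closure.
by move=> /(near_eq_derive (ee i)) e; move: dx; rewrite /partial e derive_cst eqxx.
Qed.

Lemma test_continuous phi : test_function phi -> continuous phi.
Proof. by move=> [/(_ [::])[]]. Qed.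

Lemma test_support phi : test_function phi -> exists n, forall x, ~ cbox n x -> phi x = 0.
Proof.
move=> [_ hc]; have [n hn] := compact_sub_cbox hc.
exists n => x nx; apply/eqP; apply: contrapT => /negP h.
by apply: nx; apply: hn; exact: subset_closure.
Qed.

Lemma test_bounded phi : test_function phi -> exists2 B : R, 0 <= B & forall x, `|phi x| <= B.
Proof.
move=> tphi; have cphi := test_continuous tphi.
have hK := tphi.2.
have : compact (phi @` closure [set x | phi x != 0]).
  by apply: continuous_compact => //; exact: continuous_subspaceT.
move=> /compact_bounded[M [_ hM]]; exists (`|M| + 1); first meas.
move=> x; have [->|px] := eqVneq (phi x) 0; first by rewrite normr0 addr_ge0.
apply: (hM (`|M| + 1)); first by rewrite (le_lt_trans (ler_norm _))// ltrDl.
by exists x => //; apply: subset_closure.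
Qed.

Lemma test_meas phi : test_function phi -> mfunT phi.
Proof. by move=> /test_continuous; exact: cont_measurable_rV. Qed.

Lemma cL1_supported (f : V -> C) n (B : R) : cmeas f -> (forall x, ~ cbox n x -> f x = 0) ->
  (forall x, cabs (f x) <= B) -> cL1 mu f.
Proof.
move=> mf f0 fB; have E : f = fun x => ind (cbox n) x * f x.
  apply/funext => x; rewrite /ind indicE; have [_|/negP h] := boolP (x \in _); first by rewrite mul1r.
  by rewrite mul0r f0// => /mem_set.
by rewrite E; apply: (cL1_ind_bounded (M := B) (meas_cbox n)) => //; exact: obox_lty.
Qed.

Lemma cL1_test phi : test_function phi -> cL1 mu (tocx phi).
Proof.
move=> tphi; have [n hn] := test_support tphi.
have [B B0 hB] := test_bounded tphi.
apply: (cL1_supported (n := n) (B := B)).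
- by apply: cmeas_tocx; exact: test_meas.
- by move=> x /hn; rewrite /tocx => ->.
- by move=> x; rewrite cabs_real.
Qed.

Lemma is_derive_line phi x v (t : R) : derivable phi (x + t *: v) v ->
  is_derive t 1 (fun s : R => phi (x + s *: v)) ('D_v phi (x + t *: v)).
Proof.
move=> dphi.
have E : (fun h : R => h^-1 *: (((fun s : R => phi (x + s *: v)) \o shift t) (h *: (1 : R)) - phi (x + t *: v))) =
   (fun h => h^-1 *: ((phi \o shift (x + t *: v)) (h *: v) - phi (x + t *: v))).
  apply/funext => h /=; congr (_ *: (phi _ - _)). have h1 : h *: (1 : R) = h by rewrite /GRing.scale /= mulr1.
  by rewrite h1 scalerDl addrCA.
split; first by rewrite /derivable E; exact: dphi.
by rewrite /derive E.
Qed.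

Lemma test_derivable phi i x : test_function phi -> derivable phi x (ee i).
Proof. by move=> [/(_ [::])[_ h] _]; exact: h. Qed.

(** Integration by parts through difference quotients: a translation by 1/(n+1) along the i-th axis
    multiplies the transform by a phase, whose quotient tends to -i xi_i, while dominated
    convergence yields the derivative under the integral. *)
Lemma ift_partial phi i xi : test_function phi ->
  ift (tocx (partial i phi)) xi = Complex 0 (- xi ord0 i) * ift (tocx phi) xi.
Proof.
move=> tphi; have tp := test_partial i tphi.
have [B B0 hB] := test_bounded tp.
have [N hN] := test_support tphi.
pose v := ee i.
pose g n x : C := (n.+1%:R * (phi (x + n.+1%:R^-1 *: v) - phi x))%:C.
have mcx : cmeas (fun x : V => cexp (dotv xi x) : C) by apply: cmeas_cexp; exact: meas_dotv.
have f1 := cL1_test tphi; have mp := test_meas tphi.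
have mg n : cmeas (g n).
  apply: cmeas_real; apply: measurable_funM; first meas. apply: measurable_funB => //.
  exact: (measurableT_comp mp (meas_addr (n.+1%:R^-1 *: v))).
have n0 n : (n.+1%:R : R) != 0 by rewrite pnatr_eq0.
have line x (t : R) : is_derive t 1 (fun s : R => phi (x + s *: v)) (partial i phi (x + t *: v)).
  by apply: is_derive_line; exact: test_derivable.
have gB n x : cabs (g n x) <= B.
  have h0 : 0 < n.+1%:R^-1 :> R by rewrite invr_gt0.
  have [|c _] := @MVT _ (fun s : R => phi (x + s *: v)) (fun s => partial i phi (x + s *: v)) 0 n.+1%:R^-1 h0 (fun s _ => line x s).
    apply: continuous_subspaceT => t; apply: differentiable_continuous; apply/derivable1_diffP.
    exact: (@ex_derive _ _ _ _ _ _ _ (line x t)).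
  rewrite scale0r addr0 subr0 => e; rewrite /g cabs_real e mulrCA mulfV// mulr1; exact: hB.
(* Steps are at most 1, so all quotients vanish outside the support cube enlarged by 1. *)
have gN n x : ~ cbox N.+1 x -> g n x = 0.
  move=> nx; rewrite /g (hN x); last by move=> h; apply: nx; exact: (cbox_subset (leqnSn N)).
  rewrite (hN (x + _)) ?subrr ?mulr0// => h; apply: nx => j /=. have := h j; rewrite /= !in_itv /= !mxE eqxx /=.
  have hn1 : n.+1%:R^-1 <= 1 :> R by rewrite invf_le1// ler1n. have hn0 : 0 <= n.+1%:R^-1 :> R by [].
  have hN1 : (N.+1%:R : R) = N%:R + 1 by rewrite natr1.
  rewrite hN1; move: (n.+1%:R^-1 : R) (N%:R : R) hn1 hn0 => q M hn1 hn0.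
  by case: (j == i); rewrite ?mulr1 ?mulr0 => /andP[h1 h2]; apply/andP; split; lra.
have gcv x : ccvg (g ^~ x) (tocx (partial i phi) x).
  apply: ccvg_ReIm => /=; last exact: cvg_cst. have := cvg_derive_harmonic (line x 0); rewrite scale0r addr0.
  by under eq_fun do rewrite addr0.
have dct : ccvg (fun n => cint mu (fun x => g n x * cexp (dotv xi x)))
    (cint mu (fun x => tocx (partial i phi) x * cexp (dotv xi x))).
  refine (cint_dct (fun n => cmeasM (mg n) mcx) (cmeasM (cL1_test tp).1 mcx) (g := fun x => (B * \1_(cbox N.+1) x)%:E) _ _ _).2.
  - have cB (x : V) : cabs (B%:C : C) <= B by rewrite cabs_real ger0_norm.
    have := cL1_cabs (cL1_ind_bounded (meas_cbox N.+1) (obox_lty _ _) (cmeas_cst B%:C) cB).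
    rewrite (_ : (fun x : V => _) = fun x : V => (B * \1_(cbox N.+1) x)%:E)//.
    by apply/funext => x; rewrite cabsM cabs_ind cabs_real ger0_norm// mulrC.
  - by apply: aeW => x; exact: (ccvgM (gcv x) (ccvg_cst _)).
  - apply: aeW => x n; rewrite lee_fin cabsM cabs_cexp mulr1 indicE.
    have [_|/negP h] := boolP (x \in _); first by rewrite mulr1; exact: gB. by rewrite gN ?cabs0 ?mulr0// => /mem_set.
have E n : cint mu (fun x => g n x * cexp (dotv xi x)) =
    (n.+1%:R%:C * (cexp (- (n.+1%:R^-1 * xi ord0 i)) - 1)) * cint mu (fun x => tocx phi x * cexp (dotv xi x)).
  have f1x := cL1_cexp xi f1. have s1 := cL1_addr (n.+1%:R^-1 *: v) f1x. rewrite mulrBr mulr1 mulrBl -!mulrA.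
  rewrite -[in X in _ * (_ * X)](cint_addr (n.+1%:R^-1 *: v) f1x.1).
  rewrite -(cintZ _ s1) -(cintZ _ f1x) -(cintZ _ (cL1Z _ s1)) -(cintB (cL1Z _ (cL1Z _ s1)) (cL1Z _ f1x)).
  apply: eq_cint => x. have -> : dotv xi (x + n.+1%:R^-1 *: v) = n.+1%:R^-1 * xi ord0 i + dotv xi x.
    rewrite dotvC dotvD (dotvC x) addrC; congr (_ + _). rewrite /dotv (bigD1 i)//= big1 ?addr0; last first.
      by move=> j ji; rewrite !mxE (negbTE ji) mulr0 mul0r.
    by rewrite !mxE !eqxx mulr1.
  rewrite cexpD /g /tocx rmorphM rmorphB /=.
  have : cexp (- (n.+1%:R^-1 * xi ord0 i)) * cexp (n.+1%:R^-1 * xi ord0 i) = 1 :> C.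
    by rewrite -cexpD addNr cexp0.
  move: (cexp (- _)) (cexp (_ * _)) (cexp (dotv xi x)) (phi (x + _))%:C (phi x)%:C (n.+1%:R)%:C.
  move=> a b c p q k ab. rewrite (_ : k * (a * (p * (b * c))) = (a * b) * (k * (p * c))); last by ring.
  by rewrite ab; ring.
have lim : ccvg (fun n => (n.+1%:R%:C * (cexp (- (n.+1%:R^-1 * xi ord0 i)) - 1)) *
    cint mu (fun x => tocx phi x * cexp (dotv xi x)))
    (Complex 0 (- xi ord0 i) * cint mu (fun x => tocx phi x * cexp (dotv xi x))).
  apply: ccvgM; last exact: ccvg_cst. apply: ccvg_ReIm.
  - have dc : is_derive (0 : R) 1 (fun t => cos (- (t * xi ord0 i))) 0.
      apply: is_derive_eq; rewrite mul0r oppr0 sin0; move: (xi ord0 i) => z; rewrite /GRing.scale /=; ring.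
    have := cvg_derive_harmonic dc; rewrite mul0r oppr0 cos0. apply: cvg_trans; apply: near_eq_cvg; near=> n.
    by rewrite ReM ReD ReN /= addr0; ring.
  - have ds : is_derive (0 : R) 1 (fun t => sin (- (t * xi ord0 i))) (- xi ord0 i).
      apply: is_derive_eq; rewrite mul0r oppr0 cos0; move: (xi ord0 i) => z; rewrite /GRing.scale /=; ring.
    have := cvg_derive_harmonic ds; rewrite mul0r oppr0 sin0. apply: cvg_trans; apply: near_eq_cvg; near=> n.
    by rewrite ImM ImD ImN /= addr0; ring.
rewrite /ift mulrCA; congr (_ * _).
by apply: (ccvg_unique dct); under eq_fun do rewrite E.
Unshelve. all: by end_near. Qed.

Lemma ift_partial2 phi i xi : test_function phi ->
  ift (tocx (partial i (partial i phi))) xi = (- (xi ord0 i) ^+ 2)%:C * ift (tocx phi) xi.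
Proof.
move=> tphi; rewrite (ift_partial _ _ (test_partial i tphi)) (ift_partial _ _ tphi) mulrA.
by congr (_ * _); apply: complex_ext; rewrite ?ReM ?ImM /=; ring.
Qed.

Lemma tocx_laplacian phi : tocx (laplacian phi) =
  fun x => \sum_(i < d) tocx (partial i (partial i phi)) x.
Proof. by apply/funext => x; rewrite /tocx /laplacian rmorph_sum. Qed.

Lemma cL1_laplacian phi : test_function phi -> cL1 mu (tocx (laplacian phi)).
Proof.
move=> tphi; rewrite tocx_laplacian; apply: (cint_sum_seq _ _).1 => i.
by apply: cL1_test; do 2!apply: test_partial.
Qed.

Lemma ift_laplacian phi xi : test_function phi ->
  ift (tocx (laplacian phi)) xi = (- (enorm xi ^+ 2))%:C * ift (tocx phi) xi.
Proof.
move=> tphi; have t2 i : test_function (partial i (partial i phi)) by do 2!apply: test_partial.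
rewrite /ift tocx_laplacian.
have -> : cint mu (fun x => (\sum_(i < d) tocx (partial i (partial i phi)) x) * cexp (dotv xi x)) =
   cint mu (fun x => \sum_(i < d) (tocx (partial i (partial i phi)) x * cexp (dotv xi x))).
  by apply: eq_cint => x; rewrite mulr_suml.
rewrite (cint_sum_seq _ (fun i => cL1_cexp xi (cL1_test (t2 i)))).2 mulr_sumr.
have E i : c0%:C * cint mu (fun x => tocx (partial i (partial i phi)) x * cexp (dotv xi x)) =
    (- (xi ord0 i) ^+ 2)%:C * ift (tocx phi) xi by exact: ift_partial2.
under eq_bigr do rewrite E.
rewrite -mulr_suml; congr (_ * _); rewrite -rmorph_sum sumrN sqr_enorm /dotv.
by congr (- _)%:C; apply: eq_bigr => i _; rewrite expr2.
Qed.

(** The value of [ift_laplacian] at frequency 0. It lets e^{-w} be replaced by e^{-w} - 1 when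
    tested against a Laplacian. *)
Lemma cint_laplacian phi : test_function phi -> cint mu (tocx (laplacian phi)) = 0.
Proof.
move=> tphi; have := ift_laplacian 0 tphi.
have -> : enorm (0 : V) ^+ 2 = 0 by rewrite sqr_enorm dot0v.
rewrite oppr0 mul0r /ift => /eqP; rewrite mulf_eq0 => /orP[/eqP h|/eqP].
  by have := fourier_cst_gt0 (R := R) (d := d); move: h => [->]; rewrite ltxx.
by move=> h; rewrite -[RHS]h; apply: eq_cint => x; rewrite dot0v cexp0 mulr1.
Qed.

(* The transform of [phi - laplacian phi], against which transforms are tested. *)
Definition btest phi xi : C := (1 + enorm xi ^+ 2)%:C * ift (tocx phi) xi.

Lemma cL1_btest_aux phi : test_function phi -> cL1 mu (fun x => tocx phi x - tocx (laplacian phi) x).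
Proof. by move=> tphi; apply: cL1B; [exact: cL1_test|exact: cL1_laplacian]. Qed.

Lemma btestE phi xi : test_function phi ->
  btest phi xi = ift (fun x => tocx phi x - tocx (laplacian phi) x) xi.
Proof.
move=> tphi; rewrite (iftB _ (cL1_test tphi) (cL1_laplacian tphi)) ift_laplacian//.
by rewrite /btest rmorphD rmorphN rmorph1 mulrDl mul1r mulNr opprK.
Qed.

Lemma cmeas_btest phi : test_function phi -> cmeas (btest phi).
Proof.
move=> tphi; rewrite (_ : btest phi = ift (fun x => tocx phi x - tocx (laplacian phi) x)); last first.
  by apply/funext => xi; exact: btestE.
by apply: cmeas_ift; exact: (cL1_btest_aux tphi).1.
Qed.

Lemma btest_bounded phi : test_function phi -> exists2 B : R, 0 <= B & forall xi, cabs (btest phi xi) <= B.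
Proof.
move=> tphi; exists (\int[mu]_x cabs (tocx phi x - tocx (laplacian phi) x)).
  by apply: Rintegral_ge0 => x _; meas.
by move=> xi; rewrite btestE//; apply: cabs_ift_le; exact: cL1_btest_aux.
Qed.

Lemma sqint_ift_test phi : test_function phi -> (sqint mu (ift (tocx phi)) < +oo)%E.
Proof.
move=> tphi; apply: le_lt_trans (bessel_ift (cL1_test tphi)) _.
have [B B0 hB] := test_bounded tphi; have L := cL1_test tphi.
apply: (bounded_sqint_lty (M := B) L.1 _ L) => x; by rewrite cabs_real.
Qed.

End test_functions.

(** * Smooth compactly supported bumps *)

Section flat_functions.
Context {R : realType}.
Implicit Type t : R.

(** The powers of 1/t come along so that linear combinations of the family are stable under
    differentiation, the origin included. *)
Definition flat p t : R := if 0 < t then t^-1 ^+ p * expR (- t^-1) else 0.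

Lemma flat_ge0 p t : 0 <= flat p t.
Proof.
rewrite /flat; case: ifP => // t0; apply: mulr_ge0; last meas.
meas.
Qed.

(** From exp(1/t) >= (1/t)^(p+2) / (p+2)!. The quadratic bound gives the derivative 0 at the
    origin. *)
Lemma flat_le p t : flat p t <= p.+2`!%:R * t ^+ 2.
Proof.
rewrite /flat; case: ifPn => [t0|_]; last meas.
have i0 : 0 < t^-1 by rewrite invr_gt0.
have h := expR_ge1Dxn p.+1 (ltW i0).
have f0 : 0 < (p.+2`!%:R : R) by rewrite ltr0n fact_gt0.
have {}h : t^-1 ^+ p.+2 <= p.+2`!%:R * expR t^-1.
  rewrite mulrC -ler_pdivrMr//; apply: le_trans h; by rewrite lerDr.
rewrite expRN -ler_pdivlMr ?invr_gt0 ?expR_gt0// invrK.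
have -> : t^-1 ^+ p = t^-1 ^+ p.+2 * t ^+ 2.
  by rewrite -addn2 exprD -mulrA -exprMn mulVf ?gt_eqF// expr1n mulr1.
rewrite [leRHS]mulrAC; apply: ler_wpM2r; meas.
Qed.

Lemma is_derive_flat p t : is_derive t 1 (flat p) (flat p.+2 t - p%:R * flat p.+1 t).
Proof.
have [t0|t0|t0] := ltgtP 0 t; last rewrite -t0.
- have e : flat p.+2 t - p%:R * flat p.+1 t =
     (t^-1 ^+ p.+2 - p%:R * t^-1 ^+ p.+1) * expR (- t^-1).
    by rewrite /flat t0; ring.
  rewrite e; apply: (@near_eq_is_derive _ _ _ (fun s : R => s^-1 ^+ p * expR (- s^-1) : R)).
    have := lt_nbhsr t0; apply: filterS => s s0; by rewrite /flat s0.
  have dV : is_derive t 1 (fun s : R => s^-1) (- (t^-1 ^+ 2)).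
    have t1 : t != 0 by rewrite gt_eqF. have d1 : derivable (fun s : R => s) t 1 by exact: derivable_id.
    split; first exact: (derivableV t1 d1). by rewrite (deriveV t1 d1) derive_id /GRing.scale /= mulr1 exprVn.
  have dX : is_derive t 1 (fun s : R => s^-1 ^+ p) ((p%:R * t^-1 ^+ p.-1) * - (t^-1 ^+ 2)).
    rewrite (_ : (fun s : R => s^-1 ^+ p) = (fun s : R => s^-1) ^+ p); last first.
      by apply/funext => s; rewrite exprfctE.
    exact: (@is_deriveX _ _ (fun s : R => s^-1) p t 1 _ dV).
  have dE : is_derive t 1 (fun s : R => expR (- s^-1)) (expR (- t^-1) * t^-1 ^+ 2).
    have dN : is_derive t 1 (fun s : R => - s^-1) (t^-1 ^+ 2).
      by have := @is_deriveN _ _ _ (fun s : R => s^-1) t 1 _ dV; rewrite opprK.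
    exact: (@is_derive1_comp _ expR (fun s : R => - s^-1) t _ _ (is_derive_expR _) dN).
  have := @is_deriveM _ _ (fun s : R => s^-1 ^+ p) (fun s : R => expR (- s^-1)) t 1 _ _ dX dE.
  rewrite (_ : t^-1 ^+ p *: _ + _ = (t^-1 ^+ p.+2 - p%:R * t^-1 ^+ p.+1) * expR (- t^-1))//.
  rewrite /GRing.scale/=; move: (expR (- t^-1)) => a; move: (t^-1) => b.
  by case: (p) => [|q]; rewrite /= ?exprS; ring.
- have e : flat p.+2 t - p%:R * flat p.+1 t = 0.
    by rewrite /flat ltNge (ltW t0) /= mulr0 subr0.
  rewrite e; apply: (@near_eq_is_derive _ _ _ (fun=> 0)).
    have := lt_nbhsl t0; apply: filterS => s s0; by rewrite /flat ltNge (ltW s0).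
- have e : flat p.+2 0 - p%:R * flat p.+1 0 = 0 by rewrite /flat ltxx mulr0 subr0. rewrite e.
  have lim : h^-1 *: ((flat p \o shift 0) (h *: (1 : R)) - flat p 0) @[h --> 0^'] --> (0 : R).
    apply/cvgr0Pnorm_le => e0 e00. have K0 : 0 < (p.+2`!%:R : R) by rewrite ltr0n fact_gt0. near=> h.
    have h0 : h != 0 by near: h; exact: nbhs_dnbhs_neq. have -> : h *: (1 : R) = h by rewrite /GRing.scale /= mulr1.
    rewrite /= addr0 {2}/flat ltxx subr0 /GRing.scale /= normrM normfV ler_pdivrMl ?normr_gt0//.
    rewrite (ger0_norm (flat_ge0 _ _)); apply: le_trans (flat_le _ _) _.
    rewrite -real_normK ?num_real// expr2 mulrA mulrC; apply: ler_wpM2l => //.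
    rewrite mulrC -ler_pdivlMr//; near: h; apply: dnbhs0_le. by rewrite divr_gt0.
  split; first by apply: cvgP lim. exact: cvg_lim lim.
Unshelve. all: by end_near. Qed.

Lemma cont_flat p : continuous (flat p).
Proof.
move=> t; apply: differentiable_continuous; apply/derivable1_diffP.
exact: (@ex_derive _ _ _ _ _ _ _ (is_derive_flat p t)).
Qed.

Lemma flat0_le1 t : flat 0 t <= 1.
Proof.
rewrite /flat; case: ifPn => // t0; rewrite expr0 mul1r expRN_le1// invr_ge0 ltW //.
Qed.

Lemma cvg_flat0 t : (fun n => flat 0 (n.+1%:R * t)) @ \oo --> ((0 < t)%R%:R : R).
Proof.
have [t0|t0] := ltP 0 t; last first.
  rewrite (_ : (fun n => _) = fun=> 0); first exact: cvg_cst.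
  by apply/funext => n; rewrite /flat pmulr_rgt0// ltNge t0.
rewrite (_ : (fun n => _) = fun n : nat => expR (- (n.+1%:R^-1 * t^-1))); last first.
  by apply/funext => n; rewrite /flat pmulr_rgt0// t0 expr0 mul1r invfM.
rewrite -[X in _ --> X]expR0.
have lim : (fun n : nat => - (n.+1%:R^-1 * t^-1)) @ \oo --> (0 : R).
  rewrite -oppr0; apply: cvgN; rewrite -[X in _ --> X](mul0r t^-1); apply: cvgM; last exact: cvg_cst.
  exact: cvg_harmonic.
exact: (cvg_comp _ _ lim (@continuous_expR R 0)).
Qed.

End flat_functions.

Section smooth_products.
Context {R : realType} {d : nat}.
Notation V := 'rV[R]_d.
Implicit Types (f g : V -> R) (x : V) (i : 'I_d).
Notation ee i := (delta_mx ord0 i : V).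

(** A syntactic class closed under partial derivatives, so that smoothness of its members follows by
    induction on the list of directions. *)
Inductive flat_alg : (V -> R) -> Prop :=
| flat_alg_cst (k : R) : flat_alg (fun=> k)
| flat_alg_flat p i (a b : R) : flat_alg (fun x => flat p (a * x ord0 i + b))
| flat_algD f g : flat_alg f -> flat_alg g -> flat_alg (fun x => f x + g x)
| flat_algM f g : flat_alg f -> flat_alg g -> flat_alg (fun x => f x * g x).

Lemma flat_alg_continuous f : flat_alg f -> continuous f.
Proof.
elim=> {f} [k|p i a b|f g _ cf _ cg|f g _ cf _ cg] x.
- exact: cst_continuous.
- apply: (@continuous_comp _ _ _ (fun x : V => x ord0 i) (fun t : R => flat p (a * t + b))).
    exact: coord_continuous.
  move=> t; apply: (@continuous_comp _ _ _ (fun t : R => a * t + b) (flat p)); last exact: cont_flat.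
  by apply: cvgD; [apply: cvgM; [exact: cvg_cst|exact: cvg_id]|exact: cvg_cst].
- exact: (cvgD (cf x) (cg x)).
- exact: (cvgM (cf x) (cg x)).
Qed.

Lemma is_derive_along f x v (l : R) :
  is_derive (0 : R) 1 (fun s : R => f (x + s *: v)) l -> is_derive x v f l.
Proof.
have E : (fun h : R => h^-1 *: (((fun s : R => f (x + s *: v)) \o shift 0) (h *: (1 : R)) - f (x + 0 *: v))) =
   (fun h => h^-1 *: ((f \o shift x) (h *: v) - f x)).
  apply/funext => h /=; have h1 : h *: (1 : R) = h by rewrite /GRing.scale /= mulr1.
  by rewrite h1 addr0 scale0r addr0 (addrC x).
move=> [df dl]; split; first by move: df; rewrite /derivable E.
by move: dl; rewrite /derive E.
Qed.

Lemma flat_alg_derive f j : flat_alg f ->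
  exists2 g, flat_alg g & forall x, is_derive x (ee j) f (g x).
Proof.
elim=> {f} [k|p i a b|f g sf [f' sf' df] sg [g' sg' dg]|f g sf [f' sf' df] sg [g' sg' dg]].
- by exists (fun=> 0); [exact: flat_alg_cst|move=> x; exact: is_derive_cst].
- exists (fun x => (flat p.+2 (a * x ord0 i + b) + (- p%:R) * flat p.+1 (a * x ord0 i + b)) *
     (a * (i == j)%:R)).
    apply: flat_algM; last exact: flat_alg_cst. apply: flat_algD; first exact: flat_alg_flat.
    by apply: flat_algM; [exact: flat_alg_cst|exact: flat_alg_flat].
  move=> x; have := is_derive_flat p (a * x ord0 i + b). rewrite -mulNr => d1; apply: is_derive_along.
  have da : is_derive (0 : R) 1 (fun s : R => (a * (i == j)%:R) * s + (a * x ord0 i + b)) (a * (i == j)%:R).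
    apply: is_derive_eq; rewrite /GRing.scale /=; ring.
  rewrite (_ : (fun s : R => _) = (flat p \o (fun s : R => (a * (i == j)%:R) * s + (a * x ord0 i + b)))).
    apply: (@is_derive1_comp _ (flat p) _ 0 _ _ _ da). by rewrite mulr0 add0r.
  apply/funext => s /=; rewrite !mxE eqxx /=; congr (flat p _); ring.
- exists (fun x => f' x + g' x); first exact: flat_algD. by move=> x; exact: is_deriveD.
- exists (fun x => f x * g' x + g x * f' x).
    by apply: flat_algD; apply: flat_algM.
  by move=> x; exact: is_deriveM.
Qed.

Lemma flat_alg_partials s f : flat_alg f -> flat_alg (partials s f).
Proof.
move=> sf; elim: s => //= j s IH; have [g sg dg] := flat_alg_derive j IH.
rewrite (_ : partial j (partials s f) = g)//; apply/funext => x.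
by rewrite /partial; exact: (@derive_val _ _ _ _ _ _ _ (dg x)).
Qed.

Lemma test_flat_alg f n : flat_alg f -> (forall x, ~ cbox n x -> f x = 0) -> test_function f.
Proof.
move=> sf f0; split.
  move=> s; have ss := flat_alg_partials s sf; split; first exact: flat_alg_continuous.
  move=> i x; have [g _ dg] := flat_alg_derive i ss. exact: (@ex_derive _ _ _ _ _ _ _ (dg x)).
pose K : set V := [set x | forall i, `[- n%:R, n%:R]%classic (x ord0 i)].
have cK : compact K by apply: (@rV_compact R d (fun=> `[- n%:R, n%:R]%classic)) => i; exact: segment_compact.
apply: (@subclosed_compact _ _ K _ cK); first exact: closed_closure.
rewrite (closure_id K).1; last exact: (compact_closed _ cK).
apply: closure_subset => x /= /negP fx i; have : cbox n x by apply: contrapT => h; apply: fx; rewrite f0.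
by move=> /(_ i); rewrite /= !in_itv /= => /andP[/ltW -> ->].
Qed.

Lemma flat_alg_prod (F : 'I_d -> V -> R) : (forall i, flat_alg (F i)) ->
  flat_alg (fun x => \prod_(i < d) F i x).
Proof.
move=> hF; have : forall r : seq 'I_d, flat_alg (fun x => \prod_(i <- r) F i x); last exact.
elim=> [|i r IH].
  rewrite (_ : (fun x => _) = fun=> 1); first exact: flat_alg_cst. by apply/funext => x; rewrite big_nil.
rewrite (_ : (fun x => _) = fun x => F i x * \prod_(j <- r) F j x); first exact: flat_algM.
by apply/funext => x; rewrite big_cons.
Qed.

(** As n grows each factor tends to 1 on the open box while the support stays put, so indicators of
    boxes are bounded limits of test functions. *)
Definition bump (a b : 'I_d -> R) n x : R :=
  \prod_(i < d) (flat 0 (n.+1%:R * x ord0 i + - (n.+1%:R * a i)) *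
                 flat 0 (- n.+1%:R * x ord0 i + n.+1%:R * b i)).

Lemma bump_ge0 a b n x : 0 <= bump a b n x.
Proof. by apply: prodr_ge0 => i _; apply: mulr_ge0; exact: flat_ge0. Qed.

Lemma bump_le1 a b n x : bump a b n x <= 1.
Proof.
apply: prodr_itv01 => i; apply/andP; split; first by apply: mulr_ge0; exact: flat_ge0.
by apply: mulr_ile1; rewrite ?flat_ge0 ?flat0_le1.
Qed.

Lemma flat_gt0 (p : nat) (t : R) : (0 < flat p t) = (0 < t).
Proof.
rewrite /flat; case: ifPn => t0; last by rewrite ltxx.
by rewrite mulr_gt0 ?expR_gt0 ?exprn_gt0 ?invr_gt0.
Qed.

Lemma flat_eq0 (p : nat) (t : R) : t <= 0 -> flat p t = 0.
Proof. by move=> t0; rewrite /flat ltNge t0. Qed.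

Lemma bump_eq0 a b n x i : ~~ (a i < x ord0 i < b i) -> bump a b n x = 0.
Proof.
move=> h; rewrite /bump (bigD1 i)//=.
have n0 : 0 < n.+1%:R :> R by [].
suff -> : flat 0 (n.+1%:R * x ord0 i + - (n.+1%:R * a i)) *
    flat 0 (- n.+1%:R * x ord0 i + n.+1%:R * b i) = 0 by rewrite mul0r.
move: h; rewrite negb_and -!leNgt => /orP[h|h].
- by rewrite flat_eq0 ?mul0r// -mulrBr pmulr_rle0// subr_le0.
- have z : - n.+1%:R * x ord0 i + n.+1%:R * b i <= 0.
    by rewrite mulNr addrC -mulrBr pmulr_rle0// subr_le0.
  by rewrite (flat_eq0 _ z) mulr0.
Qed.

Lemma bump_gt0 a b n x : (forall i, a i < x ord0 i < b i) -> 0 < bump a b n x.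
Proof.
move=> h; apply: prodr_gt0 => i _; have n0 : 0 < n.+1%:R :> R by [].
have /andP[h1 h2] := h i.
apply: mulr_gt0; rewrite flat_gt0.
  by rewrite -mulrBr pmulr_rgt0// subr_gt0.
by rewrite mulNr addrC -mulrBr pmulr_rgt0// subr_gt0.
Qed.

Lemma test_bump a b n : test_function (bump a b n).
Proof.
have [N hN] := obox_sub_cbox a b.
apply: (@test_flat_alg _ N).
  by apply: flat_alg_prod => i; apply: flat_algM; exact: flat_alg_flat.
move=> x nx; have /existsNP[i hi] : ~ forall i, a i < x ord0 i < b i.
  by move=> h; apply: nx; apply: hN => i /=; rewrite in_itv /=; have /andP[-> /ltW ->] := h i.
by apply: (@bump_eq0 a b n x i); apply/negP.
Qed.

(** Only the faces x_i = b_i are excluded: bumps vanish there, whereas the box is closed on that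
    side. *)
Lemma cvg_bump a b x : (forall i, x ord0 i != b i) ->
  (fun n => bump a b n x) @ \oo --> (\1_(obox a b) x : R).
Proof.
move=> xb.
have -> : (\1_(obox a b) x : R) = \prod_(i < d) ((0 < x ord0 i - a i)%R%:R * (0 < b i - x ord0 i)%R%:R).
  rewrite indicE; have [/set_mem h|/negP h] := boolP (x \in _).
    rewrite big1// => i _; have := h i; rewrite /= in_itv /= => /andP[h1 h2].
    by rewrite !subr_gt0 h1 lt_neqAle xb h2 mulr1.
  have /existsNP[i hi] : ~ forall i, a i < x ord0 i <= b i.
    by move=> h'; apply: h; apply/mem_set => i /=; rewrite in_itv /=.
  rewrite (bigD1 i)//= !subr_gt0; move: hi; rewrite [_ <= b i]le_eqVlt (negbTE (xb i)) /=.
  by case: (a i < _); case: (_ < b i); rewrite ?mulr0 ?mul0r.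
apply: cvg_prod_ord => i; apply: cvgM.
- rewrite (_ : (fun n => _) = fun n => flat 0 (n.+1%:R * (x ord0 i - a i))); first exact: cvg_flat0.
  by apply/funext => n; rewrite mulrBr.
- rewrite (_ : (fun n => _) = fun n => flat 0 (n.+1%:R * (b i - x ord0 i))); first exact: cvg_flat0.
  by apply/funext => n; rewrite mulrBr mulNr addrC.
Qed.

End smooth_products.

Lemma cL1_bounded_mul {R : realType} d0 (T : measurableType d0) (m : {measure set T -> \bar R})
    (f g : T -> R[i]) (B : R) : 0 <= B -> cL1 m f -> cmeas g -> (forall x, cabs (g x) <= B) ->
  cL1 m (fun x => f x * g x).
Proof.
move=> B0 [mf fo] mg gB; have mfg := cmeasM mf mg; split => //.
apply: (@le_lt_trans _ _ (\int[m]_x (B%:E * (cabs (f x))%:E))%E).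
  apply: int_mono; [meas|by apply: nnfunZ; [rewrite lee_fin|meas]|].
  by move=> x; rewrite -EFinM lee_fin cabsM mulrC; apply: ler_wpM2r; meas.
rewrite integralZ; [|meas|meas].
by apply: mule_lty => //; rewrite ?lee_fin ?ltry.
Qed.

(** * Fundamental lemma for functions and for transforms *)

Section fundamental_lemma.
Context {R : realType} {d : nat}.
Notation V := 'rV[R]_d.
Notation C := R[i].
Notation mu := (lebesgue_rV d).
Implicit Types (phi : V -> R) (x xi : V).
Notation c0 := (@fourier_cst R d).

Lemma loc_integrable_cbox (g : V -> R) n : loc_integrable g ->
  cL1 mu (fun x => ind (cbox n) x * tocx g x).
Proof.
move=> [mg hg]; pose K : set V := [set x | forall i, `[- n%:R, n%:R]%classic (x ord0 i)].
have cK : compact K by apply: (@rV_compact R d (fun=> `[- n%:R, n%:R]%classic)) => i; exact: segment_compact.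
have sK : cbox n `<=` K.
  by move=> x h i; have := h i; rewrite /= !in_itv /= => /andP[/ltW -> ->].
have := integrableS (compact_measurable_rV cK) (meas_cbox n) sK (hg _ cK).
move=> /integrable_abse /integrable_lty => h.
split; first by apply: cmeasM; [apply: cmeas_ind; exact: meas_cbox|meas].
have -> : (\int[mu]_x (cabs (ind (cbox n) x * tocx g x))%:E = \int[mu]_(x in cbox n) (`|g x|)%:E)%E.
  rewrite [RHS]integral_mkcond; apply: eq_integral => x _. rewrite cabsM cabs_ind /tocx cabs_real patchE indicE.
  by case: ifP => _; rewrite ?mul1r ?mul0r.
apply: h; meas.
Qed.

Lemma test_ae0 (g : V -> R) : loc_integrable g ->
  (forall phi, test_function phi -> \int[mu]_x (g x * phi x) = 0) ->
  {ae mu, forall x, g x = 0}.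
Proof.
move=> hg g0; have mg : cmeas (tocx g) by apply: cmeas_tocx; exact: hg.1.
have L n := loc_integrable_cbox n hg.
suff : {ae mu, forall x, tocx g x = 0}.
  by apply: filterS => x; rewrite /tocx => -[].
apply: (cint_box_ae0 mg L) => a b ab.
have Lab := cL1_obox a b mg L.
have mb n : cmeas (fun x => (bump a b n x)%:C : C).
  by apply: cmeas_real; apply: test_meas; exact: test_bump.
have z n : cint mu (fun x => (bump a b n x)%:C * tocx g x) = 0.
  apply: complex_ext; rewrite ?Re_cint ?Im_cint /=.
  - rewrite -[RHS](g0 (bump a b n))//; last exact: test_bump.
    by apply: eq_Rintegral => x _; rewrite mul0r subr0 mulrC.
  - under eq_Rintegral do rewrite mul0r mulr0 addr0. by rewrite /Rintegral integral0.
have [_ lim] : cL1 mu (fun x => ind (obox a b) x * tocx g x) /\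
    ccvg (fun n => cint mu (fun x => (bump a b n x)%:C * tocx g x)) (cint mu (fun x => ind (obox a b) x * tocx g x)).
  apply: (cint_dct (fun n => cmeasM (mb n) mg) Lab.1 (cL1_cabs Lab)).
  - have := ae_coord_neq b; apply: filterS => x hx; apply: ccvgM; last exact: ccvg_cst.
    by apply: ccvg_ReIm => /=; [exact: cvg_bump|exact: cvg_cst].
  - apply: aeW => x n; rewrite lee_fin !cabsM cabs_ind cabs_real ger0_norm ?bump_ge0//.
    apply: ler_wpM2r; first meas. rewrite indicE; have [_|/negP h] := boolP (x \in _); first exact: bump_le1.
    have /existsNP[i hi] : ~ forall i, a i < x ord0 i < b i.
      move=> h'; apply: h; apply/mem_set => i /=; rewrite in_itv /=. by have /andP[-> /ltW ->] := h' i.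
    by rewrite (@bump_eq0 _ _ a b n x i)//; apply/negP.
apply: (ccvg_unique lim); rewrite (_ : (fun n => _) = fun=> 0); first exact: ccvg_cst.
by apply/funext => n; exact: z.
Qed.

Lemma bump_addr (a b : 'I_d -> R) n (v x : V) :
  bump a b n (x + v) = bump (fun i => a i - v ord0 i) (fun i => b i - v ord0 i) n x.
Proof.
apply: eq_bigr => i _; rewrite mxE; congr (flat 0 _ * flat 0 _); ring.
Qed.

Lemma ift_addr (f : V -> C) v xi : cL1 mu f ->
  ift (fun x => f (x + v)) xi = cexp (- dotv xi v) * ift f xi.
Proof.
move=> Lf; have Lc := cL1_cexp xi Lf; have Lv := cL1_addr v Lc.
rewrite /ift mulrCA; congr (_ * _); rewrite -(cint_addr v Lc.1) -(cintZ _ Lv).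
apply: eq_cint => x.
have -> : dotv xi (x + v) = dotv xi v + dotv xi x by rewrite dotvC dotvD addrC !(dotvC _ xi).
rewrite cexpD; have := cexpD (- dotv xi v) (dotv xi v); rewrite addNr cexp0.
move: (cexp (- _)) (cexp (dotv xi v)) (cexp (dotv xi x)) (f _) => p q r s pq.
by rewrite (_ : p * (s * (q * r)) = (p * q) * (s * r)); [rewrite -pq mul1r|ring].
Qed.

Lemma int_gt0_box (f : V -> R) a b : (forall i, a i < b i) -> mfunT f ->
  (forall x, 0 <= f x) -> (forall x, (forall i, a i < x ord0 i < b i) -> 0 < f x) ->
  cL1 mu (tocx f) -> 0 < \int[mu]_x f x.
Proof.
move=> ab mf f0 fp Lf; rewrite lt_neqAle Rintegral_ge0 ?andbT//; apply/eqP => h.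
have Io : (\int[mu]_x (f x)%:E < +oo)%E.
  have [_] := Lf; by under eq_integral do rewrite cabs_real ger0_norm//.
have I0 : (\int[mu]_x (f x)%:E = 0)%E.
  rewrite -[LHS]fineK; first by rewrite -[fine _]h. by rewrite ge0_fin_numE; meas.
have := @ae_eq_integral_abs _ V R mu setT measurableT (fun x => (f x)%:E) ((measurable_EFinP _ _).2 mf).
under eq_integral do rewrite gee0_abs ?lee_fin//.
move=> [] /(_ I0) [N [mN N0 sN]] _.
(* [obox] is closed on the right; stopping at the midpoints keeps the comparison box inside the open
   one. *)
pose m i := (a i + b i) / 2.
have : (mu (obox a m) <= mu N)%E.
  apply: le_measure; rewrite ?inE//; first exact: meas_obox. move=> x hx; apply: sN => /(_ I) [] fx0.
  suff : 0 < f x by rewrite fx0 ltxx. apply: fp => i; have := hx i; rewrite /= in_itv /= => /andP[-> h2] /=.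
  apply: le_lt_trans h2 _; rewrite /m; have := ab i; lra.
rewrite N0 lebesgue_rV_obox; last by move=> i; rewrite /m; have := ab i; lra.
rewrite lee_fin leNgt => /negP; apply; apply: prodr_gt0 => i _.
by rewrite /m; have := ab i; lra.
Qed.

Definition kbump k : V -> R := bump (fun=> - k.+1%:R^-1) (fun=> k.+1%:R^-1) 0.

(** On a support so small that |xi.x| <= 1/2 the cosine is positive, hence so is the real part of
    the transform of a nonnegative bump. *)
Lemma ift_kbump_neq0 xi : exists k, ift (tocx (kbump k)) xi != 0.
Proof.
pose S := \sum_(i < d) `|xi ord0 i|.
have S0 : 0 <= S by apply: sumr_ge0.
pose k := Num.truncn (S * 2).
have Sk : S * 2 < k.+1%:R by rewrite -truncn_le_nat // real_truncnS_gt.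
exists k; have k0 : 0 < (k.+1%:R^-1 : R) by rewrite invr_gt0.
have tk : test_function (kbump k) by exact: test_bump.
have dk x : (forall i, - k.+1%:R^-1 < x ord0 i < k.+1%:R^-1) -> 0 < cos (dotv xi x).
  move=> hx; have h1 : `|dotv xi x| <= 2^-1.
    apply: (via (S * k.+1%:R^-1)).
      apply: le_trans (ler_norm_sum _ _ _) _; rewrite /S mulr_suml; apply: ler_sum => i _.
      rewrite normrM; apply: ler_wpM2l => //; rewrite ler_norml; have /andP[? ?] := hx i.
      by apply/andP; split; apply: ltW.
    rewrite ler_pdivrMr//; move: Sk; move: (k.+1%:R : R) => r; lra.
  have := @pi_ge2 R; move: h1; rewrite ler_norml => /andP[h1 h2] p2. apply: cos_gt0_pihalf; apply/andP; split; lra.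
have Lb := cL1_test tk; have Lc := cL1_cexp xi Lb.
have mre : mfunT (fun x : V => kbump k x * cos (dotv xi x)).
  have := Lc.1.1; by under eq_fun do rewrite ReM /= mul0r subr0.
have := @int_gt0_box (fun x => kbump k x * cos (dotv xi x)) (fun=> - k.+1%:R^-1) (fun=> k.+1%:R^-1).
move=> /(_ _ mre) h; have {}h : 0 < \int[mu]_x (kbump k x * cos (dotv xi x)).
  apply: h.
  - by move=> i; apply: (lt_trans _ k0); rewrite oppr_lt0.
  - move=> x; have [hx|/existsNP[i hi]] := pselect (forall i, - k.+1%:R^-1 < x ord0 i < k.+1%:R^-1).
      by rewrite mulr_ge0 ?bump_ge0// ltW// dk.
    by rewrite /kbump (@bump_eq0 _ _ _ _ 0%N x i) ?mul0r//; apply/negP.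
  - by move=> x hx; rewrite mulr_gt0 ?bump_gt0 ?dk.
  - split; first meas. apply: le_lt_trans _ Lc.2; apply: int_mono.
    + meas.
    + meas.
    + move=> x; rewrite lee_fin cabsM cabs_cexp mulr1 /tocx !cabs_real normrM.
      by apply: ler_piMr => //; rewrite ler_norml cos_geN1 cos_le1.
apply/eqP => /(congr1 (@complex.Re R)); rewrite /ift ReM /= mul0r subr0 Re_cint.
under eq_Rintegral do rewrite ReM /= mul0r subr0.
by move/eqP; rewrite mulf_eq0 gt_eqF ?fourier_cst_gt0// gt_eqF.
Qed.

Lemma btest_eq0 (g : V -> C) : cL1 mu g ->
  (forall phi, test_function phi -> cint mu (fun xi => g xi * btest phi xi) = 0) ->
  {ae mu, forall xi, g xi = 0}.
Proof.
move=> Lg h.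
have tk k : test_function (kbump k) by exact: test_bump.
have LL k : cL1 mu (fun xi => g xi * btest (kbump k) xi).
  have [B B0 hB] := btest_bounded (tk k). exact: (cL1_bounded_mul B0 Lg (cmeas_btest (tk k)) hB).
have : {ae mu, forall xi, forall k, g xi * btest (kbump k) xi = 0}.
  apply/ae_foralln => k; apply: (ift_eq0 (LL k)) => x.
  have E v : kbump k \o (fun x => x + v) = bump (fun i => - k.+1%:R^-1 - v ord0 i) (fun i => k.+1%:R^-1 - v ord0 i) 0.
    by apply/funext => y; exact: bump_addr.
  have tv : test_function (kbump k \o (fun y => y + (- x))) by rewrite E; exact: test_bump.
  rewrite /ift -[RHS](mulr0 c0%:C) -(h _ tv); congr (_ * _); apply: eq_cint => xi.
  rewrite -mulrA; congr (_ * _); rewrite /btest.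
  have -> : tocx (kbump k \o (fun y => y + (- x))) = fun y => tocx (kbump k) (y + (- x)) by [].
  rewrite (ift_addr _ _ (cL1_test (tk k))) dotvN opprK (dotvC xi); ring.
apply: filterS => xi hk; have [k] := ift_kbump_neq0 xi.
have := hk k => /eqP; rewrite /btest !mulf_eq0 => /orP[/eqP//|/orP[|->//]].
by move=> /eqP[] /eqP; rewrite gt_eqF// ltr_wpDr// sqr_ge0.
Qed.

End fundamental_lemma.

(** * The weak equation on the Fourier side *)

Section weak_formulation.
Context {R : realType} {d : nat}.
Notation V := 'rV[R]_d.
Notation C := R[i].
Notation mu := (lebesgue_rV d).
Implicit Types (phi f w : V -> R) (G U : V -> C) (x xi : V).

Definition lap_hat G xi : C := (- (enorm xi ^+ 2))%:C * G xi.

Lemma cmeas_lap_hat G : cmeas G -> cmeas (lap_hat G).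
Proof.
move=> mG; apply: cmeasM => //; apply: cmeas_real; apply: measurableT_comp => //.
meas.
Qed.

Lemma wnorm_lap_hat G : (\int[mu]_xi (cabs (lap_hat G xi))%:E = wnorm 2 G)%E.
Proof.
apply: eq_integral => xi _; rewrite cabsM cabs_real normrN ger0_norm; meas.
Qed.

Lemma cL1_lap_hat G : cmeas G -> (wnorm 2 G < +oo)%E -> cL1 mu (lap_hat G).
Proof. by move=> mG Go; split; [exact: cmeas_lap_hat|rewrite wnorm_lap_hat]. Qed.

(* Square integrable near the origin, and dominated by [lap_hat G] away from it. *)
Lemma cL1_of_lap_hat G : cmeas G -> (sqint mu G < +oo)%E -> (wnorm 2 G < +oo)%E -> cL1 mu G.
Proof.
move=> mG G2 Go; have mB := @meas_eball R d 1.
have L1 : cL1 mu (fun xi => ind (eball 1) xi * G xi).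
  apply: cL1_mul_sqint => //; first exact: cmeas_ind. by rewrite sqint_ind//; exact: eball_lty.
have L2 := cL1_lap_hat mG Go; split => //.
apply: (@le_lt_trans _ _ (\int[mu]_xi ((cabs (ind (eball 1) xi * G xi))%:E + (cabs (lap_hat G xi))%:E))%E).
  apply: int_mono; [meas| |].
    meas.
  move=> xi; rewrite -EFinD lee_fin !cabsM cabs_ind cabs_real normrN.
  rewrite ger0_norm ?sqr_ge0// -mulrDl; apply: ler_peMl; first meas.
  rewrite indicE; have [_|/negP h] := boolP (xi \in _); first by rewrite lerDl sqr_ge0.
  rewrite add0r; apply: exprn_ege1; rewrite leNgt; apply/negP => h1.
  by apply: h; apply/mem_set; rewrite /eball /= ltW.
rewrite integralD2; [|meas|meas].
by apply: lte_add_pinfty; [exact: L1.2|exact: L2.2].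
Qed.

Lemma pairing f G psi : mfunT f -> {ae mu, forall x, tocx f x = ift G x} ->
  cL1 mu G -> cL1 mu (tocx psi) ->
  cL1 mu (tocx (fun x => f x * psi x)) /\
  (\int[mu]_x (f x * psi x))%:C = cint mu (fun xi => G xi * ift (tocx psi) xi).
Proof.
move=> mf fG LG Lp; have mi := cmeas_ift LG.1.
have M0 : 0 <= \int[mu]_xi cabs (G xi) by apply: Rintegral_ge0 => xi _; meas.
have Lpi : cL1 mu (fun x => tocx psi x * ift G x).
  by apply: (cL1_bounded_mul M0 Lp mi) => x; exact: cabs_ift_le.
have mfp : cmeas (tocx (fun x => f x * psi x)).
  meas.
have ae : {ae mu, forall x, tocx psi x * ift G x = tocx (fun x => f x * psi x) x}.
  by apply: filterS fG => x <-; rewrite /tocx rmorphM mulrC.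
split; first exact: ae_eq_cL1 ae Lpi.
rewrite -(cint_mul_ift Lp LG) (ae_eq_cint Lpi.1 mfp ae).
apply: complex_ext; rewrite ?Re_cint ?Im_cint //=.
by rewrite /Rintegral integral0.
Qed.

Lemma loc_integrable_bounded f (B : R) : mfunT f ->
  {ae mu, forall x, `|f x| <= B} -> loc_integrable f.
Proof.
move=> mf fB; split => // K cK; have mK := compact_measurable_rV cK.
have mfK : measurable_fun K (EFin \o f) by apply/measurable_EFinP; exact: measurable_funTS.
apply/integrableP; split => //.
have [n hn] := compact_sub_cbox cK.
apply: (@le_lt_trans _ _ (\int[mu]_(x in K) (`|B|)%:E)%E).
  apply: ae_ge0_le_integral => //.
  - exact: measurableT_comp.
  - by apply: filterS fB => x fx _; rewrite lee_fin; apply: le_trans fx (ler_norm _).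
rewrite integral_cst//; apply: mule_lty; rewrite ?lee_fin ?ltry//.
by apply: le_lt_trans (obox_lty (fun=> - n%:R) (fun=> n%:R)); apply: le_measure; rewrite ?inE//; exact: meas_cbox.
Qed.

Lemma cL1_loc_test w phi : loc_integrable w -> test_function phi -> cL1 mu (tocx (fun x => w x * phi x)).
Proof.
move=> lw tphi; have [n hn] := test_support tphi; have [B B0 hB] := test_bounded tphi.
rewrite (_ : tocx _ = fun x => ind (cbox n) x * tocx w x * tocx phi x).
  apply: (cL1_bounded_mul B0 (loc_integrable_cbox n lw) (cL1_test tphi).1) => x; by rewrite cabs_real.
apply/funext => x; rewrite /tocx rmorphM /= /ind indicE; have [_|/negP h] := boolP (x \in _).
  by rewrite mul1r.
by rewrite (hn x) ?rmorph0 ?mulr0// => /mem_set.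
Qed.

Lemma ae_bounded_ift f G : {ae mu, forall x, tocx f x = ift G x} -> cL1 mu G ->
  {ae mu, forall x, `|f x| <= \int[mu]_xi cabs (G xi)}.
Proof. by move=> fG LG; apply: filterS fG => x e; rewrite -cabs_real -/(tocx f x) e; exact: cabs_ift_le. Qed.

Lemma loc_integrable_ift f G : mfunT f -> {ae mu, forall x, tocx f x = ift G x} ->
  cL1 mu G -> loc_integrable f.
Proof. by move=> mf fG LG; apply: loc_integrable_bounded mf (ae_bounded_ift fG LG). Qed.

Lemma loc_integrable_exp w U : mfunT w -> {ae mu, forall x, tocx w x = ift U x} ->
  cL1 mu U -> loc_integrable (fun x => expR (- w x)).
Proof.
move=> mw wU LU; apply: (@loc_integrable_bounded _ (expR (\int[mu]_xi cabs (U xi)))).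
  meas.
apply: filterS (ae_bounded_ift wU LU) => x h; rewrite ger0_norm ?expR_ge0// ler_expR.
by apply: le_trans h; rewrite -normrN ler_norm.
Qed.

Lemma laplacian_pairing f G phi : mfunT f -> {ae mu, forall x, tocx f x = ift G x} ->
  cL1 mu G -> (wnorm 2 G < +oo)%E -> test_function phi ->
  (\int[mu]_x (f x * laplacian phi x))%:C = cint mu (fun x => tocx phi x * ift (lap_hat G) x).
Proof.
move=> mf fG LG Go tphi; rewrite (pairing mf fG LG (cL1_laplacian tphi)).2.
rewrite (cint_mul_ift (cL1_test tphi) (cL1_lap_hat LG.1 Go)); apply: eq_cint => xi.
by rewrite ift_laplacian// /lap_hat; move: (- _)%:C (G xi) (ift _ _) => a b c; ring.
Qed.

(** With e = 1 - exp(-w), the inverse transform of U - Nhat U, the right-hand side of the equation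
    is the pairing of e with phi - laplacian phi, because a Laplacian has zero integral. *)
Lemma equation_rhs w U phi (y : R) : mfunT w -> {ae mu, forall x, tocx w x = ift U x} ->
  cmeas U -> 0 <= y -> y < 1 -> (\int[mu]_xi (cabs (U xi))%:E <= y%:E)%E -> test_function phi ->
  (\int[mu]_x (expR (- w x) * laplacian phi x) + \int[mu]_x ((1 - expR (- w x)) * phi x))%:C =
  cint mu (fun xi => (U xi - Nhat U xi) * btest phi xi).
Proof.
move=> mw wU mU y0 y1 Uy tphi.
have LU : cL1 mu U by split=> //; apply: le_lt_trans Uy (ltry _).
have LN := cL1_Nhat mU y0 y1 Uy; have LK := cL1B LU LN.
pose e x := 1 - expR (- w x).
have me : mfunT e.
  apply: measurable_funB; first meas. meas.
have eK : {ae mu, forall x, tocx e x = ift (fun xi => U xi - Nhat U xi) x}.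
  apply: filterS wU => x h; rewrite (iftB _ LU LN) -h (ift_Nhat (a := w x) mU y0 y1 Uy)//.
  by rewrite /tocx -rmorphB /=; congr (_%:C); rewrite /e; ring.
have Lt := cL1_test tphi; have Ll := cL1_laplacian tphi.
have [L1 E1] := pairing me eK LK Lt; have [L2 E2] := pairing me eK LK Ll.
have -> : \int[mu]_x (expR (- w x) * laplacian phi x) = - \int[mu]_x (e x * laplacian phi x).
  have -> : \int[mu]_x (expR (- w x) * laplacian phi x) =
     complex.Re (cint mu (fun x => tocx (laplacian phi) x - tocx (fun x => e x * laplacian phi x) x)).
    by rewrite Re_cint; apply: eq_Rintegral => x _; rewrite /tocx /e /=; ring.
  by rewrite (cintB Ll L2) cint_laplacian// sub0r ReN Re_cint.
rewrite rmorphD rmorphN /= E1 E2 addrC.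
have [B B0 hB] := btest_bounded tphi.
have Li psi : cL1 mu (tocx psi) -> cL1 mu (fun xi => (U xi - Nhat U xi) * ift (tocx psi) xi).
  move=> Lp; apply: (cL1_bounded_mul _ LK (cmeas_ift Lp.1) (fun x => cabs_ift_le x Lp)).
  by apply: Rintegral_ge0 => x _; meas.
rewrite -(cintB (Li _ Lt) (Li _ Ll)); apply: eq_cint => xi.
by rewrite btestE// (iftB _ Lt Ll); ring.
Qed.

(** Both w and the inverse transform of [lap_hat G] represent the distributional Laplacian of f; the
    fundamental lemma, applied to real and imaginary parts, identifies them. *)
Lemma ae_lap w f G : mfunT f -> {ae mu, forall x, tocx f x = ift G x} ->
  cL1 mu G -> (wnorm 2 G < +oo)%E -> distr_laplacian f w ->
  {ae mu, forall x, tocx w x = ift (lap_hat G) x}.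
Proof.
move=> mf fG LG Go [_ lw hw]; have LU := cL1_lap_hat LG.1 Go; have mi := cmeas_ift LU.1.
pose M := \int[mu]_xi cabs (lap_hat G xi).
have lre : loc_integrable (fun x => complex.Re (ift (lap_hat G) x)).
  apply: (@loc_integrable_bounded _ M mi.1); apply: aeW => x. by apply: le_trans (normr_Re_le _) (cabs_ift_le _ _).
have lim : loc_integrable (fun x => complex.Im (ift (lap_hat G) x)).
  apply: (@loc_integrable_bounded _ M mi.2); apply: aeW => x. by apply: le_trans (normr_Im_le _) (cabs_ift_le _ _).
have E phi : test_function phi -> (\int[mu]_x (w x * phi x))%:C = cint mu (fun x => tocx phi x * ift (lap_hat G) x).
  by move=> tphi; rewrite -hw// (laplacian_pairing mf fG LG Go tphi).
have Im0 : {ae mu, forall x, complex.Im (ift (lap_hat G) x) = 0}.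
  apply: (test_ae0 lim) => phi tphi. have := congr1 (@complex.Im R) (E phi tphi); rewrite Im_cint /= => ->.
  by apply: eq_Rintegral => x _; rewrite /tocx; move: (ift _ _) => z; rewrite ImM /=; ring.
have Re0 : {ae mu, forall x, w x - complex.Re (ift (lap_hat G) x) = 0}.
  apply: test_ae0.
    split; first exact: measurable_funB lw.1 lre.1.
    move=> K cK; have := integrableB (compact_measurable_rV cK) (lw.2 K cK) (lre.2 K cK). by congr (integrable _ _ _).
  move=> phi tphi; have L1 := cL1_loc_test lw tphi; have L2 := cL1_loc_test lre tphi.
  have e : \int[mu]_x (complex.Re (ift (lap_hat G) x) * phi x) = \int[mu]_x (w x * phi x).
    have := congr1 (@complex.Re R) (E phi tphi); rewrite Re_cint /= => ->.
    by apply: eq_Rintegral => x _; rewrite /tocx; move: (ift _ _) => z; rewrite ReM /=; ring.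
  transitivity (complex.Re (cint mu (fun x => tocx (fun x => w x * phi x) x -
      tocx (fun x => complex.Re (ift (lap_hat G) x) * phi x) x))).
    by rewrite Re_cint; apply: eq_Rintegral => x _; rewrite /tocx /=; ring.
  by rewrite (cintB L1 L2) ReD ReN !Re_cint /= e subrr.
apply: filterS2 Re0 Im0 => x /eqP; rewrite subr_eq0 => /eqP h1 h2.
by apply: complex_ext; rewrite /tocx /=.
Qed.

End weak_formulation.

(** * Lipschitz bounds on the ball of radius 1/4 *)

Section drift.
Context {R : realType} {d : nat}.
Notation V := 'rV[R]_d.
Notation C := R[i].
Notation mu := (lebesgue_rV d).
Implicit Types (u v : V -> C) (xi : V).

Definition drift u xi : C := u xi - Nhat u xi.

Lemma cmeas_drift u : cmeas u -> cmeas (drift u).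
Proof. by move=> mu_; apply: cmeasB; meas. Qed.

Lemma cL1_drift u : cmeas u -> (\int[mu]_xi (cabs (u xi))%:E <= (4^-1)%:E)%E -> cL1 mu (drift u).
Proof.
move=> mu_ uy; apply: cL1B; first by split=> //; apply: le_lt_trans uy (ltry _).
by apply: (cL1_Nhat mu_ _ _ uy); lra.
Qed.

(** Origin of 1/4: the common majorant |u| + |v| has mass at most 1/2, where the factor y / (1 - y)
    of [int_Lip_le] equals 1. A constant of at most 1 is what the Euler step can absorb. *)
Lemma int_NhatB_le u v (z : R) : cmeas u -> cmeas v ->
  (\int[mu]_xi (cabs (u xi))%:E <= (4^-1)%:E)%E -> (\int[mu]_xi (cabs (v xi))%:E <= (4^-1)%:E)%E ->
  0 <= z -> (\int[mu]_xi (cabs (u xi - v xi))%:E <= z%:E)%E ->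
  (\int[mu]_xi (cabs (Nhat u xi - Nhat v xi))%:E <= z%:E)%E.
Proof.
move=> mu_ mv uy vy z0 uvz.
have nu := nnfun_cabs mu_; have nv := nnfun_cabs mv; have nuv := nnfunD nu nv.
have nd := nnfun_cabs (cmeasB mu_ mv).
have y0 : 0 <= 2^-1 :> R by lra.
have y1 : 2^-1 < 1 :> R by lra.
have I : (\int[mu]_xi ((cabs (u xi))%:E + (cabs (v xi))%:E) <= (2^-1)%:E)%E.
  rewrite (integralD2 mu nu nv) (_ : 2^-1 = 4^-1 + 4^-1); last by lra. by rewrite EFinD; exact: leeD.
have := int_Lip_le nuv nd y0 y1 z0 I uvz.
rewrite (_ : 2^-1 / (1 - 2^-1) * z = z); last by field.
apply: le_trans; apply: int_mono.
- meas.
- exact: nnfun_Lip.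
- move=> x; apply: cabs_NhatB_le => // y; rewrite -EFinD lee_fin ?lerDl ?lerDr ?cabs_ge0//.
Qed.

Lemma int_driftB_le u v (z : R) : cmeas u -> cmeas v ->
  (\int[mu]_xi (cabs (u xi))%:E <= (4^-1)%:E)%E -> (\int[mu]_xi (cabs (v xi))%:E <= (4^-1)%:E)%E ->
  0 <= z -> (\int[mu]_xi (cabs (u xi - v xi))%:E <= z%:E)%E ->
  (\int[mu]_xi (cabs (drift u xi - drift v xi))%:E <= (2 * z)%:E)%E.
Proof.
move=> mu_ mv uy vy z0 uvz; have N := int_NhatB_le mu_ mv uy vy z0 uvz.
have nd := nnfun_cabs (cmeasB mu_ mv).
have nN := nnfun_cabs (cmeasB (cmeas_Nhat1 mu_) (cmeas_Nhat1 mv)).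
apply: (via (\int[mu]_xi ((cabs (u xi - v xi))%:E + (cabs (Nhat u xi - Nhat v xi))%:E))%E).
  apply: int_mono; [by apply: nnfun_cabs; apply: cmeasB; exact: cmeas_drift|meas|].
  move=> x; rewrite -EFinD lee_fin /drift; move: (u x) (v x) (Nhat u x) (Nhat v x) => a b p q.
  rewrite (_ : a - p - (b - q) = (a - b) - (p - q)); last by ring. exact: cabsB.
by rewrite (integralD2 mu nd nN) mulr_natl mulr2n EFinD; exact: leeD.
Qed.

End drift.

Lemma herm_ift {R : realType} {d : nat} (g : 'rV[R]_d -> R[i]) x : cmeas g -> herm g ->
  ift g x = (complex.Re (ift g x))%:C.
Proof.
move=> mg hg; have e : conjc (ift g x) = ift g x.
  rewrite ift_conj; have -> : (fun xi => conjc (g xi)) = fun xi => g (- xi).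
    by apply/funext => xi; rewrite hg.
  by rewrite ft_ift (ift_reflect _ mg) ft_ift opprK.
apply: complex_ext => //=; move/(congr1 (@complex.Im R)): e; rewrite Im_conj; lra.
Qed.

(** * From the fixed point to a solution of the equation *)

Section mild_solution.
Context {R : realType} {d : nat}.
Notation V := 'rV[R]_d.
Notation C := R[i].
Notation mu := (lebesgue_rV d).
Notation TR := (measurableTypeR R).
Notation leb := (@lebesgue_measure R).
Implicit Types (xi : V) (t s T : R).

Variables (u0 : V -> C) (u : R -> V -> C) (M : V -> \bar R).
Hypotheses (mu0 : cmeas u0) (mu_ : cmeas (fun p : TR * V => u p.1 p.2)) (nM : nnfun M)
  (uM : forall t xi, ((cabs (u t xi))%:E <= M xi)%E)
  (MI : (\int[mu]_xi M xi <= (6^-1)%:E)%E)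
  (hu : {ae mu, forall xi, forall t, 0 <= t ->
     u t xi = duhamel (lam xi) (u0 xi) (fun s => Nhat (u s) xi) t}).

Lemma rsumM_lty : (\int[mu]_xi rsum M xi < +oo)%E.
Proof.
have y1 : (6^-1 : R) < 1 by rewrite invf_lt1// ltr1n.
by apply: le_lt_trans (int_rsum_le nM _ y1 MI) (ltry _); meas.
Qed.

Lemma Msup_lty' : (\int[mu]_xi M xi < +oo)%E.
Proof. by apply: le_lt_trans MI (ltry _). Qed.

Lemma mu_t t : cmeas (u t). Proof. exact: cmeas_curry. Qed.

Lemma Nhat_bound xi : (rsum M xi < +oo)%E -> 0 <= fine (rsum M xi) /\
  forall s, cabs (Nhat (u s) xi) <= fine (rsum M xi).
Proof.
move=> ro; have r0 := (nnfun_rsum nM).2 xi.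
split=> [|s]; first by rewrite fine_ge0.
by rewrite -lee_fin fineK ?ge0_fin_numE//; exact: (cabs_Nhat_le_sum xi (mu_t s) nM (uM s)).
Qed.

Lemma uL1 t : (\int[mu]_xi (cabs (u t xi))%:E < +oo)%E.
Proof. by apply: le_lt_trans Msup_lty'; apply: int_mono => //; exact: nnfun_cabs (mu_t t). Qed.

(** At a fixed frequency u is Lipschitz in time, with a constant proportional to lam; [min_modulus],
    with the time-independent majorant 2 M, turns this into continuity in L^1, uniform over
    nonnegative times. *)
Lemma u_modulus e : 0 < e -> exists2 dl : R, 0 < dl &
  forall s t, 0 <= s -> 0 <= t -> `|t - s| <= dl -> (\int[mu]_xi (cabs (u t xi - u s xi))%:E <= e%:E)%E.
Proof.
move=> e0; pose A xi := (M xi + M xi)%E.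
have nA : nnfun A by exact: nnfunD.
have Ao : (\int[mu]_xi A xi < +oo)%E.
  by rewrite /A (integralD2 mu nM nM); apply: lte_add_pinfty; exact: Msup_lty'.
pose G xi := ((lam xi)%:E * ((cabs (u0 xi))%:E + 2%:E * rsum M xi))%E.
have nlam : nnfun (fun xi : V => (lam xi)%:E).
  meas.
have nG : nnfun G.
  apply: nnfunM nlam _; apply: nnfunD; first meas. meas.
have Gf : {ae mu, forall xi, (G xi < +oo)%E}.
  apply: filterS (ae_lty (nnfun_rsum nM) rsumM_lty) => xi ro. apply: mule_lty; rewrite ?lee_fin ?lam_ge0 ?ltry//.
  by apply: lte_add_pinfty; rewrite ?ltry//; apply: mule_lty; rewrite ?lee_fin ?ltry.
have [dl dl0 hdl] := min_modulus nA nG Ao Gf e0.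
exists dl => // s t s0 t0 ts; apply: le_trans hdl.
have dl0' : (0 <= dl%:E)%E by rewrite lee_fin ltW.
have ndG := nnfunZ dl0' nG.
have mB : cmeas (fun xi => u t xi - u s xi) by exact: cmeasB (mu_t t) (mu_t s).
apply: int_mono_ae; first meas.
  split; first exact: measurable_mine nA.1 ndG.1. by move=> x; rewrite le_min nA.2 ndG.2.
apply: filterS2 (ae_lty (nnfun_rsum nM) rsumM_lty) hu => xi ro hxi.
rewrite le_min; apply/andP; split.
  apply: (via ((cabs (u t xi))%:E + (cabs (u s xi))%:E)%E); first by rewrite -EFinD lee_fin cabsB.
  by apply: leeD; exact: uM.
have [B0 NB] := Nhat_bound ro.
have mz := cmeas_Nhat_time xi mu_.
have [B eB] : exists B : R, rsum M xi = B%:E.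
  by exists (fine (rsum M xi)); rewrite fineK// ge0_fin_numE// (nnfun_rsum nM).2.
move: B0 NB; rewrite eB /= => B0 NB.
have key a b : 0 <= a -> a <= b -> b - a <= dl -> ((cabs (u b xi - u a xi))%:E <= dl%:E * G xi)%E.
  move=> a0 ab ba; rewrite (hxi a a0) (hxi b (le_trans a0 ab)).
  have := cabs_duhamelB_le (u0 xi) (lam_ge0 xi) B0 mz NB a0 ab. rewrite -lee_fin /G eB => h; apply: le_trans h _.
  rewrite -!(EFinM, EFinD) lee_fin mulrC ler_wpM2r//. meas.
have [st|ts'] := leP s t; first by apply: key => //; rewrite -(ger0_norm (_ : 0 <= t - s)) ?subr_ge0.
rewrite cabs_distC; apply: key => //; first exact: ltW.
by move: ts; rewrite distrC ger0_norm// subr_ge0 ltW.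
Qed.

(** The modulus of u is bounded by the scalar Duhamel formula with forcing |Nhat u|, and that
    formula satisfies the energy identity exactly; |u| itself is never differentiated. *)
Lemma pointwise_energy xi T : (rsum M xi < +oo)%E ->
  (forall t, 0 <= t -> u t xi = duhamel (lam xi) (u0 xi) (fun s => Nhat (u s) xi) t) -> 0 <= T ->
  ((cabs (u T xi))%:E + (lam xi)%:E * \int[leb]_t ((tri T t)%:E * (cabs (u t xi))%:E) <=
   (cabs (u0 xi))%:E + (lam xi)%:E * \int[leb]_s ((tri T s)%:E * (cabs (Nhat (u s) xi))%:E))%E.
Proof.
move=> ro hxi T0; have l0 := lam_ge0 xi; set l := lam xi in l0 hxi *.
pose g (s : TR) := (cabs (Nhat (u s) xi))%:E.
have mz := cmeas_Nhat_time xi mu_; have ng : nnfun g by exact: nnfun_cabs.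
have [B0 NB] := Nhat_bound ro.
have nD := nnfun_Duh l0 ng.
have nt := @nnfun_tri R T.
pose ex (t : TR) : \bar R := (expR (- (l * t)))%:E.
have nex : nnfun ex.
  split; last by move=> t; rewrite lee_fin expR_ge0. apply/measurable_EFinP; apply: measurableT_comp; first meas.
  meas.
have a0 : (0 <= (cabs (u0 xi))%:E)%E by rewrite lee_fin cabs_ge0.
have ut t : 0 <= t -> ((cabs (u t xi))%:E <= ex t * (cabs (u0 xi))%:E + Duh l t g)%E.
  move=> t0; rewrite (hxi t t0) /duhamel.
  apply: (via ((cabs ((expR (- (l * t)))%:C * u0 xi))%:E +
     (cabs (cint leb (fun s => (heat l t s)%:C * Nhat (u s) xi)))%:E)%E).
    by rewrite -EFinD lee_fin cabsD.
  apply: leeD; first by rewrite cabsM cabs_real ger0_norm ?expR_ge0// EFinM.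
  have h1 := (cL1_heat_mul l0 B0 mz NB t).1. apply: le_trans (le_cabs_cint leb h1) _; apply: int_mono.
  - meas.
  - exact: nnfun_heat_mul.
  - by move=> s; rewrite cabsM cabs_real ger0_norm ?heat_ge0// EFinM.
have le0 : (0 <= l%:E)%E by rewrite lee_fin.
have nu : nnfun (fun t : TR => (cabs (u t xi))%:E) by apply: nnfun_cabs; exact: cmeas_curry_time.
have ne := nnfunM nt nex.
have h2 : (l%:E * \int[leb]_t ((tri T t)%:E * (cabs (u t xi))%:E) <=
   (1 - expR (- (l * T)))%:E * (cabs (u0 xi))%:E + l%:E * \int[leb]_t ((tri T t)%:E * Duh l t g))%E.
  have -> : ((1 - expR (- (l * T)))%:E * (cabs (u0 xi))%:E =
      l%:E * \int[leb]_t (((tri T t)%:E * ex t) * (cabs (u0 xi))%:E))%E.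
    have -> : (\int[leb]_t (((tri T t)%:E * ex t) * (cabs (u0 xi))%:E) =
        (cabs (u0 xi))%:E * \int[leb]_t ((tri T t)%:E * ex t))%E.
      by rewrite -(integralZ leb a0 ne); apply: eq_integral => t _; rewrite muleC.
    rewrite muleCA muleC; congr (_ * _)%E; rewrite -(integralZ leb le0 ne).
    have <- : (\int[leb]_(t in `[0%R, T]) (l * expR (- (l * t)))%:E = (1 - expR (- (l * T)))%:E)%E.
      rewrite -[in RHS](subr0 T) -(int_exp_right l T0). by apply: eq_integral => t _; rewrite subr0.
    rewrite -(int_tri_mul T (fun s => l * expR (- (l * s)))).
    by apply: eq_integral => t _; rewrite /ex -!EFinM; congr (_%:E); ring.
  rewrite -ge0_muleDr; last 2 first.
  - by apply: integral_ge0 => t _; meas.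
  - by apply: integral_ge0 => t _; meas.
  apply: lee_wpmul2l => //.
  have nea : nnfun (fun t : TR => ((tri T t)%:E * ex t) * (cabs (u0 xi))%:E)%E by exact: nnfunM ne (nnfun_cst a0).
  rewrite -(integralD2 leb nea (nnfunM nt nD)); apply: int_mono.
  - meas.
  - meas.
  move=> t; rewrite -muleA -ge0_muleDr; [|meas|exact: nD.2].
  rewrite /tri; have [/andP[t0 _]|_] := boolP ((0 <= t) && (t <= T)); last by rewrite !mul0e.
  by rewrite !mul1e; exact: ut.
apply: le_trans (leeD (ut T T0) h2) _.
rewrite -(Duh_identity T l0 ng) addeACA -ge0_muleDl.
- by have -> : (ex T + (1 - expR (- (l * T)))%:E = 1)%E; [rewrite /ex -EFinD; congr (_%:E); ring|rewrite mul1e].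
- meas.
- by rewrite lee_fin subr_ge0 expRN_le1// mulr_ge0.
Qed.

Lemma nnfun_wlam K : nnfun (fun xi : V => (wlam K xi)%:E).
Proof. by split; [apply/measurable_EFinP; exact: meas_wlam|move=> xi; rewrite lee_fin; exact: wlam_ge0]. Qed.

Hypothesis hd : (0 < d)%N.

(** The pointwise inequality is multiplied by [wlam K / lam], leaving the bounded weight [wlam K] on
    damping and nonlinearity. The damping integral is then finite and can be subtracted; K -> oo
    follows by Fatou. *)
Lemma energy T (b : R) : 0 <= T -> 0 <= b -> f2 b <= 1 ->
  (forall t, 0 <= t -> t <= T -> (\int[mu]_xi (cabs (u t xi))%:E <= b%:E)%E) ->
  (\int[mu]_xi (cabs (u0 xi))%:E < +oo)%E ->
  (\int[mu]_xi ((cabs (u T xi))%:E + (1 - f2 b)%:E *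
      ((lam xi)%:E * \int[leb]_t ((tri T t)%:E * (cabs (u t xi))%:E))) <=
   \int[mu]_xi (cabs (u0 xi))%:E)%E.
Proof.
move=> T0 b0 fb ub u0o.
have f2b0 : 0 <= f2 b.
  by have := f2_ge_slope (lexx 0) b0; rewrite f2_0 add0r subr0; apply: le_trans; meas.
have nt := @nnfun_tri R T.
have nF : nnfun (fun p : TR * V => (cabs (u p.1 p.2))%:E) by exact: nnfun_cabs.
have nNF : nnfun (fun p : TR * V => (cabs (Nhat (u p.1) p.2))%:E).
  by apply: nnfun_cabs; exact: (cmeas_Nhat (X := TR) (u := fun s : TR => u s) mu_).
pose U xi := (\int[leb]_t ((tri T t)%:E * (cabs (u t xi))%:E))%E.
pose Nn xi := (\int[leb]_t ((tri T t)%:E * (cabs (Nhat (u t) xi))%:E))%E.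
have nU : nnfun U by exact: (nnfun_tri_integral T nF).
have nNn : nnfun Nn by exact: (nnfun_tri_integral T nNF).
have nuT := nnfun_cabs (mu_t T); have nu0 := nnfun_cabs mu0.
have good : {ae mu, forall xi, xi != 0 /\ ((rsum M xi < +oo)%E /\
   (forall t, 0 <= t -> u t xi = duhamel (lam xi) (u0 xi) (fun s => Nhat (u s) xi) t))}.
  have hb : {ae mu, forall xi, (rsum M xi < +oo)%E /\
     (forall t, 0 <= t -> u t xi = duhamel (lam xi) (u0 xi) (fun s => Nhat (u s) xi) t)}.
    by apply: filterS2 (ae_lty (nnfun_rsum nM) rsumM_lty) hu => xi h2 h3.
  by apply: filterS2 (ae_neq0 hd) hb => xi h1 h2.
(* At most 1, and equal to 1 for nonzero xi as soon as K >= |xi|. *)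
pose r K xi : \bar R := (wlam K xi / lam xi)%:E.
have r0 K xi : 0 <= wlam K xi / lam xi by rewrite divr_ge0 ?wlam_ge0 ?lam_ge0.
have nr K : nnfun (r K).
  split; last by move=> xi; rewrite lee_fin.
  apply/measurable_EFinP; apply: measurable_funM; first exact: meas_wlam.
  under eq_fun do rewrite -(powR_inv1 (lam_ge0 _)).
  exact: (measurableT_comp (@measurable_powR R (-1)) meas_lam).
have s0 : (0 <= (1 - f2 b)%:E)%E by rewrite lee_fin subr_ge0.
pose f K xi := (r K xi * (cabs (u T xi))%:E + (1 - f2 b)%:E * ((wlam K xi)%:E * U xi))%E.
have nwU K := nnfunM (nnfun_wlam K) nU.
have nwN K := nnfunM (nnfun_wlam K) nNn.
have nf K : nnfun (f K) by exact: nnfunD (nnfunM (nr K) nuT) (nnfunZ s0 (nwU K)).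
have nlam : nnfun (fun xi : V => (lam xi)%:E).
  meas.
have nlim : nnfun (fun xi => (cabs (u T xi))%:E + (1 - f2 b)%:E * ((lam xi)%:E * U xi))%E.
  meas.
apply: (fatou_le (f_ := f)) => //.
- by move=> K; exact: (nf K).1.
- by move=> K; exact: (nf K).2.
- exact: nlim.1.
- exact: nlim.2.
- apply: filterS good => xi [x0 _]; apply: cvg_near_cst.
  apply: filterS (wlam_near xi) => K hK; rewrite /f /r hK mulfV ?mul1e//. by rewrite gt_eqF// lam_gt0.
move=> K; rewrite /f (integralD2 mu (nnfunM (nr K) nuT) (nnfunZ s0 (nwU K))) (integralZ mu s0 (nwU K)).
pose k : R := K%:R ^+ 2 + K%:R ^+ 4.
have k0 : 0 <= k by rewrite addr_ge0// exprn_ge0.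
have k0' : (0 <= k%:E)%E by rewrite lee_fin.
have wU : (\int[mu]_xi ((wlam K xi)%:E * U xi) =
    \int[leb]_t ((tri T t)%:E * \int[mu]_xi ((wlam K xi)%:E * (cabs (u t xi))%:E)))%E.
  exact: (tri_swap T (nnfun_wlam K) nF).
have wub t : 0 <= t -> t <= T -> (\int[mu]_xi ((wlam K xi)%:E * (cabs (u t xi))%:E) <= (k * b)%:E)%E.
  move=> t0 tT; apply: (via (\int[mu]_xi (k%:E * (cabs (u t xi))%:E))%E).
    apply: int_mono; [exact: nnfunM (nnfun_wlam K) (nnfun_cabs (mu_t t))|exact: nnfunZ k0' (nnfun_cabs (mu_t t))|].
    by move=> x; apply: lee_wpmul2r; rewrite lee_fin ?cabs_ge0//; exact: wlam_bounded.
  by rewrite (integralZ mu k0' (nnfun_cabs (mu_t t))) EFinM; apply: lee_wpmul2l; meas.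
have nwt : nnfun (fun t : TR => \int[mu]_xi ((wlam K xi)%:E * (cabs (u t xi))%:E))%E.
  split; last by move=> t; apply: integral_ge0 => x _; exact: (nnfunM (nnfun_wlam K) (nnfun_cabs (mu_t t))).2.
  apply: (@measurable_fun_fubini_tonelli_F _ _ _ _ R mu (fun p : TR * V => (wlam K p.2)%:E * (cabs (u p.1 p.2))%:E)%E).
    by apply: emeasurable_funM; [exact: (measurableT_comp (nnfun_wlam K).1 measurable_snd)|exact: nF.1].
  by move=> p; apply: mule_ge0; [exact: (nnfun_wlam K).2|exact: nF.2].
have kb0 : (0 <= (k * b)%:E)%E by rewrite lee_fin mulr_ge0.
have Ao : (\int[mu]_xi ((wlam K xi)%:E * U xi) < +oo)%E.
  rewrite wU; apply: (@le_lt_trans _ _ ((k * b)%:E * \int[leb]_t (tri T t)%:E)%E); last first.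
    by rewrite int_tri// -EFinM ltry.
  rewrite -(integralZ leb kb0 nt); apply: int_mono; [meas|meas|].
  move=> t; rewrite /tri; have [/andP[t0 tT]|_] := boolP ((0 <= t) && (t <= T)); last by rewrite mul0e mule0.
  by rewrite mul1e mule1; exact: wub.
have BA : (\int[mu]_xi ((wlam K xi)%:E * Nn xi) <= (f2 b)%:E * \int[mu]_xi ((wlam K xi)%:E * U xi))%E.
  rewrite (tri_swap T (nnfun_wlam K) nNF) wU. have fb0 : (0 <= (f2 b)%:E)%E by rewrite lee_fin.
  rewrite -(integralZ leb fb0 (nnfunM nt nwt)); apply: int_mono.
  - apply: nnfunM => //; split; last first.
      by move=> t; apply: integral_ge0 => x _; exact: (nnfunM (nnfun_wlam K) (nnfun_cabs (cmeas_Nhat1 (mu_t t)))).2.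
    apply: (@measurable_fun_fubini_tonelli_F _ _ _ _ R mu (fun p : TR * V => (wlam K p.2)%:E * (cabs (Nhat (u p.1) p.2))%:E)%E).
      by apply: emeasurable_funM; [exact: (measurableT_comp (nnfun_wlam K).1 measurable_snd)|exact: nNF.1].
    by move=> p; apply: mule_ge0; [exact: (nnfun_wlam K).2|exact: nNF.2].
  - meas.
  move=> t; apply: lee_scale; first meas.
  rewrite /tri; case: (boolP ((0 <= t) && (t <= T))) => [/andP[t0 tT] _|_ /eqP//].
  refine (@int_weight_Nhat_le _ _ (fun xi => (wlam K xi)%:E) (u t) b _ _ _ b0 _ _ _).
  - exact: nnfun_wlam.
  - by move=> x; rewrite ltry.
  - exact: mu_t.
  - by move=> j x x'; rewrite -!EFinM -EFinD lee_fin; exact: wlam_weight.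
  - exact: ub.
  - by apply: le_lt_trans (wub t t0 tT) _; rewrite ltry.
have h : (\int[mu]_xi (r K xi * (cabs (u T xi))%:E) + \int[mu]_xi ((wlam K xi)%:E * U xi) <=
   \int[mu]_xi (cabs (u0 xi))%:E + \int[mu]_xi ((wlam K xi)%:E * Nn xi))%E.
  rewrite -(integralD2 mu (nnfunM (nr K) nuT) (nwU K)) -(integralD2 mu nu0 (nwN K)).
  apply: int_mono_ae; [meas|meas|]. apply: filterS good => xi [x0 [ro hxi]]. have lx := lam_gt0 x0.
  have e : ((wlam K xi)%:E = r K xi * (lam xi)%:E)%E by rewrite -EFinM divfK// gt_eqF.
  have rr0 : (0 <= r K xi)%E by exact: (nr K).2.
  rewrite e -!muleA -ge0_muleDr; [|exact: nuT.2|exact: (nnfunM nlam nU).2].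
  apply: le_trans (lee_wpmul2l rr0 (pointwise_energy ro hxi T0)) _. rewrite ge0_muleDr; [|exact: nu0.2|meas].
  apply: leeD => //; rewrite -[leRHS]mul1e; apply: lee_wpmul2r; first exact: nu0.2.
  by rewrite lee_fin ler_pdivrMr// mul1r wlam_le_lam.
have I1o : (\int[mu]_xi (r K xi * (cabs (u T xi))%:E) < +oo)%E.
  apply: le_lt_trans (uL1 T); apply: int_mono; [meas|exact: nuT|].
  move=> x; rewrite -[leRHS]mul1e; apply: lee_wpmul2r; first exact: nuT.2.
  have [lx|lx] := ltP 0 (lam x); first by rewrite lee_fin ler_pdivrMr// mul1r wlam_le_lam.
  have -> : r K x = 0%E by rewrite /r (_ : lam x = 0) ?invr0 ?mulr0//; apply/eqP; rewrite eq_le lx lam_ge0. meas.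
have A0 : (0 <= \int[mu]_xi ((wlam K xi)%:E * U xi))%E by apply: integral_ge0 => x _; exact: (nwU K).2.
have I0 : (0 <= \int[mu]_xi (r K xi * (cabs (u T xi))%:E))%E by apply: integral_ge0 => x _; exact: (nnfunM (nr K) nuT).2.
have I00 : (0 <= \int[mu]_xi (cabs (u0 xi))%:E)%E by apply: integral_ge0 => x _; meas.
(* This reads I + A <= J + f2(b) A; since A is finite, f2(b) A can be moved to the left. *)
have := le_trans h (leeD (lexx _) BA); move: A0 Ao I0 I1o I00 u0o; clear.
case: (\int[mu]_xi ((wlam K xi)%:E * U xi))%E => [A| |] //.
case: (\int[mu]_xi (r K xi * (cabs (u T xi))%:E))%E => [I| |] //.
case: (\int[mu]_xi (cabs (u0 xi))%:E)%E => [J| |] //.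
rewrite -!EFinM -!EFinD !lee_fin => *; lra.
Qed.

Variable g0 : V -> R.
Hypotheses (mg : mfunT g0) (g00 : forall xi, 0 <= g0 xi)
  (u0g : forall xi, cabs (u0 xi) ^+ 2 <= enorm xi ^+ 4 * g0 xi)
  (g0o : (\int[mu]_xi (g0 xi)%:E < +oo)%E)
  (hP : forall T, 0 <= T ->
    (\int[mu]_xi \int[leb]_t ((tri T t)%:E * (cabs (Nhat (u t) xi) ^+ 2)%:E) < +oo)%E).

(* the transform of the solution h itself, as u is the one of its Laplacian *)
Definition hhat t xi : C := (- (enorm xi ^+ 2)^-1)%:C * u t xi.

Lemma meas_inv_enorm2 : mfunT (fun xi : V => - (enorm xi ^+ 2)^-1).
Proof.
apply: measurableT_comp; first meas.
under eq_fun do rewrite -(powR_inv1 (sqr_ge0 _)).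
apply: (measurableT_comp (@measurable_powR R (-1)) _).
meas.
Qed.

Lemma cmeas_hhat t : cmeas (hhat t).
Proof. by apply: cmeasM; [apply: cmeas_real; exact: meas_inv_enorm2|exact: cmeas_curry]. Qed.

Let P T xi := (\int[leb]_t ((tri T t)%:E * (cabs (Nhat (u t) xi) ^+ 2)%:E))%E.

(** Bounds the squared transform of h on [0, T]: 2 g0 from the linear part, and twice 4 (T + 1) P T
    from the Duhamel part. *)
Definition Qmaj T xi : \bar R := ((2 * g0 xi)%:E + (8 * (T + 1))%:E * P T xi)%E.

Lemma nnfun_Qmaj T : 0 <= T -> nnfun (Qmaj T).
Proof.
move=> T0; apply: nnfunD.
  meas.
apply: nnfunZ; first meas.
apply: (nnfun_tri_integral T (nnfun_sq_joint (v := fun t => Nhat (u t)) _)).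
exact: (cmeas_Nhat (X := TR) (u := fun s : TR => u s) mu_).
Qed.

Lemma Qmaj_lty T : 0 <= T -> (\int[mu]_xi Qmaj T xi < +oo)%E.
Proof.
move=> T0.
have ng : nnfun (fun xi : V => (2 * g0 xi)%:E).
  meas.
have ng0 : nnfun (fun xi : V => (g0 xi)%:E) by split; meas.
have nP : nnfun (P T).
  apply: (nnfun_tri_integral T (nnfun_sq_joint (v := fun t => Nhat (u t)) _)).
  exact: (cmeas_Nhat (X := TR) (u := fun s : TR => u s) mu_).
have k0 : (0 <= (8 * (T + 1))%:E)%E by rewrite lee_fin mulr_ge0// addr_ge0.
have e2 : (0 <= 2%:E :> \bar R)%E by rewrite lee_fin.
rewrite (integralD2 mu ng (nnfunZ k0 nP)) (integralZ mu k0 nP); apply: lte_add_pinfty.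
  under eq_integral do rewrite EFinM. by rewrite (integralZ mu e2 ng0); apply: mule_lty; rewrite ?ltry.
by apply: mule_lty; rewrite ?ltry//; exact: hP.
Qed.

Let goodpt xi := xi != 0 /\ ((rsum M xi < +oo)%E /\
   (forall t, 0 <= t -> u t xi = duhamel (lam xi) (u0 xi) (fun s => Nhat (u s) xi) t)).

Lemma ae_goodpt : {ae mu, forall xi, goodpt xi}.
Proof.
have hb : {ae mu, forall xi, (rsum M xi < +oo)%E /\
   (forall t, 0 <= t -> u t xi = duhamel (lam xi) (u0 xi) (fun s => Nhat (u s) xi) t)}.
  by apply: filterS2 (ae_lty (nnfun_rsum nM) (rsumM_lty)) hu => xi h2 h3.
by apply: filterS2 (ae_neq0 hd) hb => xi h1 h2.
Qed.

Lemma enorm_gt0 xi : xi != 0 -> 0 < enorm xi.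
Proof.
by move=> x0; rewrite lt_neqAle enorm_ge0 andbT eq_sym; apply: contra_neq x0 => /enorm_eq0.
Qed.

Lemma hhat_sq_le t T xi : goodpt xi -> 0 <= t -> t <= T ->
  ((cabs (hhat t xi) ^+ 2)%:E <= Qmaj T xi)%E.
Proof.
move=> [x0 [ro hxi]] t0 tT; have T0 := le_trans t0 tT.
have r0 := enorm_gt0 x0; have l0 := lam_ge0 xi.
have mz := cmeas_Nhat_time xi mu_.
have nz : nnfun (fun s : TR => (cabs (Nhat (u s) xi) ^+ 2)%:E).
  meas.
have nt := @nnfun_tri R T.
pose J := cint leb (fun s => (heat (lam xi) t s)%:C * Nhat (u s) xi).
have DP : (Duh (lam xi) t (fun s => (cabs (Nhat (u s) xi) ^+ 2)%:E) <= (lam xi)%:E * P T xi)%E.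
  have l0' : (0 <= (lam xi)%:E)%E by rewrite lee_fin.
  rewrite -(integralZ leb l0' (nnfunM nt nz)); apply: int_mono.
  - exact: nnfun_heat_mul.
  - meas.
  move=> s; rewrite muleA; apply: lee_wpmul2r; first exact: nz.2. rewrite -EFinM lee_fin /heat /tri.
  have [/andP[s0 st]|_] := boolP ((0 <= s) && (s <= t)); last by rewrite mul0r mulr_ge0.
  by rewrite s0 (le_trans st tT) /= mul1r mulr1 ler_piMr// expRN_le1// mulr_ge0// subr_ge0.
have P0 : (0 <= P T xi)%E by apply: integral_ge0 => s _; meas.
have [Po|] := ltP (P T xi) +oo%E; last first.
  rewrite leye_eq => /eqP e; rewrite /Qmaj e gt0_muley ?addey ?leey//. by rewrite lte_fin mulr_gt0// ltr_wpDl.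
have [p ep] : exists p, P T xi = p%:E by exists (fine (P T xi)); rewrite fineK// ge0_fin_numE.
rewrite /Qmaj ep -EFinM -EFinD lee_fin; rewrite ep -EFinM in DP; rewrite ep lee_fin in P0.
have J1 : cabs J ^+ 2 <= lam xi * p.
  rewrite -lee_fin; apply: le_trans DP.
  by have := sq_cabs_cint_heat_le (t := t) l0 mz ltr01 (int_heat_le1 t l0); rewrite mul1e.
have lp := lam_gt0 x0.
(* Besides 1, the kernel mass is at most lam t; this second bound compensates the division by |xi|^4
   near the origin. T + 1 in place of T keeps the constant positive. *)
have J2 : cabs J ^+ 2 <= lam xi * (T + 1) * (lam xi * p).
  have k0 : 0 < lam xi * (T + 1) by rewrite mulr_gt0// ltr_wpDl.
  have hk : (\int[leb]_s (heat (lam xi) t s)%:E <= (lam xi * (T + 1))%:E)%E.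
    rewrite (int_heat (lam xi) t0) lee_fin.
    have := expR_ge1Dx (- (lam xi * t)); have : lam xi * t <= lam xi * (T + 1).
      by rewrite ler_wpM2l//; lra.
    lra.
  rewrite -lee_fin; apply: le_trans (sq_cabs_cint_heat_le (t := t) l0 mz k0 hk) _.
  by rewrite (EFinM (lam xi * (T + 1))); apply: lee_wpmul2l; meas.
rewrite /hhat (hxi t t0) /duhamel -/J cabsM cabs_real normrN ger0_norm ?invr_ge0 ?sqr_ge0// exprMn.
have J3 : ((enorm xi ^+ 2)^-1) ^+ 2 * cabs J ^+ 2 <= 4 * (T + 1) * p.
  rewrite exprVn mulrC ler_pdivrMr ?exprn_gt0// -exprM.
  move: J1 J2; rewrite /lam; move: (cabs J ^+ 2) (enorm xi) r0 => j r r0 J1 J2.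
  have r20 : 0 <= r ^+ 2 by rewrite sqr_ge0. have r4 : r ^+ 4 = r ^+ 2 * r ^+ 2 by rewrite -exprD.
  have pT : 0 <= p * (T + 1) by rewrite mulr_ge0// addr_ge0. have pTp : p <= p * (T + 1) by rewrite ler_peMr//; lra.
  (* For |xi| >= 1, lam <= 2 |xi|^4 and the first bound suffices; for |xi| < 1, lam^2 <= 4 |xi|^4
     and the second does. *)
  rewrite (_ : (2 * 2)%N = 4%N)// r4 in J1 J2 *. have [r1|r1] := leP 1 (r ^+ 2).
    apply: le_trans J1 _. have h1 : r ^+ 2 + r ^+ 2 * r ^+ 2 <= 2 * (r ^+ 2 * r ^+ 2).
      have := ler_wpM2l r20 r1; rewrite mulr1; lra.
    apply: le_trans (ler_wpM2r P0 h1) _. have h2 := ler_wpM2l (mulr_ge0 r20 r20) pTp.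
    have h3 := mulr_ge0 (mulr_ge0 r20 r20) pT. move: h2 h3; move: (r ^+ 2 * r ^+ 2) => q h2 h3; lra.
  apply: le_trans J2 _. have h1 : (1 + r ^+ 2) ^+ 2 <= 4.
    have : (1 + r ^+ 2) ^+ 2 <= (1 + 1) ^+ 2 by rewrite lerXn2r ?nnegrE ?addr_ge0// lerD2l ltW.
    by rewrite (_ : (1 + 1) ^+ 2 = 4)//; ring.
  rewrite (_ : _ * _ * _ = (r ^+ 2 * r ^+ 2) * (p * (T + 1)) * (1 + r ^+ 2) ^+ 2); last by ring.
  have h3 := ler_wpM2l (mulr_ge0 (mulr_ge0 r20 r20) pT) h1.
  apply: le_trans h3 _; rewrite le_eqVlt; apply/orP; left; apply/eqP; ring.
have U3 : ((enorm xi ^+ 2)^-1) ^+ 2 * cabs ((expR (- (lam xi * t)))%:C * u0 xi) ^+ 2 <= g0 xi.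
  rewrite exprVn mulrC ler_pdivrMr ?exprn_gt0// -exprM cabsM cabs_real ger0_norm ?expR_ge0// [leRHS]mulrC.
  apply: le_trans (u0g xi); rewrite exprMn ler_piMl ?sqr_ge0//.
  by rewrite expr_le1// ?expR_ge0// expRN_le1// mulr_ge0.
have := ler_wpM2l (_ : 0 <= ((enorm xi ^+ 2)^-1) ^+ 2) (cabs_sqD ((expR (- (lam xi * t)))%:C * u0 xi) J).
rewrite sqr_ge0 => /(_ isT) h; apply: le_trans h _.
move: U3 J3; move: (((enorm xi ^+ 2)^-1) ^+ 2) => q; rewrite mulrDr !(mulrCA q); lra.
Qed.

Lemma sqint_hhat_lty t : 0 <= t -> (sqint mu (hhat t) < +oo)%E.
Proof.
move=> t0; apply: le_lt_trans (Qmaj_lty t0); apply: int_mono_ae.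
- exact: nnfun_sqcabs (cmeas_hhat t).
- exact: nnfun_Qmaj.
- by apply: filterS ae_goodpt => xi h; exact: (hhat_sq_le h).
Qed.

Lemma hhat_modulus T e : 0 <= T -> 0 < e -> exists2 dl : R, 0 < dl &
  forall s t, 0 <= s -> s <= T -> 0 <= t -> t <= T -> `|t - s| <= dl ->
    (sqint mu (fun xi => hhat t xi - hhat s xi)%R <= e%:E)%E.
Proof.
move=> T0 e0.
have e4 : (0 <= 4%:E :> \bar R)%E by rewrite lee_fin.
pose A xi := (4%:E * Qmaj T xi)%E.
have nA : nnfun A by exact: nnfunZ e4 (nnfun_Qmaj T0).
have Ao : (\int[mu]_xi A xi < +oo)%E.
  by rewrite (integralZ mu e4 (nnfun_Qmaj T0)); apply: mule_lty; rewrite ?ltry//; exact: Qmaj_lty.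
pose H xi := ((1 + enorm xi ^+ 2)%:E * ((cabs (u0 xi))%:E + 2%:E * rsum M xi))%E.
pose G xi := (H xi * H xi)%E.
have nH : nnfun H.
  apply: nnfunM.
    meas.
  meas.
have nG : nnfun G by exact: nnfunM.
have Hf xi : (rsum M xi < +oo)%E -> (H xi < +oo)%E.
  move=> ro; apply: mule_lty; rewrite ?lee_fin ?addr_ge0 ?sqr_ge0 ?ltry//.
  by apply: lte_add_pinfty; rewrite ?ltry//; apply: mule_lty; rewrite ?lee_fin ?ltry.
have Gf : {ae mu, forall xi, (G xi < +oo)%E}.
  apply: filterS ae_goodpt => xi [_ [ro _]]. by apply: mule_lty; [exact: nH.2|exact: Hf|exact: Hf].
have [dl dl0 hdl] := min_modulus nA nG Ao Gf e0.
(* With b - a <= 1 the squared Lipschitz bound is at most linear in b - a. *)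
exists (Num.min dl 1); first by rewrite lt_min dl0 ltr01.
move=> s t s0 sT t0 tT ts; apply: le_trans hdl.
have dl0' : (0 <= dl%:E)%E by rewrite lee_fin ltW.
have ndG := nnfunZ dl0' nG.
apply: int_mono_ae; first exact: nnfun_sqcabs (cmeasB (cmeas_hhat t) (cmeas_hhat s)).
  split; first exact: measurable_mine nA.1 ndG.1. by move=> x; rewrite le_min nA.2 ndG.2.
apply: filterS ae_goodpt => xi gx; rewrite le_min; apply/andP; split.
  have h1 := hhat_sq_le gx t0 tT; have h2 := hhat_sq_le gx s0 sT.
  apply: (via (2%:E * (cabs (hhat t xi) ^+ 2)%:E + 2%:E * (cabs (hhat s xi) ^+ 2)%:E)%E).
    by rewrite -!EFinM -EFinD lee_fin -(cabsN (hhat s xi)); exact: cabs_sqD.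
  have e2 : (0 <= 2%:E :> \bar R)%E by rewrite lee_fin.
  apply: le_trans (leeD (lee_wpmul2l e2 h1) (lee_wpmul2l e2 h2)) _.
  by rewrite -ge0_muleDl// -EFinD /A (_ : 2 + 2 = 4 :> R)//; ring.
have [x0 [ro hxi]] := gx.
have [B0 NB] := Nhat_bound ro.
have mz := cmeas_Nhat_time xi mu_.
have [B eB] : exists B : R, rsum M xi = B%:E.
  by exists (fine (rsum M xi)); rewrite fineK// ge0_fin_numE// (nnfun_rsum nM).2.
move: B0 NB; rewrite eB /= => B0 NB.
have r0 := enorm_gt0 x0.
pose h := (1 + enorm xi ^+ 2) * (cabs (u0 xi) + 2 * B).
have h0 : 0 <= h by rewrite mulr_ge0 ?addr_ge0 ?sqr_ge0 ?cabs_ge0// mulr_ge0.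
have eG : G xi = (h ^+ 2)%:E by rewrite /G /H eB -!(EFinM, EFinD) -expr2.
rewrite eG -EFinM lee_fin.
have key a b : 0 <= a -> a <= b -> b - a <= Num.min dl 1 -> cabs (hhat b xi - hhat a xi) ^+ 2 <= dl * h ^+ 2.
  move=> a0 ab; rewrite le_min => /andP[ba1 ba2]. have ba0 : 0 <= b - a by rewrite subr_ge0.
  rewrite /hhat -mulrBr cabsM cabs_real normrN ger0_norm ?invr_ge0 ?sqr_ge0//.
  rewrite (hxi a a0) (hxi b (le_trans a0 ab)). have hh := cabs_duhamelB_le (u0 xi) (lam_ge0 xi) B0 mz NB a0 ab.
  apply: (via ((h * (b - a)) ^+ 2)).
    apply: lerXn2r; rewrite ?nnegrE; [meas|meas|]. rewrite mulrC ler_pdivrMr ?exprn_gt0//; apply: le_trans hh _.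
    by rewrite le_eqVlt; apply/orP; left; apply/eqP; rewrite /h /lam; ring.
  rewrite exprMn mulrC ler_wpM2r ?sqr_ge0// expr2. by apply: le_trans ba1; rewrite ler_piMl.
have [st|ts'] := leP s t; first by apply: key => //; rewrite -(ger0_norm (_ : 0 <= t - s)) ?subr_ge0.
rewrite cabs_distC; apply: key => //; first exact: ltW.
by move: ts; rewrite distrC ger0_norm// subr_ge0 ltW.
Qed.

Lemma u_quarter t : (\int[mu]_xi (cabs (u t xi))%:E <= (4^-1)%:E)%E.
Proof.
apply: (via (6^-1)%:E); last by rewrite lee_fin; lra.
apply: le_trans MI; apply: int_mono => //; by apply: nnfun_cabs; exact: mu_t.
Qed.

Lemma duhamel0 (l B : R) (a : C) (z : TR -> C) : 0 <= l -> 0 <= B -> cmeas z ->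
  (forall s, cabs (z s) <= B) -> duhamel l a z 0 = a.
Proof.
move=> l0 B0 mz zB; rewrite (duhamel_identity a l0 B0 mz zB (lexx 0)).
have mD : cmeas (duhamel l a z : TR -> C) by exact: cmeas_duhamel.
have z0 (v : TR -> C) : cmeas v -> cint leb (fun s => (tri 0 s)%:C * v s) = 0.
  move=> mv; rewrite -(cint0 leb); apply: ae_eq_cint.
  - apply: cmeasM => //; apply: cmeas_real; apply: meas_tri; meas.
  - meas.
  - exists [set 0]; split; [meas|exact: lebesgue_measure_set1|].
    move=> s /= h; apply: contrapT => s0; apply: h; rewrite /tri -eq_le eq_sym. by rewrite (introF eqP s0) mul0r.
by rewrite (z0 _ mz) (z0 _ mD) mulr0 subr0 addr0.
Qed.

Lemma ae_u_initial : {ae mu, forall xi, u 0 xi = u0 xi}.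
Proof.
apply: filterS (ae_goodpt) => xi [_ [ro hxi]].
have [B0 NB] := Nhat_bound ro.
by rewrite (hxi 0 (lexx _)) (duhamel0 _ (lam_ge0 xi) B0 (cmeas_Nhat_time xi mu_) NB).
Qed.

(** The integrated equation for u divided by -|xi|^2, with lam / |xi|^2 = 1 + |xi|^2. The
    exceptional null set does not depend on T. *)
Lemma hhat_flow : {ae mu, forall xi, forall T, 0 <= T ->
  cL1 leb (fun s : TR => (tri T s)%:C * drift (u s) xi) /\
  hhat T xi = hhat 0 xi +
    (1 + enorm xi ^+ 2)%:C * cint leb (fun s => (tri T s)%:C * drift (u s) xi)}.
Proof.
apply: filterS (ae_goodpt) => xi [x0 [ro hxi]] T T0.
have [B0 NB] := Nhat_bound ro; have mz := cmeas_Nhat_time xi mu_.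
have l0 := lam_ge0 xi; have id := duhamel_identity (u0 xi) l0 B0 mz NB T0.
have cb t : 0 <= t -> cabs (u t xi) <= cabs (u0 xi) + fine (rsum M xi).
  by move=> t0; rewrite (hxi t t0); exact: (cabs_duhamel_le (u0 xi) l0 B0 mz NB t0).
have mux := cmeas_curry_time xi mu_.
have Lu := cL1_tri_mul T0 mux cb.
have LN := cL1_tri_mul T0 mz (fun s _ => NB s).
have e0 : u 0 xi = u0 xi by rewrite (hxi 0 (lexx _)) (duhamel0 _ l0 B0 mz NB).
have eu : cint leb (fun t => (tri T t)%:C * duhamel (lam xi) (u0 xi) (fun s => Nhat (u s) xi) t) =
    cint leb (fun t => (tri T t)%:C * u t xi).
  apply: eq_cint => t; rewrite /tri; have [t0|_] := boolP (0 <= t); last by rewrite !mul0r. by rewrite (hxi t t0).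
have ed : cint leb (fun s => (tri T s)%:C * drift (u s) xi) =
   cint leb (fun t => (tri T t)%:C * u t xi) - cint leb (fun s => (tri T s)%:C * Nhat (u s) xi).
  by rewrite -(cintB Lu LN); apply: eq_cint => s; rewrite /drift mulrBr.
split.
  rewrite (_ : (fun s : TR => _) = fun s : TR => (tri T s)%:C * u s xi - (tri T s)%:C * Nhat (u s) xi).
    exact: cL1B Lu LN.
  by apply/funext => s; rewrite /drift mulrBr.
rewrite ed /hhat e0 (hxi T T0) id eu.
move: (cint _ _) (cint _ _) (u0 xi) => p q a.
have n0 : enorm xi ^+ 2 != 0 by rewrite expf_neq0// gt_eqF// enorm_gt0.
have -> : 1 + enorm xi ^+ 2 = (enorm xi ^+ 2)^-1 * lam xi.
  by rewrite /lam (exprD _ 2 2) mulrDr mulKf// mulVf.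
rewrite rmorphN rmorphM /=; move: ((enorm xi ^+ 2)^-1)%:C (lam xi)%:C => b c; ring.
Qed.

Lemma wnorm_hhat t : (\int[mu]_xi (cabs (u t xi))%:E = wnorm 2 (hhat t))%E.
Proof.
apply: ge0_ae_eq_integral => //; first by apply: meas_ecabs; exact: mu_t.
- by apply: meas_wnorm; exact: cmeas_hhat.
- meas.
- meas.
apply: filterS (ae_neq0 hd) => x x0 _; congr (_%:E).
rewrite /hhat cabsM cabs_real normrN ger0_norm ?invr_ge0 ?sqr_ge0// mulrA mulfV ?mul1r//.
by rewrite expf_neq0// gt_eqF// enorm_gt0.
Qed.

Lemma wnorm_hhat_lty t : (wnorm 2 (hhat t) < +oo)%E.
Proof. by rewrite -wnorm_hhat; exact: (uL1). Qed.

Lemma ae_lap_hat_hhat t : {ae mu, forall xi, lap_hat (hhat t) xi = u t xi}.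
Proof.
apply: filterS (ae_neq0 hd) => x x0; rewrite /lap_hat /hhat mulrA -rmorphM /= mulrNN mulfV ?mul1r//.
by rewrite expf_neq0// gt_eqF// enorm_gt0.
Qed.

Lemma cL1_hhat t : 0 <= t -> cL1 mu (hhat t).
Proof.
move=> t0; apply: cL1_of_lap_hat; [exact: cmeas_hhat| |exact: wnorm_hhat_lty].
exact: (sqint_hhat_lty t0).
Qed.

Section tested.
Variable phi : V -> R.
Hypothesis tphi : test_function phi.

Definition tdrift t : C := cint mu (fun xi => drift (u t) xi * btest phi xi).

Lemma cL1_tdrift (v : V -> C) : cL1 mu v -> cL1 mu (fun xi => v xi * btest phi xi).
Proof.
by move=> Lv; have [B B0 hB] := btest_bounded tphi; exact: (cL1_bounded_mul B0 Lv (cmeas_btest tphi) hB).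
Qed.

Lemma tdrift_modulus (e : R) : 0 < e -> exists2 dl : R, 0 < dl &
  forall s t, 0 <= s -> 0 <= t -> `|t - s| <= dl -> cabs (tdrift t - tdrift s) <= e.
Proof.
move=> e0; have [B B0 hB] := btest_bounded tphi.
have e1 : 0 < e / (2 * (B + 1)) by rewrite divr_gt0// mulr_gt0// ltr_wpDl.
have [dl dl0 hdl] := u_modulus e1; exists dl => // s t s0 t0 st.
have h := int_driftB_le (mu_t t) (mu_t s) (u_quarter t) (u_quarter s) (ltW e1) (hdl s t s0 t0 st).
have Ld r : cL1 mu (drift (u r)) by apply: cL1_drift (u_quarter r); exact: mu_t.
rewrite /tdrift -(cintB (cL1_tdrift (Ld t)) (cL1_tdrift (Ld s))).
have LB := cL1_tdrift (cL1B (Ld t) (Ld s)).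
rewrite (@eq_cint _ _ _ _ _ (fun xi => (drift (u t) xi - drift (u s) xi) * btest phi xi)); last first.
  by move=> x; move: (drift (u t) x) (drift (u s) x) (btest phi x) => p q r; rewrite mulrBl.
rewrite -lee_fin; apply: le_trans (le_cabs_cint mu LB.1) _.
apply: (via (\int[mu]_x (B%:E * (cabs (drift (u t) x - drift (u s) x))%:E))%E).
  apply: int_mono; [meas| |].
    by apply: nnfunZ; [rewrite lee_fin|apply: nnfun_cabs; exact: (cL1B (Ld t) (Ld s)).1].
  by move=> x; rewrite -EFinM lee_fin cabsM mulrC; apply: ler_wpM2r; meas.
rewrite integralZ; [|meas|by apply: nnfun_cabs; exact: (cL1B (Ld t) (Ld s)).1].
apply: (via (B%:E * (2 * (e / (2 * (B + 1))))%:E)%E); first by apply: lee_wpmul2l; meas.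
rewrite -EFinM lee_fin (_ : B * _ = e * (B / (B + 1))); last by field; rewrite gt_eqF// ltr_wpDl.
by apply: ler_piMr; [exact: ltW|rewrite ler_pdivrMr ?ltr_wpDl// mul1r lerDl].
Qed.

(** The unbounded factor 1 + |xi|^2 is moved to the test function, where it becomes the bounded
    [btest phi]; Fubini then exchanges time and frequency. *)
Lemma tested_flow T : 0 <= T ->
  cint mu (fun xi => hhat T xi * ift (tocx phi) xi) =
  cint mu (fun xi => hhat 0 xi * ift (tocx phi) xi) + cint leb (fun s => (tri T s)%:C * tdrift s).
Proof.
move=> T0; have Lt := cL1_test tphi.
have K0 : 0 <= \int[mu]_x cabs (tocx phi x) by apply: Rintegral_ge0 => xi _; meas.
have LH t : 0 <= t -> cL1 mu (fun xi => hhat t xi * ift (tocx phi) xi).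
  by move=> t0; apply: (cL1_bounded_mul K0 (cL1_hhat t0) (cmeas_ift Lt.1)) => x; exact: cabs_ift_le.
have [B B0 hB] := btest_bounded tphi.
pose F (p : V * TR) : C := (tri T p.2)%:C * (drift (u p.2) p.1 * btest phi p.1).
have mD : cmeas (fun p : TR * V => drift (u p.1) p.2).
  by apply: cmeasB => //; exact: (cmeas_Nhat (X := TR) (u := fun s : TR => u s) mu_).
have mF : cmeas F.
  apply: cmeasM.
    meas.
  apply: cmeasM; first exact: (cmeas_comp (p := fun p : V * TR => (p.2, p.1)) mD meas_swapVT).
  exact: (cmeas_comp (cmeas_btest tphi) measurable_fst).
have nMr := nnfunD nM (nnfun_rsum nM).
have LF : cL1 (mu \x leb)%E F.
  apply: cL1_prod => //. apply: (@le_lt_trans _ _ (\int[mu]_x ((T * B)%:E * (M x + rsum M x)))%E); last first.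
    rewrite integralZ; [|meas|exact: nMr]. apply: mule_lty; rewrite ?lee_fin ?mulr_ge0 ?ltry//.
    rewrite (integralD2 mu nM (nnfun_rsum nM)); apply: lte_add_pinfty; last exact: (rsumM_lty).
    exact: le_lt_trans MI (ltry _).
  apply: int_mono; [|meas|].
    meas.
  move=> x; have nk : (0 <= B%:E * (M x + rsum M x))%E by apply: mule_ge0; meas.
  apply: (via (\int[leb]_(t in setT) ((B%:E * (M x + rsum M x)) * (tri T t)%:E))%E).
    apply: int_mono.
    - meas.
    - meas.
    - move=> t; have -> : cabs (F (x, t)) = cabs (btest phi x) * cabs (drift (u t) x) * tri T t.
        by rewrite /F /= cabsM cabsM cabs_real (ger0_norm (tri_ge0 T t)); ring.
      rewrite EFinM; apply: lee_wpmul2r; first meas. rewrite EFinM; apply: lee_pmul; rewrite ?lee_fin ?cabs_ge0//.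
      apply: (via ((cabs (u t x))%:E + (cabs (Nhat (u t) x))%:E)%E).
        by rewrite -EFinD lee_fin; exact: cabsB.
      by apply: leeD; [exact: uM|exact: (cabs_Nhat_le_sum x (mu_t t) nM (uM t))].
  rewrite (integralZ leb nk (nnfun_tri T)) (int_tri T0) muleC EFinM muleA //.
have E : {ae mu, forall xi, hhat T xi * ift (tocx phi) xi =
    hhat 0 xi * ift (tocx phi) xi + cint leb (fun s => F (xi, s))}.
  apply: filterS hhat_flow => xi /(_ T T0) [LT ->]; rewrite mulrDl; congr (_ + _).
  rewrite mulrAC -/(btest phi xi) -(cintZ _ LT); apply: eq_cint => s; rewrite /F /=.
  by move: (tri T s)%:C (drift (u s) xi) (btest phi xi) => p q r; ring.
rewrite (ae_eq_cint (LH T T0).1 (cmeasD (LH 0 (lexx _)).1 (cL1_cint1 LF).1) E).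
rewrite (cintD (LH 0 (lexx _)) (cL1_cint1 LF)) (cint_swap LF); congr (_ + _).
apply: eq_cint => s; rewrite /F /tdrift /= cintZ//.
by apply: cL1_tdrift; apply: cL1_drift (u_quarter s); exact: mu_t.
Qed.

End tested.

Hypothesis hermu : forall t, herm (u t).

(** Hermitian symmetry makes the inverse transform real, so taking the real part loses nothing. *)
Definition hsol t x : R := complex.Re (ift (hhat t) x).

Let mhh t : cmeas (hhat t) := cmeas_hhat t.
Let Lhh t (t0 : 0 <= t) : cL1 mu (hhat t) := cL1_hhat t0.
Let L2hh t (t0 : 0 <= t) : (sqint mu (hhat t) < +oo)%E :=
  sqint_hhat_lty t0.
Let mut t : cmeas (u t) := mu_t t.
Let Lu t : cL1 mu (u t) := conj (mut t) (uL1 t).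

Lemma tocx_hsol t : tocx (hsol t) = ift (hhat t).
Proof.
apply/funext => x; rewrite /tocx /hsol -herm_ift//.
by move=> xi; rewrite /hhat enormN hermu conjcM; congr (_ * _); apply: complex_ext; rewrite /= ?oppr0.
Qed.

Lemma meas_hsol t : mfunT (hsol t).
Proof. exact: (cmeas_ift (mhh t)).1. Qed.

Lemma inL2_hsol t : 0 <= t -> inL2 (hsol t).
Proof.
move=> t0; split; first exact: meas_hsol.
by rewrite tocx_hsol; apply: le_lt_trans (bessel_ift (Lhh t0)) (L2hh t0).
Qed.

Lemma fourier_hsol t : 0 <= t -> {ae mu, forall xi, fourier (hsol t) xi = hhat t xi}.
Proof.
move=> t0; apply: (ae_fourier (inL2_hsol t0)); rewrite tocx_hsol.
exact: is_ft2_ift (Lhh t0) (L2hh t0).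
Qed.

Lemma wnorm_hsol k t : 0 <= t -> wnorm k (fourier (hsol t)) = wnorm k (hhat t).
Proof.
move=> t0; apply: ae_eq_wnorm (fourier_hsol t0); last exact: mhh.
exact: cmeas_fourier (inL2_hsol t0).
Qed.

Lemma fourier_hsolB s t : 0 <= s -> 0 <= t ->
  {ae mu, forall xi, fourier (hsol s \- hsol t) xi = hhat s xi - hhat t xi}.
Proof.
move=> s0 t0; have e := ae_fourierB (inL2_hsol s0) (inL2_hsol t0).
have e2 : {ae mu, forall xi, fourier (hsol s) xi = hhat s xi /\ fourier (hsol t) xi = hhat t xi}.
  by apply: filterS2 (fourier_hsol s0) (fourier_hsol t0).
by apply: filterS2 e e2 => xi -> [-> ->].
Qed.

Lemma hsol_space t : 0 <= t -> (Fspace 0 2 `&` Fspace 2 1) (hsol t).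
Proof.
move=> t0; apply/FspaceP; split; first exact: inL2_hsol.
by rewrite wnorm_hsol//; exact: (wnorm_hhat_lty t).
Qed.

Let near0 t (Q : R -> Prop) (dl : R) : 0 <= t -> 0 < dl ->
  (forall s, 0 <= s -> `|s - t| <= dl -> Q s) -> \forall s \near within `[0, +oo[ (nbhs t), Q s.
Proof.
move=> t0 dl0 h; rewrite near_withinE.
have hn : \forall s \near t, `|t - s| <= dl by exact: (@cvgr_dist_le _ _ _ (nbhs t) _ id t _ dl dl0).
by apply: filterS hn => s hs; rewrite /= in_itv /= andbT => s0; apply: h s0 _; rewrite distrC.
Qed.

Lemma hsol_continuous t : 0 <= t ->
  Fnorm 0 2 (hsol s \- hsol t) @[s --> within `[0, +oo[ (nbhs t)] --> 0%E /\
  Fnorm 2 1 (hsol s \- hsol t) @[s --> within `[0, +oo[ (nbhs t)] --> 0%E.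
Proof.
move=> t0; split.
- under eq_fun do rewrite Fnorm02.
  apply: (iffRL (@ecvg0_sqrt R R (within `[0, +oo[ (nbhs t)) _ (fun s => sqint mu (fourier (hsol s \- hsol t))) _)) => [s|]; first meas.
  apply/ecvg0P => [s|e e0]; first meas. have t10 : 0 <= t + 1 by rewrite addr_ge0.
  have [dl dl0 hdl] := hhat_modulus t10 e0. apply: (@near0 t _ (Num.min dl 1) t0); first by rewrite lt_min dl0 ltr01.
  move=> s s0; rewrite le_min => /andP[s1 s2].
  rewrite (ae_eq_sqint (cmeas_fourier (inL2B (inL2_hsol s0) (inL2_hsol t0))) (cmeasB (mhh s) (mhh t)) (fourier_hsolB s0 t0)).
  by apply: hdl => //; [rewrite lerDl|move: s2; rewrite ler_norml => /andP[]; lra].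
- have E s : Fnorm 2 1 (hsol s \- hsol t) = wnorm 2 (fourier (hsol s \- hsol t)) by rewrite -Fnorm1.
  under eq_fun do rewrite E. apply/ecvg0P => [s|e e0]; first meas. have [dl dl0 hdl] := u_modulus e0.
  apply: (near0 t0 dl0) => s s0 st.
  rewrite (ae_eq_wnorm 2 (cmeas_fourier (inL2B (inL2_hsol s0) (inL2_hsol t0))) (cmeasB (mhh s) (mhh t)) (fourier_hsolB s0 t0)).
  rewrite -wnorm_lap_hat; apply: le_trans (hdl t s t0 s0 st). rewrite le_eqVlt; apply/orP; left; apply/eqP.
  apply: ge0_ae_eq_integral => //.
  + by apply: meas_ecabs; apply: cmeas_lap_hat; meas.
  + meas.
  + meas.
  + meas.
  + apply: filterS2 (ae_lap_hat_hhat s) (ae_lap_hat_hhat t) => xi <- <- _. by rewrite /lap_hat mulrBr.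
Qed.

Definition wsol t x : R := complex.Re (ift (u t) x).

Lemma tocx_wsol t : {ae mu, forall x, tocx (wsol t) x = ift (u t) x}.
Proof. by apply: aeW => x; rewrite /tocx /wsol -herm_ift. Qed.

Let tocx_hsol_ae t : {ae mu, forall x, tocx (hsol t) x = ift (hhat t) x}.
Proof. by apply: aeW => x; rewrite tocx_hsol. Qed.

Lemma hsol_laplacian t : 0 <= t -> distr_laplacian (hsol t) (wsol t).
Proof.
move=> t0; have mw : mfunT (wsol t) by exact: (cmeas_ift (mut t)).1.
split.
- exact: loc_integrable_ift (meas_hsol t) (tocx_hsol_ae t) (Lhh t0).
- exact: loc_integrable_ift mw (tocx_wsol t) (Lu t).
move=> phi tphi.
have e1 := laplacian_pairing (meas_hsol t) (tocx_hsol_ae t) (Lhh t0) (wnorm_hhat_lty t) tphi.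
have e2 := (pairing mw (tocx_wsol t) (Lu t) (cL1_test tphi)).2.
rewrite -(cint_mul_ift (cL1_test tphi) (Lu t)) in e2.
have e3 : (\int[mu]_x (hsol t x * laplacian phi x))%:C = (\int[mu]_x (wsol t x * phi x))%:C :> C.
  rewrite e1 e2; apply: eq_cint => x; congr (_ * _).
  apply: ae_eq_ift (ae_lap_hat_hhat t); [exact: cmeas_lap_hat|exact: mut].
by case: e3.
Qed.

Lemma hsol_equation t phi : 0 < t -> test_function phi ->
  is_derive t 1 (fun s => \int[mu]_x (hsol s x * phi x))
    (\int[mu]_x (expR (- wsol t x) * laplacian phi x) + \int[mu]_x ((1 - expR (- wsol t x)) * phi x)).
Proof.
move=> t0 tphi; have mw : mfunT (wsol t) by exact: (cmeas_ift (mut t)).1.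
have y0 : 0 <= 4^-1 :> R by lra.
have y1 : 4^-1 < 1 :> R by lra.
have rhs := equation_rhs mw (tocx_wsol t) (mut t) y0 y1 (u_quarter t) tphi.
have {}rhs := congr1 (@complex.Re R) rhs; rewrite [LHS]/= in rhs; rewrite rhs {rhs}.
(* Freezing negative times at 0 makes q continuous on the whole line. *)
pose q s := complex.Re (tdrift phi (Num.max 0 s)).
have cq : continuous q.
  move=> s; apply/cvgrPdist_le => /= e e0. have [dl dl0 hdl] := tdrift_modulus tphi e0.
  near=> r; rewrite /q -ReN -ReD; apply: le_trans (normr_Re_le _) _; apply: hdl; rewrite ?le_max ?lexx//.
  apply: (via `|s - r|).
    have h1 := ler_norm (s - r); have h2 := ler_norm (r - s); rewrite distrC in h2.
    move: `|s - r| h1 h2 => n h1 h2; rewrite ler_norml !maxEle.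
    by case: (leP 0 s); case: (leP 0 r) => h3 h4; apply/andP; split; lra.
  by near: r; apply: (@cvgr_dist_le _ _ _ (nbhs s) _ id s) => //.
pose p0 := complex.Re (cint mu (fun xi => hhat 0 xi * ift (tocx phi) xi)).
have E s : 0 <= s -> \int[mu]_x (hsol s x * phi x) = p0 + \int[leb]_(r in `[0%R, s]) q r.
  move=> s0; have e := (pairing (meas_hsol s) (tocx_hsol_ae s) (Lhh s0) (cL1_test tphi)).2.
  rewrite (tested_flow tphi s0) in e. move/(congr1 (@complex.Re R)): e; rewrite ReD /= => ->; congr (_ + _).
  rewrite Re_cint [RHS]Rintegral_mkcond; apply: eq_Rintegral => r _.
  rewrite ReM /= mul0r subr0 patchE /tri mem_setE in_itv /=.
  have qr : (0 <= r)%R -> q r = complex.Re (tdrift phi r) by move=> r0; rewrite /q max_r.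
  move: (q r) (complex.Re (tdrift phi r)) qr => a b.
  by case: (0 <= r)%R; case: (r <= s)%R => ab; rewrite /= ?mul1r ?mul0r ?ab.
have t1 : t < t + 1 by rewrite ltrDl.
have iq : leb.-integrable `[0%R, (t + 1)%R] (EFin \o q).
  apply: continuous_compact_integrable; first exact: segment_compact. exact: continuous_subspaceT.
have [dF F'] := @continuous_FTC1_closed R q 0 t (t + 1) t1 iq t0 (cq t).
apply: (@near_eq_is_derive _ _ _ (fun s => p0 + \int[leb]_(r in `[0%R, s]) q r)).
  by have := lt_nbhsr t0; apply: filterS => s /ltW s0; rewrite -(E s s0).
have -> : complex.Re (cint mu (fun xi => (u t xi - Nhat (u t) xi) * btest phi xi)) = 0 + q t.
  by rewrite add0r; have mt := max_r (ltW t0); rewrite /q mt; reflexivity.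
have dq : is_derive t 1 (fun s : R => \int[leb]_(r in `[0%R, s]) q r) (q t).
  by split; [exact: dF|rewrite -derive1E; exact: F'].
exact: (is_deriveD (is_derive_cst p0 t 1) dq).
Unshelve. all: by end_near. Qed.

Lemma hsol_is_solution h0 : {ae mu, forall x, hsol 0 x = h0 x} -> is_solution h0 hsol.
Proof.
move=> e0; split; [exact: hsol_space|exact: hsol_continuous| |].
  by apply: filterS e0.
move=> t t0; exists (wsol t); split.
- exact: hsol_laplacian (ltW t0).
- have mw : mfunT (wsol t) by exact: (cmeas_ift (mut t)).1.
  exact: loc_integrable_exp mw (tocx_wsol t) (Lu t).
- by move=> phi; exact: hsol_equation.
Qed.

End mild_solution.

(** * Distance in L^1 *)

Section L1_distance.
Context {R : realType} d0 {T : measurableType d0} (m : {measure set T -> \bar R}).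
Implicit Types f g h : T -> R[i].

Definition L1d f g : \bar R := (\int[m]_x (cabs (f x - g x))%:E)%E.

Lemma nnfun_L1d f g : cmeas f -> cmeas g -> nnfun (fun x => (cabs (f x - g x))%:E).
Proof. meas. Qed.

Lemma L1d_sym f g : L1d f g = L1d g f.
Proof. by apply: eq_integral => x _; rewrite cabs_distC. Qed.

Lemma L1d_triangle g f h : cmeas f -> cmeas g -> cmeas h -> (L1d f h <= L1d f g + L1d g h)%E.
Proof.
move=> mf mg mh; have n1 := nnfun_L1d mf mg; have n2 := nnfun_L1d mg mh.
rewrite /L1d -(integralD2 m n1 n2); apply: int_mono; [meas|meas|].
by move=> x; rewrite -EFinD lee_fin; exact: cabs_dist_triangle.
Qed.

Lemma L1dD f f' g g' : cmeas f -> cmeas f' -> cmeas g -> cmeas g' ->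
  (L1d (fun x => f x + f' x)%R (fun x => g x + g' x)%R <= L1d f g + L1d f' g')%E.
Proof.
move=> mf mf' mg mg'; have n1 := nnfun_L1d mf mg; have n2 := nnfun_L1d mf' mg'.
rewrite /L1d -(integralD2 m n1 n2); apply: int_mono; [|meas|].
  meas.
move=> x; rewrite -EFinD lee_fin; move: (f x) (f' x) (g x) (g' x) => a a' b b'.
by rewrite (_ : a + a' - (b + b') = (a - b) + (a' - b')); [exact: cabsD|ring].
Qed.

Lemma L1dZ (k : R) f g : 0 <= k -> cmeas f -> cmeas g ->
  (L1d (fun x => k%:C * f x)%R (fun x => k%:C * g x)%R = k%:E * L1d f g)%E.
Proof.
move=> k0 mf mg; rewrite /L1d -integralZ; [|meas|meas].
by apply: eq_integral => x _; rewrite -mulrBr cabsM cabs_real ger0_norm.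
Qed.

Lemma cmeasZ (z : R[i]) f : cmeas f -> cmeas (fun x => z * f x).
Proof. meas. Qed.

Lemma cint_dist_le f g (k : T -> R[i]) (B e : R) : 0 <= B -> cL1 m f -> cL1 m g -> cmeas k ->
  (forall x, cabs (k x) <= B) -> 0 <= e -> (L1d f g <= e%:E)%E ->
  cabs (cint m (fun x => f x * k x) - cint m (fun x => g x * k x)) <= e * B.
Proof.
move=> B0 Lf Lg mk kB e0 fg.
have Lfk := cL1_bounded_mul B0 Lf mk kB; have Lgk := cL1_bounded_mul B0 Lg mk kB.
have n1 := nnfun_L1d Lf.1 Lg.1.
rewrite -(cintB Lfk Lgk) -lee_fin; apply: le_trans (le_cabs_cint m (cmeasB Lfk.1 Lgk.1)) _.
apply: (via (\int[m]_x (B%:E * (cabs (f x - g x))%:E))%E).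
  apply: int_mono; [meas|meas|].
  move=> x; rewrite -EFinM lee_fin; move: (f x) (g x) (k x) (kB x) => a b c cB.
  by rewrite -mulrBl cabsM mulrC; apply: ler_wpM2r cB; meas.
by rewrite integralZ ?lee_fin// mulrC EFinM; apply: lee_wpmul2l; meas.
Qed.

End L1_distance.

(** * From a tested derivative to an increment in L^1 *)

Section riemann_sums.
Context {R : realType} {d : nat}.
Notation V := 'rV[R]_d.
Notation C := R[i].
Notation mu := (lebesgue_rV d).
Implicit Types (a b c s t : R) (n k : nat).

Variables (T : R) (Z D : R -> V -> C) (r : (V -> R) -> R -> R).
Hypotheses (LZ : forall t, cL1 mu (Z t)) (LD : forall t, cL1 mu (D t))
  (Du : forall e : R, 0 < e -> exists2 dl : R, 0 < dl &
     forall s t, `|s - t| <= dl -> (L1d mu (D s) (D t) <= e%:E)%E)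
  (rZ : forall phi s, test_function phi -> 0 <= s <= T ->
     (r phi s)%:C = cint mu (fun xi => Z s xi * btest phi xi))
  (rD : forall phi t, test_function phi -> 0 < t < T ->
     exists2 l : R, l%:C = cint mu (fun xi => D t xi * btest phi xi) & is_derive t 1 (r phi) l)
  (rc : forall phi, test_function phi -> {within `[0, T], continuous (r phi)}).

(** The left Riemann sum over 2^n equal subintervals, in place of an L^1-valued integral of D.
    Recursive bisection makes every estimate an induction on n. *)
Fixpoint dsum n a b : V -> C :=
  if n is k.+1 then fun xi => dsum k a ((a + b) / 2) xi + dsum k ((a + b) / 2) b xi
  else fun xi => (b - a)%:C * D a xi.

Let mD t : cmeas (D t) := (LD t).1.

Lemma cL1_dsum n a b : cL1 mu (dsum n a b).
Proof. by elim: n a b => [|n IH] a b /=; [exact: cL1Z|exact: cL1D]. Qed.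

Let mid a b : a <= b -> a <= (a + b) / 2 /\ (a + b) / 2 <= b.
Proof. by move=> ab; split; lra. Qed.

Let mS n a b : cmeas (dsum n a b) := (cL1_dsum n a b).1.

Lemma dsum_const_le n a b c (e : R) : a <= b ->
  (forall s, a <= s -> s <= b -> (L1d mu (D s) (D c) <= e%:E)%E) ->
  (L1d mu (dsum n a b) (fun xi => (b - a)%:C * D c xi)%R <= ((b - a) * e)%:E)%E.
Proof.
elim: n a b => [|n IH] a b ab h /=.
  have ba : 0 <= b - a by rewrite subr_ge0. by rewrite (L1dZ mu ba (mD a) (mD c)) EFinM; apply: lee_wpmul2l; meas.
have [am mb] := mid ab; set p := (a + b) / 2 in am mb *.
have E : (fun xi => (b - a)%:C * D c xi) = fun xi => (p - a)%:C * D c xi + (b - p)%:C * D c xi.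
  by apply/funext => xi; rewrite -mulrDl -rmorphD /=; congr (_%:C * _); ring.
rewrite E; apply: le_trans (L1dD mu (mS n a p) (mS n p b) (cmeasZ _ (mD c)) (cmeasZ _ (mD c))) _.
rewrite (_ : (b - a) * e = (p - a) * e + (b - p) * e); last by ring.
rewrite EFinD; apply: leeD; apply: IH => // s s1 s2; apply: h => //; lra.
Qed.

Lemma dsum_cauchy n k a b (e : R) : a <= b ->
  (forall s t, `|s - t| <= (b - a) / 2 ^+ n -> (L1d mu (D s) (D t) <= e%:E)%E) ->
  (L1d mu (dsum n a b) (dsum (n + k) a b) <= ((b - a) * e)%:E)%E.
Proof.
elim: n a b => [|n IH] a b ab h.
  rewrite L1d_sym; apply: dsum_const_le => // s s1 s2; apply: h. by rewrite expr0 divr1 ger0_norm; lra.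
have [am mb] := mid ab; rewrite addSn /=; set p := (a + b) / 2 in am mb *.
apply: le_trans (L1dD mu (mS n a p) (mS n p b) (mS _ a p) (mS _ p b)) _.
rewrite (_ : (b - a) * e = (p - a) * e + (b - p) * e); last by ring.
have e1 : (p - a) / 2 ^+ n = (b - a) / 2 ^+ n.+1 by rewrite exprS invfM mulrA; congr (_ / _); rewrite /p; lra.
have e2 : (b - p) / 2 ^+ n = (b - a) / 2 ^+ n.+1 by rewrite exprS invfM mulrA; congr (_ / _); rewrite /p; lra.
by rewrite EFinD; apply: leeD; apply: IH => // s t; rewrite ?e1 ?e2; exact: h.
Qed.

Section tested_sums.
Variables (phi : V -> R) (B : R).
Hypotheses (tphi : test_function phi) (B0 : 0 <= B) (hB : forall xi, cabs (btest phi xi) <= B).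

Let tst (f : V -> C) : C := cint mu (fun xi => f xi * btest phi xi).

(** On a subinterval of the finest level the mean value theorem turns the increment of r into the
    tested D at an intermediate time, where D is e-close to its value at the left endpoint. *)
Lemma dsum_tested n a b (e : R) : 0 <= a -> a <= b -> b <= T -> 0 <= e ->
  (forall s t, `|s - t| <= (b - a) / 2 ^+ n -> (L1d mu (D s) (D t) <= e%:E)%E) ->
  cabs ((r phi b - r phi a)%:C - tst (dsum n a b)) <= (b - a) * (e * B).
Proof.
elim: n a b => [|n IH] a b a0 ab bT e0 h.
  have Lt := cL1_bounded_mul B0 (LD a) (cmeas_btest tphi) hB. have -> : tst (dsum 0 a b) = (b - a)%:C * tst (D a).
    rewrite /tst /= -(cintZ _ Lt); apply: eq_cint => xi.
    by move: (b - a)%:C (D a xi) (btest phi xi) => x y z; rewrite mulrA.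
  have [->|ab'] := eqVneq a b; first by rewrite !subrr !mul0r subr0 cabs0. have {}ab : a < b by rewrite lt_neqAle ab'.
  have inT c : c \in `]a, b[ -> 0 < c < T.
    by rewrite in_itv /= => /andP[h1 h2]; rewrite (le_lt_trans a0 h1) (lt_le_trans h2 bT).
  (* [rD] gives a derivative only at times inside ]0, T[; the value 0 elsewhere is a default. *)
  pose df c : R := if pselect (0 < c < T) is left h then sval (cid2 (rD tphi h)) else 0.
  have hdf c : c \in `]a, b[ -> is_derive c 1 (r phi) (df c) /\ (df c)%:C = tst (D c).
    move=> /inT cT; rewrite /df; case: pselect => // h'; case: (cid2 _) => l /= h1 h2. by split.
  have [c cab ->] : exists2 c, c \in `]a, b[%R & r phi b - r phi a = df c * (b - a).
    apply: MVT => // [c /hdf[]//|]. apply: continuous_subspaceW (rc tphi) => x /=; rewrite !in_itv /= => /andP[h1 h2].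
    by rewrite (le_trans a0 h1) (le_trans h2 bT).
  rewrite mulrC rmorphM /= (hdf c cab).2 -mulrBr cabsM cabs_real ger0_norm; last meas.
  apply: ler_wpM2l; first meas. apply: (cint_dist_le B0 (LD c) (LD a) (cmeas_btest tphi) hB e0); apply: h.
  by move: cab; rewrite in_itv /= expr0 divr1 => /andP[h1 h2]; rewrite ger0_norm; lra.
have [am mb] := mid ab; rewrite /=; set p := (a + b) / 2 in am mb *.
have L1 := cL1_bounded_mul B0 (cL1_dsum n a p) (cmeas_btest tphi) hB.
have L2 := cL1_bounded_mul B0 (cL1_dsum n p b) (cmeas_btest tphi) hB.
have -> : tst (fun xi => dsum n a p xi + dsum n p b xi) = tst (dsum n a p) + tst (dsum n p b).
  rewrite /tst -(cintD L1 L2); apply: eq_cint => xi.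
  by move: (dsum n a p xi) (dsum n p b xi) (btest phi xi) => x y z; rewrite mulrDl.
have e1 : (p - a) / 2 ^+ n = (b - a) / 2 ^+ n.+1 by rewrite exprS invfM mulrA; congr (_ / _); rewrite /p; lra.
have e2 : (b - p) / 2 ^+ n = (b - a) / 2 ^+ n.+1 by rewrite exprS invfM mulrA; congr (_ / _); rewrite /p; lra.
have h1 : cabs ((r phi p - r phi a)%:C - tst (dsum n a p)) <= (p - a) * (e * B).
  by apply: IH => //; [lra|move=> s t; rewrite e1; exact: h].
have h2 : cabs ((r phi b - r phi p)%:C - tst (dsum n p b)) <= (b - p) * (e * B).
  by apply: IH => //; [lra|move=> s t; rewrite e2; exact: h].
have -> : (r phi b - r phi a)%:C - (tst (dsum n a p) + tst (dsum n p b)) =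
   ((r phi p - r phi a)%:C - tst (dsum n a p)) + ((r phi b - r phi p)%:C - tst (dsum n p b)).
  rewrite (_ : r phi b - r phi a = (r phi p - r phi a) + (r phi b - r phi p)); last by ring.
  by rewrite rmorphD /=; ring.
apply: le_trans (cabsD _ _) _.
rewrite (_ : (b - a) * (e * B) = (p - a) * (e * B) + (b - p) * (e * B)); last by ring.
exact: lerD.
Qed.

End tested_sums.

Lemma eq_of_le_geometric (x y : R) : (forall j, x <= y + 4 / 2 ^+ j) -> x <= y.
Proof.
move=> h; apply/ler_addgt0Pr => e e0.
have : \forall n \near \oo, (4 / 2 ^+ n : R) <= e.
  have := @cvg_geometric R 4 2^-1; rewrite ger0_norm ?invr_ge0// invf_lt1// ltr1n => /(_ isT).
  move=> /cvgr0Pnorm_le /(_ e e0); apply: filterS => n; rewrite /geometric /= exprVn.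
  by rewrite ger0_norm// divr_ge0// exprn_ge0.
move=> [n _ /(_ n (leqnn n)) hn]; apply: le_trans (h n) _; by rewrite lerD2l.
Qed.

(** The Riemann sums have an L^1 limit F. Tested against every [btest phi], F and Z b - Z a agree,
    so they are equal almost everywhere; the oscillation of D then compares F with (b - a) D b,
    taken at the right end as an implicit scheme requires. *)
Lemma integrated_increment a b (e : R) : 0 <= a -> a <= b -> b <= T -> 0 <= e ->
  (forall s, a <= s -> s <= b -> (L1d mu (D s) (D b) <= e%:E)%E) ->
  (L1d mu (fun xi => Z b xi - Z a xi)%R (fun xi => (b - a)%:C * D b xi)%R <= ((b - a) * e)%:E)%E.
Proof.
move=> a0 ab bT e0 osc; have ba : 0 <= b - a by rewrite subr_ge0.
have ba1 : 0 < b - a + 1 by rewrite ltr_wpDl.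
(* Dividing by b - a + 1, positive also for a = b, keeps (b - a) ej j at most 2^-j. *)
pose ej (j : nat) : R := (2 ^+ j)^-1 / (b - a + 1).
have ej0 j : 0 < ej j by rewrite divr_gt0// invr_gt0 exprn_gt0.
have baej j : (b - a) * ej j <= (2 ^+ j)^-1.
  rewrite /ej mulrCA; apply: ler_piMr; first meas. by rewrite ler_pdivrMr// mul1r lerDl.
have /choice[N hN] : forall j, exists n : nat, forall s t, `|s - t| <= (b - a) / 2 ^+ n ->
    (L1d mu (D s) (D t) <= (ej j)%:E)%E.
  move=> j; have [dl dl0 hdl] := Du (ej0 j). have : \forall n \near \oo, (b - a) / 2 ^+ n <= dl.
    have := @cvg_geometric R (b - a) 2^-1; rewrite ger0_norm ?invr_ge0// invf_lt1// ltr1n => /(_ isT).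
    move=> /cvgr0Pnorm_le /(_ dl dl0); apply: filterS => n; rewrite /geometric /= exprVn.
    by rewrite ger0_norm// divr_ge0// exprn_ge0.
  move=> [n _ /(_ n (leqnn n)) hn]; exists n => s t st; apply: hdl; exact: le_trans st hn.
pose w j := dsum (N j) a b.
have mw j : cmeas (w j) := mS (N j) a b.
have cau j k : (j <= k)%N -> (L1d mu (w k) (w j) <= (2 / 2 ^+ j)%:E)%E.
  move=> jk; have c1 := dsum_cauchy (N j) ab (hN k); have c2 := dsum_cauchy (N k) ab (hN j).
  apply: le_trans (L1d_triangle mu (mw k) (mS (N k + N j) a b) (mw j)) _.
  rewrite (L1d_sym mu (dsum (N k + N j) a b)); rewrite (addnC (N j)) in c2.
  apply: (via ((2 ^+ k)^-1%:E + (2 ^+ j)^-1%:E)%E).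
    apply: leeD.
      by apply: le_trans c1 _; meas.
    by apply: le_trans c2 _; meas.
  have : (2 ^+ k)^-1 <= (2 ^+ j)^-1 :> R by rewrite lef_pV2 ?posrE ?exprn_gt0// ler_eXn2l ?ltr1n.
  by rewrite -EFinD lee_fin; move: ((2 ^+ k)^-1 : R) ((2 ^+ j)^-1 : R) => x y; lra.
have [F mF hF] := L1_complete mw cau.
have LF : cL1 mu F.
  split => //; have Lw := cL1_dsum (N 0%N) a b.
  apply: (@le_lt_trans _ _ (\int[mu]_x ((cabs (w 0%N x))%:E + (cabs (w 0%N x - F x))%:E))%E).
    apply: int_mono; [meas|apply: nnfunD; [meas|meas]|].
    move=> x; rewrite -EFinD lee_fin; move: (w 0%N x) (F x) => y z. by have := cabsB y (y - z); rewrite subKr.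
  rewrite (integralD2 mu (nnfun_cabs (mw 0%N)) (nnfun_L1d (mw 0%N) mF)).
  by apply: lte_add_pinfty; [exact: Lw.2|apply: le_lt_trans (hF 0%N) (ltry _)].
have LZZ := cL1B (LZ b) (LZ a).
have e1 : {ae mu, forall xi, Z b xi - Z a xi - F xi = 0}.
  apply: (btest_eq0 (cL1B LZZ LF)) => phi tphi. have [B B0 hB] := btest_bounded tphi; have mb := cmeas_btest tphi.
  have tl f : cL1 mu f -> cL1 mu (fun xi => f xi * btest phi xi).
    by move=> Lf; exact: (cL1_bounded_mul B0 Lf mb hB).
  have -> : cint mu (fun xi => (Z b xi - Z a xi - F xi) * btest phi xi) =
      (r phi b - r phi a)%:C - cint mu (fun xi => F xi * btest phi xi).
    rewrite rmorphB /= !rZ ?a0 ?bT ?(le_trans ab bT) ?(le_trans a0 ab)//.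
    rewrite -(cintB (tl _ (LZ b)) (tl _ (LZ a))) -(cintB (cL1B (tl _ (LZ b)) (tl _ (LZ a))) (tl _ LF)).
    apply: eq_cint => xi; move: (Z b xi) (Z a xi) (F xi) (btest phi xi) => x y z k; ring.
  apply: cabs0_eq0; apply/eqP; rewrite eq_le cabs_ge0 andbT. have B1 : 0 < B + 1 by rewrite ltr_wpDl.
  rewrite -(pmulr_rle0 _ (x := (B + 1)^-1)) ?invr_gt0//. apply: eq_of_le_geometric => j; rewrite add0r ler_pdivrMl//.
  apply: le_trans (cabs_dist_triangle (cint mu (fun xi => w j xi * btest phi xi)) _ _) _.
  have h1 := dsum_tested tphi B0 hB a0 ab bT (ltW (ej0 j)) (hN j).
  have h2 := cint_dist_le B0 (cL1_dsum (N j) a b) LF mb hB (divr_ge0 (ler0n _ 2) (exprn_ge0 j (ler0n _ 2))) (hF j).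
  apply: le_trans (lerD h1 h2) _.
  have h3 : (b - a) * (ej j * B) <= (2 ^+ j)^-1 * B by rewrite mulrA; apply: ler_wpM2r.
  apply: le_trans (lerD h3 (lexx _)) _. have : 0 <= (2 ^+ j)^-1 :> R by rewrite invr_ge0 exprn_ge0.
  by move: ((2 ^+ j)^-1) => x x0; nra.
have e2 : L1d mu (fun xi => Z b xi - Z a xi) (fun xi => (b - a)%:C * D b xi) =
    L1d mu F (fun xi => (b - a)%:C * D b xi).
  apply: ge0_ae_eq_integral => //.
  - meas.
  - meas.
  - meas.
  - meas.
  - by apply: filterS e1 => xi /eqP; rewrite subr_eq0 => /eqP -> _.
rewrite e2; have fin_ : L1d mu F (fun xi => (b - a)%:C * D b xi) \is a fin_num.
  rewrite ge0_fin_numE; last by apply: integral_ge0 => x _; meas. exact: (cL1B LF (cL1Z _ (LD b))).2.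
rewrite -(fineK fin_) lee_fin; apply: eq_of_le_geometric => j; rewrite -lee_fin fineK//.
apply: le_trans (L1d_triangle mu mF (mw j) (cmeasZ _ (mD b))) _.
rewrite addeC EFinD; apply: leeD; first exact: dsum_const_le.
rewrite L1d_sym; apply: le_trans (hF j) _; rewrite lee_fin; apply: ler_wpM2r; last by lra.
meas.
Qed.

End riemann_sums.

(** The Heine theorem for a family seen only through an extended-valued distance between its
    members. *)
Lemma segment_modulus {R : realType} (dist : R -> R -> \bar R) (T : R) :
  (forall s t, dist s t = dist t s) ->
  (forall s t r, (dist s r <= dist s t + dist t r)%E) ->
  (forall t, 0 <= t <= T -> forall e : R, 0 < e -> exists2 dl : R, 0 < dl &
     forall s, 0 <= s <= T -> `|s - t| <= dl -> (dist s t <= e%:E)%E) ->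
  forall e : R, 0 < e -> exists2 dl : R, 0 < dl &
    forall s t, 0 <= s <= T -> 0 <= t <= T -> `|s - t| <= dl -> (dist s t <= e%:E)%E.
Proof.
move=> sym tri_ h e e0.
have /compact_near_coveringP := @segment_compact R 0 T.
move=> /(_ R (nbhs (0 : R)^'+) (fun dl t => forall s, 0 <= s <= T -> 0 <= t <= T -> `|s - t| <= dl -> (dist s t <= e%:E)%E)).
case.
  move=> t /=; rewrite in_itv /= => tT. have [dl dl0 hdl] := h t tT (e / 2) (divr_gt0 e0 (ltr0n _ 2)).
  have d2 : 0 < dl / 2 by rewrite divr_gt0. exists ([set t' | `|t - t'| <= dl / 2], [set e' : R | e' <= dl / 2]).
    split => /=; first by exact: (@cvgr_dist_le _ _ _ (nbhs t) _ id t _ _ d2). by apply: nbhs_right_le.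
  move=> [t' e'] /= [h1 h2] s sT t'T st. apply: le_trans (tri_ s t t') _; rewrite (splitr e) EFinD; apply: leeD.
    apply: hdl => //; rewrite (_ : s - t = (s - t') + (t' - t)); last by ring.
    apply: le_trans (ler_normD _ _) _; rewrite (distrC t' t).
    by rewrite (splitr dl); apply: lerD => //; apply: le_trans st h2.
  rewrite sym; apply: hdl => //; rewrite distrC; apply: le_trans h1 _; lra.
move=> dl /= dl0 hdl; exists (dl / 2); first by rewrite divr_gt0.
move=> s t sT tT st; apply: (hdl (dl / 2)) => //=; rewrite ?divr_gt0//.
- by rewrite sub0r normrN ger0_norm; lra.
Qed.

(** * Implicit Euler scheme *)

Section euler.
Context {R : realType} {d : nat}.
Notation V := 'rV[R]_d.
Notation C := R[i].
Notation mu := (lebesgue_rV d).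
Implicit Types (a b t : R) (u v Z Y : V -> C).

(* One step of the implicit Euler scheme is a contraction: the damping [lam] absorbs
   the difference of the nonlinear terms. *)
Lemma euler_step (Z Y u v : V -> C) (tau e : R) : 0 <= tau ->
  cL1 mu Z -> cL1 mu Y -> cmeas u -> cmeas v ->
  (\int[mu]_xi (cabs (u xi))%:E <= (4^-1)%:E)%E -> (\int[mu]_xi (cabs (v xi))%:E <= (4^-1)%:E)%E ->
  (forall xi, u xi - v xi = - (lam xi)%:C * Y xi) ->
  (L1d mu (fun xi => Y xi - Z xi)%R (fun xi => tau%:C * (drift u xi - drift v xi))%R <= e%:E)%E ->
  (\int[mu]_xi (cabs (Y xi))%:E <= \int[mu]_xi (cabs (Z xi))%:E + e%:E)%E.
Proof.
move=> tau0 LZ LY mu_ mv uy vy huv he.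
have Luv : cL1 mu (fun xi => u xi - v xi).
  by apply: cL1B; split=> //; [apply: le_lt_trans uy (ltry _)|apply: le_lt_trans vy (ltry _)].
have nuv := nnfun_cabs Luv.1.
pose L := fine (\int[mu]_xi (cabs (u xi - v xi))%:E).
have L0 : 0 <= L by apply: fine_ge0; meas.
have EL : (\int[mu]_xi (cabs (u xi - v xi))%:E = L%:E)%E.
  rewrite fineK// ge0_fin_numE; [exact: Luv.2|meas].
have N := int_NhatB_le mu_ mv uy vy L0; rewrite EL lexx in N; have {}N := N isT.
have mN := cmeasB (cmeas_Nhat1 mu_) (cmeas_Nhat1 mv); have nN := nnfun_cabs mN.
have mD := cmeasB (cmeas_drift mu_) (cmeas_drift mv).
have nE := nnfun_L1d (cmeasB LY.1 LZ.1) (cmeasZ tau%:C mD).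
have nZ := nnfun_cabs LZ.1; have nY := nnfun_cabs LY.1.
have t0 : (0 <= tau%:E)%E by rewrite lee_fin.
have key : (\int[mu]_xi ((cabs (Y xi))%:E + tau%:E * (cabs (u xi - v xi))%:E) <=
   \int[mu]_xi (((cabs (Z xi))%:E + (cabs (Y xi - Z xi - tau%:C * (drift u xi - drift v xi)))%:E) +
     tau%:E * (cabs (Nhat u xi - Nhat v xi))%:E))%E.
  apply: int_mono.
  - meas.
  - meas.
  - move=> xi; rewrite -!EFinM -!EFinD lee_fin; have l0 := lam_ge0 xi.
    have -> : cabs (u xi - v xi) = lam xi * cabs (Y xi).
      by rewrite huv mulNr cabsN cabsM cabs_real ger0_norm.
    have -> : drift u xi - drift v xi = - (lam xi)%:C * Y xi - (Nhat u xi - Nhat v xi).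
      by rewrite -huv /drift; move: (u xi) (v xi) (Nhat u xi) (Nhat v xi) => p q x y; ring.
    move: (Y xi) (Z xi) (Nhat u xi - Nhat v xi) (lam xi) l0 => y z n l l0.
    have -> : cabs y + tau * (l * cabs y) = cabs ((1 + tau * l)%:C * y).
      rewrite cabsM cabs_real ger0_norm ?addr_ge0 ?mulr_ge0//; ring.
    (* The implicit step solved for Y: (1 + tau lam) Y = Z + error - tau (Nhat u - Nhat v). *)
    have -> : (1 + tau * l)%:C * y = (z + (y - z - tau%:C * (- l%:C * y - n))) + - (tau%:C * n).
      by rewrite rmorphD rmorphM rmorph1 /=; ring.
    apply: le_trans (cabsD _ _) _; rewrite cabsN cabsM cabs_real ger0_norm//. by apply: lerD => //; exact: cabsD.
move: key; rewrite (integralD2 mu nY (nnfunZ t0 nuv)) (integralZ mu t0 nuv) EL.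
rewrite (integralD2 mu (nnfunD nZ nE) (nnfunZ t0 nN)) (integralZ mu t0 nN) (integralD2 mu nZ nE).
move=> key.
have : (\int[mu]_xi (cabs (Y xi))%:E + tau%:E * L%:E <= \int[mu]_xi (cabs (Z xi))%:E + e%:E + tau%:E * L%:E)%E.
  apply: le_trans key _; apply: leeD; last by apply: lee_wpmul2l. by apply: leeD.
by rewrite -EFinM leeD2rE.
Qed.

(* n Euler steps of size tau, each with an error [tau * e]. *)
Lemma euler_zero (E : R -> \bar R) (T : R) : 0 <= T -> (forall t, 0 <= E t)%E -> E 0 = 0%E ->
  (forall e : R, 0 < e -> exists2 dl : R, 0 < dl & forall a b, 0 <= a -> a <= b -> b <= T ->
     b - a <= dl -> (E b <= E a + ((b - a) * e)%:E)%E) ->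
  forall t, 0 <= t <= T -> E t = 0%E.
Proof.
move=> T0 E0 Ei h t /andP[t0 tT]; apply/eqP; rewrite eq_le E0 andbT.
apply/lee_addgt0Pr => e e0; rewrite add0e.
have t1 : 0 < t + 1 by rewrite ltr_wpDl.
(* The errors accumulate to t e / (t + 1), which is at most e. *)
have [dl dl0 hdl] := h _ (divr_gt0 e0 t1).
pose n := (Num.truncn (t / dl)).+1.
have n0 : 0 < n%:R :> R by rewrite ltr0n.
have tn : t / n%:R <= dl.
  rewrite ler_pdivrMr// mulrC -ler_pdivrMr//; apply: ltW; exact: truncnS_gt.
have step k : (k <= n)%N -> (E (k%:R * (t / n%:R))%R <= (k%:R * (t / n%:R) * (e / (t + 1)))%:E)%E.
  elim: k => [|k IH] kn; first by rewrite !mul0r Ei. have q0 : 0 <= t / n%:R by rewrite divr_ge0// ltW.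
  have k0 : 0 <= k%:R :> R by []. have kT : k.+1%:R * (t / n%:R) <= T.
    apply: le_trans tT; rewrite mulrA ler_pdivrMr// mulrC; apply: ler_wpM2l => //. by rewrite ler_nat.
  have e1 : k.+1%:R * (t / n%:R) - k%:R * (t / n%:R) = t / n%:R by rewrite -natr1; ring.
  have a0 : 0 <= k%:R * (t / n%:R) by rewrite mulr_ge0.
  have ab : k%:R * (t / n%:R) <= k.+1%:R * (t / n%:R) by apply: ler_wpM2r => //; rewrite ler_nat.
  have := hdl _ _ a0 ab kT; rewrite e1 => /(_ tn) hs; apply: le_trans hs _.
  rewrite -natr1 mulrDl mul1r mulrDl EFinD; apply: leeD => //; apply: IH; exact: ltnW.
have := step n (leqnn n); rewrite mulrC divfK ?gt_eqF// => hs; apply: le_trans hs _.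
rewrite lee_fin mulrCA; apply: ler_piMr; first exact: ltW.
by rewrite ler_pdivrMr// mul1r lerDl.
Qed.

End euler.

Lemma cabs_subACA {R : realType} (p p' q q' : R[i]) :
  cabs (p - p' - (q - q')) <= cabs (p - q) + cabs (p' - q').
Proof. by rewrite (_ : p - p' - (q - q') = (p - q) - (p' - q')); [exact: cabsB|ring]. Qed.

(** * Properties of an arbitrary solution *)

Section solutions.
Context {R : realType} {d : nat}.
Notation V := 'rV[R]_d.
Notation C := R[i].
Notation mu := (lebesgue_rV d).
Implicit Types (h : R -> V -> R) (s t a b e : R) (xi : V).

Definition Uhat h t : V -> C := lap_hat (fourier (h t)).

Lemma within_nonneg_ecvg0 (f : R -> \bar R) t : (forall s, 0 <= f s)%E ->
  f s @[s --> within `[0%R, +oo[ (nbhs t)] --> 0%E ->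
  forall e, 0 < e -> exists2 dl : R, 0 < dl & forall s, 0 <= s -> `|s - t| <= dl -> (f s <= e%:E)%E.
Proof.
move=> f0 hf e e0; have FF : Filter (within `[0%R, +oo[ (nbhs t)) by exact: within_filter.
have := iffLR (@ecvg0P R R (within `[0%R, +oo[ (nbhs t)) FF f f0) hf e e0; rewrite near_withinE => hn; have [dl /= dl0 hdl] := (nbhs_ballP _ _).1 hn.
exists (dl / 2); first by rewrite divr_gt0.
move=> s s0 st; apply: hdl; last by rewrite /= in_itv /= andbT.
by rewrite /ball /= distrC; apply: le_lt_trans st _; rewrite ltr_pdivrMr// ltr_pMr// ltr1n.
Qed.

Section one_solution.
Variables (h0 : V -> R) (h : R -> V -> R).
Hypothesis hs : is_solution h0 h.

Lemma sol_inL2 t : 0 <= t -> inL2 (h t).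
Proof. by case: hs => + _ _ _ => /[apply] /FspaceP[]. Qed.

Lemma sol_wnorm t : 0 <= t -> (wnorm 2 (fourier (h t)) < +oo)%E.
Proof. by case: hs => + _ _ _ => /[apply] /FspaceP[]. Qed.

Lemma sol_cmeas t : 0 <= t -> cmeas (fourier (h t)).
Proof. by move=> t0; exact: cmeas_fourier (sol_inL2 t0). Qed.

Lemma sol_sqint t : 0 <= t -> (sqint mu (fourier (h t)) < +oo)%E.
Proof.
move=> t0; have i2 := sol_inL2 t0.
exact: sqint_ft2_lty (cmeas_tocx i2.1) i2.2 (fourierP i2).
Qed.

Lemma sol_cL1 t : 0 <= t -> cL1 mu (fourier (h t)).
Proof. by move=> t0; exact: cL1_of_lap_hat (sol_cmeas t0) (sol_sqint t0) (sol_wnorm t0). Qed.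

Lemma sol_cL1_Uhat t : 0 <= t -> cL1 mu (Uhat h t).
Proof. by move=> t0; exact: cL1_lap_hat (sol_cmeas t0) (sol_wnorm t0). Qed.

Lemma sol_ift t : 0 <= t -> {ae mu, forall x, tocx (h t) x = ift (fourier (h t)) x}.
Proof.
move=> t0; have i2 := sol_inL2 t0.
exact: ft2_inversion (cmeas_tocx i2.1) i2.2 (fourierP i2) (sol_cL1 t0).
Qed.

Lemma sol_Uhat_modulus t : 0 <= t -> forall e, 0 < e -> exists2 dl : R, 0 < dl &
  forall s, 0 <= s -> `|s - t| <= dl -> (L1d mu (Uhat h s) (Uhat h t) <= e%:E)%E.
Proof.
move=> t0 e e0; have [_ /(_ t t0)[_ hc] _ _] := hs.
have E s : Fnorm 2 1 (h s \- h t) = wnorm 2 (fourier (h s \- h t)) by rewrite -Fnorm1.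
have F0 s : (0 <= Fnorm 2 1 (h s \- h t)%R)%E by rewrite E; meas.
have [dl dl0 hdl] := within_nonneg_ecvg0 F0 hc e0; exists dl => // s s0 st.
have := hdl s s0 st; rewrite E => H; apply: le_trans H.
have i2 := inL2B (sol_inL2 s0) (sol_inL2 t0).
have mB := cmeasB (sol_cmeas s0) (sol_cmeas t0).
rewrite (ae_eq_wnorm 2 (cmeas_fourier i2) mB (ae_fourierB (sol_inL2 s0) (sol_inL2 t0))).
rewrite -wnorm_lap_hat /L1d; rewrite le_eqVlt; apply/orP; left; apply/eqP.
by apply: eq_integral => xi _; rewrite /Uhat /lap_hat -mulrBr.
Qed.

Section sol_tested.
Variable phi : V -> R.
Hypothesis tphi : test_function phi.

Lemma sol_pairing t : 0 <= t ->
  cL1 mu (fun xi => fourier (h t) xi * ift (tocx phi) xi) /\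
  (\int[mu]_x (h t x * phi x))%:C = cint mu (fun xi => fourier (h t) xi * ift (tocx phi) xi).
Proof.
move=> t0; have Lt := cL1_test tphi; split.
  apply: (cL1_bounded_mul _ (sol_cL1 t0) (cmeas_ift Lt.1) (fun x => cabs_ift_le x Lt)).
  by apply: Rintegral_ge0 => x _; meas.
exact: (pairing (sol_inL2 t0).1 (sol_ift t0) (sol_cL1 t0) Lt).2.
Qed.

(** Here the continuity in \dot F^{0,2} enters: the transform of phi is square integrable and is
    paired in L^2. *)
Lemma sol_tested_modulus t : 0 <= t -> forall e, 0 < e -> exists2 dl : R, 0 < dl &
  forall s, 0 <= s -> `|s - t| <= dl -> `|\int[mu]_x (h s x * phi x) - \int[mu]_x (h t x * phi x)| <= e.
Proof.
move=> t0 e e0; have [_ /(_ t t0)[hc _] _ _] := hs.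
have {}hc : sqint mu (fourier (h s \- h t)) @[s --> within `[0, +oo[ (nbhs t)] --> 0%E.
  apply/(@ecvg0_sqrt R R (within `[0, +oo[ (nbhs t)) _ (fun s => sqint mu (fourier (h s \- h t)))).
    meas.
  by move: hc; under eq_fun do rewrite Fnorm02.
pose Q := fine (sqint mu (ift (tocx phi))).
have EQ : (sqint mu (ift (tocx phi)) = Q%:E)%E.
  by rewrite fineK// ge0_fin_numE ?sqint_ge0//; exact: sqint_ift_test.
have Q0 : 0 <= Q by apply: fine_ge0; meas.
have Q1 : 0 < Q + 1 by rewrite ltr_wpDl.
(* The Cauchy-Schwarz parameter: it makes k^-1 Q at most e / 2, and the tolerance e / (2 k) on the
   distance gives the other half. *)
pose k := 2 * (Q + 1) / e.
have k0 : 0 < k by rewrite divr_gt0// mulr_gt0.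
have [dl dl0 hdl] := within_nonneg_ecvg0 (fun s => sqint_ge0 mu (fourier (h s \- h t))) hc (divr_gt0 e0 (mulr_gt0 (ltr0n _ 2) k0)).
exists dl => // s s0 st.
have i2 := inL2B (sol_inL2 s0) (sol_inL2 t0).
have mB := cmeasB (sol_cmeas s0) (sol_cmeas t0).
have := hdl s s0 st; rewrite (ae_eq_sqint (cmeas_fourier i2) mB (ae_fourierB (sol_inL2 s0) (sol_inL2 t0))) => H.
have Bo : (sqint mu (fun xi => fourier (h s) xi - fourier (h t) xi)%R < +oo)%E by apply: le_lt_trans H (ltry _).
have [L1 E1] := sol_pairing s0; have [L2 E2] := sol_pairing t0.
rewrite -cabs_real rmorphB /= E1 E2 -(cintB L1 L2) -lee_fin.
rewrite (@eq_cint _ _ _ _ _ (fun xi => (fourier (h s) xi - fourier (h t) xi) * ift (tocx phi) xi)); last first.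
  by move=> xi; move: (fourier (h s) xi) (fourier (h t) xi) (ift _ _) => p q r; rewrite mulrBl.
apply: le_trans (cabs_cint_mul_le mB (cmeas_ift (cL1_test tphi).1) Bo (sqint_ift_test tphi) k0) _.
rewrite EQ; apply: (via (k%:E * (e / (2 * k))%:E + k^-1%:E * Q%:E)%E).
  by apply: leeD => //; apply: lee_wpmul2l; meas.
rewrite -!EFinM -EFinD lee_fin (_ : k * (e / (2 * k)) = e / 2); last by field; rewrite gt_eqF.
have -> : k^-1 * Q = e / 2 * (Q / (Q + 1)).
  by rewrite /k; field; rewrite !gt_eqF.
have : Q / (Q + 1) <= 1 by rewrite ler_pdivrMr// mul1r lerDl.
move: (Q / (Q + 1)) => x x1; nra.
Qed.

(** The w of the weak formulation is otherwise unspecified: [ae_lap] identifies it with the inverse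
    transform of [Uhat h t], and the bound 1/4 makes [equation_rhs] applicable. *)
Lemma sol_derive t : 0 < t -> (\int[mu]_xi (cabs (Uhat h t xi))%:E <= (4^-1)%:E)%E ->
  exists2 l : R, l%:C = cint mu (fun xi => drift (Uhat h t) xi * btest phi xi) &
    is_derive t 1 (fun s => \int[mu]_x (h s x * phi x)) l.
Proof.
move=> t0 Ut; have [_ _ _ /(_ t t0)[w [lapw _ /(_ phi tphi) hd]]] := hs.
eexists; last exact: hd.
have t0' := ltW t0; have mw : mfunT w by case: lapw => _ [].
have wU := ae_lap (sol_inL2 t0').1 (sol_ift t0') (sol_cL1 t0') (sol_wnorm t0') lapw.
have y0 : 0 <= 4^-1 :> R by lra.
have y1 : 4^-1 < 1 :> R by lra.
exact: equation_rhs mw wU (sol_cL1_Uhat t0').1 y0 y1 Ut tphi.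
Qed.

End sol_tested.
End one_solution.

Lemma fourier_ae_eq f g : inL2 f -> inL2 g -> {ae mu, forall x, f x = g x} ->
  {ae mu, forall xi, fourier f xi = fourier g xi}.
Proof.
move=> f2 g2 fg; apply: ae_fourier => //.
apply: (ae_eq_is_ft2 (cmeas_tocx g2.1) (cmeas_tocx f2.1) _ (fourierP g2)).
by apply: filterS fg => x e; rewrite /tocx e.
Qed.

(** * Comparison of two solutions *)

Section two_solutions.
Variables (h0 : V -> R) (h1 h2 : R -> V -> R) (T : R).
Hypotheses (s1 : is_solution h0 h1) (s2 : is_solution h0 h2) (T0 : 0 <= T)
  (small1 : forall t, 0 <= t <= T -> (\int[mu]_xi (cabs (Uhat h1 t xi))%:E <= (4^-1)%:E)%E)
  (small2 : forall t, 0 <= t <= T -> (\int[mu]_xi (cabs (Uhat h2 t xi))%:E <= (4^-1)%:E)%E).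

(** The Riemann sum argument asks for functions of every real time; clamping to [0, T] extends them
    without enlarging moduli of continuity. *)
Let clamp t : R := Num.min T (Num.max 0 t).

Let clampT t : 0 <= clamp t <= T.
Proof. by rewrite /clamp le_min T0 le_max lexx /= ge_min lexx. Qed.

Let clamp0 t : 0 <= clamp t. Proof. by case/andP: (clampT t). Qed.

Let clamp_id t : 0 <= t <= T -> clamp t = t.
Proof. by move=> /andP[t0 tT]; rewrite /clamp max_r// min_r. Qed.

Let clamp_lip s t : `|clamp s - clamp t| <= `|s - t|.
Proof.
have n2 (a b : R) : a - b <= `|a - b| /\ b - a <= `|a - b|.
  by split; [exact: ler_norm|rewrite distrC ler_norm].
have mx (a b : R) : `|Num.max 0 a - Num.max 0 b| <= `|a - b|.
  have [g1 g2] := n2 a b; move: `|a - b| g1 g2 => n g1 g2; rewrite ler_norml !maxEle.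
  by case: (leP 0 a); case: (leP 0 b) => h3 h4; apply/andP; split; lra.
have mn (a b : R) : `|Num.min T a - Num.min T b| <= `|a - b|.
  have [g1 g2] := n2 a b; move: `|a - b| g1 g2 => n g1 g2; rewrite ler_norml !minEle.
  by case: (leP T a); case: (leP T b) => h3 h4; apply/andP; split; lra.
exact: le_trans (mn _ _) (mx _ _).
Qed.

Let wt xi : R := (1 + enorm xi ^+ 2)^-1.

Let wt0 xi : 1 + enorm xi ^+ 2 != 0.
Proof. by rewrite gt_eqF// ltr_wpDr// sqr_ge0. Qed.

Let mwt : cmeas (fun xi : V => (wt xi)%:C : C).
Proof.
apply: cmeas_real; rewrite /wt.
under eq_fun do rewrite -(@powR_inv1 _ (1 + _)) ?addr_ge0 ?sqr_ge0//.
apply: (measurableT_comp (@measurable_powR R (-1)) _).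
meas.
Qed.

Let wt_le1 xi : cabs ((wt xi)%:C : C) <= 1.
Proof.
have w0 : 0 <= wt xi by rewrite invr_ge0 addr_ge0// sqr_ge0.
rewrite cabs_real ger0_norm// invf_le1; first by rewrite lerDl sqr_ge0.
by rewrite ltr_wpDr// sqr_ge0.
Qed.

(** Unweighted, the difference would have time derivative (1 + |xi|^2) D, which is not controlled in
    L^1. *)
Let Z t xi : C := (fourier (h1 (clamp t)) xi - fourier (h2 (clamp t)) xi) * (wt xi)%:C.
Let D t xi : C := drift (Uhat h1 (clamp t)) xi - drift (Uhat h2 (clamp t)) xi.
Let r phi s : R := \int[mu]_x (h1 s x * phi x) - \int[mu]_x (h2 s x * phi x).

Let LZ t : cL1 mu (Z t).
Proof.
apply: (cL1_bounded_mul (B := 1) ler01 _ mwt wt_le1).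
by apply: cL1B; [exact: (sol_cL1 s1 (clamp0 t))|exact: (sol_cL1 s2 (clamp0 t))].
Qed.

Let mU1 t : cmeas (Uhat h1 (clamp t)). Proof. exact: (sol_cL1_Uhat s1 (clamp0 t)).1. Qed.
Let mU2 t : cmeas (Uhat h2 (clamp t)). Proof. exact: (sol_cL1_Uhat s2 (clamp0 t)).1. Qed.

Let LD t : cL1 mu (D t).
Proof.
by apply: cL1B; apply: cL1_drift; [exact: mU1|exact: small1|exact: mU2|exact: small2].
Qed.

Let clamped_modulus h : is_solution h0 h -> forall e, 0 < e -> exists2 dl : R, 0 < dl &
  forall s t, `|s - t| <= dl -> (L1d mu (Uhat h (clamp s)) (Uhat h (clamp t)) <= e%:E)%E.
Proof.
move=> hs e e0; have mU t : cmeas (Uhat h (clamp t)) by exact: (sol_cL1_Uhat hs (clamp0 t)).1.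
have [||t tT e' e'0|dl dl0 hdl] := @segment_modulus R (fun s t => L1d mu (Uhat h (clamp s)) (Uhat h (clamp t))) T _ _ _ e e0.
- by move=> s t; exact: L1d_sym.
- by move=> s t u; exact: L1d_triangle.
- have [dl dl0 hdl] := sol_Uhat_modulus hs (clamp0 t) e'0; exists dl => // s sT st.
  by apply: hdl => //; rewrite !clamp_id.
exists dl => // s t st; have := hdl (clamp s) (clamp t) (clampT s) (clampT t) (le_trans (clamp_lip s t) st).
by rewrite !(clamp_id (clampT _)).
Qed.

Let Du e : 0 < e -> exists2 dl : R, 0 < dl &
  forall s t, `|s - t| <= dl -> (L1d mu (D s) (D t) <= e%:E)%E.
Proof.
move=> e0; have e4 : 0 < e / 4 by rewrite divr_gt0.
have [d1 d10 H1] := clamped_modulus s1 e4; have [d2 d20 H2] := clamped_modulus s2 e4.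
exists (Num.min d1 d2); first by rewrite lt_min d10.
move=> s t; rewrite le_min => /andP[st1 st2].
have K1 := int_driftB_le (mU1 s) (mU1 t) (small1 (clampT s)) (small1 (clampT t)) (ltW e4) (H1 s t st1).
have K2 := int_driftB_le (mU2 s) (mU2 t) (small2 (clampT s)) (small2 (clampT t)) (ltW e4) (H2 s t st2).
have m1 q := cmeas_drift (mU1 q); have m2 q := cmeas_drift (mU2 q).
have n1 := nnfun_L1d (m1 s) (m1 t); have n2 := nnfun_L1d (m2 s) (m2 t).
apply: (via ((2 * (e / 4))%:E + (2 * (e / 4))%:E)%E); last by rewrite -EFinD lee_fin; lra.
apply: le_trans (leeD K1 K2); rewrite -(integralD2 mu n1 n2); apply: int_mono.
- by apply: nnfun_L1d; apply: cmeasB.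
- meas.
- move=> xi; rewrite -EFinD lee_fin /D. exact: cabs_subACA.
Qed.

Let rZ phi s : test_function phi -> 0 <= s <= T -> (r phi s)%:C = cint mu (fun xi => Z s xi * btest phi xi).
Proof.
move=> tphi sT; have s0 : 0 <= s by case/andP: sT.
have [L1 E1] := sol_pairing s1 tphi s0; have [L2 E2] := sol_pairing s2 tphi s0.
rewrite /r rmorphB /= E1 E2 -(cintB L1 L2); apply: eq_cint => xi.
rewrite /Z (clamp_id sT) /btest; have e : (wt xi)%:C * (1 + enorm xi ^+ 2)%:C = 1 :> C.
  by rewrite -rmorphM /= mulVf.
move: ((wt xi)%:C) ((1 + enorm xi ^+ 2)%:C) e (fourier (h1 s) xi) (fourier (h2 s) xi) (ift (tocx phi) xi) => k l kl p q x.
by rewrite mulrA -(mulrA _ k) kl mulr1 mulrBl.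
Qed.

Let rD phi t : test_function phi -> 0 < t < T ->
  exists2 l : R, l%:C = cint mu (fun xi => D t xi * btest phi xi) & is_derive t 1 (r phi) l.
Proof.
move=> tphi /andP[t0 tT]; have tT' : 0 <= t <= T by rewrite !ltW.
have [l1 E1 D1] := sol_derive s1 tphi t0 (small1 tT'); have [l2 E2 D2] := sol_derive s2 tphi t0 (small2 tT').
exists (l1 - l2); last exact: is_deriveB.
have [B B0 hB] := btest_bounded tphi; have mb := cmeas_btest tphi.
have Ld1 : cL1 mu (fun xi => drift (Uhat h1 t) xi * btest phi xi).
  by apply: (cL1_bounded_mul B0 _ mb hB); have := cL1_drift (mU1 t) (small1 (clampT t)); rewrite (clamp_id tT').
have Ld2 : cL1 mu (fun xi => drift (Uhat h2 t) xi * btest phi xi).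
  by apply: (cL1_bounded_mul B0 _ mb hB); have := cL1_drift (mU2 t) (small2 (clampT t)); rewrite (clamp_id tT').
rewrite rmorphB /= E1 E2 -(cintB Ld1 Ld2); apply: eq_cint => xi; rewrite /D (clamp_id tT').
exact: (esym (mulrBl (btest phi xi) (drift (Uhat h1 t) xi) (drift (Uhat h2 t) xi))).
Qed.

Let rc phi : test_function phi -> {within `[0, T], continuous (r phi)}.
Proof.
move=> tphi; apply/subspace_continuousP => t /=; rewrite in_itv /= => tT.
have t0 : 0 <= t by case/andP: tT.
apply/cvgrPdist_le => /= e e0; have e2 : 0 < e / 2 by rewrite divr_gt0.
have [d1 d10 H1] := sol_tested_modulus s1 tphi t0 e2; have [d2 d20 H2] := sol_tested_modulus s2 tphi t0 e2.
rewrite near_withinE.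
have hn : \forall s \near t, `|t - s| <= Num.min d1 d2.
  by apply: (@cvgr_dist_le _ _ _ (nbhs t) _ id t) => //; rewrite lt_min d10.
apply: filterS hn => s; rewrite le_min distrC => /andP[st1 st2] /=; rewrite in_itv /= => /andP[s0 _].
have := H1 s s0 st1; have := H2 s s0 st2; rewrite /from_subspace /r.
move: (\int[mu]_x _) (\int[mu]_x _) (\int[mu]_x _) (\int[mu]_x _) => p q x y.
rewrite !ler_norml => /andP[g1 g2] /andP[g3 g4]; apply/andP; split; lra.
Qed.

Lemma solutions_eq t : 0 <= t <= T -> {ae mu, forall x, h1 t x = h2 t x}.
Proof.
move=> tT; pose E t := (\int[mu]_xi (cabs (Z t xi))%:E)%E.
have nZ q := nnfun_cabs (LZ q).1.
have Ei : E 0 = 0%E.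
  have z0 : 0 <= (0 : R) <= T by rewrite lexx. have ae0 : {ae mu, forall xi, fourier (h1 0) xi = fourier (h2 0) xi}.
    apply: fourier_ae_eq; [exact: (sol_inL2 s1 (lexx 0))|exact: (sol_inL2 s2 (lexx 0))|].
    have [_ _ a1 _] := s1; have [_ _ a2 _] := s2. by apply: filterS2 a1 a2 => x e1 e2; rewrite e1// e2.
  rewrite -(integral0 mu setT); apply: ge0_ae_eq_integral => //.
  - exact: (nZ 0).1.
  - meas.
  - by apply: filterS ae0 => xi e _; rewrite /Z (clamp_id z0) e subrr mul0r cabs0.
have E0 q : (0 <= E q)%E by apply: integral_ge0 => x _; meas.
have Et : E t = 0%E.
  apply: (euler_zero T0 E0 Ei _ tT) => e e0; have [dl dl0 hdl] := Du e0. exists dl => // a b a0 ab bT ba.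
  have osc s : a <= s -> s <= b -> (L1d mu (D s) (D b) <= e%:E)%E.
    move=> as_ sb; apply: hdl; rewrite distrC ger0_norm; lra.
  have inc := integrated_increment LZ LD Du rZ rD rc a0 ab bT (ltW e0) osc.
  apply: (@euler_step _ _ (Z a) (Z b) (Uhat h1 (clamp b)) (Uhat h2 (clamp b)) (b - a) ((b - a) * e)) => //.
  - meas.
  - exact: small1.
  - exact: small2.
  (* The difference of the transforms of the Laplacians is -lam Z, because lam = |xi|^2 (1 +
     |xi|^2). *)
  - move=> xi; rewrite /Uhat /lap_hat /Z. have e1 : (- (enorm xi ^+ 2))%:C = - ((lam xi)%:C * (wt xi)%:C) :> C.
      rewrite rmorphN -rmorphM /=; have -> : lam xi = enorm xi ^+ 2 * (1 + enorm xi ^+ 2).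
        by rewrite /lam (exprD _ 2 2); ring.
      by rewrite mulfK.
    rewrite -mulrBr e1. by move: ((lam xi)%:C) ((wt xi)%:C) (fourier (h1 _) xi) (fourier (h2 _) xi) => p q x y; ring.
have Z0 : {ae mu, forall xi, Z t xi = 0}.
  have := @ae_eq_integral_abs _ V R mu setT measurableT (fun x => (cabs (Z t x))%:E) (nZ t).1.
  under eq_integral do rewrite gee0_abs ?lee_fin ?cabs_ge0//.
  move=> [] /(_ Et) + _; apply: filterS => xi /(_ I)[] /= e; exact: cabs0_eq0.
have t0 : 0 <= t by case/andP: tT.
have G12 : {ae mu, forall xi, fourier (h1 t) xi = fourier (h2 t) xi}.
  apply: filterS Z0 => xi /eqP; rewrite /Z (clamp_id tT) mulf_eq0 subr_eq0 => /orP[/eqP//|/eqP[] /eqP].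
  by move=> w0; exfalso; move: w0; rewrite /wt invr_eq0 (negbTE (wt0 xi)).
have ie x : ift (fourier (h1 t)) x = ift (fourier (h2 t)) x.
  by apply: ae_eq_ift G12; [exact: (sol_cmeas s1 t0)|exact: (sol_cmeas s2 t0)].
apply: filterS2 (sol_ift s1 t0) (sol_ift s2 t0) => x e1 e2.
exact: (congr1 (@complex.Re R) (etrans e1 (etrans (ie x) (esym e2)))).
Qed.

End two_solutions.
End solutions.

(** * L^1 norms and Hermitian symmetry of the data *)

Section L1_norm.
Context {R : realType} {d : nat}.
Notation V := 'rV[R]_d.
Notation C := R[i].
Notation mu := (lebesgue_rV d).
Implicit Types (f g : V -> C) (xi : V).

Definition nrm1 f : R := fine (\int[mu]_xi (cabs (f xi))%:E)%E.

Lemma nrm1E f : cL1 mu f -> (\int[mu]_xi (cabs (f xi))%:E = (nrm1 f)%:E)%E.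
Proof.
move=> Lf; rewrite /nrm1 fineK// ge0_fin_numE; first exact: Lf.2.
meas.
Qed.

Lemma ae_eq_nrm1 f g : cmeas f -> cmeas g -> {ae mu, forall xi, f xi = g xi} -> nrm1 f = nrm1 g.
Proof.
move=> mf mg fg; rewrite /nrm1; congr fine; apply: ge0_ae_eq_integral => //.
- meas.
- meas.
- meas.
- meas.
- by apply: filterS fg => xi ->.
Qed.

Lemma nrm1_le_dist f g (e : R) : cL1 mu f -> cL1 mu g -> (L1d mu f g <= e%:E)%E -> nrm1 f <= nrm1 g + e.
Proof.
move=> Lf Lg h; rewrite -lee_fin EFinD -!nrm1E//; apply: le_trans (leeD2l _ h).
have ng := nnfun_cabs Lg.1; have nd := nnfun_L1d Lf.1 Lg.1.
rewrite /L1d -(integralD2 mu ng nd); apply: int_mono; [meas|meas|].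
by move=> x; rewrite -EFinD lee_fin; have := cabsD (g x) (f x - g x); rewrite addrC subrK.
Qed.

Lemma nrm1_lip f g (e : R) : cL1 mu f -> cL1 mu g -> (L1d mu f g <= e%:E)%E -> `|nrm1 f - nrm1 g| <= e.
Proof.
move=> Lf Lg h; have h1 := nrm1_le_dist Lf Lg h; rewrite L1d_sym in h.
by have h2 := nrm1_le_dist Lg Lf h; rewrite ler_norml; apply/andP; split; lra.
Qed.

End L1_norm.

Section hermitian.
Context {R : realType} {d : nat}.
Notation V := 'rV[R]_d.
Notation C := R[i].
Notation mu := (lebesgue_rV d).
Implicit Type xi : V.

Lemma lamN xi : lam (- xi) = lam xi. Proof. by rewrite /lam enormN. Qed.

Lemma conjc_real (a : R) : conjc (a%:C) = a%:C :> C.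
Proof. by apply: complex_ext; rewrite /= ?oppr0. Qed.

Lemma conjcB (a b : C) : conjc (a - b) = conjc a - conjc b.
Proof. by case: a => ? ?; case: b => ? ?; apply: complex_ext => /=; ring. Qed.

Lemma herm_un (u0 : V -> C) n t : cmeas u0 -> herm u0 -> herm (un u0 n t).
Proof.
move=> mu0 h0; elim: n t => [|n IH] t xi /=; first by apply: complex_ext; rewrite /= ?oppr0.
rewrite /Phi /duhamel lamN h0 conjcD conjcM conjc_real -cint_conj; congr (_ + _).
apply: eq_cint => s; rewrite conjcM conjc_real; congr (_ * _).
by apply: herm_Nhat; [exact: cmeas_curry (cmeas_un mu0 n)|exact: IH].
Qed.

Lemma herm_usol (u0 : V -> C) t : cmeas u0 -> herm u0 -> herm (usol u0 t).
Proof.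
move=> mu0 h0 xi; rewrite /usol -cint_conj; apply: eq_cint => k.
have h n : un u0 n t (- xi) = conjc (un u0 n t xi) by apply: herm_un.
by rewrite !h conjcB.
Qed.

(** [fourier h0] is determined only up to a null set, so it is Hermitian only almost everywhere;
    symmetrizing gives a representative that is so at every frequency, as the induction on iterates
    needs. *)
Definition herm_part (G : V -> C) xi : C := (2^-1)%:C * (G xi + conjc (G (- xi))).

Lemma herm_herm_part G : herm (herm_part G).
Proof.
move=> xi; rewrite /herm_part conjcM conjc_real conjcD conjcK opprK; congr (_ * _).
by rewrite addrC.
Qed.

Lemma herm_lap_hat (G : V -> C) : herm G -> herm (lap_hat G).
Proof. by move=> hG xi; rewrite /lap_hat enormN hG conjcM conjc_real. Qed.

Lemma cmeas_herm_part G : cmeas G -> cmeas (herm_part G).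
Proof.
move=> mG; apply: cmeasZ; apply: cmeasD => //; apply: cmeas_conj.
exact: (cmeas_comp mG meas_oppV).
Qed.

(** The conjugate reflection of [fourier f] is another transform of the real function f, so the two
    agree almost everywhere. *)
Lemma ae_herm_part (f : V -> R) : inL2 f -> {ae mu, forall xi, herm_part (fourier f) xi = fourier f xi}.
Proof.
move=> f2; have mf := cmeas_tocx f2.1; have mF := cmeas_fourier f2; have [_ hF] := fourierP f2.
pose G xi := conjc (fourier f (- xi)).
have mG : cmeas G by apply: cmeas_conj; exact: (cmeas_comp mF meas_oppV).
have GF : is_ft2 (tocx f) G.
  split => //.
  suff -> : (fun n => sqint mu (fun xi => ft (trunc (tocx f) n) xi - G xi)) =
    (fun n => sqint mu (fun xi => ft (trunc (tocx f) n) xi - fourier f xi)) by exact: hF.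
  apply/funext => n; have mt := cmeas_ft (cmeas_trunc n mf).
  rewrite -(sqint_reflect (cmeasB mt mF)); apply: eq_cabs_sqint => xi.
  rewrite -[RHS]cabs_conj conjcB; congr (cabs (_ - _)); rewrite ft_conj -ft_ift.
  congr (ft _ xi); apply/funext => x; rewrite /trunc conjcM /ind /tocx !conjc_real //.
have e := is_ft2_unique mf (fourierP f2) GF.
apply: filterS e => xi h; rewrite /herm_part -/(G xi) -h.
by move: (fourier f xi) => [a b]; apply: complex_ext => /=; lra.
Qed.

End hermitian.

(** * Existence, decay and uniqueness *)

Section assembly.
Context {R : realType} {d : nat}.
Notation V := 'rV[R]_d.
Notation C := R[i].
Notation mu := (lebesgue_rV d).
Notation TR := (measurableTypeR R).
Notation leb := (@lebesgue_measure R).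
Implicit Types (xi x : V) (t s : R).

Lemma Fnorm21 (f : V -> R) : Fnorm 2 1 f = wnorm 2 (fourier f).
Proof. by rewrite -Fnorm1. Qed.

Lemma Fnorm61 (f : V -> R) : Fnorm 6 1 f = wnorm 6 (fourier f).
Proof. by rewrite -Fnorm1. Qed.

Lemma wnorm6_hhat (u : R -> V -> C) t : (0 < d)%N -> cmeas (fun p : TR * V => u p.1 p.2) ->
  (wnorm 6 (hhat u t) = \int[mu]_xi ((enorm xi ^+ 4)%:E * (cabs (u t xi))%:E))%E.
Proof.
move=> hd mu_; apply: ge0_ae_eq_integral => //.
- by apply: meas_wnorm; exact: cmeas_hhat.
- apply: emeasurable_funM; last by apply: meas_ecabs; exact: cmeas_curry. meas.
- meas.
- meas.
apply: filterS (ae_neq0 hd) => x x0 _; rewrite -EFinM; congr (_%:E).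
rewrite /hhat cabsM cabs_real normrN ger0_norm ?invr_ge0 ?sqr_ge0// mulrA; congr (_ * _).
rewrite (exprD _ 4 2) mulfK// expf_neq0// gt_eqF// enorm_gt0//.
Qed.

Variables (h0 : V -> R) (ystar : R).
Hypotheses (hd : (0 < d)%N) (ystar0 : 0 < ystar) (f2ystar : f2 ystar = 1)
  (h0F : (Fspace 0 2 `&` Fspace 2 1) h0) (h0_small : (Fnorm 2 1 h0 < ystar%:E)%E).

Let y0 := fine (Fnorm 2 1 h0).
Let i2 : inL2 h0. Proof. by case/FspaceP: h0F. Qed.
Let w2 : (wnorm 2 (fourier h0) < +oo)%E. Proof. by case/FspaceP: h0F. Qed.
Let H0 := herm_part (fourier h0).
Let u0 := lap_hat H0.
Let u := usol u0.
Let M := Msup u0.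
(** With u0 = -|xi|^2 H0 this makes |u0|^2 = |xi|^4 g0, the form asked for by the square integral
    estimates. *)
Let g0 xi := cabs (H0 xi) ^+ 2.

Let y00 : 0 <= y0. Proof. by apply: fine_ge0; rewrite Fnorm21; meas. Qed.
Let y0E : Fnorm 2 1 h0 = y0%:E.
Proof. by rewrite fineK// Fnorm21 ge0_fin_numE// wnorm_ge0. Qed.
Let y0_lt : y0 < ystar. Proof. by move: h0_small; rewrite y0E lte_fin. Qed.
Let ystar_le : ystar <= 8^-1.
Proof. by have := f2_ge_slope (lexx 0) (ltW ystar0); rewrite f2_0 f2ystar; lra. Qed.
Let y0_le : y0 <= 8^-1. Proof. exact: le_trans (ltW y0_lt) ystar_le. Qed.

Lemma sigma_gt0 : 0 < 1 - f2 y0.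
Proof. by have := f2_ge_slope y00 (ltW y0_lt); rewrite f2ystar; have := y0_lt; lra. Qed.

Let mf0 : cmeas (fourier h0) := cmeas_fourier i2.
Let mH0 : cmeas H0 := cmeas_herm_part mf0.
Let H0E : {ae mu, forall xi, H0 xi = fourier h0 xi} := ae_herm_part i2.
Let mu0 : cmeas u0 := cmeas_lap_hat mH0.
Let hermu0 : herm u0 := herm_lap_hat (herm_herm_part (fourier h0)).
Let u0I : (\int[mu]_xi (cabs (u0 xi))%:E = y0%:E)%E.
Proof. by rewrite wnorm_lap_hat (ae_eq_wnorm 2 mH0 mf0 H0E) -Fnorm21 y0E. Qed.
Let u0_le : (\int[mu]_xi (cabs (u0 xi))%:E <= y0%:E)%E. Proof. by rewrite u0I. Qed.
Let mu_ : cmeas (fun p : TR * V => u p.1 p.2) := cmeas_usol mu0.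
Let nM : nnfun M := nnfun_Msup mu0.
Let uM t xi : ((cabs (u t xi))%:E <= M xi)%E := usol_le mu0 t xi.
Let MI : (\int[mu]_xi M xi <= (6^-1)%:E)%E := int_Msup_le mu0 y00 y0_le u0_le.
Let hu : {ae mu, forall xi, forall t, 0 <= t ->
   u t xi = duhamel (lam xi) (u0 xi) (fun s => Nhat (u s) xi) t}.
Proof.
apply: filterS (usol_fixpoint mu0 y00 y0_le u0_le) => xi h t t0; rewrite /u h /Phi.
by rewrite (max_r t0).
Qed.
Let g00 xi : 0 <= g0 xi. Proof. exact: sqr_ge0. Qed.
Let mg : mfunT g0.
Proof. by apply: measurable_funX; meas. Qed.
Let u0g xi : cabs (u0 xi) ^+ 2 <= enorm xi ^+ 4 * g0 xi.
Proof.
rewrite /u0 /lap_hat cabsM cabs_real normrN ger0_norm ?sqr_ge0// exprMn -exprM.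
exact: lexx.
Qed.
Let g0o : (\int[mu]_xi (g0 xi)%:E < +oo)%E.
Proof.
have := ae_eq_sqint mH0 mf0 H0E; rewrite /sqint /g0 => ->.
exact: sqint_ft2_lty (cmeas_tocx i2.1) i2.2 (fourierP i2).
Qed.
Let hP T : 0 <= T ->
  (\int[mu]_xi \int[leb]_t ((tri T t)%:E * (cabs (Nhat (u t) xi) ^+ 2)%:E) < +oo)%E.
Proof.
apply: (Nhat_usol_sq_lty mu0 y00 y0_le u0_le mg g00 _ g0o) => xi.
apply: le_trans (u0g xi) _; apply: ler_wpM2r => //; rewrite /lam lerDr; meas.
Qed.
Let hermu t : herm (u t) := herm_usol t mu0 hermu0.

Definition solution : R -> V -> R := hsol u.

Let mut t : cmeas (u t) := mu_t mu_ t.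
Let Lu t : cL1 mu (u t) := conj (mut t) (uL1 mu_ nM uM MI t).
Let nrm1_u t : (\int[mu]_xi (cabs (u t xi))%:E = (nrm1 (u t))%:E)%E := nrm1E (Lu t).

Lemma solution_initial : {ae mu, forall x, solution 0 x = h0 x}.
Proof.
have L0 : cL1 mu (fourier h0).
  apply: cL1_of_lap_hat => //. exact: sqint_ft2_lty (cmeas_tocx i2.1) i2.2 (fourierP i2).
have inv := ft2_inversion (cmeas_tocx i2.1) i2.2 (fourierP i2) L0.
have e0 : {ae mu, forall xi, hhat u 0 xi = fourier h0 xi}.
  have hb : {ae mu, forall xi, xi != 0 /\ u 0 xi = u0 xi}.
    by apply: filterS2 (ae_neq0 hd) (ae_u_initial mu_ nM uM MI hu hd) => xi h1 h2.
  apply: filterS2 hb H0E => xi [x0 e1] <-; rewrite /hhat e1 /u0 /lap_hat mulrA -rmorphM /= mulrNN.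
  by rewrite mulVf ?mul1r// expf_neq0// gt_eqF// enorm_gt0.
have ie x : ift (hhat u 0) x = ift (fourier h0) x.
  exact: (ae_eq_ift x (cmeas_hhat mu_ 0) mf0 e0).
apply: filterS inv => x e1; rewrite /solution /hsol ie.
exact: (esym (congr1 (@complex.Re R) e1)).
Qed.

Lemma solution_is_solution : is_solution h0 solution.
Proof.
apply: (hsol_is_solution mu0 mu_ nM uM MI hu hd mg g00 u0g g0o hP hermu).
exact: solution_initial.
Qed.

(** Continuity argument with barrier [ystar]: while the norm is at most [ystar] the coefficient
    [1 - f2 ystar = 0] is still nonnegative, and [energy] returns the bound y0 < ystar. *)
Lemma solution_nrm1 t : 0 <= t -> nrm1 (u t) <= y0.
Proof.
move=> t0; apply: (@bootstrap R (fun t => nrm1 (u t)) y0 ystar t y0_lt) => //.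
- rewrite (ae_eq_nrm1 (mut 0) mu0 (ae_u_initial mu_ nM uM MI hu hd)) -lee_fin. by rewrite /nrm1 u0I.
- move=> e e0; have [dl dl0 hdl] := u_modulus mu0 mu_ nM uM MI hu e0; exists dl => // a b a0 _ b0 _ ab.
  by apply: nrm1_lip; [exact: Lu|exact: Lu|exact: hdl].
- move=> s s0 st hb; have f21 : f2 ystar <= 1 by rewrite f2ystar.
  have hb' r : 0 <= r -> r <= s -> (\int[mu]_xi (cabs (u r xi))%:E <= ystar%:E)%E.
    by move=> r0 rs; rewrite nrm1_u lee_fin; meas.
  have u0o : (\int[mu]_xi (cabs (u0 xi))%:E < +oo)%E by rewrite u0I ltry.
  have := energy mu0 mu_ nM uM MI hu hd s0 (ltW ystar0) f21 hb' u0o.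
  rewrite f2ystar subrr u0I; under eq_integral do rewrite mul0e adde0. by rewrite nrm1_u lee_fin.
Qed.

Let wnorm_u t : 0 <= t -> wnorm 2 (fourier (solution t)) = (nrm1 (u t))%:E.
Proof.
move=> t0; rewrite (wnorm_hsol mu_ nM uM MI hu hd mg g00 u0g g0o hP hermu 2 t0).
by rewrite -(wnorm_hhat mu_ hd t) nrm1_u.
Qed.

(** The norm being now known to stay at most y0, [energy] applies with b = y0 and its coefficient
    becomes sigma. The norm of order 6 of h is the integral of |xi|^4 |u|, below that of lam |u|. *)
Lemma solution_decay t : 0 <= t ->
  (Fnorm 2 1 (solution t) + (1 - f2 y0)%:E * \int[leb]_(tau in `[0%R, t]) Fnorm 6 1 (solution tau)
   <= Fnorm 2 1 h0)%E.
Proof.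
move=> t0; pose F (p : TR * V) := (cabs (u p.1 p.2))%:E.
have nF : nnfun F by exact: nnfun_cabs.
pose w4 xi := ((enorm xi ^+ 4)%:E : \bar R).
have nw4 : nnfun w4.
  split; first by apply/measurable_EFinP; meas. by move=> x; rewrite lee_fin exprn_ge0// enorm_ge0.
have nlam : nnfun (fun xi : V => (lam xi)%:E).
  meas.
pose I xi := (\int[leb]_s ((tri t s)%:E * F (s, xi)))%E.
have nI : nnfun I by exact: nnfun_tri_integral.
have s0 := ltW sigma_gt0; have es : (0 <= (1 - f2 y0)%:E)%E by rewrite lee_fin.
have E6 : (\int[leb]_(tau in `[0%R, t]) Fnorm 6 1 (solution tau) = \int[mu]_xi (w4 xi * I xi))%E.
  rewrite (tri_swap t nw4 nF) integral_mkcond; apply: eq_integral => s _.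
  rewrite patchE /tri mem_setE in_itv /=; case: (boolP (0 <= s <= t)%R) => [/andP[s0' _]|_]; last by rewrite mul0e.
  rewrite mul1e Fnorm61 (wnorm_hsol mu_ nM uM MI hu hd mg g00 u0g g0o hP hermu 6 s0'). exact: wnorm6_hhat.
have le6 : (\int[mu]_xi (w4 xi * I xi) <= \int[mu]_xi ((lam xi)%:E * I xi))%E.
  apply: int_mono; [meas|meas|move=> xi]. apply: lee_wpmul2r; first exact: nI.2.
  by rewrite lee_fin /lam lerDr sqr_ge0.
rewrite Fnorm21 (wnorm_u t0) -nrm1_u E6.
have u0o : (\int[mu]_xi (cabs (u0 xi))%:E < +oo)%E by rewrite u0I ltry.
have hb r : 0 <= r -> r <= t -> (\int[mu]_xi (cabs (u r xi))%:E <= y0%:E)%E.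
  by move=> r0 _; rewrite nrm1_u lee_fin; exact: solution_nrm1.
have f21 : f2 y0 <= 1 by have := sigma_gt0; lra.
have := energy mu0 mu_ nM uM MI hu hd t0 y00 f21 hb u0o.
rewrite u0I -y0E; apply: le_trans.
rewrite (integralD2 mu (nnfun_cabs (mut t)) (nnfunZ es (nnfunM nlam nI))) (integralZ mu es (nnfunM nlam nI)).
by apply: leeD => //; apply: lee_wpmul2l.
Qed.

Let Uhat_small (h : R -> V -> R) t : is_solution h0 h -> 0 <= t ->
  (\int[mu]_xi (cabs (Uhat h t xi))%:E = wnorm 2 (fourier (h t)))%E.
Proof. by move=> _ _; rewrite /Uhat wnorm_lap_hat. Qed.

(** A competitor h is known to be small only at time 0. As long as the L^1 norm of [Uhat h] is at
    most 1/4, [solutions_eq] identifies h with the constructed solution, whose norm is at most y0 <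
    1/4; continuity propagates this to all times. *)
Lemma solution_unique (h : R -> V -> R) t : is_solution h0 h -> 0 <= t ->
  {ae mu, forall x, h t x = solution t x}.
Proof.
move=> hs t0; have ss := solution_is_solution.
have q4 : 8^-1 <= 4^-1 :> R by lra.
have sm T s : 0 <= s <= T -> (\int[mu]_xi (cabs (Uhat solution s xi))%:E <= (4^-1)%:E)%E.
  move=> /andP[s0 _]; rewrite (Uhat_small ss s0) (wnorm_u s0) lee_fin.
  exact: le_trans (solution_nrm1 s0) (le_trans y0_le q4).
have N s : 0 <= s -> (\int[mu]_xi (cabs (Uhat h s xi))%:E = (nrm1 (Uhat h s))%:E)%E.
  by move=> s0; apply: nrm1E; exact: (sol_cL1_Uhat hs s0).
have nE s : 0 <= s -> {ae mu, forall x, h s x = solution s x} -> nrm1 (Uhat h s) <= y0.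
  move=> s0 e; have e1 := fourier_ae_eq (sol_inL2 hs s0) (sol_inL2 ss s0) e.
  rewrite -lee_fin -(N s s0) (Uhat_small hs s0) (ae_eq_wnorm 2 (sol_cmeas hs s0) (sol_cmeas ss s0) e1).
  by rewrite (wnorm_u s0) lee_fin; exact: solution_nrm1.
have ys4 : y0 < 4^-1 by apply: le_lt_trans y0_le _; lra.
have bd s : 0 <= s <= t -> nrm1 (Uhat h s) <= 4^-1.
  move=> /andP[s0 st]; apply: le_trans (ltW ys4).
  apply: (@bootstrap R (fun s => nrm1 (Uhat h s)) y0 4^-1 t ys4) => //.
  - apply: nE => //; have [_ _ a1 _] := hs; have [_ _ a2 _] := ss.
    by apply: filterS2 a1 a2 => x e1 e2; rewrite e1// e2.
  - move=> e e0.
    have [||s' sT e' e'0|dl dl0 hdl] := @segment_modulus R (fun a b => L1d mu (Uhat h (Num.max 0 a)) (Uhat h (Num.max 0 b))) t _ _ _ e e0.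
    + by move=> a b; exact: L1d_sym.
    + have mm (a : R) : 0 <= Num.max 0 a by rewrite le_max lexx.
      by move=> a b c; apply: L1d_triangle; exact: (sol_cL1_Uhat hs (mm _)).1.
    + have s'0 : 0 <= s' by case/andP: sT.
      have [dl dl0 hdl] := sol_Uhat_modulus hs s'0 e'0; exists dl => // a /andP[a0 _] ab.
      by rewrite (max_r a0) (max_r s'0); exact: hdl.
    exists dl => // a b a0 aT b0 bT ab.
    have := hdl b a; rewrite a0 aT b0 bT (max_r a0) (max_r b0) => /(_ isT isT); rewrite distrC => h'.
    by apply: nrm1_lip; [exact: (sol_cL1_Uhat hs b0)|exact: (sol_cL1_Uhat hs a0)|apply: h'; rewrite distrC].
  - move=> a a0 aT ha; apply: nE => //.
    have sm1 q : 0 <= q <= a -> (\int[mu]_xi (cabs (Uhat h q xi))%:E <= (4^-1)%:E)%E.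
      by move=> /andP[q0 qa]; rewrite (N q q0) lee_fin; meas.
    by apply: (solutions_eq hs ss a0 sm1 (sm a)); rewrite a0 lexx.
have sm1 q : 0 <= q <= t -> (\int[mu]_xi (cabs (Uhat h q xi))%:E <= (4^-1)%:E)%E.
  by move=> qt; have q0 : 0 <= q by [case/andP: qt]; rewrite (N q q0) lee_fin; meas.
by apply: (solutions_eq hs ss t0 sm1 (sm t)); rewrite t0 lexx.
Qed.

End assembly.

Theorem theorem3 (R : realType) (d : nat) (hd : (1 <= d)%N)
  (ystar : R) (ystar_gt0 : 0 < ystar) (f2_ystar : f2 ystar = 1)
  (h0 : 'rV[R]_d -> R) (h0F : (Fspace 0 2 `&` Fspace 2 1) h0)
  (h0_small : (Fnorm 2 1 h0 < ystar%:E)%E) :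
  let sigma : R := 1 - f2 (fine (Fnorm 2 1 h0)) in
  0 < sigma /\
  exists h : R -> 'rV[R]_d -> R,
    [/\ is_solution h0 h,
        (forall h' : R -> 'rV[R]_d -> R, is_solution h0 h' ->
           forall t : R, 0 <= t -> h' t = h t %[ae lebesgue_rV d]) &
        (forall t : R, 0 <= t ->
           (Fnorm 2 1 (h t)
            + sigma%:E * \int[lebesgue_measure]_(tau in `[0%R, t]) Fnorm 6 1 (h tau)
            <= Fnorm 2 1 h0)%E)].
Proof.
move=> sigma; split; first exact: (sigma_gt0 f2_ystar h0F h0_small).
exists (solution h0); split.
- exact: (solution_is_solution hd ystar_gt0 f2_ystar h0F h0_small).
- move=> h' hs t t0. have := solution_unique hd ystar_gt0 f2_ystar h0F h0_small hs t0. by apply: filterS => x e _.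
- move=> t t0; exact: (solution_decay hd ystar_gt0 f2_ystar h0F h0_small t0).
Qed.
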